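(* Let $(X,\xi)$ be a pair where $X=(X(t))_{t\geq 0}$ is a random process with paths in $D[0,\infty)$ and $\xi$ is a positive random variable (no assumption is made on the dependence between $X$ and $\xi$), and let $(X_k,\xi_k)_{k\in\mathbb{N}}$ be independent copies of $(X,\xi)$. Put $S_0:=0$, $S_n:=\xi_1+\cdots+\xi_n$. Assume that $\mathbb{E}[|X(t)|^l]<\infty$ for all $t\geq0$ and $l\in\mathbb{N}$, that $h(t):=\mathbb{E}[X(t)]$ is a càdlàg function, and write $\widehat{X}(t):=X(t)-h(t)$. Assume: (A1) $\mathbb{P}\{\xi>t\}\sim t^{-\alpha}\ell_\xi(t)$ as $t\to\infty$ for some $\alpha\in(0,1)$ and some $\ell_\xi$ slowly varying at infinity; (A2) $h(t)\sim t^{\rho}\ell_h(t)$ as $t\to\infty$ for some $\rho>-\alpha$ and some $\ell_h$ slowly varying at infinity. Further suppose that for every $l\in\mathbb{N}$ there exists a constant $C_l>0$ such that $\mathbb{E}[\widehat{X}(t)^{2l}]\leq C_l h(t)$ for all $t\geq0$, and that for some $\delta>0$ (and every $l\in\mathbb{N}$) the function $t\mapsto \mathbb{E}\big[\sup_{y\in[0,\delta)}|\widehat{X}(t)-\widehat{X}(t-y)\mathbf{1}_{\{y\leq t\}}|^{l}\big]$ is either directly Riemann integrable, or locally bounded and satisfies $\mathbb{E}\big[\sup_{y\in[0,\delta)}|\widehat{X}(t)-\widehat{X}(t-y)\mathbf{1}_{\{y\leq t\}}|^{l}\big]=O(\mathbb{P}\{\xi>t\})$ as $t\to\infty$. Then,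 as $t\to\infty$, \[\Big(\frac{\mathbb{P}\{\xi>t\}}{h(t)}\sum_{k\geq 0}X_{k+1}(ut-S_k)\mathbf{1}_{\{S_k\leq ut\}}\Big)_{u>0}\Rightarrow \big(J_{\alpha,\rho}(u)\big)_{u>0}\] weakly on $D(0,\infty)$ endowed with the $J_1$-topology.
   Context: $(W_\alpha(t))_{t\geq0}$ denotes an $\alpha$-stable subordinator with Laplace exponent $-\log\mathbb{E}e^{-sW_\alpha(1)}=\Gamma(1-\alpha)s^\alpha$, $s\geq0$, and $W_\alpha^{\leftarrow}(y):=\inf\{t\geq0: W_\alpha(t)>y\}$, $y\geq 0$, its generalized inverse. The fractionally integrated inverse $\alpha$-stable subordinator is $J_{\alpha,\rho}(u):=\int_{[0,u]}(u-y)^{\rho}\,\mathrm{d}W_\alpha^{\leftarrow}(y)$, $u\geq0$, a pathwise Lebesgue–Stieltjes integral. $D(0,\infty)$ is the Skorokhod space of càdlàg functions on $(0,\infty)$. *)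

(* Defs.v *)
From HB Require Import structures.
From mathcomp Require Import all_boot all_order all_algebra.
From mathcomp Require Import all_classical all_reals all_analysis.
Set Implicit Arguments. Unset Strict Implicit. Unset Printing Implicit Defensive.
Import Order.TTheory GRing.Theory Num.Theory.
Import numFieldNormedType.Exports.
Local Open Scope classical_set_scope.
Local Open Scope ring_scope.

Section defs.
Variable R : realType.

Definition cadlag0 (f : R -> R) : Prop :=
  (forall t, 0 <= t -> f x @[x --> t^'+] --> f t) /\
  (forall t, 0 < t -> cvg (f x @[x --> t^'-])).

Definition cadlag_pos (f : R -> R) : Prop :=
  (forall t, 0 < t -> f x @[x --> t^'+] --> f t) /\
  (forall t, 0 < t -> cvg (f x @[x --> t^'-])).

Definition J1_conv_ab (a b : R) (fn : nat -> R -> R) (f : R -> R) : Prop :=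
  exists lam : nat -> R -> R,
    (forall n, {within `[a, b], continuous (lam n)}) /\
    (forall n, {in `[a, b] &, forall x y, x < y -> lam n x < lam n y}) /\
    (forall n, lam n a = a /\ lam n b = b) /\
    (forall e, 0 < e -> \forall n \near \oo,
        forall t, a <= t <= b -> `|lam n t - t| < e) /\
    (forall e, 0 < e -> \forall n \near \oo,
        forall t, a <= t <= b -> `|fn n (lam n t) - f t| < e).

Definition J1_conv (fn : nat -> R -> R) (f : R -> R) : Prop :=
  forall a b, 0 < a -> a < b -> {for a, continuous f} -> {for b, continuous f} ->
    J1_conv_ab a b fn f.

(* sequential continuity w.r.t. the (metrizable) J1 topology of D(0,oo) *)
Definition J1_continuous (F : (R -> R) -> R) : Prop :=
  forall (fn : nat -> R -> R) (f : R -> R),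
    (forall n, cadlag_pos (fn n)) -> cadlag_pos f -> J1_conv fn f ->
    F (fn n) @[n --> \oo] --> F f.

Definition slowly_varying (l : R -> R) : Prop :=
  measurable_fun setT l /\
  (exists A, forall t, A <= t -> 0 < l t) /\
  (forall lam, 0 < lam -> (l (lam * t) / l t) @[t --> +oo] --> (1 : R)).

Definition asym_equiv (f g : R -> R) : Prop :=
  (f t / g t) @[t --> +oo] --> (1 : R).

Definition upper_val (f : R -> R) (h : R) (n : nat) : \bar R :=
  ereal_sup [set (f t)%:E | t in `[n%:R * h, n.+1%:R * h]].
Definition lower_val (f : R -> R) (h : R) (n : nat) : \bar R :=
  ereal_inf [set (f t)%:E | t in `[n%:R * h, n.+1%:R * h]].

Definition dRi (f : R -> R) : Prop :=
  (forall h, 0 < h ->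
     ((\sum_(0 <= n <oo) `|upper_val f h n|) < +oo)%E /\
     ((\sum_(0 <= n <oo) `|lower_val f h n|) < +oo)%E) /\
  ((h%:E * \sum_(0 <= n <oo) (upper_val f h n - lower_val f h n))%E
     @[h --> 0^'+] --> 0%E).

Definition Gammaf (x : R) : R :=
  fine (\int[lebesgue_measure]_(y in [set y : R | (0 < y)%R]) ((powR y (x - 1) * expR (- y))%R)%:E)%E.

(* pathwise Lebesgue-Stieltjes integral \int_A g dF for F nondecreasing and
   right-continuous (0 otherwise; never used in that case) *)
Definition LS_integral (F : R -> R) (g : R -> R) (A : set R) : \bar R :=
  match pselect ({homo F : x y / x <= y} /\ (forall x, F @ at_right x --> F x)) with
  | left pf =>
      (\int[lebesgue_stieltjes_measure
              (HB.pack F (isCumulative.Build R _ R F (proj1 pf) (proj2 pf)))]_(y in A)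
         (g y)%:E)%E
  | right _ => 0%E
  end.

End defs.

Section prob.
Variables (R : realType) (d : measure_display) (T : measurableType d).
Variable P : probability T R.

(* (X_k, xi_k)_{k in nat} are independent copies of (X_0, xi_0): for any finite
   set K of distinct indices and any cylinder events (finitely many times >= 0,
   Borel sets), the joint probability factorizes into the probabilities of the
   corresponding events for the pair (X_0, xi_0). *)
Definition iid_pairs (X : nat -> T -> R -> R) (xi : nat -> T -> R) : Prop :=
  forall (m : nat) (ts : 'I_m -> R) (K : seq nat)
         (A0 : nat -> set R) (A : nat -> 'I_m -> set R),
    (forall j, 0 <= ts j) -> uniq K ->
    (forall k, measurable (A0 k)) -> (forall k j, measurable (A k j)) ->
    P (\big[setI/setT]_(k <- K)
          [set w | A0 k (xi k w) /\ forall j, A k j (X k w (ts j))])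
    = (\prod_(k <- K) P [set w | A0 k (xi 0%N w) /\ forall j, A k j (X 0%N w (ts j))])%E.

(* expectation of a real random variable (used only for integrable ones) *)
Definition Exp (Y : T -> R) : R := fine (\int[P]_w (Y w)%:E)%E.

Definition tail (xi : T -> R) (t : R) : R := fine (P [set w | t < xi w]).

Definition sup_mod (Xh : T -> R -> R) (delta : R) (l : nat) (t : R) : \bar R :=
  (\int[P]_w ereal_sup [set ((`|Xh w t - (if y <= t then Xh w (t - y) else 0)| ^+ l)%R)%:E
                       | y in `[0%R, delta[ ])%E.

(* the shot-noise process, rescaled:
   Y t w u = P{xi>t}/h(t) * sum_{k>=0} X_{k+1}(ut - S_k) 1_{S_k <= ut},
   (indices shifted by one: X k here is X_{k+1} of the paper) *)
Definition partial_sum (xi : nat -> T -> R) (k : nat) (w : T) : R :=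
  \sum_(i < k) xi i w.

Definition shot_noise (X : nat -> T -> R -> R) (xi : nat -> T -> R) (w : T) (s : R) : R :=
  limn (series (fun k => X k w (s - partial_sum xi k w) *
                         ((partial_sum xi k w <= s)%R)%:R)).

End prob.

Section limit.
Variables (R : realType) (d : measure_display) (T : measurableType d).
Variable P : probability T R.

Definition stable_subordinator (alpha : R) (W : T -> R -> R) : Prop :=
  (forall w, W w 0 = 0) /\
  (forall w, cadlag0 (W w)) /\
  (forall w, {in `[0, +oo[ &, {homo W w : x y / x <= y}}) /\
  (forall t, measurable_fun setT (fun w => W w t)) /\
  (forall r t s, 0 <= r -> r <= t -> 0 <= s ->
     (\int[P]_w (expR (- s * (W w t - W w r)))%:E)%E
     = (expR (- ((t - r) * (Gammaf (1 - alpha) * powR s alpha))))%:E) /\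
  (forall (n : nat) (ts : nat -> R) (B : nat -> set R),
     0 <= ts 0 -> (forall i, ts i <= ts i.+1) -> (forall i, measurable (B i)) ->
     P (\big[setI/setT]_(i < n) [set w | B i (W w (ts i.+1) - W w (ts i))])
     = (\prod_(i < n) P [set w | B i (W w (ts i.+1) - W w (ts i))%R])%E).

Definition inverse_sub (W : T -> R -> R) (w : T) (y : R) : R :=
  inf [set t | 0 <= t /\ y < W w t].

Definition J_proc (rho : R) (W : T -> R -> R) (w : T) (u : R) : R :=
  fine (LS_integral (inverse_sub W w) (fun y => powR (u - y) rho) `[0, u]).

End limit.

Definition weak_conv_J1 (R : realType)
  (d : measure_display) (T : measurableType d) (P : probability T R)
  (Y : R -> T -> R -> R)
  (d' : measure_display) (T' : measurableType d') (P' : probability T' R)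
  (Z : T' -> R -> R) : Prop :=
  forall F : (R -> R) -> R,
    J1_continuous F -> (exists M, forall f, `|F f| <= M) ->
    (\int[P]_w (F (Y t w))%:E)%E @[t --> +oo] --> (\int[P']_w (F (Z w))%:E)%E.

(* Main.v *)
Require Import Defs.
From HB Require Import structures.
From mathcomp Require Import all_boot all_order all_algebra.
From mathcomp Require Import all_classical all_reals all_analysis.
From mathcomp Require Import measurable_realfun.
From mathcomp Require Import ring lra.
Set Implicit Arguments. Unset Strict Implicit. Unset Printing Implicit Defensive.
Import Order.TTheory GRing.Theory Num.Theory.
Import numFieldNormedType.Exports.
Local Open Scope classical_set_scope.
Local Open Scope ring_scope.

(** Split [X_(k+1) = h + (X_(k+1) - h)].

    The mean part is the integral of [h(ut - .)/h(t)] against the counting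
    measure of the walk [S_k].  The Laplace transform of the steps controls, off
    an event of small probability, the number of points of the walk in every
    window of dyadic length, so the singularity of [u^rho] at [0] contributes
    little and [u^rho] may be replaced by a Lipschitz kernel.  The mean part is
    then uniformly close to a Lipschitz function of finitely many coordinates
    [exp(-(S_((i+1)m) - S_(im))/t)], with [m] of order [1/P(xi > t)].  The same
    argument, applied to the subordinator instead of the walk, brings
    [J_(alpha,rho)] close to the same function of the coordinates
    [exp(-(W((i+1)eta) - W(i eta)))].  The coordinates lie in a cube and their
    mixed moments are Laplace transforms, which converge; by Bernstein
    approximation they converge in distribution.  The limit is continuous and
    all the approximations are uniform on compact subsets of [(0, oo)], so no
    other tightness argument is needed.

    The centred part is a sum of martingale differences.  A discounted power of
    it is a supermartingale, which gives tail bounds of arbitrary polynomial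
    order, hence a bound on a grid of mesh [delta] by a union bound; between grid
    points the oscillation condition is treated in the same way. *)

(** * Independence and the renewal walk *)

(** The test functional [F] carries no measurability, so only lower integrals of [F] along the two
    processes are at hand. [F] is therefore replaced by its inf-convolutions for locally uniform
    closeness: composed with the finite-dimensional approximations they are Lipschitz functions on a
    cube, hence measurable, and they recover [F] at the limit path by sequential continuity. This
    bounds the limit inferior only; the limit superior is obtained from [M - F], which requires the
    lower integral to be additive at the limit.

    The quantitative part rests on two exponents [p < gam] below [alpha]. A window of length
    [2 ^- j * t] typically holds [2 ^ (- alpha * j) / P(xi > t)] points; allowing [gam] in place of
    [alpha] leaves a probability of failure that is summable over all windows and scales. A kernel
    bounded by the power [- p] of the age is summable against such windows because [p < gam], and
    Potter bounds yield such a kernel because [- p < rho]. The assumption [- alpha < rho] is what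
    makes room for both. *)

Section indep.
Context {R : realType} {d : measure_display} {T : measurableType d}.
Variable (P : probability T R).

Lemma prob_le1_pi_unique (m1 m2 : {measure set T -> \bar R}) (G : set (set T)) :
  G `<=` measurable -> setI_closed G -> G setT -> (m1 setT < +oo)%E ->
  (forall A, G A -> m1 A = m2 A) -> forall A, <<s G >> A -> m1 A = m2 A.
Proof.
move=> Gm GI GT fin m12; apply: (g_sigma_algebra_measure_unique G Gm (fun=> setT)) => //.
by rewrite bigcup_const//; exists 0%N.
Qed.

Context {dE : measure_display} {E : measurableType dE} (mu : probability E R).
Variables (G : set (set T)) (C : set (set E)) (Th : T -> E).
Hypotheses (Gm : G `<=` measurable) (GI : setI_closed G) (GT : G setT).
Hypotheses (Cgen : @measurable _ E = <<s C >>) (CI : setI_closed C) (CT : C setT).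
Hypothesis mTh : measurable_fun setT Th.
Hypothesis ind : forall A B, G A -> C B -> P (A `&` Th @^-1` B) = (P A * mu B)%E.

Let Gsub A : <<s G >> A -> measurable A.
Proof. exact: (smallest_sub (@sigma_algebra_measurable _ T) Gm). Qed.

(** Two passes of uniqueness for finite measures: with [B] in the generator both sides are measures
    in [A]; with [A] then fixed in [<<s G >>] both are measures in [B]. The constant factor enters
    as a scaling by a nonnegative real, which keeps the right-hand side a measure. *)
Lemma indep_sigma A B : <<s G >> A -> measurable B ->
  P (A `&` Th @^-1` B) = (P A * mu B)%E.
Proof.
have mpre B' : measurable B' -> measurable (Th @^-1` B').
  by move=> mB; rewrite -[X in measurable X]setTI; exact: mTh.
have step1 A' B' : <<s G >> A' -> C B' -> P (A' `&` Th @^-1` B') = (P A' * mu B')%E.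
  move=> sA CB.
  have mB : measurable B' by rewrite Cgen; exact: sub_sigma_algebra.
  have mTB := mpre _ mB.
  have r0 : 0 <= fine (mu B') by rewrite fine_ge0.
  pose m1 : {measure set T -> \bar R} := mrestr P mTB.
  pose m2 : {measure set T -> \bar R} := mscale (NngNum r0) P.
  have h : forall A, <<s G >> A -> m1 A = m2 A.
    apply: prob_le1_pi_unique => //.
      by rewrite /m1 /= /mrestr setTI; apply: (le_lt_trans (probability_le1 P mTB)); rewrite ltry.
    move=> A0 GA0; rewrite /m1 /m2 /= /mrestr /mscale /= ind// muleC.
    by rewrite fineK// fin_num_measure.
  have := h _ sA; rewrite /m1 /m2 /= /mrestr /mscale /= => ->.
  by rewrite fineK ?fin_num_measure// muleC.
move=> sA mB.
have mA := Gsub sA.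
have mTB := mpre _ mB.
have r0 : 0 <= fine (P A) by rewrite fine_ge0.
pose m0 := [the measure E R of pushforward (mrestr P mA) Th].
pose m1 : {measure set E -> \bar R} := m0 mTh.
pose m2 : {measure set E -> \bar R} := mscale (NngNum r0) mu.
have h : m1 B = m2 B.
  apply: (measure_unique C (fun=> setT)) => //.
  - by rewrite bigcup_const//; exists 0%N.
  - move=> B0 CB0; rewrite /m1 /m0 /m2 /= /pushforward /mrestr /mscale /= setIC step1//.
    by rewrite fineK// fin_num_measure.
  - by move=> _; rewrite /m1 /m0 /= /pushforward /mrestr preimage_setT setTI;
      apply: (le_lt_trans (probability_le1 P mA)); rewrite ltry.
move: h; rewrite /m1 /m0 /m2 /= /pushforward /mrestr /mscale /= setIC => ->.
by rewrite fineK ?fin_num_measure// muleC.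
Qed.

Local Notation TG := (g_sigma_algebraType G).

(** By [indep_sigma] on rectangles, the map [w |-> (w, Th w)] into [TG * E] has as law the product
    of [P] on [<<s G >>] and [mu]. Tonelli then integrates out the fresh variable with the past
    frozen; this takes the place of conditional expectation. *)
Lemma indep_fubini (phi : TG * E -> \bar R) : measurable_fun setT phi ->
  (forall z, 0 <= phi z)%E ->
  (\int[P]_w phi (w : TG, Th w) = \int[P]_w \int[mu]_e phi (w : TG, e))%E.
Proof.
move=> mphi phi0.
have mid : measurable_fun setT (id : T -> TG).
  by move=> _ A mA; rewrite setTI; exact: Gsub.
pose idm : {mfun T >-> TG} := HB.pack (id : T -> TG) (isMeasurableFun.Build _ _ _ _ _ mid).
have mpair : measurable_fun setT (fun w : T => (w : TG, Th w)).
  exact: (measurable_fun_pair mid mTh).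
pose pm : {mfun T >-> (TG * E)%type} :=
  HB.pack (fun w : T => (w : TG, Th w)) (isMeasurableFun.Build _ _ _ _ _ mpair).
have prodE X : measurable X -> (distribution P idm \x mu)%E X = distribution P pm X.
  move=> mX; apply: product_measure_unique => // A B mA mB.
  exact: indep_sigma.
rewrite -(@ge0_integral_distribution _ _ _ _ _ P pm _ mphi)//.
rewrite (eq_measure_integral (distribution P idm \x mu)%E); last by move=> A mA _; apply: esym; exact: prodE.
rewrite fubini_tonelli1//.
rewrite (@ge0_integral_distribution _ _ _ _ _ P idm)//.
- exact: measurable_fun_fubini_tonelli_F.
- by move=> w; rewrite /fubini_F; exact: integral_ge0.
Qed.

End indep.

Lemma measurable_set_gt {R : realType} {d : measure_display} {T : measurableType d}
  (f : T -> R) (a : R) : measurable_fun setT f -> measurable [set w | a < f w].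
Proof.
move=> mf; rewrite (_ : [set w | a < f w] = setT `&` f @^-1` `]a, +oo[); first exact: mf.
by rewrite setTI; apply/seteqP; split=> w /=; rewrite in_itv /= andbT.
Qed.

Lemma measurable_set_le {R : realType} {d : measure_display} {T : measurableType d}
  (f : T -> R) (a : R) : measurable_fun setT f -> measurable [set w | f w <= a].
Proof.
move=> mf; rewrite (_ : [set w | f w <= a] = setT `&` f @^-1` `]-oo, a]); first exact: mf.
by rewrite setTI; apply/seteqP; split=> w /=; rewrite in_itv.
Qed.

Lemma integral_prob_cst {R : realType} {d : measure_display} {T : measurableType d}
  (P : probability T R) (c : R) : (\int[P]_w c%:E = c%:E)%E.
Proof.
rewrite integral_cst//; transitivity (c%:E * 1)%E; last by rewrite mule1.
by congr (_ * _)%E; exact: probability_setT.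
Qed.

Section past.
Context {R : realType} {d : measure_display} {T : measurableType d}.
Variable (P : probability T R).
Context {dE : measure_display} {E : measurableType dE} (mu : probability E R).
Variables (Th : nat -> T -> E) (C : set (set E)).

(** Independence and the common law are recorded on a pi-system [C] only, which is what both the
    cylinder hypothesis on the pairs and the rays used for the subordinator deliver. [C] contains
    [setT] so that coordinates can be left free. *)
Record iid_gen : Prop := IidGen {
  iid_gen_gen : @measurable _ E = <<s C >> ;
  iid_genI : setI_closed C ;
  iid_genT : C setT ;
  iid_gen_meas : forall k, measurable_fun setT (Th k) ;
  iid_gen_prod : forall n (A : nat -> set E), (forall k, C (A k)) ->
    P (\bigcap_(k in `I_n) Th k @^-1` A k) = (\prod_(k < n) mu (A k))%E }.

(** A pi-system generating the sigma-algebra of the first [n] marks; on [pastT n], measurability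
    means measurability with respect to that past. *)
Definition past n : set (set T) :=
  [set B | exists2 A : nat -> set E, (forall k, C (A k)) &
     B = \bigcap_(k in `I_n) Th k @^-1` A k].

Hypothesis iid : iid_gen.

Let mpre k A : C A -> measurable (Th k @^-1` A).
Proof.
move=> CA; rewrite -[X in measurable X]setTI; apply: (iid_gen_meas iid) => //.
by rewrite (iid_gen_gen iid); exact: sub_sigma_algebra.
Qed.

Lemma past_measurable n : past n `<=` measurable.
Proof.
by move=> B [A CA ->]; apply: bigcap_measurableType => // k _; exact: mpre.
Qed.

Lemma past_setI n : setI_closed (past n).
Proof.
move=> _ _ [A CA ->] [B CB ->]; exists (fun k => A k `&` B k).
  by move=> k; exact: (iid_genI iid).
by rewrite -bigcapI; apply: eq_bigcapr => k _; rewrite preimage_setI.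
Qed.

Lemma past_setT n : past n setT.
Proof.
exists (fun=> setT); first by move=> k; exact: (iid_genT iid).
by apply/esym; rewrite -subTset => w _ k _.
Qed.

Local Notation pastT n := (g_sigma_algebraType (past n)).

Lemma past_next n (phi : pastT n * E -> \bar R) : measurable_fun setT phi ->
  (forall z, 0 <= phi z)%E ->
  (\int[P]_w phi (w : pastT n, Th n w) = \int[P]_w \int[mu]_e phi (w : pastT n, e))%E.
Proof.
move=> mphi phi0.
apply: (@indep_fubini _ _ T P _ E mu (past n) C (Th n)) => //.
- exact: past_measurable.
- exact: past_setI.
- exact: past_setT.
- exact: (iid_gen_gen iid).
- exact: (iid_genI iid).
- exact: (iid_genT iid).
- exact: (iid_gen_meas iid).
move=> _ B [A CA ->] CB; rewrite (iid_gen_prod iid)//.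
rewrite -(iid_gen_prod iid n CA).
pose A' k := if k == n then B else A k.
have CA' k : C (A' k) by rewrite /A'; case: ifP.
have e : \bigcap_(k in `I_n) Th k @^-1` A k `&` Th n @^-1` B =
    \bigcap_(k in `I_n.+1) Th k @^-1` A' k.
  apply/seteqP; split=> [w [h hn] k /=|w h].
    rewrite /A' ltnS leq_eqVlt; case: eqVneq => [->//|_ /= kn]; exact: h.
  split; last by have := h n (ltnSn n); rewrite /A' eqxx.
  move=> k /= kn; have := h k (leqW kn).
  by rewrite /A'; case: eqVneq kn => // ->; rewrite ltnn.
rewrite e (iid_gen_prod iid)// big_ord_recr /= /A' eqxx.
congr (_ * _)%E; rewrite (iid_gen_prod iid)//; apply: eq_bigr => i _.
by case: eqVneq (ltn_ord i) => // ->; rewrite ltnn.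
Qed.

Lemma past_Th n k : (k < n)%N -> measurable_fun setT (Th k : pastT n -> E).
Proof.
move=> kn; apply: (measurability C); first exact: (iid_gen_gen iid).
move=> _ [B CB <-]; rewrite setTI; apply: sub_sigma_algebra.
exists (fun i => if i == k then B else setT).
  by move=> i; case: ifP => // _; exact: (iid_genT iid).
apply/seteqP; split=> [w Bw i _ /=|w h].
  by case: eqVneq => // ->.
by have := h k kn; rewrite eqxx.
Qed.

Lemma past_mono n m : (n <= m)%N -> measurable_fun setT (id : pastT m -> pastT n).
Proof.
move=> nm; apply: (@measurability _ _ (pastT m) (pastT n) setT id (past n)) => //.
move=> _ [_ [A CA ->] <-]; rewrite setTI preimage_id; apply: sub_sigma_algebra.
exists (fun k => if (k < n)%N then A k else setT).
  by move=> k; case: ifP => // _; exact: (iid_genT iid).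
apply/seteqP; split=> [w h k _ /=|w h k /= kn].
  by case: ifP => // kn; exact: h.
by have := h k (leq_trans kn nm); rewrite kn.
Qed.

Lemma past_meas n d' (U : measurableType d') (f : pastT n -> U) :
  measurable_fun setT f -> measurable_fun setT (f : T -> U).
Proof.
move=> mf _ A mA; rewrite setTI.
apply: (smallest_sub (@sigma_algebra_measurable _ T) (@past_measurable n)).
by have := mf measurableT A mA; rewrite setTI.
Qed.

Lemma past_set n (A : set T) : measurable (A : set (pastT n)) -> measurable A.
Proof. exact: (smallest_sub (@sigma_algebra_measurable _ T) (@past_measurable n)). Qed.

Lemma iid_law k (B : set E) : measurable B -> P (Th k @^-1` B) = mu B.
Proof.
move=> mB.
have mTh := iid_gen_meas iid k.
pose pm : {mfun T >-> E} := HB.pack (Th k) (isMeasurableFun.Build _ _ _ _ _ mTh).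
suff : distribution P pm B = mu B by [].
apply: (measure_unique C (fun=> setT)) => //.
- exact: (iid_gen_gen iid).
- exact: (iid_genI iid).
- by move=> _; exact: (iid_genT iid).
- by rewrite bigcup_const//; exists 0%N.
- move=> A CA; transitivity (P (Th k @^-1` A)) => //.
  pose A' i := if i == k then A else setT.
  have CA' i : C (A' i) by rewrite /A'; case: ifP => // _; exact: (iid_genT iid).
  have -> : Th k @^-1` A = \bigcap_(i in `I_k.+1) Th i @^-1` A' i.
    apply/seteqP; split=> [w Aw i _ /=|w h]; first by rewrite /A'; case: eqVneq => // ->.
    by have := h k (ltnSn k); rewrite /A' eqxx.
  rewrite (iid_gen_prod iid)// big_ord_recr /= /A' eqxx big1 ?mul1e// => i _.
  by rewrite ltn_eqF// probability_setT.
- move=> _; apply: (@le_lt_trans _ _ 1%E); last by rewrite ltry.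
  exact: (probability_le1 (distribution P pm)).
Qed.

End past.

(** * Windows that hold too many points of the walk *)

Section renewal.
Context {R : realType} {d : measure_display} {T : measurableType d}.
Variable (P : probability T R).
Context {dE : measure_display} {E : measurableType dE} (mu : probability E R).
Variables (Th : nat -> T -> E) (C : set (set E)).
Hypothesis iid : iid_gen P mu Th C.
Local Notation pastT n := (g_sigma_algebraType (past Th C n)).

Lemma past_measW k n d' (U : measurableType d') (f : T -> U) : (k <= n)%N ->
  measurable_fun setT (f : pastT k -> U) -> measurable_fun setT (f : pastT n -> U).
Proof.
move=> kn mf; have := measurableT_comp mf (past_mono iid kn).
by rewrite [X in measurable_fun _ X](_ : _ = f).
Qed.

(** Induction peels off the last factor, which is fresh given all the previous ones. The same
    formula serves the bound on crowded windows and the mixed moments of block sums. *)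
Lemma past_integral_prod k n (f : T -> R) (g : nat -> E -> R) (q : nat -> R) :
  measurable_fun setT (f : pastT k -> R) -> (forall w, 0 <= f w) ->
  (forall i, measurable_fun setT (g i)) -> (forall i e, 0 <= g i e) ->
  (forall i, (\int[mu]_e (g i e)%:E = (q i)%:E)%E) ->
  (\int[P]_w (f w * \prod_(i < n) g i (Th (k + i) w))%:E =
   \int[P]_w (f w)%:E * (\prod_(i < n) q i)%:E)%E.
Proof.
move=> mf f0 mg g0 gq.
have mfn m : measurable_fun setT
    ((fun w => f w * \prod_(i < m) g i (Th (k + i) w)) : pastT (k + m) -> R).
  apply: measurable_funM; first by apply: (@past_measW k) => //; exact: leq_addr.
  apply: measurable_prod => i _; apply: measurableT_comp => //.
  by apply: (past_Th iid); rewrite ltn_add2l.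
elim: n => [|n IH].
  under eq_integral do rewrite big_ord0 mulr1.
  by rewrite big_ord0 mule1.
have m1 : measurable_fun setT (fun z : pastT (k + n) * E =>
    ((f z.1 * \prod_(i < n) g i (Th (k + i) z.1)) * g n z.2)%:E).
  apply/measurable_EFinP; apply: measurable_funM; last exact: measurableT_comp.
  exact: (measurableT_comp (mfn n)).
have p0 w : 0 <= f w * \prod_(i < n) g i (Th (k + i) w).
  by rewrite mulr_ge0// prodr_ge0.
transitivity (\int[P]_w
   ((f w * \prod_(i < n) g i (Th (k + i) w)) * g n (Th (k + n)%N w))%:E)%E.
  by apply: eq_integral => w _; rewrite big_ord_recr/= mulrA.
rewrite (past_next iid m1); last by move=> z; rewrite lee_fin mulr_ge0.
transitivity (\int[P]_w ((f w * \prod_(i < n) g i (Th (k + i) w))%:E * (q n)%:E))%E.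
  apply: eq_integral => w _ /=.
  under eq_integral do rewrite EFinM.
  rewrite ge0_integralZl_EFin//.
  - by rewrite gq.
  - by move=> e _; rewrite lee_fin.
  - exact/measurable_EFinP.
have q0 i : 0 <= q i.
  by rewrite -lee_fin -gq; apply: integral_ge0 => e _; rewrite lee_fin.
rewrite ge0_integralZr//.
- by rewrite IH big_ord_recr /= EFinM muleA.
- by apply/measurable_EFinP; apply: (past_meas iid); exact: mfn.
- by move=> w _; rewrite lee_fin.
- by rewrite lee_fin.
Qed.

Variable sz : E -> R.
Hypothesis msz : measurable_fun setT sz.
Definition walk n (w : T) : R := \sum_(i < n) sz (Th i w).

Lemma walk_past k n : (k <= n)%N -> measurable_fun setT (walk k : pastT n -> R).
Proof.
move=> kn; apply: measurable_sum => i; apply: measurableT_comp => //.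
by apply: (past_Th iid); exact: leq_trans kn.
Qed.

Lemma measurable_walk k : measurable_fun setT (walk k).
Proof. by apply: (past_meas iid); exact: (walk_past (leqnn k)). Qed.

Definition first_in (c e : R) k : set T :=
  [set w | c < walk k w <= e] `&` \bigcap_(i in `I_k) [set w | ~ (c < walk i w <= e)].

(** A window with too many points is caught through its first point, because the [m] steps that
    follow are independent of the event that this first point has index [k]. *)
Definition crowded (c e : R) (m : nat) : set T :=
  \bigcup_k (first_in c e k `&` [set w | walk (k + m) w - walk k w <= e - c]).

Let m_in c e k n : (k <= n)%N ->
  measurable ([set w | c < walk k w <= e] : set (pastT n)).
Proof.
move=> kn; rewrite [X in measurable X](_ : _ = walk k @^-1` `]c, e]).
  by rewrite -[X in measurable X]setTI; exact: walk_past.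
by apply/seteqP; split => w /=; rewrite in_itv.
Qed.

Let m_first_in c e k : measurable (first_in c e k : set (pastT k)).
Proof.
apply: measurableI; first exact: m_in.
apply: bigcap_measurableType => i ik; apply: measurableC; apply: m_in.
exact: ltnW.
Qed.

Lemma measurable_crowded c e m : measurable (crowded c e m).
Proof.
apply: bigcup_measurable => k _; apply: measurableI.
  exact: (past_set iid (@m_first_in c e k)).
rewrite [X in measurable X](_ : _ = (fun w => walk (k + m) w - walk k w) @^-1` `]-oo, e - c]).
  rewrite -[X in measurable X]setTI.
  by apply: (measurable_funB (measurable_walk _) (measurable_walk _)).
by apply/seteqP; split => w /=; rewrite in_itv.
Qed.

(** On the event attached to [k], the exponential of minus the next [m] steps divided by [e - c] is
    at least [expR (-1)]; Markov's inequality and independence give [expR 1 * q ^+ m] times the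
    probability of a first visit at [k]. First visits are disjoint, so summing over [k] costs
    nothing. *)
Lemma prob_crowded c e m q : c < e ->
  (\int[mu]_x (expR (- (e - c)^-1 * sz x))%:E = q%:E)%E ->
  (P (crowded c e m) <= (expR 1 * q ^+ m)%:E)%E.
Proof.
move=> ce hq.
have ec0 : 0 < e - c by rewrite subr_gt0.
pose A k := first_in c e k `&` [set w | walk (k + m) w - walk k w <= e - c].
have mA k : measurable (A k).
  apply: measurableI; first exact: (past_set iid (@m_first_in c e k)).
  rewrite [X in measurable X](_ : _ = (fun w => walk (k + m) w - walk k w) @^-1` `]-oo, e - c]).
    rewrite -[X in measurable X]setTI.
    by apply: (measurable_funB (measurable_walk _) (measurable_walk _)).
  by apply/seteqP; split => w /=; rewrite in_itv.
have mF k : measurable (first_in c e k) by exact: (past_set iid (@m_first_in c e k)).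
have q0 : 0 <= q.
  by rewrite -lee_fin -hq; apply: integral_ge0 => x _; rewrite lee_fin expR_ge0.
have PA k : (P (A k) <= P (first_in c e k) * (expR 1 * q ^+ m)%:E)%E.
  have m1 : measurable_fun setT ((\1_(first_in c e k) : T -> R) : pastT k -> R).
    exact: (@measurable_indic _ (pastT k)).
  have := @past_integral_prod k m (\1_(first_in c e k))
    (fun=> fun x => expR (- (e - c)^-1 * sz x)) (fun=> q) m1.
  have -> : (\prod_(i < m) q = q ^+ m) by rewrite prodr_const card_ord.
  rewrite integral_indic// setIT => h.
  rewrite EFinM muleCA -h//; last first.
    move=> _; apply: measurableT_comp => //.
    by apply: measurable_funM => //; exact: measurable_cst.
  have -> : P (A k) = (\int[P]_w (\1_(A k) w)%:E)%E by rewrite integral_indic// setIT.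
  rewrite -ge0_integralZl_EFin//; last 2 first.
  - move=> w _; rewrite lee_fin mulr_ge0// prodr_ge0// => i _; exact: expR_ge0.
  - apply/measurable_EFinP; apply: measurable_funM; first exact: measurable_indic.
    apply: measurable_prod => i _; apply: measurableT_comp => //.
    apply: measurable_funM; first exact: measurable_cst.
    by apply: measurableT_comp => //; exact: (iid_gen_meas iid).
  apply: ge0_le_integral => //.
  - by apply/measurable_EFinP; exact: measurable_indic.
  - apply/measurable_EFinP; apply: measurable_funM; first exact: measurable_cst.
    apply: measurable_funM; first exact: measurable_indic.
    apply: measurable_prod => i _; apply: measurableT_comp => //.
    apply: measurable_funM; first exact: measurable_cst.
    by apply: measurableT_comp => //; exact: (iid_gen_meas iid).
  move=> w _; rewrite lee_fin !indicE.
  case: (boolP (w \in A k)) => [|_]; last first.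
    by rewrite mulr_ge0 ?expR_ge0// mulr_ge0// prodr_ge0// => i _; exact: expR_ge0.
  rewrite inE => -[Fw /= le]; rewrite mem_set// mul1r.
  rewrite -expR_sum -expRD -[leLHS]expR0 ler_expR.
  have -> : \sum_(i < m) - (e - c)^-1 * sz (Th (k + i) w) =
     - (e - c)^-1 * (walk (k + m) w - walk k w).
    rewrite -mulr_sumr; congr (_ * _).
    by rewrite /walk big_split_ord /= [X in _ = X]addrC addKr.
  rewrite mulNr subr_ge0 -[leRHS](mulVf (lt0r_neq0 ec0)) ler_pM2l//.
  by rewrite invr_gt0.
have tF : trivIset setT (first_in c e).
  apply: ltn_trivIset => i j ij; rewrite -subset0 => w [[Fj _] [_ Fi]].
  exact: (Fi j ij Fj).
apply: (@le_trans _ _ (\sum_(k <oo) P (A k))%E).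
  apply: generalized_Boole_inequality => //; exact: bigcupT_measurable.
apply: (@le_trans _ _ (\sum_(k <oo) (P (first_in c e k) * (expR 1 * q ^+ m)%:E))%E).
  by apply: lee_nneseries => // k _ ; exact: PA.
under eq_eseriesr do rewrite muleC.
rewrite nneseriesZl//.
rewrite -[leRHS]mule1; apply: lee_wpmul2l.
  by rewrite lee_fin mulr_ge0// ?expR_ge0// exprn_ge0.
rewrite -measure_semi_bigcup//.
  by apply: probability_le1; exact: bigcupT_measurable.
exact: bigcupT_measurable.
Qed.

(** All visits have an index at least that of the first one, [k]. If [walk (k + m)] were beyond [e],
    monotonicity would leave only the [m] indices from [k] to [k + m - 1]. *)
Lemma not_crowded c e m n w : (forall k, 0 <= sz (Th k w)) -> ~ crowded c e m w ->
  (\sum_(k < n) (c < walk k w <= e)%R <= m)%N.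
Proof.
move=> pos nc; rewrite leqNgt; apply/negP => big.
have mono i j : (i <= j)%N -> walk i w <= walk j w.
  move=> /subnK <-; elim: (j - i)%N => [|r IH]; first by rewrite add0n.
  by rewrite addSn /walk big_ord_recr/= (le_trans IH)// lerDl.
have ex : exists k, (k < n)%N && (c < walk k w <= e).
  apply: contrapT => nex; move: big; rewrite big1// => k _; apply/eqP.
  by rewrite eqb0; apply/negP => h; apply: nex; exists k; rewrite ltn_ord.
case: (ex_minnP ex) => k /andP[kn kin] kmin.
apply: nc; exists k => //; split.
  split=> // i /= ik /[dup] hi; move: (kmin i) => /=; rewrite (ltn_trans ik kn) => km hi2.
  by have := km hi; rewrite leqNgt ik.
rewrite /=.
suff : walk (k + m) w <= e by move: kin => /andP[? ?] ?; lra.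
rewrite leNgt; apply/negP => gt.
suff : (\sum_(i < n) (c < walk i w <= e)%R <= m)%N by rewrite leqNgt big.
apply: (@leq_trans (\sum_(i < n) ((k <= i) && (i < k + m)))%N).
  apply: leq_sum => i _; case: (boolP (c < walk i w <= e)) => // ii.
  have -> : (k <= i)%N by apply: kmin; rewrite ltn_ord.
  rewrite /= lt0b; case: (ltnP i (k + m)) => // kmi.
  by have := mono _ _ kmi; move: ii => /andP[_ ie] /(lt_le_trans gt); rewrite ltNge ie.
rewrite -(big_mkord xpredT (fun i : nat => nat_of_bool ((k <= i) && (i < k + m))))%N.
rewrite (eq_bigr (fun i : nat => if ((k <= i) && (i < k + m))%N then 1 else 0)%N); last first.
  by move=> i _; case: (_ && _).
rewrite -big_mkcond /= sum1_count.
apply: (@leq_trans (size (index_iota k (k + m)))); last by rewrite size_iota addKn.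
rewrite -size_filter; apply: uniq_leq_size; first by rewrite filter_uniq// iota_uniq.
by move=> i; rewrite mem_filter => /andP[/= h _]; rewrite mem_index_iota.
Qed.

End renewal.

(** * The pairs as random elements of a space of marks *)

Section cadlag.
Context {R : realType}.
Implicit Types f : R -> R.

(** A supremum argument on the set of [x] such that [f] is bounded on [[0, x]]: the left limit at
    the supremum [s] bounds [f] just before [s], right-continuity bounds it at and just after [s],
    so [s] cannot stop before [b]. *)
Lemma cadlag0_bounded f (b : R) : cadlag0 f -> 0 <= b ->
  exists2 M, 0 <= M & forall t, 0 <= t <= b -> `|f t| <= M.
Proof.
move=> [fr fl] b0.
pose A := [set x | 0 <= x <= b /\ exists M, forall t, 0 <= t <= x -> `|f t| <= M].
have A0 : A 0.
  split; first by rewrite lexx.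
  by exists `|f 0| => t /andP[t0 t1]; rewrite (_ : t = 0)//; apply/le_anti/andP.
have ubA : ubound A b by move=> x [/andP[]].
have supA : has_sup A by split; [exists 0|exists b].
set s := sup A.
have s0 : 0 <= s by exact: (ub_le_sup (ex_intro _ b ubA)).
have sb : s <= b by apply: ge_sup; [exists 0|].
have [e e0 [M1 HM1]] : exists2 e, 0 < e & exists M, forall t, s <= t < s + e -> `|f t| <= M.
  have := fr _ s0; move/cvgrPdist_le => /(_ 1 ltr01) /nbhs_ballP[e /= e0 He].
  exists e => //; exists (`|f s| + 1) => t /andP[st te].
  move: st; rewrite le_eqVlt => /orP[/eqP <-|st]; first by rewrite lerDl.
  have := He t; rewrite /ball /= ltr0_norm ?subr_lt0//= opprB ltrBlDl => /(_ te st).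
  rewrite distrC => h; have := ler_normD (f t - f s) (f s); rewrite subrK; lra.
have [M2 HM2] : exists M, forall t, 0 <= t < s -> `|f t| <= M.
  move: s0; rewrite le_eqVlt => /orP[/eqP <-|s0].
    by exists 0 => t /andP[t0 t1]; have := le_lt_trans t0 t1; rewrite ltxx.
  have /cvg_ex[l] := fl _ s0; move/cvgrPdist_le => /(_ 1 ltr01) /nbhs_ballP[e' /= e0' He'].
  have [x [x0 [M HM]] xs] := sup_adherent e0' supA.
  exists (Num.max M (`|l| + 1)) => t /andP[t0 ts]; rewrite le_max.
  case: (leP t x) => tx; first by rewrite HM// t0.
  have := He' t; rewrite /ball /= gtr0_norm ?subr_gt0// => /(_ _ ts) h.
  have {}h : `|l - f t| <= 1 by apply: h; move: xs tx; rewrite -/s; lra.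
  apply/orP; right; have := ler_normB l (l - f t).
  by rewrite opprB addrC subrK; lra.
have As : forall x, 0 <= x <= b -> x < s + e -> A x.
  move=> x xb xe; split=> //; exists (Num.max M1 M2) => t /andP[t0 tx]; rewrite le_max.
  case: (leP s t) => st; first by rewrite HM1 ?st// (le_lt_trans tx).
  by rewrite HM2 ?orbT// t0.
have sE : s = b.
  apply/eqP; rewrite eq_le sb /= leNgt; apply/negP => sltb.
  pose x := Num.min b (s + e / 2).
  have sx : s < x by rewrite /x lt_min sltb ltrDl divr_gt0.
  have : A x.
    apply: As; first by rewrite /x ge_min lexx (le_trans s0 (ltW sx)).
    by rewrite /x gt_min ltrD2l ltr_pdivrMr// mulr2n mulrDr mulr1 ltrDl e0 orbT.
  by move=> /(ub_le_sup (ex_intro _ b ubA)); rewrite -/s leNgt sx.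
have [_ [M HM]] : A b by apply: As; rewrite ?b0 ?lexx// sE ltrDl.
exists M => //; apply: (le_trans (normr_ge0 (f 0))); apply: HM.
by rewrite lexx.
Qed.

Lemma cvg_grid_right (x : R) : 0 <= x ->
  let u n := (Num.truncn (x * n.+1%:R)).+1%:R / n.+1%:R in
  (forall n, x < u n) /\ (u n @[n --> \oo] --> x).
Proof.
move=> x0 u.
have lb n : x < u n.
  by rewrite /u ltr_pdivlMr// truncnS_gt.
split=> //.
have ub n : u n <= x + n.+1%:R^-1.
  rewrite /u -natr1 mulrDl mul1r lerD2r ler_pdivrMr// truncn_le// mulr_ge0//.
apply: (@squeeze_cvgr _ _ _ _ (fun=> x) (fun n => x + n.+1%:R^-1)).
- by apply: nearW => n; rewrite (ltW (lb n)) ub.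
- exact: cvg_cst.
- rewrite -[X in _ --> X]addr0; apply: cvgD; first exact: cvg_cst.
  exact: cvg_harmonic.
Qed.

(** The value at [z.2] is the limit of the values at the next point, strictly to the right, of the
    grid of mesh [1 / n.+1]; on each cell of the grid this approximation depends on [z.1] only. *)
Lemma measurable_joint (d : measure_display) (U : measurableType d) (f : U -> R -> R) :
  (forall t, 0 <= t -> measurable_fun setT (f ^~ t)) ->
  (forall u t, 0 <= t -> f u x @[x --> t^'+] --> f u t) ->
  measurable_fun setT (fun z : U * R => if 0 <= z.2 then f z.1 z.2 else 0).
Proof.
move=> mf rc.
pose g n (z : U * R) := if 0 <= z.2 then
  f z.1 ((Num.truncn (z.2 * n.+1%:R)).+1%:R / n.+1%:R) else 0.
apply: (measurable_fun_cvg (h := g)); last first.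
  move=> [u t] _ /=; rewrite /g /=; case: (leP 0 t) => t0; last exact: cvg_cst.
  have [ut uc] := cvg_grid_right t0.
  have /cvg_at_rightP := rc u t t0; apply.
  by split.
move=> n.
pose D k := [set z : U * R | (k%:R <= z.2 * n.+1%:R < k.+1%:R)].
have mD k : measurable (D k).
  rewrite [X in measurable X](_ : _ = setT `&` (fun z : U * R => z.2 * n.+1%:R) @^-1` `[k%:R, k.+1%:R[).
    apply: (_ : measurable_fun setT (fun z : U * R => z.2 * n.+1%:R)) => //.
    by apply: measurable_funM; [exact: measurable_snd|exact: measurable_cst].
  by rewrite setTI; apply/seteqP; split => z /=; rewrite in_itv.
pose D' := [set z : U * R | z.2 < 0].
have mD' : measurable D'.
  rewrite [X in measurable X](_ : _ = setT `&` snd @^-1` `]-oo, 0[).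
    exact: measurable_snd.
  by rewrite setTI; apply/seteqP; split => z /=; rewrite in_itv.
have -> : [set: U * R] = D' `|` \bigcup_k D k.
  apply/esym; rewrite -subTset => -[u t] _; case: (ltP t 0) => t0; [by left|right].
  exists (Num.truncn (t * n.+1%:R)) => //=.
  by apply: truncn_itv; rewrite mulr_ge0.
apply/measurable_funU => //; first exact: bigcup_measurable.
split.
  apply: (eq_measurable_fun (cst 0 : U * R -> R)); last exact: measurable_cst.
  by move=> z; rewrite inE /D' /= => z0; rewrite /g leNgt z0.
apply/measurable_fun_bigcup => // k.
apply: (eq_measurable_fun (fun z : U * R => f z.1 (k.+1%:R / n.+1%:R))).
  move=> [u t]; rewrite inE /D /= => tk; rewrite /g /=.
  have t0 : 0 <= t.
    have /andP[h _] := tk; rewrite -(pmulr_lge0 t (x := n.+1%:R))//.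
    by rewrite (le_trans _ h).
  by rewrite t0 (truncn_def tk).
apply: measurable_funTS; apply: (measurableT_comp (mf _ _) measurable_fst).
by rewrite divr_ge0.
Qed.

End cadlag.

(** The proof of regularity travels with the path, so that right-continuity, and with it joint
    measurability in mark and time, holds on the whole space of marks. *)
Record mark (R : realType) := Mark {
  mark_size : R ; mark_path : R -> R ; mark_cadlag : cadlag0 mark_path }.

Lemma cadlag0_cst (R : realType) (c : R) : cadlag0 (fun=> c : R).
Proof. by split=> t _; [exact: cvg_cst|apply/cvg_ex; exists c; exact: cvg_cst]. Qed.

HB.instance Definition _ (R : realType) := gen_eqMixin (mark R).
HB.instance Definition _ (R : realType) := gen_choiceMixin (mark R).
HB.instance Definition _ (R : realType) :=
  isPointed.Build (mark R) (Mark 0 (cadlag0_cst (0 : R))).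

(** Times are restricted to be nonnegative, as in the independence hypothesis on the pairs. *)
Definition cylinder (R : realType) : set (set (mark R)) :=
  [set B | exists A0 : set R, exists s : seq (R * set R),
    [/\ measurable A0, (forall p, p \in s -> 0 <= p.1 /\ measurable p.2) &
      B = [set e | A0 (mark_size e) /\ forall p, p \in s -> p.2 (mark_path e p.1)]]].

Definition markT (R : realType) := g_sigma_algebraType (@cylinder R).
HB.instance Definition _ (R : realType) := Measurable.on (markT R).

Section marks.
Context {R : realType}.
Local Notation M := (markT R).

Lemma cylinderI : setI_closed (@cylinder R).
Proof.
move=> _ _ [A [s [mA ms ->]]] [A' [s' [mA' ms' ->]]].
exists (A `&` A'), (s ++ s'); split; first exact: measurableI.
  by move=> p; rewrite mem_cat => /orP[/ms|/ms'].
apply/seteqP; split=> [e [[h1 h2] [h3 h4]]|e [[h1 h2] h3]]; split=> //.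
- by move=> p; rewrite mem_cat => /orP[/h2|/h4].
- by split=> // p ps; apply: h3; rewrite mem_cat ps.
- by split=> // p ps; apply: h3; rewrite mem_cat ps orbT.
Qed.

Lemma cylinderT : cylinder [set: M].
Proof.
exists setT, [::]; split=> //.
by apply/esym; rewrite -subTset => e _; split.
Qed.

Lemma measurable_mark_size : measurable_fun setT (@mark_size R : M -> R).
Proof.
move=> _ A mA; rewrite setTI; apply: sub_sigma_algebra; exists A, [::]; split=> //.
by apply/seteqP; split=> [e h|e []].
Qed.

Lemma measurable_mark_path t : 0 <= t ->
  measurable_fun setT ((fun e => mark_path e t) : M -> R).
Proof.
move=> t0 _ A mA; rewrite setTI; apply: sub_sigma_algebra; exists setT, [:: (t, A)]; split=> //.
  by move=> p; rewrite inE => /eqP ->.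
apply/seteqP; split=> [e h|e [_ h]].
  by split=> // p; rewrite inE => /eqP ->.
by apply: (h (t, A)); rewrite inE.
Qed.

Section copies.
Context {d : measure_display} {T : measurableType d} (P : probability T R).
Variables (X : nat -> T -> R -> R) (xi : nat -> T -> R).
Hypothesis mX : forall k t, measurable_fun setT (fun w => X k w t).
Hypothesis mxi : forall k, measurable_fun setT (xi k).
Hypothesis cX : forall k w, cadlag0 (X k w).
Hypothesis iidX : iid_pairs P X xi.

Definition marks k (w : T) : M := Mark (xi k w) (cX k w).

Lemma measurable_marks k : measurable_fun setT (marks k).
Proof.
apply: (@measurability _ _ T M setT (marks k) (@cylinder R)) => //.
move=> _ [_ [A0 [s [mA ms ->]]] <-]; rewrite setTI.
rewrite [X in measurable X](_ : _ = xi k @^-1` A0 `&`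
  \bigcap_(p in [set p | p \in s]) ((fun w => X k w p.1) @^-1` p.2)).
  apply: measurableI; first by rewrite -[X in measurable X]setTI; exact: mxi.
  apply: fin_bigcap_measurable => //.
  by move=> p /ms[_ mp]; rewrite -[X in measurable X]setTI; exact: mX.
by apply/seteqP; split.
Qed.

Let marks0 : {mfun T >-> M} :=
  HB.pack (marks 0) (isMeasurableFun.Build _ _ _ _ _ (measurable_marks 0)).

Definition mark_law : probability M R := distribution P marks0.

Lemma mark_lawE (A : set M) : mark_law A = P (marks 0 @^-1` A).
Proof. by []. Qed.

(** The independence hypothesis uses one list of times for all indices, whereas each cylinder [A k]
    comes with its own. The lists are merged into [L], every time being tagged with the index that
    owns it. *)
Lemma iid_marks : iid_gen P mark_law marks (@cylinder R).
Proof.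
split=> //; [exact: cylinderI|exact: cylinderT|exact: measurable_marks|].
move=> n A cA.
have h1 : forall k, exists A0 : set R, exists s : seq (R * set R),
    [/\ measurable A0, (forall p, p \in s -> 0 <= p.1 /\ measurable p.2) &
      A k = [set e | A0 (mark_size e) /\ forall p, p \in s -> p.2 (mark_path e p.1)]].
  by move=> k; have [A0 [s h]] := cA k; exists A0, s.
have [A0 h2] := choice h1; have [s hs] := choice h2; clear h1 h2.
pose L : seq (nat * (R * set R)) := flatten [seq [seq (k, p) | p <- s k] | k <- iota 0 n].
pose x0 : nat * (R * set R) := (0%N, (0, setT)).
pose ts (j : 'I_(size L)) := (nth x0 L j).2.1.
(* At a time owned by another index the constraint is the trivial one. *)
pose B k (j : 'I_(size L)) := if (nth x0 L j).1 == k then (nth x0 L j).2.2 else setT.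
have Lin j : (j < size L)%N -> exists2 p, p \in s (nth x0 L j).1 & nth x0 L j = ((nth x0 L j).1, p).
  move=> jL; have /flatten_mapP[k _ /mapP[p ps e]] := mem_nth x0 jL.
  by exists p; rewrite e.
have E k y f : (k < n)%N -> (A0 k y /\ forall j, B k j (f (ts j))) <->
    (A0 k y /\ forall p, p \in s k -> p.2 (f p.1)).
  move=> kn; split=> -[h1 h2]; split=> //.
    move=> p ps.
    have kpL : (k, p) \in L.
      apply/flatten_mapP; exists k; first by rewrite mem_iota.
      by apply/mapP; exists p.
    have jL : (index (k, p) L < size L)%N by rewrite index_mem.
    by have := h2 (Ordinal jL); rewrite /B /ts /= nth_index//= eqxx.
  move=> j; rewrite /B /ts; case: eqP => // jk.
  by have [p + ->] := Lin j (ltn_ord j); rewrite jk; exact: h2.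
have := @iidX (size L) ts (iota 0 n) A0 B.
have aux : forall a b c e Q' Q : Prop, (Q' -> Q) -> a -> b -> c -> e -> (a -> b -> c -> e -> Q') -> Q by move=> a b c e Q' Q f ha hb hc he g; apply: f; exact: g.
apply: aux.
- move=> H.
  rewrite bigcap_mkord -(big_mkord xpredT (fun k => marks k @^-1` A k)).
  rewrite -(big_mkord xpredT (fun k => mark_law (A k))) /index_iota subn0.
  have e1 k : (k < n)%N -> marks k @^-1` A k =
      [set w | A0 k (xi k w) /\ forall j, B k j (X k w (ts j))].
    move=> kn; have [_ _ ->] := hs k; apply/seteqP; split=> w /=; first by move=> h; apply/E.
    by move=> h; apply/(E k).
  have e2 k : (k < n)%N -> mark_law (A k) =
      P [set w | A0 k (xi 0 w) /\ forall j, B k j (X 0 w (ts j))].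
    move=> kn; rewrite mark_lawE; congr (P _).
    have [_ _ ->] := hs k; apply/seteqP; split=> w /=; first by move=> h; apply/E.
    by move=> h; apply/(E k).
  rewrite (eq_big_seq (fun k => [set w | A0 k (xi k w) /\ forall j, B k j (X k w (ts j))])); last first.
    by move=> k; rewrite mem_iota /= add0n => kn; exact: e1.
  rewrite [RHS](eq_big_seq (fun k => P [set w | A0 k (xi 0 w) /\ forall j, B k j (X 0 w (ts j))])); last first.
    by move=> k; rewrite mem_iota /= add0n => kn; exact: e2.
  exact: H.
- by move=> j; rewrite /ts; have [p ps ->] := Lin j (ltn_ord j); have [_ /(_ _ ps)[]] := hs (nth x0 L j).1.
- exact: iota_uniq.
- by move=> k; have [] := hs k.
- move=> k j; rewrite /B; case: ifP => // _.
  by have [p ps ->] := Lin j (ltn_ord j); have [_ /(_ _ ps)[]] := hs (nth x0 L j).1.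
Qed.

Lemma ge0_integral_mark_law (f : M -> \bar R) : measurable_fun setT f ->
  (forall e, 0 <= f e)%E -> (\int[mark_law]_e f e = \int[P]_w f (marks 0 w))%E.
Proof. by move=> mf f0; rewrite (@ge0_integral_distribution _ _ _ _ _ P marks0). Qed.

End copies.
End marks.

(** * Moment bounds for compensated sums over the walk *)

Section power_ineq.
Context {R : realType}.
Implicit Types x y z K L : R.

Lemma expr_interp z (j m : nat) : 0 <= z -> (0 < j <= m)%N -> z ^+ j <= z + z ^+ m.
Proof.
move=> z0 /andP[j0 jm]; case: (leP z 1) => z1.
  rewrite ler_wpDr ?exprn_ge0//.
  by rewrite -[leRHS]expr1; apply: ler_wiXn2l.
rewrite ler_wpDl//; apply: ler_weXn2l => //; exact: ltW.
Qed.

(* Second order Taylor expansion of [(K + x^2)^l], with a remainder that is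
   relatively small when [K] is large. *)
Lemma power_step (l : nat) : exists2 C : R, 0 <= C & forall K x y, 1 <= K ->
  (K + (x + y) ^+ 2) ^+ l.+1 <= (K + x ^+ 2) ^+ l.+1
    + 2 * l.+1%:R * x * (K + x ^+ 2) ^+ l * y
    + C * (K + x ^+ 2) ^+ l * (y ^+ 2 + y ^+ (2 * l.+1)).
Proof.
elim: l => [|l [C C0 IH]].
  exists 1 => // K x y K1; rewrite !expr1 !expr0 muln1 !mulr1.
  have := sqr_ge0 y; rewrite !expr2; lra.
(* The four error terms in [E1] cost respectively [1], [4 * l.+1], [2 * l.+1] and [8 * C] times
   [q * q ^+ l * Z]. *)
exists (1 + 6 * l.+1%:R + 8 * C).
  by rewrite addr_ge0 ?mulr_ge0// addr_ge0 ?mulr_ge0.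
move=> K x y K1; have {}IH := IH K x y K1.
set q := K + x ^+ 2 in IH *.
have q1 : 1 <= q by rewrite /q ler_wpDr// sqr_ge0.
have A0 : 0 <= K + (x + y) ^+ 2 by rewrite addr_ge0 ?sqr_ge0// (le_trans ler01).
have xq2 : x ^+ 2 <= q by rewrite /q ler_wpDl// (le_trans ler01).
rewrite exprSr.
apply: (le_trans (ler_wpM2r A0 IH)).
have -> : K + (x + y) ^+ 2 = q + 2 * x * y + y ^+ 2 by rewrite /q; ring.
set z := y ^+ 2.
have z0 : 0 <= z by exact: sqr_ge0.
have -> : y ^+ (2 * l.+1) = z ^+ l.+1 by rewrite /z exprM.
have -> : y ^+ (2 * l.+2) = z ^+ l.+2 by rewrite /z exprM.
set Z := z + z ^+ l.+2.
have zZ : z <= Z by rewrite /Z lerDl exprn_ge0.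
have zZ1 : z ^+ l.+1 <= Z by apply: expr_interp => //; rewrite ltnS leqnSn.
have zZ2 : z ^+ 2 <= Z by apply: expr_interp.
have zZ3 : z ^+ l.+2 <= Z by rewrite /Z lerDr.
set Q := q ^+ l.
have Q0 : 0 <= Q by rewrite exprn_ge0// (le_trans ler01).
have -> : q ^+ l.+1 = q * Q by rewrite exprS.
have -> : q ^+ l.+2 = q * (q * Q) by rewrite !exprS.
have Z0 : 0 <= Z by exact: le_trans zZ.
have r1 : x * y * z <= q * Z.
  have h1 : x * y * z <= `|x| * (`|y| * z).
    by rewrite mulrA -normrM; apply: ler_wpM2r => //; exact: ler_norm.
  apply: (le_trans h1).
  have xq : `|x| <= q.
    have := sqr_ge0 (`|x| - 1); rewrite sqrrB1 real_normK ?num_real// => h.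
    rewrite mulr2n in h; have := normr_ge0 x; move: K1 (sqr_ge0 x) h; rewrite /q; lra.
  have yz : `|y| * z <= Z.
    have h : `|y| <= (1 + z) / 2.
      rewrite ler_pdivlMr//; have := sqr_ge0 (`|y| - 1).
      by rewrite sqrrB1 real_normK ?num_real// -/z mulr2n; lra.
    apply: (le_trans (ler_wpM2r z0 h)).
    by move: zZ zZ2; rewrite expr2; lra.
  by apply: ler_pM => //; exact: mulr_ge0.
have r2 : x ^+ 2 * z <= q * Z by apply: ler_pM => //; exact: sqr_ge0.
have r3 : (z + z ^+ l.+1) * (q + 2 * x * y + z) <= 8 * (q * Z).
  have h1 : q + 2 * x * y + z <= 2 * (q * (1 + z)).
    have h : 2 * x * y <= x ^+ 2 + z by have := sqr_ge0 (x - y); rewrite /z sqrrB mulr2n; lra.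
    have : z <= q * z by rewrite ler_peMl.
    by rewrite mulrDr mulr1; lra.
  have Y0 : 0 <= z + z ^+ l.+1 by rewrite addr_ge0// exprn_ge0.
  apply: (le_trans (ler_wpM2l Y0 h1)).
  have -> : (z + z ^+ l.+1) * (2 * (q * (1 + z))) =
    2 * (q * (z + z ^+ l.+1 + z ^+ 2 + z ^+ l.+2)) by rewrite [z ^+ l.+2]exprSr expr2; ring.
  have -> : 8 * (q * Z) = 2 * (q * (Z + Z + Z + Z)) by ring.
  apply: ler_wpM2l => //; apply: ler_wpM2l; first exact: le_trans q1.
  by rewrite !lerD.
have l0 : 0 <= l.+1%:R :> R by [].
rewrite -/z.
have E1 : (q * Q + 2 * l.+1%:R * x * Q * y + C * Q * (z + z ^+ l.+1)) * (q + 2 * x * y + z)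
  = q * (q * Q) + 2 * l.+2%:R * x * (q * Q) * y
    + Q * (q * z + 4 * l.+1%:R * (x ^+ 2 * z) + 2 * l.+1%:R * (x * y * z)
      + C * ((z + z ^+ l.+1) * (q + 2 * x * y + z))).
  rewrite -[l.+2%:R]natr1; move: (z ^+ l.+1) (l.+1%:R : R) => zl nl; rewrite /z; ring.
rewrite E1 lerD2l.
have -> : (1 + 6 * l.+1%:R + 8 * C) * (q * Q) * Z =
  Q * (q * Z + 4 * l.+1%:R * (q * Z) + 2 * l.+1%:R * (q * Z) + C * (8 * (q * Z))) by ring.
apply: ler_wpM2l => //.
have h1 : q * z <= q * Z by apply: ler_wpM2l => //; exact: le_trans q1.
have h2 : 4 * l.+1%:R * (x ^+ 2 * z) <= 4 * l.+1%:R * (q * Z) by apply: ler_wpM2l => //; exact: mulr_ge0.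
have h3 : 2 * l.+1%:R * (x * y * z) <= 2 * l.+1%:R * (q * Z) by apply: ler_wpM2l => //; exact: mulr_ge0.
have h4 : C * ((z + z ^+ l.+1) * (q + 2 * x * y + z)) <= C * (8 * (q * Z)) by exact: ler_wpM2l.
by rewrite !lerD.
Qed.

End power_ineq.

Section one_step.
Context {R : realType} {dE : measure_display} {E : measurableType dE} (mu : probability E R).

Lemma integral_power_step (l : nat) : exists2 C : R, 0 <= C &
  forall (Y : E -> R) (L M c m b : R), measurable_fun setT Y -> 1 <= L ->
  (\int[mu]_e (Y e ^+ 2 + Y e ^+ (2 * l.+1))%:E <= c%:E)%E ->
  `|fine (\int[mu]_e (Y e)%:E)%E| <= m -> c / L ^+ 2 + m / L <= b ->
  (\int[mu]_e ((L ^+ 2 + (M + Y e) ^+ 2) ^+ l.+1)%:E <=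
     ((L ^+ 2 + M ^+ 2) ^+ l.+1 * expR (C * b))%:E)%E.
Proof.
have [C0 C00 HC] := @power_step R l.
exists (C0 + 2 * l.+1%:R); first by rewrite addr_ge0// mulr_ge0.
move=> Y L M c m b mY L1 hc hm hb.
have L0 : 0 < L by exact: lt_le_trans L1.
have K1 : 1 <= L ^+ 2 by exact: exprn_ege1.
set q := L ^+ 2 + M ^+ 2.
have q1 : 1 <= q by rewrite /q ler_wpDr// sqr_ge0.
have q0 : 0 <= q by exact: le_trans q1.
have Yp0 e : 0 <= Y e ^+ 2 + Y e ^+ (2 * l.+1).
  by rewrite addr_ge0 ?sqr_ge0// exprM exprn_ge0// sqr_ge0.
have mYp : measurable_fun setT (fun e => Y e ^+ 2 + Y e ^+ (2 * l.+1)).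
  by apply: measurable_funD; apply: measurable_funX.
have iYp : mu.-integrable setT (fun e => (Y e ^+ 2 + Y e ^+ (2 * l.+1))%:E).
  apply/integrableP; split; first exact/measurable_EFinP.
  under eq_integral do rewrite gee0_abs ?lee_fin//.
  by apply: (le_lt_trans hc); rewrite ltry.
have iY : mu.-integrable setT (fun e => (Y e)%:E).
  apply: (@le_integrable _ _ _ mu setT measurableT _ (fun e => (1 + (Y e ^+ 2 + Y e ^+ (2 * l.+1)))%:E)).
  - exact/measurable_EFinP.
  - move=> e _; rewrite !abse_EFin lee_fin [leRHS]ger0_norm; last by rewrite addr_ge0.
    have h : 0 <= Y e ^+ (2 * l.+1) by rewrite exprM exprn_ge0// sqr_ge0.
    have := sqr_ge0 (`|Y e| - 1); rewrite sqrrB1 real_normK ?num_real// mulr2n.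
    have := normr_ge0 (Y e); have := sqr_ge0 (Y e); move: h.
    set a := _ ^+ (2 * _); set y2 := Y e ^+ 2; lra.
  - under eq_fun do rewrite EFinD.
    by apply: integrableD => //; exact: finite_measure_integrable_cst.
pose a1 := 2 * l.+1%:R * M * q ^+ l; pose a2 := C0 * q ^+ l.
apply: (@le_trans _ _ (\int[mu]_e (q ^+ l.+1 + (a1 * Y e + a2 * (Y e ^+ 2 + Y e ^+ (2 * l.+1))))%:E)%E).
  apply: ge0_le_integral => //.
  - move=> e _; rewrite lee_fin exprn_ge0// addr_ge0 ?sqr_ge0//.
  - apply/measurable_EFinP; apply: measurable_funX; apply: measurable_funD; first exact: measurable_cst.
    by apply: measurable_funX; apply: measurable_funD => //; exact: measurable_cst.
  - apply/measurable_EFinP; apply: measurable_funD; first exact: measurable_cst.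
    by apply: measurable_funD; apply: measurable_funM => //; exact: measurable_cst.
  - move=> e _; rewrite lee_fin; apply: (le_trans (HC (L ^+ 2) M (Y e) K1)).
    by rewrite -/q /a1 /a2 addrA.
have i1 : mu.-integrable setT (fun e => (a1 * Y e)%:E).
  by under eq_fun do rewrite EFinM; exact: integrableZl.
have i2 : mu.-integrable setT (fun e => (a2 * (Y e ^+ 2 + Y e ^+ (2 * l.+1)))%:E).
  by under eq_fun do rewrite EFinM; exact: integrableZl.
have -> : (\int[mu]_e (q ^+ l.+1 + (a1 * Y e + a2 * (Y e ^+ 2 + Y e ^+ (2 * l.+1))))%:E =
   (q ^+ l.+1)%:E + (a1%:E * \int[mu]_e (Y e)%:E
     + a2%:E * \int[mu]_e (Y e ^+ 2 + Y e ^+ (2 * l.+1))%:E))%E.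
  under eq_integral do rewrite EFinD.
  rewrite integralD//; last 2 first.
  - exact: finite_measure_integrable_cst.
  - by under eq_fun do rewrite EFinD; exact: integrableD.
  congr (_ + _)%E.
    exact: integral_prob_cst.
  under eq_integral do rewrite EFinD.
  rewrite integralD//; congr (_ + _)%E.
    by under eq_integral do rewrite EFinM; rewrite integralZl.
  by under eq_integral do rewrite EFinM; rewrite integralZl.
have fY : (\int[mu]_e (Y e)%:E)%E \is a fin_num by exact: integrable_fin_num.
have fYp : (\int[mu]_e (Y e ^+ 2 + Y e ^+ (2 * l.+1))%:E)%E \is a fin_num by exact: integrable_fin_num.
rewrite -(fineK fY) -(fineK fYp) -!EFinM -!EFinD lee_fin.
move: hc; rewrite -(fineK fYp) lee_fin.
move: hm; set IY := fine _; set IP := fine _ => hm hc.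
have qE : q ^+ l.+1 = q * q ^+ l by rewrite exprS.
have ql0 : 0 <= q ^+ l by exact: exprn_ge0.
have m0 : 0 <= m by exact: le_trans (normr_ge0 _) hm.
have c0 : 0 <= c.
  apply: le_trans hc; rewrite /IP fine_ge0//.
  by apply: integral_ge0 => e _; rewrite lee_fin.
have h1 : a1 * IY <= 2 * l.+1%:R * (q ^+ l.+1 * (m / L)).
  have -> : a1 * IY = 2 * l.+1%:R * q ^+ l * (M * IY) by rewrite /a1; ring.
  have -> : 2 * l.+1%:R * (q ^+ l.+1 * (m / L)) = 2 * l.+1%:R * q ^+ l * (q * (m / L)).
    by rewrite qE; ring.
  apply: ler_wpM2l; first by rewrite !mulr_ge0.
  apply: (le_trans (ler_norm _)); rewrite normrM.
  apply: (@le_trans _ _ (`|M| * m)); first exact: ler_wpM2l.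
  rewrite mulrA ler_pdivlMr// mulrAC; apply: ler_wpM2r => //.
  have := sqr_ge0 (`|M| - L); rewrite sqrrB real_normK ?num_real// /q mulr2n.
  have : 0 <= `|M| * L by rewrite mulr_ge0// ltW.
  lra.
have h2 : a2 * IP <= C0 * (q ^+ l.+1 * (c / L ^+ 2)).
  rewrite /a2 qE -!mulrA; apply: ler_wpM2l => //.
  rewrite [leRHS]mulrCA; apply: ler_wpM2l => //.
  apply: (le_trans hc).
  rewrite mulrA ler_pdivlMr ?exprn_gt0// mulrC; apply: ler_wpM2r => //.
  by rewrite /q lerDl sqr_ge0.
have cL0 : 0 <= c / L ^+ 2 by rewrite divr_ge0// exprn_ge0// ltW.
have mL0 : 0 <= m / L by rewrite divr_ge0// ltW.
apply: (@le_trans _ _ (q ^+ l.+1 * (1 + (C0 + 2 * l.+1%:R) * b))).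
  have h3 : 2 * l.+1%:R * (m / L) + C0 * (c / L ^+ 2) <= (C0 + 2 * l.+1%:R) * b.
    apply: (@le_trans _ _ ((C0 + 2 * l.+1%:R) * (c / L ^+ 2 + m / L))); last first.
      by apply: ler_wpM2l => //; rewrite addr_ge0// mulr_ge0.
    have : 0 <= C0 * (m / L) by exact: mulr_ge0.
    have : 0 <= 2 * l.+1%:R * (c / L ^+ 2) by rewrite mulr_ge0// mulr_ge0.
    rewrite mulrDl !mulrDr; lra.
  have := ler_wpM2l (exprn_ge0 l.+1 q0) h3.
  move: h1 h2; rewrite /= !mulrDr mulr1.
  set A := q ^+ l.+1; rewrite (mulrCA A) (mulrCA A C0) => ? ? ?; lra.
by apply: ler_wpM2l; [exact: exprn_ge0|exact: expR_ge1Dx].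
Qed.

End one_step.

(** * A discounted supermartingale for sums over the walk *)

Section supermartingale.
Context {R : realType} {d : measure_display} {T : measurableType d}.
Variable (P : probability T R).
Context {dE : measure_display} {E : measurableType dE} (mu : probability E R).
Variables (Th : nat -> T -> E) (C : set (set E)).
Hypothesis iid : iid_gen P mu Th C.
Local Notation pastT n := (g_sigma_algebraType (past Th C n)).
Variable sz : E -> R.
Hypothesis msz : measurable_fun setT sz.
Local Notation walk := (walk Th sz).

Definition shots (D : E * R -> R) (s : R) (n : nat) (w : T) : R :=
  \sum_(k < n) (if walk k w <= s then D (Th k w, s - walk k w) else 0).

Definition shot_rate (b : R -> R) (s : R) (n : nat) (w : T) : R :=
  \sum_(k < n) (if walk k w <= s then b (s - walk k w) else 0).

Let mle s k n : (k <= n)%N -> measurable_fun setT ((fun w => walk k w <= s) : pastT n -> bool).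
Proof.
by move=> kn; apply: measurable_fun_ler; [exact: (walk_past iid msz)|exact: measurable_cst].
Qed.

Lemma shots_past D s n : measurable_fun setT D ->
  measurable_fun setT (shots D s n : pastT n -> R).
Proof.
move=> mD; apply: measurable_sum => k.
apply: measurable_fun_ifT.
- by apply: mle; exact: ltnW.
- apply: (measurableT_comp mD); apply: measurable_fun_pair; first exact: (past_Th iid).
  apply: measurable_funB; first exact: measurable_cst.
  by apply: (walk_past iid msz); exact: ltnW.
- exact: measurable_cst.
Qed.

(** The bound is [n.+1] and not [n] because the summand of index [i] uses [walk i], that is, the
    first [i] marks: the rate is predictable. *)
Lemma shot_rate_past b s k n : (k <= n.+1)%N -> measurable_fun setT b ->
  measurable_fun setT (shot_rate b s k : pastT n -> R).
Proof.
move=> kn mb; apply: measurable_sum => i.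
have ik : (i <= n)%N by rewrite -ltnS (leq_trans (ltn_ord i)).
apply: measurable_fun_ifT; [exact: mle| |exact: measurable_cst].
apply: (measurableT_comp mb); apply: measurable_funB; first exact: measurable_cst.
exact: (walk_past iid msz).
Qed.

Lemma measurable_shots D s n : measurable_fun setT D -> measurable_fun setT (shots D s n).
Proof. by move=> mD; apply: (past_meas iid); exact: shots_past. Qed.

Lemma measurable_shot_rate b s n : measurable_fun setT b ->
  measurable_fun setT (shot_rate b s n).
Proof.
by move=> mb; apply: (past_meas iid); apply: (@shot_rate_past b s n n.+1) => //; rewrite leqW.
Qed.

(* [(L^2 + M_n^2)^l] discounted by the exponential of the accumulated rate is a
   supermartingale. *)
Lemma shots_tail (l : nat) : exists2 K : R, 0 <= K &
  forall (D : E * R -> R) (c m b : R -> R) (L s y : R) (n : nat),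
  measurable_fun setT D -> measurable_fun setT b -> 1 <= L -> 0 < y ->
  (forall x, 0 <= x ->
    (\int[mu]_e (D (e, x) ^+ 2 + D (e, x) ^+ (2 * l.+1))%:E <= (c x)%:E)%E) ->
  (forall x, 0 <= x -> `|fine (\int[mu]_e (D (e, x))%:E)%E| <= m x) ->
  (forall x, 0 <= x -> c x / L ^+ 2 + m x / L <= b x) ->
  (P [set w | (y < `|shots D s n w|)%R /\ (shot_rate b s n w <= 1)%R]
   <= (expR K * (L / y) ^+ (2 * l.+1))%:E)%E.
Proof.
have [K K0 HK] := integral_power_step mu l.
exists K => // D c m b L s y n mD mb L1 y0 hc hm hb.
pose V k w := (L ^+ 2 + shots D s k w ^+ 2) ^+ l.+1 * expR (- K * shot_rate b s k w).
have V0 k w : 0 <= V k w.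
  by rewrite mulr_ge0 ?expR_ge0// exprn_ge0// addr_ge0 ?sqr_ge0.
have mV k : measurable_fun setT (V k).
  apply: measurable_funM.
    apply: measurable_funX; apply: measurable_funD; first exact: measurable_cst.
    by apply: measurable_funX; exact: measurable_shots.
  apply: measurableT_comp => //; apply: measurable_funM; first exact: measurable_cst.
  exact: measurable_shot_rate.
(* Given the first [k] marks, the new term is zero or the fresh mark at the known age
   [s - walk k w]. The rate up to [k.+1] is already known as well, and its increment in the discount
   absorbs the growth allowed by [integral_power_step]. *)
have step k : (\int[P]_w (V k.+1 w)%:E <= \int[P]_w (V k w)%:E)%E.
  pose phi (z : pastT k * E) :=
   ((L ^+ 2 + (shots D s k z.1 +
       (if walk k z.1 <= s then D (z.2, s - walk k z.1) else 0)) ^+ 2) ^+ l.+1 *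
     expR (- K * shot_rate b s k.+1 z.1))%:E.
  have mphi : measurable_fun setT phi.
    apply/measurable_EFinP; apply: measurable_funM.
      apply: measurable_funX; apply: measurable_funD; first exact: measurable_cst.
      apply: measurable_funX; apply: measurable_funD.
        exact: (measurableT_comp (@shots_past D s k mD)).
      apply: measurable_fun_ifT; last exact: measurable_cst.
        exact: (measurableT_comp (@mle s k k (leqnn k))).
      apply: (measurableT_comp mD); apply: measurable_fun_pair; first exact: measurable_snd.
      apply: measurable_funB; first exact: measurable_cst.
      exact: (measurableT_comp (@walk_past _ _ _ _ _ _ _ _ _ iid _ msz k k (leqnn k))).
    apply: measurableT_comp => //; apply: measurable_funM; first exact: measurable_cst.
    exact: (measurableT_comp (@shot_rate_past b s k.+1 k (leqnn k.+1) mb)).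
  have -> : (\int[P]_w (V k.+1 w)%:E = \int[P]_w phi (w : pastT k, Th k w))%E.
    by apply: eq_integral => w _; rewrite /V /phi /= {1}/shots big_ord_recr.
  rewrite (past_next iid mphi); last first.
    by move=> z; rewrite lee_fin mulr_ge0 ?expR_ge0// exprn_ge0// addr_ge0 ?sqr_ge0.
  have p0 z : (0 <= phi z)%E.
    by rewrite lee_fin mulr_ge0 ?expR_ge0// exprn_ge0// addr_ge0 ?sqr_ge0.
  apply: ge0_le_integral => //.
  - by move=> w _; apply: integral_ge0 => e _; exact: p0.
  - apply: (past_meas iid (f := fun w => \int[mu]_e phi (w, e))%E).
    exact: (measurable_fun_fubini_tonelli_F (m2 := mu) phi).
  - exact/measurable_EFinP.
  move=> w _; rewrite /phi /=.
  have mD2 x : measurable_fun setT (fun e => D (e, x)).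
    exact: (measurableT_comp mD (pair2_measurable x)).
  case: (leP (walk k w) s) => [wk|wk]; last first.
    under eq_integral do rewrite addr0.
    rewrite integral_prob_cst.
    have -> : shot_rate b s k.+1 w = shot_rate b s k w; last exact: lexx.
    by rewrite /shot_rate big_ord_recr /= lt_geF// addr0.
  under eq_integral do rewrite EFinM muleC.
  rewrite ge0_integralZl_EFin//; last 2 first.
  - by move=> e _; rewrite lee_fin exprn_ge0// addr_ge0 ?sqr_ge0.
  - apply/measurable_EFinP; apply: measurable_funX; apply: measurable_funD; first exact: measurable_cst.
    by apply: measurable_funX; apply: measurable_funD => //; exact: measurable_cst.
  have x0 : 0 <= s - walk k w by rewrite subr_ge0.
  have := HK (fun e => D (e, s - walk k w)) L (shots D s k w) _ _ _ (mD2 _) L1 (hc _ x0) (hm _ x0) (hb _ x0).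
  move=> /(lee_wpmul2l (x := (expR (- K * shot_rate b s k.+1 w))%:E)) => h.
  apply: (le_trans (h _)); first by rewrite lee_fin expR_ge0.
  rewrite -EFinM lee_fin /V mulrCA -expRD; apply: ler_wpM2l.
    by rewrite exprn_ge0// addr_ge0 ?sqr_ge0.
  by rewrite ler_expR /shot_rate big_ord_recr /= wk; lra.
have bound : (\int[P]_w (V n w)%:E <= (L ^+ (2 * l.+1))%:E)%E.
  elim: n => [|k IH]; last exact: le_trans (step k) IH.
  under eq_integral do rewrite /V /shots /shot_rate !big_ord0 mulr0 expR0 mulr1 expr0n addr0.
  rewrite integral_prob_cst.
  by rewrite exprM.
set A := [set w | _ /\ _].
have mA : measurable A.
  rewrite (_ : A = (fun w => `|shots D s n w|) @^-1` `]y, +oo[ `&` shot_rate b s n @^-1` `]-oo, 1]).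
    apply: measurableI; rewrite -[X in measurable X]setTI.
      suff : measurable_fun setT (fun w => `|shots D s n w|) by move=> h; exact: h.
      by apply: measurableT_comp => //; exact: measurable_shots.
    exact: measurable_shot_rate.
  by apply/seteqP; split => w /=; rewrite !in_itv /= andbT.
have c0 : 0 < y ^+ (2 * l.+1) * expR (- K) by rewrite mulr_gt0 ?exprn_gt0 ?expR_gt0.
(* Markov's inequality: on [A] the rate is at most [1], so [V n] is at least
   [y ^+ (2 * l.+1) * expR (- K)] there. *)
have : ((y ^+ (2 * l.+1) * expR (- K))%:E * P A <= (L ^+ (2 * l.+1))%:E)%E.
  apply: le_trans bound.
  rewrite -[P A]mul1e -integral_cst// -ge0_integralZl_EFin//; last exact: ltW.
  rewrite [leLHS]integral_mkcond /=.
  apply: ge0_le_integral => //.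
  - by move=> w _; rewrite patchE; case: ifP => // _; rewrite mule1 lee_fin ltW.
  - exact/measurable_restrict.
  - exact/measurable_EFinP.
  move=> w _; rewrite patchE; case: ifP => [|_]; last by rewrite lee_fin.
  rewrite inE => -[yw rw]; rewrite mule1 lee_fin /V; apply: ler_pM.
  - by rewrite exprn_ge0// ltW.
  - exact: expR_ge0.
  - rewrite exprM; apply: lerXn2r; rewrite ?nnegrE ?sqr_ge0//.
      by rewrite addr_ge0 ?sqr_ge0.
    rewrite ler_wpDl ?sqr_ge0// -[leRHS]real_normK ?num_real//.
    by apply: lerXn2r; rewrite ?nnegrE// ltW.
  - by rewrite ler_expR mulNr lerN2 -[leRHS]mulr1; apply: ler_wpM2l.
move=> h; rewrite -(@lee_pmul2l _ (y ^+ (2 * l.+1) * expR (- K))%:E)//.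
apply: (le_trans h); rewrite -EFinM lee_fin.
rewrite exprMn exprVn expRN le_eqVlt; apply/orP; left; apply/eqP.
have y0' : y ^+ (2 * l.+1) != 0 by rewrite expf_neq0// gt_eqF.
have K0' : expR K != 0 by rewrite gt_eqF// expR_gt0.
by field; rewrite y0' K0'.
Qed.

End supermartingale.

(** * Regular variation and the Laplace transform of the steps *)

Section slow_variation.
Context {R : realType}.
Notation mu := (@lebesgue_measure R).

Lemma lebesgue_measure_shift (c : R) (A : set R) : measurable A ->
  mu ((fun x => x + c) @^-1` A) = mu A.
Proof.
move=> mA.
have ms : measurable_fun setT ((fun x => x + c) : measurableTypeR R -> measurableTypeR R).
  by apply: measurable_funD; [exact: measurable_id|exact: measurable_cst].
pose m1 := @measure_function_pushforward__canonical__measure_function_Measure _ _ (measurableTypeR R) (measurableTypeR R) R mu _ ms.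
suff : mu A = m1 A by move=> ->.
apply: lebesgue_measure_unique => // _ [[a b] /= ab <-].
rewrite /m1 /= /pushforward.
rewrite [X in _ = mu X](_ : _ = `]a - c, b - c]%classic).
  by rewrite !lebesgue_measure_itv /= !lte_fin ltrD2r; case: ifP => // _;
     rewrite -!EFinB; congr (_%:E); ring.
by apply/seteqP; split=> x /=; rewrite !in_itv /= => /andP[h1 h2]; apply/andP; split; lra.
Qed.

Variable f : R -> R.
Hypothesis mf : measurable_fun setT f.
Hypothesis sf : forall u, f (x + u) - f x @[x --> +oo] --> (0 : R).

Let V e (z : nat -> R) n : set R :=
  [set v | 0 <= v <= 2 /\ forall k, (n <= k)%N -> `|f (z k + v) - f (z k)| <= e].

Let measurable_V e z n : measurable (V e z n).
Proof.
rewrite (_ : V e z n = `[0, 2]%classic `&` \bigcap_(k in [set k | (n <= k)%N])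
   ((fun v => `|f (z k + v) - f (z k)|) @^-1` `]-oo, e])).
  apply: measurableI => //; apply: bigcap_measurableType => k _.
  rewrite -[X in measurable X]setTI.
  suff : measurable_fun setT (fun v => `|f (z k + v) - f (z k)|) by move=> h; exact: h.
  apply: measurableT_comp => //; apply: measurable_funB; last exact: measurable_cst.
  apply: (measurableT_comp mf); apply: measurable_funD; [exact: measurable_cst|exact: measurable_id].
by apply/seteqP; split=> v /=; rewrite in_itv /= => -[h1 h2]; split=> // k nk; have := h2 k nk; rewrite /= ?in_itv.
Qed.

Let V_large e z : 0 < e -> (forall k, k%:R <= z k) ->
  exists N, forall n, (N <= n)%N -> ((3 / 2)%:E < mu (V e z n))%E.
Proof.
move=> e0 zk.
have VS m n : (m <= n)%N -> V e z m `<=` V e z n.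
  by move=> mn v [h1 h2]; split=> // k nk; apply: h2; exact: leq_trans nk.
suff [N hN] : exists N, ((3 / 2)%:E < mu (V e z N))%E.
  exists N => n Nn; apply: (lt_le_trans hN); apply: le_measure; rewrite ?inE; [exact: measurable_V|exact: measurable_V|exact: VS].
apply: contrapT => /forallNP h.
have UV : \bigcup_n V e z n = `[0, 2]%classic.
  apply/seteqP; split=> [v [n _ [h1 _]]|v]; first by rewrite /= in_itv.
  rewrite /= in_itv /= => v2.
  have := sf v => /cvgrPdist_le /(_ _ e0) [M [_ HM]].
  exists (Num.truncn `|M|).+1 => //; split=> // k nk.
  have := HM (z k); rewrite sub0r normrN; apply.
  apply: (@lt_le_trans _ _ k%:R) => //.
  apply: (le_lt_trans (ler_norm M)); apply: (lt_le_trans (truncnS_gt _)).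
  by rewrite ler_nat.
have cv : mu (V e z n) @[n --> \oo] --> mu `[0, 2]%classic.
  rewrite -UV; apply: nondecreasing_cvg_mu; [by move=> n; exact: measurable_V|by apply: bigcup_measurable => n _; exact: measurable_V|].
  by move=> m n mn; apply/subsetPset; exact: VS.
have : (limn (fun n => mu (V e z n)) <= (3 / 2)%:E)%E.
  apply: lime_le; first by apply/cvg_ex; exists (mu `[0, 2]%classic).
  by apply: nearW => n; rewrite leNgt; apply/negP; exact: h.
rewrite (cvg_lim _ cv)// lebesgue_measure_itv /= lte_fin ltr0n /= -EFinB lee_fin; lra.
Qed.

(** The uniform convergence theorem in additive form. Along a bad sequence [(x, u)], the increments
    of [f] from [x] and from [x + u] are both small on sets of [v] in [[0, 2]] of measure above
    [3 / 2]. After translating the second set by [u], both lie in [[0, 3]] and hence meet; at a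
    common point the two estimates contradict the choice of [(x, u)]. *)
Lemma slow_uniform1 e : 0 < e ->
  exists A, forall x u, A <= x -> 0 <= u <= 1 -> `|f (x + u) - f x| <= e.
Proof.
move=> e0; apply: contrapT => /forallNP h.
have h1 : forall n : nat, exists p : R * R,
    [/\ n%:R <= p.1, 0 <= p.2 <= 1 & e < `|f (p.1 + p.2) - f p.1|].
  move=> n; have /existsNP[x /existsNP[u /not_implyP[nx /not_implyP[u1 /negP]]]] := h n%:R.
  by rewrite -ltNge => he; exists (x, u).
have [p hp] := choice h1.
have e2 : 0 < e / 2 by rewrite divr_gt0.
have [N1 H1] := @V_large (e / 2) (fun k => (p k).1) e2 (fun k => let: And3 a _ _ := hp k in a).
have hz k : k%:R <= (p k).1 + (p k).2 by have [a /andP[b _] _] := hp k; rewrite ler_wpDr.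
have [N2 H2] := @V_large (e / 2) (fun k => (p k).1 + (p k).2) e2 hz.
pose n := maxn N1 N2.
have {}H1 := H1 n (leq_maxl _ _); have {}H2 := H2 n (leq_maxr _ _).
set A := V _ _ _ in H1; set B := V _ _ _ in H2.
have [_ /andP[u0 u1] he] := hp n.
pose B' := (fun x => x + - (p n).2) @^-1` B.
have mB' : measurable B'.
  rewrite /B' -[X in measurable X]setTI.
  suff : measurable_fun setT (fun x : R => x + - (p n).2) by move=> g; exact: (g measurableT B (@measurable_V _ _ _)).
  by apply: measurable_funD; [exact: measurable_id|exact: measurable_cst].
have B'E : mu B' = mu B by exact: (@lebesgue_measure_shift (- (p n).2) B (@measurable_V _ _ _)).
have [v [[_ Av] [_ Bv]]] : exists v, A v /\ B' v.
  apply: contrapT => /forallNP dis.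
  have AB : A `&` B' = set0 by rewrite -subset0 => v [av bv]; exact: (dis v).
  have : (mu (A `|` B') <= mu `[0%R, 3%R]%classic)%E.
    apply: le_measure; rewrite ?inE//.
      by apply: measurableU => //; exact: measurable_V.
    move=> v [[/andP[h2 h3] _]|[/andP[h2 h3] _]]; rewrite /= in_itv /=; apply/andP; split; lra.
  rewrite measureU//; last exact: measurable_V.
  rewrite leNgt => /negP; apply.
  rewrite lebesgue_measure_itv /= lte_fin ltr0n /= -EFinB.
  have -> : (3 - 0)%:E = ((3 / 2)%:E + (3 / 2)%:E)%E :> \bar R by rewrite -EFinD; congr (_%:E); lra.
  by rewrite B'E; apply: lteD.
have {}Av := Av n (leqnn _); have {}Bv := Bv n (leqnn _).
move: he; rewrite ltNge => /negP; apply.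
rewrite (_ : (p n).1 + (p n).2 + (v + - (p n).2) = (p n).1 + v) in Bv; last by ring.
have := ler_normD (f ((p n).1 + v) - f (p n).1) (- (f ((p n).1 + v) - f ((p n).1 + (p n).2))).
rewrite normrN.
have -> : f ((p n).1 + v) - f (p n).1 - (f ((p n).1 + v) - f ((p n).1 + (p n).2)) =
  f ((p n).1 + (p n).2) - f (p n).1 by ring.
move=> hh; apply: (le_trans hh); lra.
Qed.

(** Chaining unit steps: one error [e] for each of at most [y + 1] steps. *)
Lemma slow_potter e : 0 < e ->
  exists A, forall x y, A <= x -> 0 <= y -> `|f (x + y) - f x| <= e * (y + 1).
Proof.
move=> e0; have [A HA] := slow_uniform1 e0; exists A => x y Ax y0.
have step (m : nat) : `|f (x + m%:R) - f x| <= e * m%:R.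
  elim: m => [|m IH]; first by rewrite addr0 subrr normr0 mulr0.
  have := HA (x + m%:R) 1; rewrite ler01 lexx => /(_ _ isT).
  rewrite ler_wpDr// => /(_ isT) h.
  rewrite -natr1 addrA.
  have := ler_normD (f (x + m%:R + 1) - f (x + m%:R)) (f (x + m%:R) - f x).
  rewrite addrA subrK mulrDr mulr1; lra.
pose m := Num.truncn y.
have /andP[m1 m2] := truncn_itv y0.
have := HA (x + m%:R) (y - m%:R); rewrite ler_wpDr// => /(_ isT).
rewrite subr_ge0 m1 lerBlDr addrC natr1 (ltW m2) => /(_ isT).
rewrite (_ : x + m%:R + (y - m%:R) = x + y); last by ring.
have := step m; have := ler_normD (f (x + y) - f (x + m%:R)) (f (x + m%:R) - f x).
rewrite addrA subrK.
have : e * m%:R <= e * y by apply: ler_wpM2l => //; exact: ltW.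
rewrite mulrDr mulr1; lra.
Qed.

End slow_variation.

(** * Potter bounds and locally uniform convergence for regularly varying functions *)

Section regular_variation.
Context {R : realType}.
Implicit Types (h l : R -> R) (rho : R).

Definition rv h rho := exists l, slowly_varying l /\
  asym_equiv h (fun t => powR t rho * l t).

(** The radius is chosen so that the lower end [1 - e / (1 + e)] equals [1 / (1 + e)], whose
    logarithm is at least [- e]. *)
Lemma ln_close1 (r e : R) : 0 < e -> `|r - 1| <= e / (1 + e) -> `|ln r| <= e.
Proof.
move=> e0 hr.
have e1 : 0 < 1 + e by lra.
have h1 : e / (1 + e) < 1 by rewrite ltr_pdivrMr//; lra.
have [h2 h3] : 1 - e / (1 + e) <= r /\ r <= 1 + e / (1 + e).
  by move: hr; rewrite ler_norml => /andP[? ?]; split; lra.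
have r0 : 0 < r by lra.
rewrite ler_norml; apply/andP; split.
  rewrite lerNl -lnV ?posrE//.
  have rV : r^-1 <= 1 + e.
    rewrite -[leRHS]invrK lef_pV2 ?posrE ?invr_gt0//.
    apply: le_trans h2; rewrite le_eqVlt; apply/orP; left; apply/eqP; field; lra.
  have := @ln_sublinear R r^-1; rewrite invr_gt0 => /(_ r0).
  have := expR_ge1Dx (ln r^-1); rewrite lnK ?posrE ?invr_gt0//; lra.
have := expR_ge1Dx (ln r); rewrite lnK ?posrE//.
have : e / (1 + e) <= e by rewrite ler_pdivrMr// ler_peMr// ?ltW//; lra.
lra.
Qed.

(** In the variable [ln x] the logarithm of the slowly varying factor has vanishing increments, so
    [slow_potter] applies. Potter bounds and uniform convergence are both read off this one
    estimate. *)
Lemma rv_log h rho : rv h rho -> forall e, 0 < e -> exists2 A, 1 <= A &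
  forall x t, A <= x -> x <= t ->
  [/\ 0 < h x, 0 < h t & `|ln (h t) - ln (h x) - rho * (ln t - ln x)| <= e * (ln t - ln x + 1)].
Proof.
move=> [l [[ml [[A0 lpos] lsv]] heq]] e e0.
pose f x := ln (l (expR x)).
have mf : measurable_fun setT f.
  by do 2!apply: measurableT_comp => //.
have big (M : R) : exists B : R, forall x, B <= x -> M < expR x.
  exists (ln (`|M| + 1)) => x; rewrite -ler_expR lnK ?posrE; last by rewrite ltr_wpDl.
  by move=> h1; apply: lt_le_trans h1; rewrite (le_lt_trans (ler_norm _))// ltrDl.
have sf u : f (x + u) - f x @[x --> +oo] --> (0 : R).
  apply/cvgrPdist_le => eps eps0.
  have eu : 0 < expR u by exact: expR_gt0.
  have ep : 0 < eps / (1 + eps) by apply: divr_gt0 => //; lra.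
  have /cvgrPdist_le /(_ _ ep) [M [_ HM]] := lsv _ eu.
  have [B1 HB1] := big (Num.max M A0).
  have [B2 HB2] := big (A0 / expR u).
  exists (Num.max B1 B2); split; first exact: num_real.
  move=> x; rewrite gt_max => /andP[/ltW/HB1 + /ltW/HB2 x2]; rewrite gt_max => /andP[x1 x3].
  rewrite sub0r normrN /f -ln_div ?posrE; last 2 first.
  - by apply: lpos; rewrite expRD ltW// mulrC -ltr_pdivrMl// mulrC.
  - by apply: lpos; exact: ltW.
  apply: ln_close1 => //; rewrite distrC expRD [expR x * _]mulrC; exact: HM.
(* One quarter goes to the slowly varying factor, and one each to replacing [h] by its equivalent at
   [x] and at [t]. *)
have e4 : 0 < e / 4 by rewrite divr_gt0.
have [B HB] := @slow_potter R f mf sf (e / 4) e4.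
have ep : 0 < (e / 4) / (1 + e / 4) by apply: divr_gt0 => //; lra.
have /cvgrPdist_le /(_ _ ep) [M [_ HM]] := heq.
have p1 : (e / 4) / (1 + e / 4) < 1 by rewrite ltr_pdivrMr; lra.
pose A := Num.max (Num.max 1 A0) (Num.max (expR B) (M + 1)).
exists A; first by rewrite /A !le_max lexx.
have prop x : A <= x -> [/\ 0 < x, 0 < l x, B <= ln x, 0 < h x &
    `|ln (h x) - rho * ln x - ln (l x)| <= e / 4].
  rewrite /A !ge_max => /andP[/andP[x1 xA] /andP[xB xM]].
  have x0 : 0 < x by exact: lt_le_trans x1.
  have lx : 0 < l x by exact: lpos.
  have hx : `|h x / (x `^ rho * l x) - 1| <= e / 4 / (1 + e / 4).
    by rewrite distrC; apply: HM; lra.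
  have d0 : 0 < x `^ rho * l x by rewrite mulr_gt0// powR_gt0.
  have h0 : 0 < h x.
    have : 0 < h x / (x `^ rho * l x) by move: hx; rewrite ler_norml; lra.
    by rewrite pmulr_lgt0// invr_gt0.
  split=> //; first by rewrite -ler_expR lnK.
  have := ln_close1 e4 hx; rewrite ln_div ?posrE// lnM ?posrE// ?powR_gt0// ln_powR.
  by rewrite opprD addrA.
move=> x t Ax xt.
have [x0 lx Bx hx ex] := prop x Ax.
have [t0 lt Bt ht et] := prop t (le_trans Ax xt).
split=> //.
have lxt : 0 <= ln t - ln x by rewrite subr_ge0 ler_ln.
have := HB (ln x) (ln t - ln x) Bx lxt.
rewrite [ln x + _]addrC subrK /f !lnK ?posrE// => hf.
have -> : ln (h t) - ln (h x) - rho * (ln t - ln x) =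
  (ln (h t) - rho * ln t - ln (l t)) - (ln (h x) - rho * ln x - ln (l x)) + (ln (l t) - ln (l x)) by ring.
apply: (le_trans (ler_normD _ _)).
have := ler_normB (ln (h t) - rho * ln t - ln (l t)) (ln (h x) - rho * ln x - ln (l x)).
have : 0 <= e * (ln t - ln x) by rewrite mulr_ge0// ltW.
move: hf ex et; rewrite !mulrDr !mulr1; lra.
Qed.

Lemma rv_potter h rho : rv h rho -> forall e, 0 < e -> exists2 A, 1 <= A & exists2 C, 0 < C &
  forall x t, A <= x -> x <= t -> [/\ 0 < h x, 0 < h t,
    h x <= C * (x / t) `^ (rho - e) * h t & h t <= C * (x / t) `^ (- rho - e) * h x].
Proof.
move=> rvh e e0; have [A A1 HA] := rv_log rvh e0.
exists A => //; exists (expR e); first exact: expR_gt0.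
move=> x t Ax xt; have [hx ht] := HA x t Ax xt.
have x0 : 0 < x by apply: lt_le_trans Ax; exact: lt_le_trans A1.
have t0 : 0 < t by exact: lt_le_trans xt.
rewrite ler_norml mulrDr mulr1 => /andP[h1 h2].
have pE p : (x / t) `^ p = expR (p * (ln x - ln t)).
  by rewrite /powR gt_eqF ?divr_gt0// ln_div ?posrE.
split=> //; rewrite pE.
- rewrite -{1}[h x]lnK ?posrE// -{1}[h t]lnK ?posrE// -!expRD ler_expR; lra.
- rewrite -{1}[h x]lnK ?posrE// -{1}[h t]lnK ?posrE// -!expRD ler_expR; lra.
Qed.

Lemma expR_close (z e : R) : 0 < e <= 1 -> `|z| <= e / 3 -> `|expR z - 1| <= e.
Proof.
move=> /andP[e0 e1]; rewrite !ler_norml => /andP[h1 h2]; apply/andP; split.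
  have := expR_ge1Dx z; lra.
have : expR z <= expR (e / 3) by rewrite ler_expR.
have := expR_ge1Dx (- (e / 3)); rewrite expRN.
have p := expR_gt0 (e / 3); move=> h3.
have : expR (e / 3) <= (1 - e / 3)^-1.
  by rewrite -[leLHS]invrK lef_pV2 ?posrE ?invr_gt0//; lra.
have : (1 - e / 3)^-1 <= 1 + e.
  rewrite -[leRHS]invrK lef_pV2 ?posrE ?invr_gt0//; try lra.
  rewrite -[leLHS]mul1r ler_pdivrMr; try lra.
  have : 0 <= e * (1 - e) by rewrite mulr_ge0; lra.
  lra.
lra.
Qed.

(** [rv_log] compares ordered points, so [v >= 1] and [v < 1] are separated. Its error is
    proportional to [|ln v| + 1], which [K] bounds on [[a, b]], while [V] bounds the power of [v];
    hence the tolerances [e' / 3 / K] and [e / V]. *)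
Lemma rv_uniform h rho : rv h rho -> forall a b e, 0 < a -> a <= b -> 0 < e ->
  exists A, forall t v, A <= t -> a <= v <= b -> 0 < h t /\ `|h (v * t) / h t - v `^ rho| <= e.
Proof.
move=> rvh a b e a0 ab e0.
have b0 : 0 < b by exact: lt_le_trans ab.
pose K := `|ln a| + `|ln b| + 1.
have K0 : 0 < K by rewrite /K; have := normr_ge0 (ln a); have := normr_ge0 (ln b); lra.
pose V := expR (`|rho| * K).
have V0 : 0 < V by exact: expR_gt0.
pose e' := Num.min 1 (e / V).
have e'0 : 0 < e' by rewrite /e' lt_min ltr01 divr_gt0.
have ek : 0 < e' / 3 / K by rewrite !divr_gt0.
have [A A1 HA] := rv_log rvh ek.
exists (Num.max A (A / a)) => t v; rewrite ge_max => /andP[tA tA'] /andP[av vb].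
have v0 : 0 < v by exact: lt_le_trans av.
have t0 : 0 < t by apply: lt_le_trans tA; exact: lt_le_trans A1.
have vtA : A <= v * t.
  by move: tA'; rewrite ler_pdivrMr// mulrC => /le_trans; apply; rewrite ler_pM2r.
have lnv : `|ln v| + 1 <= K.
  have h1 : ln a <= ln v by rewrite ler_ln ?posrE.
  have h2 : ln v <= ln b by rewrite ler_ln ?posrE.
  suff : `|ln v| <= `|ln a| + `|ln b| by rewrite /K; lra.
  have := ler_norm (ln b); have := ler_norm (- ln a); rewrite normrN.
  have := normr_ge0 (ln a); have := normr_ge0 (ln b) => ? ? ? ?.
  rewrite ler_norml; apply/andP; split; lra.
have lnvt : ln (v * t) = ln v + ln t by rewrite lnM ?posrE.
have [ht hvt key] : [/\ 0 < h t, 0 < h (v * t) &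
    `|ln (h (v * t)) - ln (h t) - rho * ln v| <= e' / 3].
  have small : forall z, 0 <= z -> z + 1 <= K -> e' / 3 / K * (z + 1) <= e' / 3.
    move=> z z0 zK; rewrite -[leRHS](mulfVK (lt0r_neq0 K0)) ; apply: ler_wpM2l => //; exact: ltW.
  case: (leP 1 v) => v1.
    have tv : t <= v * t by rewrite ler_peMl// ltW.
    have [h1 h2] := HA _ _ tA tv; rewrite lnvt addrK => h3; split=> //.
    apply: (le_trans h3); apply: small; first exact: ln_ge0.
    by apply: le_trans lnv; rewrite lerD2r ler_norm.
  have tv : v * t <= t by rewrite ger_pMl// ltW.
  have [h1 h2] := HA _ _ vtA tv; rewrite lnvt opprD addrA addrAC subrr add0r => h3; split=> //.
  have -> : ln (h (v * t)) - ln (h t) - rho * ln v = - (ln (h t) - ln (h (v * t)) - rho * - ln v) by ring.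
  rewrite normrN.
  apply: (le_trans h3); apply: small; first by rewrite oppr_ge0 ln_le0 ?ltW.
  by apply: le_trans lnv; rewrite lerD2r -normrN ler_norm.
split=> //.
have -> : h (v * t) / h t - v `^ rho =
   v `^ rho * (expR (ln (h (v * t)) - ln (h t) - rho * ln v) - 1).
  have -> : v `^ rho = expR (rho * ln v) by rewrite /powR gt_eqF.
  rewrite mulrBr mulr1 -expRD [rho * _ + _]addrC subrK expRB !lnK ?posrE//.
rewrite normrM.
have vV : `|v `^ rho| <= V.
  rewrite ger0_norm ?powR_ge0// /powR gt_eqF// ler_expR.
  apply: (le_trans (ler_norm _)); rewrite normrM; apply: ler_wpM2l => //.
  by move: lnv; lra.
have e'1 : 0 < e' <= 1 by rewrite e'0 /e' ge_min lexx.
apply: (le_trans (ler_pM _ _ vV (expR_close e'1 key))) => //.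
have : e' <= e / V by rewrite /e' ge_min lexx orbT.
by rewrite ler_pdivlMr// mulrC.
Qed.

End regular_variation.

(** * The Laplace transform of a regularly varying tail near zero *)

Section gamma_integral.
Context {R : realType}.
Notation leb := (@lebesgue_measure R).

Lemma integral_expN (a : R) : 0 <= a ->
  (\int[leb]_v (if (0 < v) && (v < a) then expR (- v) else 0)%:E = (1 - expR (- a))%:E)%E.
Proof.
move=> a0.
have mE (D : set R) : measurable_fun D (fun v : R => (expR (- v))%:E).
  by apply: measurable_funTS; apply/measurable_EFinP; apply: measurableT_comp => //; exact: measurable_funN.
have -> : (\int[leb]_v (if (0 < v)%R && (v < a)%R then expR (- v) else 0%R)%:E =
   \int[leb]_(v in `]0%R, a[) (expR (- v))%:E)%E.
  rewrite [RHS]integral_mkcond; apply: eq_integral => v _; rewrite patchE.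
  case: ifPn => h; first by rewrite mem_set//= in_itv.
  by rewrite memNset//= in_itv; exact/negP.
move: a0; rewrite le_eqVlt => /orP[/eqP <-|a0].
  by rewrite set_itvoo0 integral_set0 oppr0 expR0 subrr.
rewrite integral_itv_obnd_cbnd// integral_itv_bndo_bndc//.
have := @exponential_prob_itv0c R 1 a a0; rewrite /exponential_prob mulN1r EFinB => <-.
apply: eq_integral => v; rewrite inE /= in_itv /= => /andP[v0 _].
by rewrite exponential_pdfE// mul1r mulN1r.
Qed.

(** [1 - expR (- z)] is the integral of [expR (- v)] over [0 < v < z], and Tonelli exchanges the
    integrals. The positive part is taken because steps are known to be positive only almost
    surely. *)
Lemma laplace_tail (d : measure_display) (T : measurableType d) (P : probability T R)
    (xi : T -> R) (l : R) : measurable_fun setT xi -> 0 < l ->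
  (\int[P]_w (1 - expR (- (l * Num.max 0 (xi w))))%:E =
   \int[leb]_(v in [set v : R | (0 < v)%R]) (expR (- v) * tail P xi (v / l))%:E)%E.
Proof.
move=> mxi l0.
pose y w := Num.max 0 (xi w).
have my : measurable_fun setT y by apply: measurable_maxr => //; exact: measurable_cst.
pose G (z : T * measurableTypeR R) :=
  (if (0 < z.2) && (z.2 < l * y z.1) then expR (- z.2) else 0)%:E.
have mG : measurable_fun setT G.
  apply/measurable_EFinP; apply: measurable_fun_ifT.
  - apply: measurable_and.
      by apply: measurable_fun_ltr; [exact: measurable_cst|exact: measurable_snd].
    apply: measurable_fun_ltr; first exact: measurable_snd.
    apply: measurable_funM; first exact: measurable_cst.
    exact: (measurableT_comp my).
  - apply: measurableT_comp => //; apply: measurable_funN; exact: measurable_snd.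
  - exact: measurable_cst.
have G0 z : (0 <= G z)%E by rewrite lee_fin; case: ifP => // _; exact: expR_ge0.
have := @fubini_tonelli _ _ _ _ _ P leb G mG G0.
have -> : (\int[P]_w \int[leb]_v G (w, v) = \int[P]_w (1 - expR (- (l * y w)))%:E)%E.
  apply: eq_integral => w _; rewrite -integral_expN//.
  by rewrite mulr_ge0 ?(ltW l0)// /y le_max lexx.
move=> ->; rewrite [RHS]integral_mkcond; apply: eq_integral => v _; rewrite patchE /G /=.
case: (ltP 0 v) => v0 /=; last first.
  by rewrite memNset ?integral0//= ltNge v0.
rewrite mem_set// EFinM.
have mA : measurable [set w | v / l < xi w] by exact: measurable_set_gt.
have -> : ((tail P xi (v / l))%:E = P [set w | (v / l < xi w)%R])%E.
  by rewrite /tail fineK// fin_num_measure.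
rewrite -[P _]mul1e -integral_cst// -ge0_integralZl_EFin ?expR_ge0//.
rewrite [RHS]integral_mkcond; apply: eq_integral => w _; rewrite patchE /= mule1.
have -> : (v < l * y w) = (v / l < xi w).
  rewrite ltr_pdivrMr// [xi w * l]mulrC /y; case: (leP 0 (xi w)) => x0 //.
  rewrite mulr0 ltNge (ltW v0) /=; apply/esym/negbTE; rewrite -leNgt.
  apply: (@le_trans _ _ 0); last exact: ltW.
  by rewrite pmulr_rle0// ltW.
by case: ifPn => h; [rewrite mem_set|rewrite memNset//; exact/negP].
Qed.

Definition gamma_dom (p : R) (v : R) : R := expR (- v) * v `^ (- p).

Lemma measurable_gamma_dom p (D : set R) : measurable_fun D (fun v => (gamma_dom p v)%:E).
Proof.
apply: measurable_funTS; apply/measurable_EFinP; apply: measurable_funM.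
  by apply: measurableT_comp => //; exact: measurable_funN.
exact: measurable_powR.
Qed.

(** Convergence at [0] by dyadic shells: the shell []2 ^- n.+1, 2 ^- n]] contributes at most
    [r ^+ n.+1] with [r < 1] because [p < 1]. Beyond [1] the integrand is below the exponential
    density. *)
Lemma gamma_dom_integrable p : 0 <= p < 1 ->
  leb.-integrable [set v : R | 0 < v] (fun v => (gamma_dom p v)%:E).
Proof.
move=> /andP[p0 p1].
have mD : measurable [set v : R | 0 < v].
  by rewrite -(set_itvoy (0 : R)).
have g0 v : 0 <= gamma_dom p v by rewrite mulr_ge0 ?expR_ge0// powR_ge0.
apply/integrableP; split; first exact: measurable_gamma_dom.
under eq_integral do rewrite gee0_abs ?lee_fin//.
pose F n : set R := if n is m.+1 then `]2 ^- m.+1, 2 ^- m]%classic else `]1, +oo[%classic.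
have mF n : measurable (F n) by rewrite /F; case: n => [|n]; exact: measurable_itv.
have UF : [set v : R | 0 < v] = \bigcup_n F n.
  apply/seteqP; split=> v /=; last first.
    move=> [[|n] _] /=; rewrite in_itv /= => /andP[h _]; first exact: lt_trans h.
    by apply: lt_trans h; rewrite invr_gt0 exprn_gt0.
  move=> v0; case: (ltP 1 v) => v1; first by exists 0%N => //=; rewrite in_itv /= v1.
  have ex : exists n, 2 ^- n.+1 < v.
    have [n hn] : exists n : nat, v^-1 < n%:R by exists (Num.truncn v^-1).+1; exact: truncnS_gt.
    exists n; rewrite -[ltRHS]invrK ltf_pV2 ?posrE ?exprn_gt0 ?invr_gt0//.
    apply: (lt_trans hn); rewrite -natrX ltr_nat.
    by apply: ltn_trans (ltn_expl n.+1 (ltnSn 1)).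
  case: (ex_minnP ex) => m hm mmin; exists m.+1 => //=; rewrite in_itv /= hm /=.
  case: m hm mmin => [|m] hm mmin; first by rewrite expr0 invr1.
  by rewrite leNgt; apply/negP => h; have := mmin m h; rewrite ltnn.
have tF : trivIset setT F.
  have mono (a b : nat) : (a <= b)%N -> (2 ^- b <= 2 ^- a :> R).
    by move=> ab; rewrite lef_pV2 ?posrE ?exprn_gt0// ler_eXn2l// ltr1n.
  apply: ltn_trivIset => n m mn; rewrite -subset0 => v [].
  case: n mn => // n; rewrite ltnS => mn.
  case: m mn => [|m] mn /=; rewrite !in_itv /=.
    move=> /andP[h1 _] /andP[_ h2]; have := lt_le_trans h1 h2.
    have := mono 0%N n (leq0n n); rewrite expr0 invr1 => h3 h4.
    by have := lt_le_trans h4 h3; rewrite ltxx.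
  move=> /andP[h1 _] /andP[_ h2]; have := lt_le_trans h1 h2.
  by rewrite ltNge (mono _ _ mn).
rewrite UF ge0_integral_bigcup//; last 2 first.
- exact: measurable_gamma_dom.
- by move=> v _; rewrite lee_fin.
rewrite nneseries_recl; [|by move=> n _; apply: integral_ge0 => v _; rewrite lee_fin|by []].
apply: lte_add_pinfty.
  apply: (@le_lt_trans _ _ (\int[leb]_v (exponential_pdf 1 v)%:E)%E); last first.
    by rewrite integral_exponential_pdf// ltry.
  rewrite [leLHS]integral_mkcond; apply: ge0_le_integral => //.
  - by move=> v _; rewrite patchE; case: ifP => // _; rewrite lee_fin.
  - apply/(measurable_restrictT _ _).1; [exact: (mF 0%N)|exact: (@measurable_gamma_dom p (F 0%N))].
  - by apply/measurable_EFinP; exact: measurable_exponential_pdf.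
  move=> v _; rewrite patchE; case: ifPn => [|_]; last by rewrite lee_fin exponential_pdf_ge0.
  rewrite inE /= in_itv /= andbT => v1; rewrite lee_fin exponential_pdfE ?mul1r ?mulN1r; last first.
    by rewrite (le_trans ler01)// ltW.
  rewrite /gamma_dom ler_piMr ?expR_ge0//.
  by rewrite powRN invf_le1 ?powR_gt0 ?(lt_trans ltr01)// -(powRr0 v); apply: ler_powR => //; exact: ltW.
pose r : R := 2 `^ (p - 1).
have r0 : 0 < r by rewrite powR_gt0.
have r1 : r < 1.
  have l2 : 0 < ln (2 : R) by apply: ln_gt0; lra.
  have p10 : p - 1 < 0 by lra.
  by rewrite /r /powR gt_eqF// -[ltRHS]expR0 ltr_expR nmulr_rlt0.
have bnd n : (\int[leb]_(v in F n.+1) (gamma_dom p v)%:E <= (r ^+ n.+1)%:E)%E.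
  have c0 : 0 <= 2 `^ p ^+ n.+1 :> R by rewrite exprn_ge0// powR_ge0.
  apply: (@le_trans _ _ (\int[leb]_(v in F n.+1) (2 `^ p ^+ n.+1)%:E)%E).
    apply: ge0_le_integral => //.
    - exact: (mF n.+1).
    - by move=> v _; rewrite lee_fin.
    - exact: measurable_gamma_dom.
    move=> v /=; rewrite in_itv /= => /andP[h1 h2]; rewrite lee_fin.
    have v0 : 0 < v by apply: lt_trans h1; rewrite invr_gt0 exprn_gt0.
    rewrite -[leRHS]mul1r; apply: ler_pM; rewrite ?expR_ge0 ?powR_ge0//.
      by rewrite -expR0 ler_expR oppr_le0 ltW.
    rewrite powRN -powR_mulrn ?powR_ge0// -powRAC powR_mulrn//.
    rewrite -[leRHS]invrK lef_pV2 ?posrE ?invr_gt0 ?powR_gt0 ?exprn_gt0//.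
    apply: (@le_trans _ _ ((2 ^- n.+1) `^ p)).
      by rewrite -[X in _ <= X `^ p]powR_inv1 ?exprn_ge0// -powRrM mulN1r powRN.
    by apply: ge0_ler_powR; rewrite ?nnegrE ?invr_ge0 ?exprn_ge0// ltW.
  rewrite integral_cst; last exact: (mF n.+1).
  have lt2 : 2 ^- n.+1 < 2 ^- n :> R.
    by rewrite ltf_pV2 ?posrE ?exprn_gt0// ltr_eXn2l// ltr1n.
  have mE : leb (F n.+1) = (2 ^- n - 2 ^- n.+1)%:E.
    by rewrite /F lebesgue_measure_itv /= lte_fin lt2 -EFinB.
  rewrite -[leLHS]/((2 `^ p ^+ n.+1)%:E * leb (F n.+1))%E mE -EFinM lee_fin /r powRB; last by rewrite pnatr_eq0 implybT.
  rewrite powRr1// expr_div_n le_eqVlt; apply/orP; left; apply/eqP; congr (_ * _).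
  have h2 : 2 ^+ n != 0 :> R by rewrite expf_neq0.
  by rewrite exprS; field.
apply: (@le_lt_trans _ _ (\sum_(1 <= n <oo) (r ^+ n)%:E)%E).
  rewrite eseries_cond [leRHS]eseries_cond; apply: lee_nneseries.
  - by move=> n _ _; apply: integral_ge0 => v _; rewrite lee_fin.
  - by move=> [|n] // _; exact: bnd.
apply: (@le_lt_trans _ _ (\sum_(0 <= n <oo) (r ^+ n)%:E)%E).
  by rewrite [leRHS]nneseries_recl ?leeDr// => ?; rewrite lee_fin exprn_ge0// ltW.
have : (\sum_(0 <= n < k) (r ^+ n)%:E)%E @[k --> \oo] --> ((1 - r)^-1)%:E.
  rewrite [X in X @ _ --> _](_ : _ = EFin \o series (geometric 1 r)).
    apply: cvg_EFin; first by apply: nearW.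
    have := @cvg_geometric_series R 1 r; rewrite div1r ger0_norm ?ltW//; exact.
  apply/funext => k /=; rewrite /series /= sumEFin; congr (_%:E).
  by apply: eq_bigr => i _; rewrite /geometric /= mul1r.
by move=> /cvg_lim -> //; rewrite ltry.
Qed.

Context {d : measure_display} {T : measurableType d} (P : probability T R) (xi : T -> R).
Hypothesis mxi : measurable_fun setT xi.

Lemma tail_ge0 t : 0 <= tail P xi t.
Proof. by rewrite /tail fine_ge0. Qed.

Lemma tail_le1 t : tail P xi t <= 1.
Proof.
rewrite /tail -lee_fin fineK ?fin_num_measure//; last exact: measurable_set_gt.
by apply: probability_le1; exact: measurable_set_gt.
Qed.

Lemma tail_nonincr x y : x <= y -> tail P xi y <= tail P xi x.
Proof.
move=> xy; rewrite /tail; apply: fine_le; rewrite ?fin_num_measure//; try exact: measurable_set_gt.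
apply: le_measure; rewrite ?inE; try exact: measurable_set_gt.
by move=> w /=; exact: le_lt_trans.
Qed.

Lemma measurable_tail : measurable_fun setT (tail P xi).
Proof.
have -> : tail P xi = (fun t => - (- tail P xi t)) by apply/funext => t; rewrite opprK.
apply: measurable_funN; apply: nondecreasing_measurable => //.
by move=> x y xy; rewrite lerN2 tail_nonincr.
Qed.

Definition laplace (l : R) : R := fine (\int[P]_w (expR (- (l * Num.max 0 (xi w))))%:E)%E.

Lemma laplaceE l : 0 <= l ->
  (\int[P]_w (expR (- (l * Num.max 0 (xi w))))%:E = (laplace l)%:E)%E.
Proof.
move=> l0; rewrite /laplace fineK//; apply: integrable_fin_num => //.
apply: (@le_integrable _ _ _ P setT measurableT _ (cst 1%E)).
- apply/measurable_EFinP; apply: measurableT_comp => //; apply: measurable_funN.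
  apply: measurable_funM; first exact: measurable_cst.
  by apply: measurable_maxr => //; exact: measurable_cst.
- move=> w _; rewrite !abse_EFin lee_fin normr1 ger0_norm ?expR_ge0// -expR0 ler_expR.
  by rewrite oppr_le0 mulr_ge0// le_max lexx.
- exact: finite_measure_integrable_cst.
Qed.

Lemma laplace_compl l : 0 < l ->
  ((1 - laplace l)%:E = \int[leb]_(v in [set v : R | (0 < v)%R]) (expR (- v) * tail P xi (v / l))%:E)%E.
Proof.
move=> l0; rewrite -(laplace_tail P mxi l0).
have iE : P.-integrable setT (fun w => (expR (- (l * Num.max 0 (xi w))))%:E).
  apply: (@le_integrable _ _ _ P setT measurableT _ (cst 1%E)).
  - apply/measurable_EFinP; apply: measurableT_comp => //; apply: measurable_funN.
    apply: measurable_funM; first exact: measurable_cst.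
    by apply: measurable_maxr => //; exact: measurable_cst.
  - move=> w _; rewrite !abse_EFin lee_fin normr1 ger0_norm ?expR_ge0// -expR0 ler_expR.
    by rewrite oppr_le0 mulr_ge0 ?(ltW l0)// le_max lexx.
  - exact: finite_measure_integrable_cst.
under [RHS]eq_integral do rewrite EFinB.
rewrite integralB//; last exact: finite_measure_integrable_cst.
by rewrite integral_prob_cst laplaceE ?ltW.
Qed.

(** Only [v < 1] is kept in the integral of [laplace_compl]; there the tail at [v * x] is at least
    the tail at [x]. *)
Lemma laplace_lower x : 0 < x -> (1 - expR (-1)) * tail P xi x <= 1 - laplace x^-1.
Proof.
move=> x0; rewrite -lee_fin laplace_compl ?invr_gt0// EFinM EFinB -[in leLHS](mulN1r 1).
have -> : (1%:E - (expR (-1 * 1))%:E = \int[leb]_v (if (0 < v)%R && (v < 1)%R then expR (- v) else 0%R)%:E)%E.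
  by rewrite integral_expN// mulN1r -EFinB.
have mI : measurable_fun setT (fun v : R => (if (0 < v) && (v < 1) then expR (- v) else 0)%:E).
  apply/measurable_EFinP; apply: measurable_fun_ifT.
  - by apply: measurable_and; apply: measurable_fun_ltr => //; exact: measurable_cst.
  - by apply: measurableT_comp => //; exact: measurable_funN.
  - exact: measurable_cst.
rewrite -ge0_integralZr//; last 2 first.
- by move=> v _; rewrite lee_fin; case: ifP => // _; exact: expR_ge0.
- by rewrite lee_fin tail_ge0.
rewrite [leRHS]integral_mkcond; apply: ge0_le_integral => //.
- move=> v _; rewrite mule_ge0// lee_fin ?tail_ge0//; case: ifP => // _; exact: expR_ge0.
- by apply: emeasurable_funM => //; exact: measurable_cst.
- apply/(measurable_restrictT _ _).1; first by rewrite -(set_itvoy (0 : R)).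
  apply: measurable_funTS; apply/measurable_EFinP; apply: measurable_funM.
    by apply: measurableT_comp => //; exact: measurable_funN.
  apply: (measurableT_comp measurable_tail); apply: measurable_funM => //; exact: measurable_cst.
move=> v _; rewrite patchE; case: (ltP 0 v) => v0 /=; last first.
  by rewrite mul0e memNset//= ltNge v0.
rewrite mem_set// -EFinM lee_fin; case: ifPn => [v1|_].
  apply: ler_wpM2l; first exact: expR_ge0.
  apply: tail_nonincr; rewrite invrK; apply: ler_piMl; exact: ltW.
by rewrite mul0r mulr_ge0 ?expR_ge0// tail_ge0.
Qed.

Variable alpha : R.
Hypothesis alpha01 : 0 < alpha < 1.
Hypothesis rvtail : rv (tail P xi) (- alpha).

(** The Abelian half of Karamata's theorem. The quotient is the integral of [expR (- v)] times a
    ratio of tails that converges pointwise by regular variation; Potter bounds with exponent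
    [p = alpha + e < 1] dominate it, so that integrability at [0] is kept. *)
Lemma laplace_exponent s : 0 < s ->
  ((1 - laplace (s / t)) / tail P xi t) @[t --> +oo] --> Gammaf (1 - alpha) * s `^ alpha.
Proof.
move=> s0; have /andP[a0 a1] := alpha01.
pose e := (1 - alpha) / 2; have e0 : 0 < e by rewrite /e; lra.
pose p := alpha + e; have p0 : 0 < p by rewrite /p; lra.
have p1 : p < 1 by rewrite /p /e; lra.
have [A A1 [C C0 HA]] := rv_potter rvtail e0.
have A0 : 0 < A by exact: lt_le_trans A1.
have [tA _ _ _] := HA A A (lexx _) (lexx _).
have tpos t : 0 < tail P xi t.
  case: (leP A t) => At; first by have [] := HA t t At (lexx _).
  by apply: (lt_le_trans tA); apply: tail_nonincr; exact: ltW.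
pose D := [set v : R | 0 < v].
have mD : measurable D by rewrite /D -(set_itvoy (0 : R)).
pose f t v := expR (- v) * (tail P xi (v / (s / t)) / tail P xi t).
(* [K] serves for tails at a point [x < t]: between [A] and [t] Potter's bound holds, and below [A]
   the trivial bound [1] is compared with Potter's bound at [A]. The second summand of [g] serves
   for [x >= t], where the ratio is at most [1]. *)
pose K := C * (1 + (tail P xi A)^-1) + 1.
pose g v := K * s `^ p * gamma_dom p v + gamma_dom 0 v.
have K1 : 1 <= K by rewrite /K lerDr mulr_ge0 ?(ltW C0)// addr_ge0// invr_ge0 ltW.
have fg t v : A <= t -> 0 < v -> `|f t v| <= g v.
  move=> At v0.
  have t0 : 0 < t by exact: lt_le_trans At.
  rewrite ger0_norm; last by rewrite mulr_ge0 ?expR_ge0// divr_ge0// tail_ge0.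
  have -> : g v = expR (- v) * (K * s `^ p * v `^ (- p) + 1).
    by rewrite /g /gamma_dom oppr0 powRr0; ring.
  apply: ler_wpM2l; first exact: expR_ge0.
  rewrite ler_pdivrMr//.
  set x := v / (s / t).
  have x0 : 0 < x by rewrite divr_gt0// divr_gt0.
  have xt : x / t = v / s by rewrite /x; field; rewrite !gt_eqF.
  have pw : s `^ p * v `^ (- p) = (x / t) `^ (- p).
    rewrite xt powRM ?invr_ge0 ?ltW// mulrC; congr (_ * _).
    by rewrite -powR_inv1 ?ltW// -powRrM mulrNN mul1r.
  rewrite -mulrA pw.
  have pw0 : 0 <= (x / t) `^ (- p) by exact: powR_ge0.
  have tt := ltW (tpos t).
  case: (leP t x) => tx.
    apply: (@le_trans _ _ (1 * tail P xi t)); first by rewrite mul1r tail_nonincr.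
    by apply: ler_wpM2r => //; rewrite lerDr mulr_ge0// (le_trans _ K1).
  suff h : tail P xi x <= K * (x / t) `^ (- p) * tail P xi t.
    by apply: (le_trans h); apply: ler_wpM2r => //; rewrite lerDl.
  have Kc : C <= K by rewrite /K mulrDr mulr1 -addrA lerDl addr_ge0// mulr_ge0 ?invr_ge0 ?ltW.
  have eqp : - alpha - e = - p by rewrite /p opprD.
  case: (leP A x) => Ax.
    have [_ _ + _] := HA x t Ax (ltW tx); rewrite eqp => /le_trans; apply.
    by apply: ler_wpM2r => //; apply: ler_wpM2r.
  have [_ _ + _] := HA A t (lexx _) At; rewrite eqp => h.
  have hx : (A / t) `^ (- p) <= (x / t) `^ (- p).
    rewrite !powRN lef_pV2 ?posrE ?powR_gt0 ?divr_gt0//.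
    apply: ge0_ler_powR; rewrite ?nnegrE ?divr_ge0 ?ltW//.
    by rewrite ltr_pM2r ?invr_gt0.
  apply: (le_trans (tail_le1 x)).
  rewrite -(mulVf (lt0r_neq0 tA)).
  apply: (@le_trans _ _ ((tail P xi A)^-1 * (C * (x / t) `^ (- p) * tail P xi t))).
    rewrite ler_pM2l ?invr_gt0//; apply: (le_trans h); apply: ler_wpM2r => //.
    by apply: ler_wpM2l => //; exact: ltW.
  rewrite !mulrA; apply: ler_wpM2r => //; apply: ler_wpM2r => //.
  rewrite /K mulrDr mulr1 [_^-1 * _]mulrC -addrA addrCA lerDl addr_ge0//; exact: ltW.
have ig : leb.-integrable D (fun v => (g v)%:E).
  rewrite /g; under eq_fun do rewrite EFinD EFinM.
  apply: integrableD => //.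
    by apply: integrableZl => //; apply: gamma_dom_integrable; rewrite (ltW p0) p1.
  by apply: gamma_dom_integrable; rewrite lexx ltr01.
have mf t : measurable_fun D (fun v => (f t v)%:E).
  apply: measurable_funTS; apply/measurable_EFinP; apply: measurable_funM.
    by apply: measurableT_comp => //; exact: measurable_funN.
  apply: measurable_funM; last exact: measurable_cst.
  by apply: (measurableT_comp measurable_tail); apply: measurable_funM => //; exact: measurable_cst.
have intE t : 0 < t -> (\int[leb]_(v in D) (f t v)%:E = ((1 - laplace (s / t)) / tail P xi t)%:E)%E.
  move=> t0; rewrite EFinM laplace_compl ?divr_gt0//.
  rewrite -ge0_integralZr//; last 3 first.
  - apply: measurable_funTS; apply/measurable_EFinP; apply: measurable_funM.
      by apply: measurableT_comp => //; exact: measurable_funN.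
    by apply: (measurableT_comp measurable_tail); apply: measurable_funM => //; exact: measurable_cst.
  - by move=> v _; rewrite lee_fin mulr_ge0 ?expR_ge0// tail_ge0.
  - by rewrite lee_fin invr_ge0 ltW.
  by apply: eq_integral => v _; rewrite /f -EFinM mulrA.
apply/cvg_pinftyP => u uoo.
(* Domination is needed at every index, so the sequence is raised to [A]; it is unchanged from some
   index on. *)
pose u' n := Num.max A (u n).
have u'E : \forall n \near \oo, u' n = u n.
  have /cvgryPge /(_ A) := uoo; apply: filterS => n h; rewrite /u'; exact/max_idPr.
have fc v : D v -> (f (u' n) v)%:E @[n --> \oo] --> (expR (- v) * (v / s) `^ (- alpha))%:E.
  move=> v0; apply: cvg_EFin; first exact: nearW.
  apply: cvgM; first exact: cvg_cst.
  apply/cvgrPdist_le => eps eps0.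
  have vs : 0 < v / s by rewrite divr_gt0.
  have [B HB] := rv_uniform rvtail vs (lexx _) eps0.
  have /cvgryPge /(_ (Num.max A B)) := uoo; apply: filterS => n.
  rewrite ge_max => /andP[h1 h2].
  have un0 : 0 < u n by exact: lt_le_trans h1.
  have := HB (u n) (v / s) h2; rewrite !lexx => /(_ isT)[_]; rewrite distrC.
  have -> : u' n = u n by rewrite /u'; exact/max_idPr.
  by have -> : v / (s / u n) = v / s * u n by field; rewrite !gt_eqF.
have [] := @dominated_convergence _ _ _ leb D mD (fun n v => (f (u' n) v)%:E)
  (fun v => (expR (- v) * (v / s) `^ (- alpha))%:E) (fun v => (g v)%:E).
- by move=> n; exact: mf.
- apply: measurable_funTS; apply/measurable_EFinP; apply: measurable_funM.
    by apply: measurableT_comp => //; exact: measurable_funN.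
  apply: (measurableT_comp (@measurable_powR R _)); apply: measurable_funM => //; exact: measurable_cst.
- by apply/aeW => v Dv; exact: fc.
- exact: ig.
- apply/aeW => v n Dv; rewrite abse_EFin lee_fin fg//.
  by rewrite /u' le_max lexx.
move=> iL _ cv.
have LE : (\int[leb]_(v in D) (expR (- v) * (v / s) `^ (- alpha))%:E =
   (Gammaf (1 - alpha) * s `^ alpha)%:E)%E.
  have iG : leb.-integrable D (fun v => (gamma_dom alpha v)%:E).
    by apply: gamma_dom_integrable; rewrite (ltW a0) a1.
  have -> : Gammaf (1 - alpha) = fine (\int[leb]_(v in D) (gamma_dom alpha v)%:E)%E.
    rewrite /Gammaf; congr fine; apply: eq_integral => v _.
    by rewrite /gamma_dom mulrC addrAC subrr add0r.
  rewrite EFinM fineK; last exact: integrable_fin_num.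
  rewrite -(@integralZr _ (measurableTypeR R) R leb D mD _ iG); apply: eq_integral => v; rewrite inE /D /= => v0.
  rewrite -EFinM /gamma_dom -mulrA; congr ((_ * _)%:E).
  rewrite powRM ?invr_ge0 ?ltW//; congr (_ * _).
  by rewrite -powR_inv1 ?ltW// -powRrM mulrNN mul1r.
rewrite LE in cv.
have {}cv : (((1 - laplace (s / u' n)) / tail P xi (u' n))%:E) @[n --> \oo] --> (Gammaf (1 - alpha) * s `^ alpha)%:E.
  move: cv; apply: cvg_trans; apply: near_eq_cvg; apply: nearW => n /=.
  by rewrite -intE// /u' lt_max A0.
apply: (cvg_trans _ (fine_cvg cv)); apply: near_eq_cvg.
by apply: filterS u'E => n /= ->.
Qed.

(** Positivity is read off the limit at [s = 1], along which [laplace_lower] keeps the quotient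
    above [1 - expR (-1)]. *)
Lemma Gammaf_gt0 : 0 < Gammaf (1 - alpha).
Proof.
have := @laplace_exponent 1 ltr01; rewrite powR1 mulr1 => h.
have e1 : 0 < 1 - expR (-1) :> R by rewrite subr_gt0 -[ltRHS]expR0 ltr_expR; lra.
apply: (lt_le_trans e1).
have <- : lim (((1 - laplace (1 / t)) / tail P xi t) @[t --> +oo]) = Gammaf (1 - alpha).
  exact: cvg_lim h.
apply: limr_ge; first by apply/cvg_ex; exists (Gammaf (1 - alpha)).
have [A A1 [C C0 HA]] := rv_potter rvtail (ltr01).
near=> t.
have t1 : A <= t by near: t; apply: nbhs_pinfty_ge; exact: num_real.
have t0 : 0 < t by apply: lt_le_trans t1; exact: lt_le_trans A1.
have [tt _ _ _] := HA t t t1 (lexx _).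
by rewrite ler_pdivlMr// div1r; exact: laplace_lower.
Unshelve. all: by end_near.
Qed.

End gamma_integral.

(** * Polynomial approximation on the cube *)

Section expectation.
Context {R : realType} {d : measure_display} {T : measurableType d} (P : probability T R).
Implicit Types Y Z : T -> R.

Lemma bounded_integrable Y M : measurable_fun setT Y -> (forall w, `|Y w| <= M) ->
  P.-integrable setT (fun w => (Y w)%:E).
Proof.
move=> mY bY; apply: (@le_integrable _ _ _ P setT measurableT _ (cst M%:E)).
- exact/measurable_EFinP.
- by move=> w _; rewrite !abse_EFin lee_fin (le_trans (bY w))// ler_norm.
- exact: finite_measure_integrable_cst.
Qed.

Lemma ExpE Y M : measurable_fun setT Y -> (forall w, `|Y w| <= M) ->
  (\int[P]_w (Y w)%:E = (Exp P Y)%:E)%E.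
Proof.
move=> mY bY; rewrite /Exp fineK//; apply: integrable_fin_num => //.
exact: bounded_integrable bY.
Qed.

Lemma Exp_le Y Z M : measurable_fun setT Y -> (forall w, `|Y w| <= M) ->
  measurable_fun setT Z -> (forall w, `|Z w| <= M) -> (forall w, Y w <= Z w) ->
  Exp P Y <= Exp P Z.
Proof.
move=> mY bY mZ bZ YZ; rewrite -lee_fin -(ExpE mY bY) -(ExpE mZ bZ).
by apply: le_integral => //; [exact: bounded_integrable bY|exact: bounded_integrable bZ|
  move=> w _; rewrite lee_fin].
Qed.

Lemma ExpD Y Z M : measurable_fun setT Y -> (forall w, `|Y w| <= M) ->
  measurable_fun setT Z -> (forall w, `|Z w| <= M) ->
  Exp P (fun w => Y w + Z w) = Exp P Y + Exp P Z.
Proof.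
move=> mY bY mZ bZ; apply: EFin_inj; rewrite EFinD.
rewrite -(ExpE mY bY) -(ExpE mZ bZ) -(@ExpE (fun w => Y w + Z w) (M + M)).
- under eq_integral do rewrite EFinD.
  by rewrite integralD//; [exact: bounded_integrable bY|exact: bounded_integrable bZ].
- exact: measurable_funD.
- by move=> w; rewrite (le_trans (ler_normD _ _))// lerD.
Qed.

Lemma ExpZ Y M c : measurable_fun setT Y -> (forall w, `|Y w| <= M) ->
  Exp P (fun w => c * Y w) = c * Exp P Y.
Proof.
move=> mY bY; apply: EFin_inj; rewrite EFinM.
rewrite -(ExpE mY bY) -(@ExpE (fun w => c * Y w) (`|c| * M)).
- under eq_integral do rewrite EFinM.
  by rewrite integralZl//; exact: bounded_integrable bY.
- by apply: measurable_funM => //; exact: measurable_cst.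
- by move=> w; rewrite normrM ler_wpM2l.
Qed.

Lemma Exp_cst c : Exp P (fun=> c) = c.
Proof. by rewrite /Exp integral_prob_cst. Qed.

Lemma Exp_close Y Z M e : measurable_fun setT Y -> (forall w, `|Y w| <= M) ->
  measurable_fun setT Z -> (forall w, `|Z w| <= M) -> (forall w, `|Y w - Z w| <= e) ->
  `|Exp P Y - Exp P Z| <= e.
Proof.
move=> mY bY mZ bZ YZ.
have h Y1 Y2 : measurable_fun setT Y1 -> (forall w, `|Y1 w| <= M) ->
    measurable_fun setT Y2 -> (forall w, `|Y2 w| <= M) -> (forall w, `|Y1 w - Y2 w| <= e) ->
    Exp P Y1 <= Exp P Y2 + e.
  move=> m1 b1 m2 b2 c12.
  have bM w : `|Y2 w| <= Num.max M `|e| by rewrite le_max b2.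
  have be (w : T) : `|e| <= Num.max M `|e| by rewrite le_max lexx orbT.
  rewrite -[X in _ + X]Exp_cst -(ExpD m2 bM (measurable_cst _) be).
  apply: (@Exp_le _ _ (Num.max M `|e| + Num.max M `|e|)) => //.
  - by move=> w; rewrite (le_trans (b1 w))// ler_wpDl// ?le_max ?lexx// normr_ge0 orbT.
  - by apply: measurable_funD => //; exact: measurable_cst.
  - move=> w; apply: (le_trans (ler_normD _ _)); apply: lerD; [exact: bM|exact: (be w)].
  - by move=> w; have := c12 w; rewrite ler_norml => /andP[_]; rewrite lerBlDl addrC.
rewrite ler_norml; apply/andP; split.
  have : Exp P Z <= Exp P Y + e by apply: h => // w; rewrite distrC.
  lra.
have : Exp P Y <= Exp P Z + e by exact: h.
lra.
Qed.

Lemma Exp_sum (I : finType) (Y : I -> T -> R) M : (forall i, measurable_fun setT (Y i)) ->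
  (forall i w, `|Y i w| <= M) ->
  Exp P (fun w => \sum_i Y i w) = \sum_i Exp P (Y i).
Proof.
move=> mY bY.
apply: EFin_inj; rewrite -sumEFin.
under [RHS]eq_bigr do rewrite -(ExpE (mY _) (bY _)).
rewrite -(@ExpE _ (\sum_(i in I) M)).
- under eq_integral do rewrite -sumEFin.
  by rewrite integral_sum// => i; exact: bounded_integrable (bY i).
- exact: measurable_sum.
- by move=> w; rewrite (le_trans (ler_norm_sum _ _ _))// ler_sum.
Qed.

End expectation.

Section bernstein.
Context {R : realType}.

Definition bern (n k : nat) (x : R) : R := x ^+ k * (1 - x) ^+ (n - k) *+ 'C(n, k).

Lemma bern_ge0 n k x : 0 <= x <= 1 -> 0 <= bern n k x.
Proof. by move=> /andP[x0 x1]; rewrite mulrn_wge0// mulr_ge0 ?exprn_ge0// subr_ge0. Qed.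

Lemma bern_sum n x : \sum_(k < n.+1) bern n k x = 1.
Proof.
have := exprDn (1 - x) x n; rewrite subrK expr1n => ->.
by apply: eq_bigr => k _; rewrite /bern mulrC.
Qed.

Lemma bern_mean n x : \sum_(k < n.+1) k%:R * bern n k x = n%:R * x.
Proof.
case: n => [|n]; first by rewrite big_ord1 !mul0r.
rewrite big_ord_recl mul0r add0r -[RHS]mulr1 -[X in _ = _ * X](bern_sum n x) mulr_sumr.
apply: eq_bigr => k _; rewrite lift0 /bern subSS.
rewrite -[_ *+ 'C(n.+1, k.+1)]mulr_natr -[_ *+ 'C(n, k)]mulr_natr exprS.
have : (k.+1 * 'C(n.+1, k.+1) = n.+1 * 'C(n, k))%N by rewrite mul_bin_diag.
move=> /(congr1 (fun m : nat => m%:R : R)); rewrite !natrM => h.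
set a := x ^+ k; set b := _ ^+ _.
transitivity (x * a * b * (k.+1%:R * 'C(n.+1, k.+1)%:R)); first by ring.
by rewrite h; ring.
Qed.

Lemma bern_mean2 n x : \sum_(k < n.+1) k%:R * (k%:R - 1) * bern n k x = n%:R * (n%:R - 1) * x ^+ 2.
Proof.
case: n => [|n]; first by rewrite big_ord1 !mul0r.
rewrite big_ord_recl !mul0r add0r.
transitivity (n.+1%:R * x * \sum_(k < n.+1) k%:R * bern n k x); last first.
  by rewrite bern_mean -natr1; ring.
rewrite mulr_sumr.
apply: eq_bigr => k _; rewrite lift0 /bern subSS.
rewrite -[_ *+ 'C(n.+1, k.+1)]mulr_natr -[_ *+ 'C(n, k)]mulr_natr exprS -[k.+1%:R - 1](_ : k%:R = _); last by rewrite -natr1 addrK.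
have : (k.+1 * 'C(n.+1, k.+1) = n.+1 * 'C(n, k))%N by rewrite mul_bin_diag.
move=> /(congr1 (fun m : nat => m%:R : R)); rewrite !natrM => h.
set a := x ^+ k; set b := _ ^+ _.
transitivity (k%:R * x * a * b * (k.+1%:R * 'C(n.+1, k.+1)%:R)); first by ring.
by rewrite h; ring.
Qed.

(** The inequality [|z| <= e + z ^+ 2 / e] reduces the mean deviation of the binomial frequency to
    its variance [x * (1 - x) / n]. *)
Lemma bern_dev n x e : (0 < n)%N -> 0 <= x <= 1 -> 0 < e ->
  \sum_(k < n.+1) `|x - k%:R / n%:R| * bern n k x <= e + (n%:R * e)^-1.
Proof.
move=> n0 x01 e0; have nR : 0 < n%:R :> R by rewrite ltr0n.
have n0' : n%:R != 0 :> R by rewrite gt_eqF.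
have var : \sum_(k < n.+1) (x - k%:R / n%:R) ^+ 2 * bern n k x = x * (1 - x) / n%:R.
  transitivity (\sum_(k < n.+1) (x ^+ 2 * bern n k x
     + ((1 / n%:R ^+ 2 - 2 * x / n%:R) * (k%:R * bern n k x)
     + n%:R ^- 2 * (k%:R * (k%:R - 1) * bern n k x)))).
    by apply: eq_bigr => k _; field.
  rewrite !big_split /= -!mulr_sumr bern_sum bern_mean bern_mean2; field.
  exact: n0'.
apply: (@le_trans _ _ (\sum_(k < n.+1) (e * bern n k x + e^-1 * ((x - k%:R / n%:R) ^+ 2 * bern n k x)))).
  apply: ler_sum => k _; rewrite mulrA -mulrDl; apply: ler_wpM2r; first exact: bern_ge0.
  set z := x - _.
  have := sqr_ge0 (`|z| - e); rewrite sqrrB real_normK ?num_real// mulr2n => h.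
  rewrite -(ler_pM2l e0) mulrDr mulrA divff ?gt_eqF// mul1r.
  have : 0 <= `|z| * e by rewrite mulr_ge0// ltW.
  rewrite -expr2 [e * _]mulrC; lra.
rewrite big_split /= -!mulr_sumr bern_sum var mulr1 lerD2l invfM [leRHS]mulrC ler_pM2l ?invr_gt0//.
rewrite ler_pdivrMr// mulVf//; have /andP[? ?] := x01.
by apply: mulr_ile1; lra.
Qed.

(** The hypothesis of [fdd_cvg] concerns monomials, hence the expansion. *)
Lemma bern_poly n k : exists c : nat -> R, forall x, bern n k x = \sum_(j < n.+1) c j * x ^+ j.
Proof.
case: (leqP k n) => kn; last first.
  exists (fun=> 0) => x; rewrite /bern bin_small// mulr0n big1// => j _; exact: mul0r.
pose q : {poly R} := ('X^k * (1 - 'X) ^+ (n - k)) *+ 'C(n, k).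
exists (fun j => q`_j) => x.
have -> : bern n k x = q.[x] by rewrite /q hornerMn hornerM hornerXn horner_exp !hornerE.
apply: horner_coef_wide.
rewrite /q -mulr_natr -polyC_natr mulrC; apply: (leq_trans (size_polyMleq _ _)).
apply: (@leq_trans (1 + size ('X^k * (1 - 'X) ^+ (n - k) : {poly R})).-1).
  by rewrite -!subn1 leq_sub2r// leq_add2r size_polyC_leq1.
rewrite add1n /=; apply: (leq_trans (size_polyMleq _ _)); rewrite size_polyXn addSn /=.
apply: (@leq_trans (k + (n - k).+1)); last by rewrite addnS subnKC.
rewrite leq_add2l; apply: (leq_trans (size_poly_exp_leq _ _)).
have -> : (size (1 - 'X : {poly R})).-1 = 1%N.
  by rewrite -opprB size_polyN size_XsubC.
by rewrite mul1n.
Qed.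

Definition cube N (p : 'I_N -> R) := forall i, 0 <= p i <= 1.

Definition lipschitz_cube N (K : R) (H : ('I_N -> R) -> R) :=
  forall p p', cube p -> cube p' -> `|H p - H p'| <= K * \sum_i `|p i - p' i|.

(** The tensor Bernstein polynomial is an average of [H] over the grid with product binomial
    weights; the Lipschitz bound splits the error into one-dimensional mean deviations, one per
    coordinate. *)
Lemma cube_poly_approx N (K : R) (H : ('I_N -> R) -> R) (e : R) : 0 <= K -> lipschitz_cube K H -> 0 < e ->
  exists n, exists a : {ffun 'I_N -> 'I_n.+1} -> R, forall p, cube p ->
    `|H p - \sum_s a s * \prod_i p i ^+ s i| <= e.
Proof.
move=> K0 lH e0.
pose L : R := K * N%:R + 1.
have L0 : 0 < L by rewrite ltr_wpDl// mulr_ge0.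
pose e1 : R := e / (2 * L).
have e10 : 0 < e1 by rewrite divr_gt0// mulr_gt0.
(* A degree of at least [e1 ^- 2] brings [(n * e1)^-1] in [bern_dev] below [e1]; the total error is
   then at most [K * N * (2 * e1) <= e]. *)
pose n := (Num.truncn (e1 ^- 2)).+1.
have n0 : (0 < n)%N by [].
have nR : 0 < n%:R :> R by rewrite ltr0n.
have nbig : (n%:R * e1)^-1 <= e1.
  have h : e1 ^- 2 <= n%:R by apply/ltW; exact: truncnS_gt.
  have h2 : 1 <= e1 * (n%:R * e1).
    have e2 : 0 < e1 ^+ 2 by rewrite exprn_gt0.
    have := ler_wpM2r (ltW e2) h; rewrite mulVf ?gt_eqF// expr2; lra.
  have ne : 0 < n%:R * e1 by exact: mulr_gt0.
  by rewrite -(ler_pM2r ne) mulVf ?gt_eqF.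
have [c hc] := choice (fun k => bern_poly n k).
exists n.
exists (fun s : {ffun 'I_N -> 'I_n.+1} => \sum_(k : {ffun 'I_N -> 'I_n.+1}) H (fun i => (k i)%:R / n%:R) * \prod_i c (k i) (s i)).
move=> p cp.
have polyE : \sum_(s : {ffun 'I_N -> 'I_n.+1})
    (\sum_(k : {ffun 'I_N -> 'I_n.+1}) H (fun i => (k i)%:R / n%:R) * \prod_i c (k i) (s i)) * \prod_i p i ^+ s i =
   \sum_(k : {ffun 'I_N -> 'I_n.+1}) H (fun i => (k i)%:R / n%:R) * \prod_i bern n (k i) (p i).
  under eq_bigr do rewrite mulr_suml.
  rewrite exchange_big /=; apply: eq_bigr => k _.
  under [in RHS]eq_bigr do rewrite hc.
  rewrite (bigA_distr_bigA (fun i j => c (k i) (nat_of_ord j) * p i ^+ j)) mulr_sumr.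
  by apply: eq_bigr => s _; rewrite -mulrA -big_split.
rewrite polyE.
have tot : \sum_(k : {ffun 'I_N -> 'I_n.+1}) \prod_i bern n (k i) (p i) = 1.
  rewrite -(bigA_distr_bigA (fun i (j : 'I_n.+1) => bern n j (p i))) big1// => i _.
  exact: bern_sum.
have HpE : H p = \sum_(k : {ffun 'I_N -> 'I_n.+1}) H p * \prod_i bern n (k i) (p i).
  by rewrite -mulr_sumr tot mulr1.
rewrite {1}HpE -sumrB.
apply: (le_trans (ler_norm_sum _ _ _)).
apply: (@le_trans _ _ (\sum_(k : {ffun 'I_N -> 'I_n.+1}) \sum_j K * (`|p j - (k j)%:R / n%:R| * \prod_i bern n (k i) (p i)))).
  apply: ler_sum => k _; rewrite -mulrBl normrM.
  have pr0 : 0 <= \prod_i bern n (k i) (p i) by apply: prodr_ge0 => i _; exact: bern_ge0.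
  rewrite [X in _ * X]ger0_norm// -mulr_sumr -mulr_suml mulrA; apply: ler_wpM2r => //.
  by apply: lH => // i; rewrite divr_ge0//= ler_pdivrMr// mul1r ler_nat -ltnS ltn_ord.
rewrite exchange_big /=.
apply: (@le_trans _ _ (\sum_(j < N) K * (e1 + e1))).
  apply: ler_sum => j _; rewrite -mulr_sumr; apply: ler_wpM2l => //.
  have -> : \sum_(k : {ffun 'I_N -> 'I_n.+1}) `|p j - (k j)%:R / n%:R| * \prod_i bern n (k i) (p i) =
     \sum_(m < n.+1) `|p j - m%:R / n%:R| * bern n m (p j).
    transitivity (\sum_(k : {ffun 'I_N -> 'I_n.+1}) \prod_i
       ((if i == j then `|p j - (k i)%:R / n%:R| else 1) * bern n (k i) (p i))).
      apply: eq_bigr => k _; rewrite big_split /=; congr (_ * _).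
      by rewrite (bigD1 j)//= eqxx big1 ?mulr1// => i /negbTE ->.
    rewrite -(bigA_distr_bigA (fun i (m : 'I_n.+1) =>
      (if i == j then `|p j - m%:R / n%:R| else 1) * bern n m (p i))).
    rewrite (bigD1 j)//= eqxx [X in _ * X]big1 ?mulr1// => i /negbTE ->.
    by under eq_bigr do rewrite mul1r; exact: bern_sum.
  by apply: (le_trans (bern_dev n0 (cp j) e10)); rewrite lerD2l.
rewrite sumr_const card_ord -mulr_natr.
have -> : K * (e1 + e1) * N%:R = (K * N%:R) * (2 * e1) by ring.
apply: (@le_trans _ _ (L * (2 * e1))).
  by apply: ler_wpM2r; [rewrite mulr_ge0// ltW|rewrite /L lerDl].
by rewrite /e1 le_eqVlt; apply/orP; left; apply/eqP; field; rewrite gt_eqF.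
Qed.

End bernstein.

(** * Convergence in distribution on a cube from mixed moments *)

Section fdd.
Context {R : realType}.

Lemma measurable_cube_lipschitz (d : measure_display) (T : measurableType d) N K
    (H : ('I_N -> R) -> R) (p : T -> 'I_N -> R) : 0 <= K -> lipschitz_cube K H ->
  (forall i, measurable_fun setT (fun w => p w i)) -> (forall w, cube (p w)) ->
  measurable_fun setT (fun w => H (p w)).
Proof.
move=> K0 lH mp cp.
have h m : exists f : T -> R, measurable_fun setT f /\ forall w, `|H (p w) - f w| <= m.+1%:R^-1.
  have m0 : 0 < m.+1%:R^-1 :> R by rewrite invr_gt0.
  have [n [a ha]] := cube_poly_approx K0 lH m0.
  exists (fun w => \sum_s a s * \prod_i p w i ^+ s i); split; last by move=> w; exact: ha.
  apply: measurable_sum => s; apply: measurable_funM; first exact: measurable_cst.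
  by apply: measurable_prod => i _; exact: measurable_funX.
have [f hf] := choice h.
apply: (measurable_fun_cvg (h := f)); first by move=> m; have [] := hf m.
move=> w _; apply/cvgrPdist_le => e e0.
have /cvgrPdist_le /(_ e e0) := @cvg_harmonic R.
apply: filterS => n; rewrite sub0r normrN ger0_norm ?invr_ge0// => hn.
by have [_ /(_ w)] := hf n; move=> /le_trans; apply.
Qed.

Lemma fdd_cvg (d d' : measure_display) (T : measurableType d) (T' : measurableType d')
    (P : probability T R) (P' : probability T' R) N K M (H : ('I_N -> R) -> R)
    (p : R -> T -> 'I_N -> R) (q : T' -> 'I_N -> R) : 0 <= K -> lipschitz_cube K H ->
  (forall z, `|H z| <= M) ->
  (forall t i, measurable_fun setT (fun w => p t w i)) -> (forall t w, cube (p t w)) ->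
  (forall i, measurable_fun setT (fun w => q w i)) -> (forall w, cube (q w)) ->
  (forall s : 'I_N -> nat, Exp P (fun w => \prod_i p t w i ^+ s i) @[t --> +oo] -->
     Exp P' (fun w => \prod_i q w i ^+ s i)) ->
  Exp P (fun w => H (p t w)) @[t --> +oo] --> Exp P' (fun w => H (q w)).
Proof.
move=> K0 lH bH mp cp mq cq mono.
apply/cvgrPdist_le => e e0.
have e3 : 0 < e / 3 by rewrite divr_gt0.
have [n [a ha]] := cube_poly_approx K0 lH e3.
pose M' := M + e.
have monob (z : 'I_N -> R) (s : 'I_N -> nat) : cube z -> `|\prod_i z i ^+ s i| <= 1.
  move=> cz; rewrite normr_prod; apply: prodr_ile1 => i; rewrite normr_ge0 /= normrX.
  have /andP[z0 z1] := cz i; rewrite ger0_norm// exprn_ile1//.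
have mmono (d0 : measure_display) (U : measurableType d0) (z : U -> 'I_N -> R) (s : 'I_N -> nat) :
    (forall i, measurable_fun setT (fun w => z w i)) ->
    measurable_fun setT (fun w => \prod_i z w i ^+ s i).
  by move=> mz; apply: measurable_prod => i _; exact: measurable_funX.
have ExpS (d0 : measure_display) (U : measurableType d0) (Q : probability U R) (z : U -> 'I_N -> R) :
    (forall i, measurable_fun setT (fun w => z w i)) -> (forall w, cube (z w)) ->
    `|Exp Q (fun w => H (z w)) - \sum_s a s * Exp Q (fun w => \prod_i z w i ^+ s i)| <= e / 3.
  move=> mz cz.
  have -> : \sum_s a s * Exp Q (fun w => \prod_i z w i ^+ s i) =
      Exp Q (fun w => \sum_s a s * \prod_i z w i ^+ s i).
    rewrite (@Exp_sum _ _ _ Q _ _ (\sum_s `|a s|)).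
    - apply: eq_bigr => s _; rewrite (@ExpZ _ _ _ Q _ 1)//; first exact: mmono.
      by move=> w; exact: monob.
    - by move=> s; apply: measurable_funM; [exact: measurable_cst|exact: mmono].
    - move=> s w; rewrite normrM (bigD1 s)//= -[leLHS]addr0; apply: lerD.
        by rewrite -[leRHS]mulr1 ler_wpM2l// monob.
      exact: sumr_ge0.
  apply: (@Exp_close _ _ _ Q _ _ M') => //.
  - exact: (measurable_cube_lipschitz K0 lH).
  - by move=> w; rewrite (le_trans (bH _))// /M' lerDl ltW.
  - by apply: measurable_sum => s; apply: measurable_funM; [exact: measurable_cst|exact: mmono].
  - move=> w; have := ha _ (cz w); have := bH (z w).
    set A := H _; set B := \sum_s _ => h1 h2.
    have := ler_normD (A) (- (A - B)); rewrite normrN opprB addrC subrK /M'; lra.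
  - by move=> w; exact: ha.
have : \sum_s a s * Exp P (fun w => \prod_i p t w i ^+ s i) @[t --> +oo] -->
       \sum_s a s * Exp P' (fun w => \prod_i q w i ^+ s i).
  by apply: cvg_big => [|s _]; [exact: add_continuous|apply: cvgM; [exact: cvg_cst|exact: mono]].
move=> /cvgrPdist_le /(_ _ e3); apply: filterS => t ht.
have h1 := ExpS _ _ P _ (mp t) (cp t).
have h2 := ExpS _ _ P' _ mq cq.
move: ht h1 h2.
set A := Exp P' _; set B := Exp P _; set A' := \sum_s _; set B' := \sum_s _ => ht h1 h2.
have -> : A - B = (A - A') + (A' - B') - (B - B') by ring.
have := ler_normB ((A - A') + (A' - B')) (B - B'); have := ler_normD (A - A') (A' - B'); lra.
Qed.

End fdd.

(** * The walk in dyadic windows *)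

Section decay.
Context {R : realType}.

(** If [B ^+ p.+1 >= 8], then [expR z >= (z / p.+1) ^+ p.+1] at [z = c * B ^+ j] grows at least like
    [8 ^+ j]. The factor [4 ^+ j] is to pay for the number of windows at scale [j], and [2 ^- j]
    remains for the sum over scales. *)
Lemma exp_decay (c B : R) : 0 < c -> 1 < B -> exists2 K, 0 < K &
  forall j : nat, 4 ^+ j * expR (- (c * B ^+ j)) <= K * 2 ^- j.
Proof.
move=> c0 B1.
have B0 : 0 < B by exact: lt_trans B1.
have [p hp] : exists p : nat, 8 <= B ^+ p.+1.
  have h (n : nat) : 1 + n%:R * (B - 1) <= B ^+ n.
    elim: n => [|n IH]; first by rewrite mul0r addr0 expr0.
    rewrite exprS -natr1.
    have : B * (1 + n%:R * (B - 1)) <= B * B ^+ n by rewrite ler_pM2l.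
    have : 0 <= n%:R * (B - 1) ^+ 2 by rewrite mulr_ge0// sqr_ge0.
    rewrite expr2; lra.
  pose p := Num.truncn (7 / (B - 1)).
  exists p; apply: le_trans (h p.+1).
  have b1 : 0 < B - 1 by rewrite subr_gt0.
  have := truncnS_gt (7 / (B - 1)); rewrite -/p ltr_pdivrMr//; lra.
pose K := (p.+1%:R / c) ^+ p.+1.
have K0 : 0 < K by rewrite exprn_gt0// divr_gt0.
exists K => // j.
have z0 : 0 < c * B ^+ j by rewrite mulr_gt0// exprn_gt0.
have h1 : (c * B ^+ j / p.+1%:R) ^+ p.+1 <= expR (c * B ^+ j).
  rewrite -[in leRHS](mulfVK (_ : p.+1%:R != 0 :> R) (c * B ^+ j))//.
  rewrite [X in expR X]mulrC expRM_natl; apply: lerXn2r; rewrite ?nnegrE ?divr_ge0 ?expR_ge0 ?(ltW z0)//.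
  by apply: (le_trans _ (expR_ge1Dx _)); rewrite lerDr.
have h2 : K^-1 * 8 ^+ j <= (c * B ^+ j / p.+1%:R) ^+ p.+1.
  rewrite mulrAC exprMn -exprM mulnC exprM /K -exprVn invf_div; apply: ler_wpM2l.
    by rewrite exprn_ge0// divr_ge0// ltW.
  by apply: lerXn2r; [rewrite nnegrE|rewrite nnegrE exprn_ge0// ltW|exact: hp].
have h3 := le_trans h2 h1.
rewrite expRN ler_pdivrMr ?expR_gt0//.
have e8 : 8 ^+ j = 4 ^+ j * 2 ^+ j :> R by rewrite -exprMn; congr (_ ^+ _); lra.
have p2 : 0 < 2 ^+ j :> R by rewrite exprn_gt0.
rewrite e8 in h3.
have : K * (K^-1 * (4 ^+ j * 2 ^+ j)) <= K * expR (c * B ^+ j) by rewrite ler_pM2l.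
rewrite mulrA divff ?gt_eqF// mul1r => h4.
by rewrite mulrAC ler_pdivlMr.
Qed.

Lemma prob_bigcup_geom (d : measure_display) (T : measurableType d) (P : probability T R)
    (F : nat -> set T) (K : R) (n : nat) : 0 <= K -> (forall j, measurable (F j)) ->
  (forall j, (j < n)%N -> F j = set0) ->
  (forall j, (n <= j)%N -> (P (F j) <= (K * 2 ^- j)%:E)%E) ->
  (P (\bigcup_j F j) <= (2 * K * 2 ^- n)%:E)%E.
Proof.
move=> K0 mF F0 FK.
apply: (@le_trans _ _ (\sum_(j <oo) P (F j))%E).
  by apply: generalized_Boole_inequality => //; exact: bigcupT_measurable.
apply: lime_le; first exact: is_cvg_nneseries.
apply: nearW => m.
apply: (@le_trans _ _ (\sum_(0 <= j < m) (if (j < n)%N then 0 else K * 2 ^- j)%:E)%E).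
  apply: lee_sum => j _; case: ltnP => jn; last exact: FK.
  by rewrite F0// measure0.
rewrite sumEFin lee_fin.
have key : \sum_(0 <= j < m) (if (j < n)%N then 0 else K * 2 ^- j) <=
    if (m <= n)%N then 0 else 2 * K * 2 ^- n - 2 * K * 2 ^- m.
  elim: m => [|m IH]; first by rewrite big_geq.
  rewrite big_nat_recr//=; apply: (le_trans (lerD IH (lexx _))).
  case: (ltngtP m n) => [mn|nm|->].
  - by rewrite addr0.
  - rewrite exprS invfM.
    have -> : 2 * K * (2^-1 * 2 ^- m) = K * 2 ^- m :> R by field; rewrite expf_neq0.
    lra.
  - rewrite add0r exprS invfM.
    have -> : 2 * K * (2^-1 * 2 ^- n) = K * 2 ^- n :> R by field; rewrite expf_neq0.
    lra.
apply: (le_trans key); have p j : 0 <= 2 * K * 2 ^- j :> R by rewrite !mulr_ge0// invr_ge0 exprn_ge0.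
by case: ifP => // _; rewrite gerBl.
Qed.

End decay.

(** * Simultaneous control of all dyadic windows *)

Section bad_walk.
Context {R : realType} {d : measure_display} {T : measurableType d}.
Variable (P : probability T R).
Context {dE : measure_display} {E : measurableType dE} (mu : probability E R).
Variables (Th : nat -> T -> E) (C : set (set E)).
Hypothesis iid : iid_gen P mu Th C.
Variable sz : E -> R.
Hypothesis msz : measurable_fun setT sz.
Local Notation walk := (walk Th sz).

(** The windows are centred at the multiples of [x j] and overlap, so that every interval []y - x j,
    y]] with [0 <= y <= n * 2 ^ j * x j] lies inside one of them. The parameter [n] is both the time
    horizon and the first scale considered; [cond] cuts off the scales that are too fine. *)
Definition bad_scale (n : nat) (cond : nat -> bool) (x : nat -> R) (m : nat -> nat) j : set T :=
  if (n <= j)%N && cond j then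
    \bigcup_(i in `I_(n * 2 ^ j + 2)) crowded Th sz ((i%:R - 1) * x j) ((i%:R + 1) * x j) (m j)
  else set0.

Definition bad_walk n cond x m : set T := \bigcup_j bad_scale n cond x m j.

Lemma measurable_bad_scale n cond x m j : measurable (bad_scale n cond x m j).
Proof.
rewrite /bad_scale; case: ifP => // _; apply: bigcup_measurable => i _.
exact: (measurable_crowded iid).
Qed.

Lemma measurable_bad_walk n cond x m : measurable (bad_walk n cond x m).
Proof. by apply: bigcup_measurable => j _; exact: measurable_bad_scale. Qed.

(** Since [n <= j <= 2 ^ j], scale [j] has at most [3 * 4 ^+ j] windows, which is what [exp_decay]
    is designed to absorb. *)
Lemma prob_bad_walk (c B K0 K1 : R) : 0 < K0 -> 0 < K1 ->
  (forall j : nat, 4 ^+ j * expR (- (c * B ^+ j)) <= K1 * 2 ^- j) ->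
  forall n (cond : nat -> bool) (x q : nat -> R) (m : nat -> nat),
  (forall j, (n <= j)%N -> cond j ->
     [/\ 0 < x j, (\int[mu]_e (expR (- (2 * x j)^-1 * sz e))%:E = (q j)%:E)%E &
      q j ^+ m j <= K0 * expR (- (c * B ^+ j))]) ->
  (P (bad_walk n cond x m) <= (2 * (3 * expR 1 * K0 * K1) * 2 ^- n)%:E)%E.
Proof.
move=> K00 K10 dec n cond x q m h.
apply: prob_bigcup_geom.
- by rewrite !mulr_ge0// ?expR_ge0// ltW.
- exact: measurable_bad_scale.
- by move=> j jn; rewrite /bad_scale leqNgt jn.
move=> j nj; rewrite /bad_scale nj /=; case: ifP => cj; last first.
  by rewrite measure0 lee_fin !mulr_ge0// ?expR_ge0 ?invr_ge0 ?exprn_ge0// ltW.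
have [x0 hq qm] := h j nj cj.
rewrite bigcup_mkord.
apply: (@le_trans _ _ (\sum_(i < n * 2 ^ j + 2) (expR 1 * (K0 * expR (- (c * B ^+ j))))%:E)%E).
  apply: (le_trans (Boole_inequality P (A := fun i => crowded Th sz ((i%:R - 1) * x j) ((i%:R + 1) * x j) (m j)) _)).
    by move=> i _; exact: (measurable_crowded iid).
  apply: lee_sum => i _.
  have lenE : (i%:R + 1) * x j - (i%:R - 1) * x j = 2 * x j by ring.
  have lt : (i%:R - 1) * x j < (i%:R + 1) * x j by rewrite ltr_pM2r//; lra.
  have := @prob_crowded _ _ _ P _ _ mu Th C iid sz msz _ _ (m j) (q j) lt.
  rewrite lenE => /(_ hq) /le_trans; apply.
  by rewrite lee_fin ler_pM2l// expR_gt0.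
rewrite sumEFin lee_fin sumr_const card_ord -[_ *+ (n * 2 ^ j + 2)]mulr_natr.
have nb : (n * 2 ^ j + 2)%:R <= 3 * 4 ^+ j :> R.
  have -> : 3 * 4 ^+ j = (3 * 4 ^ j)%:R :> R by rewrite natrM natrX.
  rewrite ler_nat.
  have h1 : (n <= 2 ^ j)%N by rewrite (leq_trans nj)// ltnW// ltn_expl.
  have h2 : (4 ^ j = 2 ^ j * 2 ^ j)%N by rewrite -expnMn.
  have h3 : (1 <= 2 ^ j)%N by rewrite expn_gt0.
  rewrite h2 mulSn leq_add ?leq_mul//.
  by rewrite (leq_mul2l 2 1) /= muln_gt0 expn_gt0.
have e0 : 0 <= expR 1 * (K0 * expR (- (c * B ^+ j))) by rewrite !mulr_ge0 ?expR_ge0// ltW.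
apply: (le_trans (ler_wpM2l e0 nb)).
have -> : expR 1 * (K0 * expR (- (c * B ^+ j))) * (3 * 4 ^+ j) =
  (3 * expR 1 * K0) * (4 ^+ j * expR (- (c * B ^+ j))) by ring.
rewrite -[leRHS]mulrA; apply: ler_wpM2l; first by rewrite !mulr_ge0 ?expR_ge0// ltW.
exact: dec.
Qed.

Lemma good_window n cond x m j N (y : R) w : (forall k, 0 <= sz (Th k w)) ->
  ~ bad_walk n cond x m w -> (n <= j)%N -> cond j -> 0 < x j ->
  0 <= y -> y <= (n * 2 ^ j)%:R * x j ->
  (\sum_(k < N) (y - x j < walk k w <= y)%R <= m j)%N.
Proof.
move=> pos nb nj cj x0 y0 yn.
have yx : 0 <= y / x j by rewrite divr_ge0// ltW.
pose i := Num.truncn (y / x j).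
have /andP[i1 i2] := truncn_itv yx; rewrite -/i in i1 i2.
have ib : (i < n * 2 ^ j + 2)%N.
  have : (i%:R : R) <= (n * 2 ^ j)%:R by rewrite (le_trans i1)// ler_pdivrMr.
  by rewrite ler_nat => /leq_ltn_trans; apply; rewrite addn2 ltnW.
have nc : ~ crowded Th sz ((i%:R - 1) * x j) ((i%:R + 1) * x j) (m j) w.
  move=> h; apply: nb; exists j => //; rewrite /bad_scale nj cj /=.
  by exists i.
apply: leq_trans (not_crowded N pos nc).
apply: leq_sum => k _; case: (boolP (y - x j < walk k w <= y)) => // /andP[h1 h2].
rewrite lt0b; apply/andP.
move: i1 i2; rewrite ler_pdivlMr// ltr_pdivrMr// -natr1 => i1 i2.
by split; lra.
Qed.

End bad_walk.

Section window_sums.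
Context {R : realType}.
Variables (S : nat -> R) (N : nat) (y tau t : R).

Definition window (c e : R) : nat := (\sum_(k < N) (c < S k <= e)%R)%N.

Lemma window_sum_le (f : R -> R) (c e A : R) : 0 <= A ->
  (forall k, (k < N)%N -> c < S k <= e -> f (S k) <= A) ->
  \sum_(k < N) (if c < S k <= e then f (S k) else 0) <= A * (window c e)%:R.
Proof.
move=> A0 h; rewrite /window natr_sum mulr_sumr; apply: ler_sum => k _.
by case: ifPn => hk; rewrite ?mulr1 ?mulr0//; exact: h.
Qed.

(** Decomposition by the age [y - S k]: shell [j] holds the ages from [2 ^- j.+1 * t] to
    [2 ^- j * t] and sits in a window with at most [g ^+ j / tau] points. The last shell also takes
    all smaller ages, which is the alternative [j = J] in the hypothesis on [f]. *)
Lemma near_sum (f : R -> R) (g Q A : R) (n J : nat) : 0 < tau -> 0 <= t -> 0 <= A -> 0 <= Q -> 0 <= g ->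
  (n <= J)%N ->
  (forall j, (n <= j <= J)%N -> tau * (window (y - 2 ^- j * t) y)%:R <= g ^+ j) ->
  (forall j z, (n <= j <= J)%N -> 0 <= z < 2 ^- j * t -> 2 ^- j.+1 * t <= z \/ j = J ->
     f z <= A * Q ^+ j.+1) ->
  tau * \sum_(k < N) (if y - 2 ^- n * t < S k <= y then f (y - S k) else 0) <=
    \sum_(n <= j < J.+1) A * Q ^+ j.+1 * g ^+ j.
Proof.
move=> tau0 t0 A0 Q0 g0 nJ win hf.
have AQ j : 0 <= A * Q ^+ j by rewrite mulr_ge0// exprn_ge0.
move: (nJ) => /subnKC; move: (J - n)%N => r.
elim: r n nJ win hf => [|r IH] n nJ win hf nr.
  rewrite addn0 in nr; rewrite -nr big_nat1.
  apply: (@le_trans _ _ (tau * (A * Q ^+ n.+1 * (window (y - 2 ^- n * t) y)%:R))).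
    rewrite ler_pM2l//; apply: (window_sum_le (f := fun s => f (y - s))) => // k _ /andP[h1 h2].
    apply: (hf n); [by rewrite leqnn nr leqnn|apply/andP; split; lra|by right].
  by rewrite mulrCA; apply: ler_wpM2l => //; apply: win; rewrite leqnn nr leqnn.
have nJ' : (n < J)%N by rewrite -nr addnS ltnS leq_addr.
rewrite big_ltn; last exact: leqW.
have IH' := IH n.+1 nJ'.
apply: (@le_trans _ _ (tau * (A * Q ^+ n.+1 * (window (y - 2 ^- n * t) y)%:R)
   + tau * \sum_(k < N) (if y - 2 ^- n.+1 * t < S k <= y then f (y - S k) else 0))); last first.
  apply: lerD.
    by rewrite mulrCA; apply: ler_wpM2l => //; apply: win; rewrite leqnn ltnW.
  apply: IH'; last by rewrite addSnnS.
  - by move=> j /andP[nj jJ]; apply: win; rewrite jJ ltnW.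
  - by move=> j z /andP[nj jJ]; apply: hf; rewrite jJ ltnW.
rewrite -mulrDr ler_pM2l// /window natr_sum mulr_sumr -big_split /=; apply: ler_sum => k _.
have sub : 2 ^- n.+1 * t <= 2 ^- n * t.
  by apply: ler_wpM2r => //; rewrite lef_pV2 ?posrE ?exprn_gt0// ler_eXn2l// ltr1n.
case: ifPn => [/andP[h1 h2]|h0]; last first.
  rewrite mulr0 add0r; case: ifPn => // /andP[h1 h2]; move: h0; rewrite h2 andbT -leNgt => h0.
  by exfalso; lra.
case: ifPn => h3; first by rewrite mulr1 lerDr.
rewrite mulr1 addr0; apply: (hf n); [by rewrite leqnn ltnW|by apply/andP; split; lra|left].
by move: h3; rewrite h2 andbT -leNgt; lra.
Qed.

Lemma window_total (g x : R) (M : nat) : 0 < tau -> 0 < x -> (forall k, 0 <= S k) ->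
  (forall i : nat, (i <= M)%N -> tau * (window (i%:R * x - x) (i%:R * x))%:R <= g) ->
  forall e, e <= M%:R * x -> tau * (\sum_(k < N) (S k <= e)%R)%:R <= M.+1%:R * g.
Proof.
move=> tau0 x0 S0 win e eM.
apply: (@le_trans _ _ (\sum_(i < M.+1) tau * (window (i%:R * x - x) (i%:R * x))%:R)); last first.
  apply: (@le_trans _ _ (\sum_(i < M.+1) g)).
    by apply: ler_sum => i _; apply: win; rewrite -ltnS.
  by rewrite sumr_const card_ord -[_ *+ M.+1]mulr_natl.
rewrite -mulr_sumr ler_pM2l// -natr_sum ler_nat /window exchange_big /=.
apply: leq_sum => k _; case: (leP (S k) e) => // Ske.
pose i := `|Num.ceil (S k / x)|%N.
have yx : 0 <= S k / x by rewrite divr_ge0// ltW.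
have c0 : 0 <= Num.ceil (S k / x) by rewrite ceil_ge0 (lt_le_trans _ yx)// ltrN10.
have iE : (i%:R : R) = (Num.ceil (S k / x))%:~R by rewrite /i natr_absz ger0_norm.
have h1 : S k / x <= i%:R by rewrite iE; exact: ceil_ge.
have h2 : i%:R - 1 < S k / x by rewrite iE; have := ceilB1_lt (S k / x); rewrite ?intrB.
have iM : (i < M.+1)%N.
  have h : S k / x <= M%:R by rewrite ler_pdivrMr// (le_trans Ske).
  have : (i%:R : R) < M%:R + 1 by lra.
  by rewrite natr1 ltr_nat.
rewrite (bigD1 (Ordinal iM))//= (_ : (i%:R * x - x < S k <= i%:R * x) = true) ?leq_addr//.
move: h1 h2; rewrite ler_pdivrMr// ltr_pdivlMr// => h1 h2; rewrite h1 andbT.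
by rewrite -[X in _ - X]mul1r -mulrBl.
Qed.

End window_sums.

Section growth.
Context {R : realType}.

Lemma dyadic_scale (t : R) : 1 <= t -> exists J : nat, 2 ^+ J <= t < 2 ^+ J.+1.
Proof.
move=> t1.
have ex : exists j : nat, t < 2 ^+ j.+1.
  exists (Num.truncn t); apply: (lt_le_trans (truncnS_gt t)).
  by rewrite -natrX ler_nat ltnW// ltn_expl.
case: (ex_minnP ex) => J hJ Jmin; exists J; rewrite hJ andbT.
case: J hJ Jmin => [|J] hJ Jmin; first by rewrite expr0.
by rewrite leNgt; apply/negP => h; have := Jmin J h; rewrite ltnn.
Qed.

Lemma geom_sum_lt1 (r : R) (n m : nat) : 0 <= r < 1 ->
  \sum_(n <= j < m) r ^+ j <= r ^+ n / (1 - r).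
Proof.
move=> /andP[r0 r1]; have r1' : 0 < 1 - r by rewrite subr_gt0.
rewrite ler_pdivlMr//.
case: (leqP n m) => nm; last by rewrite big_geq ?(ltnW nm)// mul0r exprn_ge0.
have -> : (\sum_(n <= j < m) r ^+ j) * (1 - r) = r ^+ n - r ^+ m.
  elim: m nm => [|m IH]; first by rewrite leqn0 => /eqP ->; rewrite big_geq// mul0r subrr.
  rewrite leq_eqVlt => /orP[/eqP ->|]; first by rewrite big_geq// mul0r subrr.
  by rewrite ltnS => nm; rewrite big_nat_recr//= mulrDl IH// exprS; ring.
by rewrite gerBl exprn_ge0.
Qed.

Lemma geom_sum_gt1 (r : R) (n m : nat) : 1 < r ->
  \sum_(n <= j < m) r ^+ j <= r ^+ m / (r - 1).
Proof.
move=> r1; have r0 : 0 <= r by rewrite (le_trans ler01)// ltW.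
have r1' : 0 < r - 1 by rewrite subr_gt0.
rewrite ler_pdivlMr//.
case: (leqP n m) => nm; last by rewrite big_geq ?(ltnW nm)// mul0r exprn_ge0.
have -> : (\sum_(n <= j < m) r ^+ j) * (r - 1) = r ^+ m - r ^+ n.
  elim: m nm => [|m IH]; first by rewrite leqn0 => /eqP ->; rewrite big_geq// mul0r subrr.
  rewrite leq_eqVlt => /orP[/eqP ->|]; first by rewrite big_geq// mul0r subrr.
  by rewrite ltnS => nm; rewrite big_nat_recr//= mulrDl IH// exprS; ring.
by rewrite gerBl exprn_ge0.
Qed.

(** Beyond [A] this is Potter's bound with loss [rho + p], which turns the exponent into [- p];
    below [A], local boundedness is compared with the bound at [A]. The maximum with [1] keeps the
    right-hand side useful at [z = 0], where the negative power of [0] would have the value [0]. *)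
Lemma rv_near (f : R -> R) (rho p : R) : rv f rho -> 0 < p -> - p < rho ->
  (forall b, 0 <= b -> exists M, forall z, 0 <= z <= b -> f z <= M) ->
  exists2 A, 1 <= A & exists2 C, 0 < C & forall t z, A <= t -> 0 <= z <= t ->
    0 < f t /\ f z <= C * f t * (Num.max z 1 / t) `^ (- p).
Proof.
move=> rvf p0 prho fb.
have e0 : 0 < rho + p by lra.
have [A A1 [C C0 HA]] := rv_potter rvf e0.
have A0 : 0 < A by exact: lt_le_trans A1.
have [M HM] := fb A (ltW A0).
have [fA _ _ _] := HA A A (lexx _) (lexx _).
pose M' := Num.max M 1.
have M0 : 0 < M' by rewrite /M' lt_max ltr01 orbT.
exists A => //; exists (C * (1 + M' / f A)).
  by rewrite mulr_gt0// addr_gt0// divr_gt0.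
have expo : rho - (rho + p) = - p by ring.
move=> t z At /andP[z0 zt].
have t0 : 0 < t by exact: lt_le_trans At.
have [ft _ _ _] := HA t t At (lexx _).
split=> //.
case: (leP A z) => Az.
  have [_ _ + _] := HA z t Az zt; rewrite expo => /le_trans; apply.
  rewrite (_ : Num.max z 1 = z); last by apply/max_idPl; exact: le_trans Az.
  rewrite -[leLHS]mulrA [X in C * X]mulrC mulrA; apply: ler_wpM2r; first exact: powR_ge0.
  apply: ler_wpM2r; first exact: ltW.
  by rewrite mulrDr mulr1 lerDl mulr_ge0 ?ltW// divr_gt0.
have [_ _ + _] := HA A t (lexx _) At; rewrite expo => hA.
apply: (@le_trans _ _ M').
  apply: (le_trans (HM z _)); first by rewrite z0 ltW.
  by rewrite /M' le_max lexx.
rewrite -[leLHS](mulfVK (lt0r_neq0 fA)).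
apply: (@le_trans _ _ (M' / f A * (C * (A / t) `^ (- p) * f t))).
  by rewrite ler_pM2l// divr_gt0.
have hp : (A / t) `^ (- p) <= (Num.max z 1 / t) `^ (- p).
  have mx : 0 < Num.max z 1 by rewrite lt_max ltr01 orbT.
  rewrite !powRN lef_pV2 ?posrE ?powR_gt0 ?divr_gt0//.
  apply: ge0_ler_powR; [exact: ltW|by rewrite nnegrE divr_ge0// ltW|by rewrite nnegrE divr_ge0// ltW|].
  by rewrite ler_pM2r ?invr_gt0// ge_max (ltW Az).
have -> : M' / f A * (C * (A / t) `^ (- p) * f t) = (C * (M' / f A) * f t) * (A / t) `^ (- p) by ring.
apply: ler_pM => //; rewrite ?powR_ge0//.
  by apply/ltW; apply: mulr_gt0 => //; apply: mulr_gt0 => //; exact: divr_gt0.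
apply: ler_wpM2r; first exact: ltW.
by apply: ler_wpM2l; [exact: ltW|rewrite lerDr].
Qed.

Lemma dyadic_powR (p : R) (j : nat) : (2 ^- j) `^ (- p) = (2 `^ p) ^+ j :> R.
Proof.
have h : 2 ^- j = 2 `^ (- j%:R) :> R by rewrite powR_invn.
by rewrite h -powRrM mulrNN -powR_mulrn ?powR_ge0// -powRrM mulrC.
Qed.

Lemma powR_near (p t z : R) (j : nat) : 0 <= p -> 0 < t -> 2 ^- j <= z / t ->
  (z / t) `^ (- p) <= (2 `^ p) ^+ j.
Proof.
move=> p0 t0 h; rewrite -dyadic_powR !powRN.
have p2 : 0 < 2 ^- j :> R by rewrite invr_gt0 exprn_gt0.
rewrite lef_pV2 ?posrE ?powR_gt0//; last exact: lt_le_trans h.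
by apply: ge0_ler_powR => //; rewrite nnegrE ?(ltW p2)// (le_trans (ltW p2)).
Qed.

End growth.

(** * The number of renewal points at every scale *)

Section good_walk.
Context {R : realType} {d : measure_display} {T : measurableType d}.
Variable (P : probability T R).
Context {dE : measure_display} {E : measurableType dE} (mu : probability E R).
Variables (Th : nat -> T -> E) (C : set (set E)).
Hypothesis iid : iid_gen P mu Th C.
Variable sz : E -> R.
Hypothesis msz : measurable_fun setT sz.
Local Notation walk := (walk Th sz).
Variables (tl q : R -> R) (alpha gam : R).
Hypothesis gam0 : 0 < gam.
Hypothesis gam_alpha : gam < alpha.
Hypothesis rvtl : rv tl (- alpha).
Hypothesis tl01 : forall t, 0 < tl t <= 1.
Hypothesis tl_mono : forall x y, x <= y -> tl y <= tl x.
Hypothesis q_laplace : forall x, 0 < x -> (\int[mu]_e (expR (- x^-1 * sz e))%:E = (q x)%:E)%E.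
Hypothesis q_lower : forall x, 0 < x -> (1 - expR (-1)) * tl x <= 1 - q x.

Definition gcst : R := 2 `^ (- gam).

(** Heuristically, a window of length [2 ^- j * t] holds about [2 ^ (- alpha * j) / tl t] points;
    the larger number [gcst ^+ j / tl t] is tolerated. The condition [2 ^+ j <= t] keeps the length
    of the windows at least [1]. *)
Definition sbad (n : nat) (t : R) : set T :=
  bad_walk Th sz n (fun j => 2 ^+ j <= t) (fun j => 2 ^- j * t)
    (fun j => Num.truncn (gcst ^+ j / tl t)).

Lemma gcst_gt0 : 0 < gcst. Proof. by rewrite powR_gt0. Qed.

Lemma measurable_sbad n t : measurable (sbad n t).
Proof. exact: (measurable_bad_walk iid). Qed.

(** At [x = 2 * 2 ^- j * t], Potter's bound makes [1 - q x] at least a multiple of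
    [2 ^ (gam' * j) * tl t] for some [gam'] between [gam] and [alpha]. With about [gcst ^+ j / tl t]
    steps, the power of [q x] is at most a multiple of [expR (- (c * B ^+ j))] with
    [B = 2 ^ (gam' - gam) > 1]. *)
Lemma prob_sbad : exists2 K, 0 < K & exists A, forall n t, (0 < n)%N -> A <= t ->
  (P (sbad n t) <= (K * 2 ^- n)%:E)%E.
Proof.
have ga := gam_alpha; have g0 := gam0.
pose e := (alpha - gam) / 2; have e0 : 0 < e by rewrite /e; lra.
pose gam' := alpha - e; have g'g : gam < gam' by rewrite /gam' /e; lra.
have g'0 : 0 < gam' by exact: lt_trans g'g.
have [A A1 [C0 C00 HA]] := rv_potter rvtl e0.
have A0 : 0 < A by exact: lt_le_trans A1.
pose c0 : R := 1 - expR (-1).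
have c00 : 0 < c0 by rewrite subr_gt0 -[ltRHS]expR0 ltr_expR; lra.
pose c1 := C0^-1 * A `^ (- gam').
have c10 : 0 < c1 by rewrite mulr_gt0 ?invr_gt0// powR_gt0.
pose c := c0 * c1 * 2 `^ (- gam').
have cpos : 0 < c by apply: mulr_gt0; [exact: mulr_gt0|exact: powR_gt0].
pose B : R := 2 `^ gam' * gcst.
have B1 : 1 < B.
  rewrite /B /gcst -powRD; last by rewrite pnatr_eq0 implybT.
  rewrite -[ltLHS](powRr0 2) /powR gt_eqF// ltr_expR ltr_pM2r; first by rewrite subr_gt0.
  by apply: ln_gt0; lra.
have [K1 K10 dec] := exp_decay cpos B1.
(* The factor [expR c0] pays for rounding [gcst ^+ j / tl t] down to an integer. *)
have HK := prob_bad_walk iid msz (expR_gt0 c0) K10 dec.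
exists (2 * (3 * expR 1 * expR c0 * K1)); first by rewrite !mulr_gt0// expR_gt0.
 exists A => n t n0 At.
have t0 : 0 < t by exact: lt_le_trans At.
apply: (HK n _ _ (fun j => q (2 * (2 ^- j * t)))) => j nj jt.
have x0 : 0 < 2 ^- j * t :> R by rewrite mulr_gt0// invr_gt0 exprn_gt0.
have x20 : 0 < 2 * (2 ^- j * t) by rewrite mulr_gt0.
split=> //; first exact: q_laplace.
set x := 2 * (2 ^- j * t) in x20 *.
have /andP[tx0 tx1] := tl01 x.
have /andP[tt0 tt1] := tl01 t.
have qe : q x <= expR (- (c0 * tl x)).
  by have := q_lower x20; have := expR_ge1Dx (- (c0 * tl x)); rewrite -/c0; lra.
have q0 : 0 <= q x.
  by rewrite -lee_fin -q_laplace//; apply: integral_ge0 => z _; rewrite lee_fin expR_ge0.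
set m := Num.truncn _.
apply: (@le_trans _ _ (expR (- (c0 * tl x)) ^+ m)).
  by apply: lerXn2r; rewrite ?nnegrE ?expR_ge0.
rewrite -expRM_natl -expRD ler_expR.
have mlow : gcst ^+ j / tl t <= m%:R + 1.
  by rewrite natr1 ltW// truncnS_gt.
have ratio : c1 * 2 `^ (- gam') * (2 `^ gam') ^+ j <= tl x / tl t.
  have -> : c1 * 2 `^ (- gam') * (2 `^ gam') ^+ j = c1 * (x / t) `^ (- gam').
    have -> : x / t = 2 * 2 ^- j by rewrite /x -!mulrA divff ?mulr1// gt_eqF.
    by rewrite powRM ?invr_ge0 ?exprn_ge0// dyadic_powR mulrA.
  have xt : x <= t.
    rewrite /x mulrA ger_pMl// -ler_pdivlMl// mulr1 lef_pV2 ?posrE ?exprn_gt0//.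
    by rewrite -[leLHS]expr1 ler_eXn2l ?ltr1n// (leq_trans n0).
  have expo : - - alpha - e = gam' by rewrite opprK.
  have C0p := C00.
  (* Potter's bound holds from [A] on. For [x < A], monotonicity replaces [x] by [A]; since
     [2 ^- j * t >= 1], the power of [A] built into [c1] makes up for the change. *)
  case: (leP A x) => Ax.
    have [_ _ _] := HA x t Ax xt; rewrite expo => h.
    rewrite ler_pdivlMr// -(ler_pM2l C00) /c1 !mulrA divff ?gt_eqF// mul1r.
    have a1 : A `^ (- gam') <= 1.
      by rewrite powRN invf_le1 ?powR_gt0// -(powRr0 A); apply: ler_powR => //; exact: ltW.
    have xt0 : 0 < (x / t) `^ gam' by rewrite powR_gt0// divr_gt0.
    rewrite -mulrA -[leRHS]mul1r; apply: ler_pM; [exact: powR_ge0| |exact: a1|].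
      by rewrite mulr_ge0 ?powR_ge0// ltW.
    by rewrite powRN mulrC ler_pdivrMr// mulrAC.
  have [_ _ _] := HA A t (lexx _) At; rewrite expo => h.
  have tAx : tl A <= tl x by apply: tl_mono; exact: ltW.
  rewrite ler_pdivlMr//; apply: le_trans tAx.
  have At0 : 0 < (A / t) `^ gam' by rewrite powR_gt0// divr_gt0.
  have h' : C0^-1 * (A / t) `^ (- gam') * tl t <= tl A.
    rewrite powRN -invfM mulrC ler_pdivrMr ?mulr_gt0//.
    by rewrite mulrC.
  apply: le_trans h'; apply: ler_wpM2r; first exact: ltW.
  rewrite /c1 -mulrA; apply: ler_wpM2l; first by rewrite invr_ge0 ltW.
  have xt0 : 0 < x / t by rewrite divr_gt0.
  rewrite -(powRM _ (ltW A0) (ltW xt0)).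
  have pA : 0 < A / t by rewrite divr_gt0.
  have pB : 0 < A * (x / t) by rewrite mulr_gt0.
  rewrite !powRN lef_pV2 ?posrE; [|exact: powR_gt0|exact: powR_gt0].
  apply: ge0_ler_powR; [exact: ltW|by rewrite nnegrE divr_ge0// ltW|by rewrite nnegrE ltW// mulr_gt0|].
  apply: ler_wpM2l; first exact: ltW.
  rewrite -[leLHS]mul1r; apply: ler_wpM2r; first by rewrite invr_ge0 ltW.
  have : 1 <= 2 ^- j * t by rewrite -ler_pdivrMl ?invr_gt0 ?exprn_gt0// invrK mulr1.
  rewrite /x; lra.
have : c * B ^+ j <= c0 * tl x * (m%:R + 1).
  apply: (@le_trans _ _ (c0 * tl x * (gcst ^+ j / tl t))); last first.
    by apply: ler_wpM2l => //; rewrite mulr_ge0 ?ltW.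
  have -> : c * B ^+ j = c0 * gcst ^+ j * (c1 * 2 `^ (- gam') * (2 `^ gam') ^+ j).
    by rewrite /c /B exprMn; ring.
  have -> : c0 * tl x * (gcst ^+ j / tl t) = c0 * gcst ^+ j * (tl x / tl t) by ring.
  by apply: ler_wpM2l => //; rewrite mulr_ge0 ?(ltW c00)// exprn_ge0// ltW// gcst_gt0.
have : c0 * tl x <= c0 by rewrite -[leRHS]mulr1 ler_wpM2l// ltW.
rewrite mulrDr mulr1 [c0 * tl x * m%:R]mulrC mulrN; lra.
Qed.

Lemma good_count n t j N y w : (forall k, 0 <= sz (Th k w)) -> ~ sbad n t w ->
  0 < t -> (n <= j)%N -> 2 ^+ j <= t -> 0 <= y <= n%:R * t ->
  tl t * (window (walk ^~ w) N (y - 2 ^- j * t) y)%:R <= gcst ^+ j.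
Proof.
move=> pos nb t0 nj jt /andP[y0 yn].
have x0 : 0 < 2 ^- j * t :> R by rewrite mulr_gt0// invr_gt0 exprn_gt0.
have /andP[tt0 tt1] := tl01 t.
have yn' : y <= (n * 2 ^ j)%:R * (2 ^- j * t).
  by rewrite natrM natrX -mulrA [2 ^+ j * _]mulrA divff ?expf_neq0// mul1r.
have := @good_window _ _ _ _ _ Th sz n _ _ _ j N y w pos nb nj jt x0 y0 yn'.
rewrite -/(window (walk ^~ w) N (y - 2 ^- j * t) y) => h.
have g0 : 0 <= gcst ^+ j / tl t by rewrite divr_ge0 ?exprn_ge0 ?ltW// gcst_gt0.
rewrite mulrC -ler_pdivlMr//.
apply: (@le_trans _ _ (Num.truncn (gcst ^+ j / tl t))%:R); first by rewrite ler_nat.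
by rewrite truncn_le.
Qed.

Lemma good_total n t N w : (forall k, 0 <= sz (Th k w)) -> ~ sbad n t w ->
  2 ^+ n <= t -> tl t * (\sum_(k < N) (walk k w <= n%:R * t)%R)%:R <= (n * 2 ^ n).+1%:R * gcst ^+ n.
Proof.
move=> pos nb nt.
have t0 : 0 < t by apply: lt_le_trans nt; rewrite exprn_gt0.
have x0 : 0 < 2 ^- n * t :> R by rewrite mulr_gt0// invr_gt0 exprn_gt0.
have En : (n * 2 ^ n)%:R * (2 ^- n * t) = n%:R * t.
  by rewrite natrM natrX -mulrA [2 ^+ n * _]mulrA divff ?expf_neq0// mul1r.
have /andP[tt0 tt1] := tl01 t.
apply: (@window_total _ (walk ^~ w) N (tl t) (gcst ^+ n) (2 ^- n * t)) => //.
- by move=> k; rewrite sumr_ge0.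
- move=> i iM; apply: (@good_count n) => //.
  rewrite mulr_ge0 ?(ltW x0)//= -En ler_pM2r// ler_nat//.
- by rewrite En.
Qed.

Lemma good_near n t N y w (f : R -> R) (p A : R) :
  (forall k, 0 <= sz (Th k w)) -> ~ sbad n t w ->
  2 ^+ n <= t -> 0 <= y <= n%:R * t -> 0 <= p -> 0 <= A ->
  (forall z, 0 <= z < 2 ^- n * t -> f z <= A * (Num.max z 1 / t) `^ (- p)) ->
  exists2 J, 2 ^+ J <= t &
  tl t * \sum_(k < N) (if y - 2 ^- n * t < walk k w <= y then f (y - walk k w) else 0) <=
    A * 2 `^ p * \sum_(n <= j < J.+1) (2 `^ p * gcst) ^+ j.
Proof.
move=> pos nb nt yn p0 A0 hf.
have t1 : 1 <= t by apply: le_trans nt; rewrite exprn_ege1// ler1n.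
have t0 : 0 < t by exact: lt_le_trans t1.
(* The windows of the last scale have length between [1] and [2], so for smaller ages the maximum
   with [1] already satisfies the bound of the last shell. *)
have [J /andP[J1 J2]] := dyadic_scale t1.
exists J => //.
have /andP[tt0 tt1] := tl01 t.
have nJ : (n <= J)%N.
  rewrite -ltnS -(ltr_eXn2l (x := 2 : R)) ?ltr1n//; exact: le_lt_trans J2.
have Q0 : 0 <= 2 `^ p :> R by exact: powR_ge0.
have := @near_sum _ (walk ^~ w) N y (tl t) t f gcst (2 `^ p) A n J tt0 (ltW t0) A0 Q0 (ltW gcst_gt0) nJ.
move=> /(_ _ _) h.
apply: (le_trans (h _ _)).
- move=> j /andP[nj jJ]; apply: (@good_count n) => //.
  by apply: le_trans J1; rewrite ler_eXn2l ?ltr1n.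
- move=> j z /andP[nj jJ] /andP[z0 zj] hz.
  have zn : z < 2 ^- n * t.
    apply: (lt_le_trans zj); apply: ler_wpM2r; first exact: ltW.
    by rewrite lef_pV2 ?posrE ?exprn_gt0// ler_eXn2l ?ltr1n.
  have z0n : 0 <= z < 2 ^- n * t by rewrite z0.
  apply: (le_trans (hf z z0n)); apply: ler_wpM2l => //.
  apply: powR_near => //; rewrite ler_pdivlMr//.
  case: hz => [hz|->]; first by rewrite le_max hz.
  by rewrite le_max mulrC ler_pdivrMr ?exprn_gt0// ler_pdivrMr ?exprn_gt0// mul1r (ltW J2) orbT.
rewrite mulr_sumr le_eqVlt; apply/orP; left; apply/eqP; apply: eq_bigr => j _.
by rewrite exprMn exprS; ring.
Qed.

End good_walk.

(** * Truncated power kernels *)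

Section lipschitz.
Context {R : realType}.
Implicit Types a b c v x : R.

Lemma expR_lip a b M : a <= M -> b <= M -> `|expR a - expR b| <= expR M * `|a - b|.
Proof.
have h x y : x <= M -> expR x - expR y <= expR M * `|x - y|.
  move=> xM.
  have h1 := expR_ge1Dx (y - x); rewrite expRD expRN in h1.
  have e0 := expR_gt0 x.
  have h2 : expR x * (1 + (y - x)) <= expR y.
    by move: h1; rewrite ler_pdivlMr// mulrC.
  have : expR x * (x - y) <= expR M * `|x - y|.
    apply: (@le_trans _ _ (expR x * `|x - y|)).
      by apply: ler_wpM2l; [exact: ltW|exact: ler_norm].
    by apply: ler_wpM2r => //; rewrite ler_expR.
  move=> h3; have h4 : expR x * (1 + (y - x)) = expR x - expR x * (x - y) by ring.
  by rewrite h4 in h2; lra.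
move=> aM bM; rewrite ler_norml; apply/andP; split; last exact: h.
by have := h b a bM; rewrite distrC; lra.
Qed.

Lemma ln_lip c x y : 0 < c -> c <= x -> c <= y -> `|ln x - ln y| <= c^-1 * `|x - y|.
Proof.
move=> c0 cx cy.
have h a b : c <= a -> c <= b -> ln a - ln b <= c^-1 * `|a - b|.
  move=> ca cb; have a0 : 0 < a by exact: lt_le_trans ca.
  have b0 : 0 < b by exact: lt_le_trans cb.
  have ab0 : 0 < a / b by rewrite divr_gt0.
  have := expR_ge1Dx (ln (a / b)); rewrite lnK ?posrE// ln_div ?posrE// => h1.
  have : a / b - 1 = (a - b) / b by field; rewrite gt_eqF.
  have : (a - b) / b <= c^-1 * `|a - b|.
    rewrite mulrC; apply: (@le_trans _ _ (b^-1 * `|a - b|)).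
      by apply: ler_wpM2l; [rewrite invr_ge0 ltW|exact: ler_norm].
    by apply: ler_wpM2r => //; rewrite lef_pV2.
  lra.
rewrite ler_norml; apply/andP; split; last exact: h.
by have := h y x cy cx; rewrite distrC; lra.
Qed.

Lemma max_lip c x y : `|Num.max x c - Num.max y c| <= `|x - y|.
Proof.
case: (leP x c) => xc; case: (leP y c) => yc; rewrite ?subrr ?normr0//.
- rewrite ltr0_norm; last lra.
  rewrite ltr0_norm; lra.
- rewrite gtr0_norm; last lra.
  rewrite gtr0_norm; lra.
Qed.

Lemma min_lip c x y : `|Num.min x c - Num.min y c| <= `|x - y|.
Proof.
case: (leP x c) => xc; case: (leP y c) => yc; rewrite ?subrr ?normr0//.
- rewrite ler0_norm; last lra.
  rewrite ltr0_norm; lra.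
- rewrite ger0_norm; last lra.
  rewrite gtr0_norm; lra.
Qed.

Lemma powR_lip (rho c b : R) : 0 < c -> exists2 L, 0 <= L & exists2 M, 0 <= M &
  forall x y, c <= x <= b -> c <= y <= b ->
    `|x `^ rho - y `^ rho| <= L * `|x - y| /\ x `^ rho <= M.
Proof.
move=> c0; pose K := `|rho| * (`|ln c| + `|ln b|).
exists (expR K * (`|rho| * c^-1)).
  by rewrite !mulr_ge0// ?expR_ge0// invr_ge0 ltW.
exists (expR K); first exact: expR_ge0.
have pE x : c <= x <= b -> x `^ rho = expR (rho * ln x) /\ rho * ln x <= K.
  move=> /andP[cx xb]; have x0 : 0 < x by exact: lt_le_trans cx.
  have b0 : 0 < b by exact: lt_le_trans xb.
  split; first by rewrite /powR gt_eqF.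
  apply: (le_trans (ler_norm _)); rewrite normrM; apply: ler_wpM2l => //.
  have h1 : ln c <= ln x by rewrite ler_ln ?posrE.
  have h2 : ln x <= ln b by rewrite ler_ln ?posrE.
  have h3 := ler_norm (ln b); have h4 := ler_norm (- ln c); rewrite normrN in h4.
  have h5 := normr_ge0 (ln c); have h6 := normr_ge0 (ln b).
  by rewrite ler_norml; apply/andP; split; lra.
move=> x y xcb ycb.
have [-> xK] := pE x xcb; have [-> yK] := pE y ycb.
split; last by rewrite ler_expR.
apply: (le_trans (expR_lip xK yK)); rewrite -mulrA; apply: ler_wpM2l; first exact: expR_ge0.
rewrite -mulrBr normrM -mulrA; apply: ler_wpM2l => //.
by apply: ln_lip => //; [case/andP: xcb|case/andP: ycb].
Qed.

Lemma prod_lip (I : Type) (s : seq I) (Q : pred I) (p p' : I -> R) :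
  (forall i, 0 <= p i <= 1) -> (forall i, 0 <= p' i <= 1) ->
  `|\prod_(i <- s | Q i) p i - \prod_(i <- s | Q i) p' i| <= \sum_(i <- s | Q i) `|p i - p' i|.
Proof.
move=> hp hp'; elim: s => [|i s IH]; first by rewrite !big_nil subrr normr0.
rewrite !big_cons; case: ifP => // _.
have -> : p i * \prod_(j <- s | Q j) p j - p' i * \prod_(j <- s | Q j) p' j =
  (p i - p' i) * \prod_(j <- s | Q j) p j + p' i * (\prod_(j <- s | Q j) p j - \prod_(j <- s | Q j) p' j).
  by ring.
apply: (le_trans (ler_normD _ _)); rewrite !normrM; apply: lerD.
  rewrite ler_piMr// ger0_norm; last by apply: prodr_ge0 => j _; case/andP: (hp j).
  by apply: prodr_ile1 => j _; exact: hp.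
apply: le_trans IH; rewrite ler_piMl//.
by have /andP[h1 h2] := hp' i; rewrite ger0_norm.
Qed.

End lipschitz.

Section kernel.
Context {R : realType}.
Variable rho : R.

(** The maximum freezes the power below [2 ^- n], and the linear ramp brings the kernel continuously
    down to [0] for every sign of [rho]. The outcome is Lipschitz on sets bounded above and equals
    the power from [2 ^- n] on. *)
Definition kap (n : nat) (v : R) : R :=
  Num.min (Num.max v 0 * 2 ^+ n) 1 * (Num.max v (2 ^- n)) `^ rho.

Lemma kap_le0 n v : v <= 0 -> kap n v = 0.
Proof.
move=> v0; rewrite /kap (_ : Num.max v 0 = 0); last exact/max_idPr.
by rewrite mul0r (_ : Num.min 0 1 = 0) ?mul0r//; exact/min_idPl.
Qed.

Lemma kap_far n v : 2 ^- n <= v -> kap n v = v `^ rho.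
Proof.
move=> nv; have n0 : 0 < 2 ^- n :> R by rewrite invr_gt0 exprn_gt0.
have v0 : 0 < v by exact: lt_le_trans nv.
rewrite /kap (_ : Num.max v 0 = v); last by apply/max_idPl; exact: ltW.
rewrite (_ : Num.max v (2 ^- n) = v); last exact/max_idPl.
rewrite (_ : Num.min (v * 2 ^+ n) 1 = 1) ?mul1r//; apply/min_idPr.
by rewrite -ler_pdivrMr ?exprn_gt0// mul1r.
Qed.

Lemma kap_ge0 n v : 0 <= kap n v.
Proof.
rewrite /kap mulr_ge0 ?powR_ge0// le_min ler01 andbT mulr_ge0 ?exprn_ge0//.
by rewrite le_max lexx orbT.
Qed.

Lemma kap_near n p v : 0 <= p -> - p < rho -> v <= 2 ^- n -> kap n v <= (2 `^ p) ^+ n.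
Proof.
move=> p0 prho vn; rewrite /kap (_ : Num.max v (2 ^- n) = 2 ^- n); last exact/max_idPr.
have n0 : 0 < 2 ^- n :> R by rewrite invr_gt0 exprn_gt0.
rewrite -dyadic_powR -[leRHS]mul1r; apply: ler_pM; rewrite ?powR_ge0//.
- by rewrite le_min ler01 andbT mulr_ge0 ?exprn_ge0// le_max lexx orbT.
- by rewrite ge_min lexx orbT.
- apply: ger_powR; last exact: ltW.
  by rewrite n0 invf_le1 ?exprn_gt0// exprn_ege1// ler1n.
Qed.

Lemma kap_lip n (b : R) : 0 <= b -> exists2 L, 0 <= L &
  forall v v', v <= b -> v' <= b -> `|kap n v - kap n v'| <= L * `|v - v'|.
Proof.
move=> b0; have n0 : 0 < 2 ^- n :> R by rewrite invr_gt0 exprn_gt0.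
have [L L0 [M M0 HL]] := powR_lip rho (Num.max b (2 ^- n)) n0.
exists (2 ^+ n * M + L); first by rewrite addr_ge0// mulr_ge0// exprn_ge0.
move=> v v' vb v'b.
have hv x : x <= b -> 2 ^- n <= Num.max x (2 ^- n) <= Num.max b (2 ^- n).
  by move=> xb; rewrite le_max lexx orbT /= ge_max !le_max xb lexx orbT.
have [h1 h2] := HL _ _ (hv v vb) (hv v' v'b).
have h3 : `|Num.min (Num.max v 0 * 2 ^+ n) 1 - Num.min (Num.max v' 0 * 2 ^+ n) 1| <= 2 ^+ n * `|v - v'|.
  apply: (le_trans (min_lip _ _ _)); rewrite -mulrBl normrM mulrC ger0_norm ?exprn_ge0//.
  by apply: ler_wpM2l; [exact: exprn_ge0|exact: max_lip].
rewrite /kap; set A := Num.min (Num.max v 0 * _) _ in h3 *; set A' := Num.min (Num.max v' 0 * _) _ in h3 *.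
set B := Num.max v _ `^ _ in h1 h2 *; set B' := Num.max v' _ `^ _ in h1 *.
have -> : A * B - A' * B' = (A - A') * B + A' * (B - B') by ring.
apply: (le_trans (ler_normD _ _)); rewrite !normrM mulrDl; apply: lerD.
  rewrite mulrAC; apply: ler_pM => //.
  by rewrite ger0_norm ?powR_ge0.
apply: (@le_trans _ _ (1 * `|B - B'|)).
  apply: ler_wpM2r => //; rewrite ger0_norm; first by rewrite /A' ge_min lexx orbT.
  by rewrite /A' le_min ler01 andbT mulr_ge0 ?exprn_ge0// le_max lexx orbT.
by rewrite mul1r (le_trans h1)// ler_wpM2l// max_lip.
Qed.

End kernel.

Section psi.
Context {R : realType}.
Variables (kp : R -> R) (n : nat) (L : R).
Hypothesis L0 : 0 <= L.
Hypothesis kp0 : forall v, v <= 0 -> kp v = 0.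
Hypothesis kpL : forall v v', v <= n%:R -> v' <= n%:R -> `|kp v - kp v'| <= L * `|v - v'|.

Lemma kp_bound v : v <= n%:R -> `|kp v| <= L * n%:R.
Proof.
move=> vn; case: (leP v 0) => v0; first by rewrite kp0// normr0 mulr_ge0.
have := @kpL v 0 vn (ler0n _ _); rewrite (kp0 (lexx 0)) !subr0 => /le_trans; apply.
by apply: ler_wpM2l => //; rewrite gtr0_norm.
Qed.

(** For coordinates that are exponentials of minus increments, the partial product is [expR (- s)]
    with [s] the partial sum, and [ln] restores [- s]. Truncating the product at [expR (- n)] and
    [u] at [n] makes the expression Lipschitz on the cube; for [u <= n] nothing is lost, as the
    kernel vanishes at nonpositive arguments. *)
Definition psi N (eta : R) (p : 'I_N -> R) (u : R) : R :=
  eta * \sum_(r < N) kp (Num.min u n%:R + ln (Num.max (\prod_(i < N | (i < r)%N) p i) (expR (- n%:R)))).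

Lemma psi_lip N eta (p p' : 'I_N -> R) u : 0 <= eta -> cube p -> cube p' ->
  `|psi eta p u - psi eta p' u| <= (eta * N%:R * (L * expR n%:R)) * \sum_i `|p i - p' i|.
Proof.
move=> eta0 cp cp'; rewrite /psi -mulrBr normrM ger0_norm// -!mulrA; apply: ler_wpM2l => //.
rewrite -sumrB; apply: (le_trans (ler_norm_sum _ _ _)).
have -> : N%:R * (L * (expR n%:R * \sum_i `|p i - p' i|)) =
    \sum_(r < N) (L * (expR n%:R * \sum_i `|p i - p' i|)).
  by rewrite sumr_const card_ord mulr_natl.
apply: ler_sum => r _.
have en : 0 < expR (- n%:R) :> R by exact: expR_gt0.
have le0 (z : 'I_N -> R) : cube z ->
   Num.min u n%:R + ln (Num.max (\prod_(i < N | (i < r)%N) z i) (expR (- n%:R))) <= n%:R.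
  move=> cz; rewrite -[leRHS]addr0; apply: lerD; first by rewrite ge_min lexx orbT.
  apply: ln_le0; rewrite ge_max; apply/andP; split.
    by apply: prodr_ile1 => i _; exact: cz.
  by rewrite -[leRHS]expR0 ler_expR oppr_le0.
apply: (le_trans (kpL (le0 p cp) (le0 p' cp'))); apply: ler_wpM2l => //.
rewrite [X in `|X|](_ : _ = ln (Num.max (\prod_(i < N | (i < r)%N) p i) (expR (- n%:R))) -
   ln (Num.max (\prod_(i < N | (i < r)%N) p' i) (expR (- n%:R)))); last by ring.
apply: (le_trans (ln_lip en _ _)); rewrite ?le_max ?lexx ?orbT//.
rewrite expRN invrK; apply: ler_wpM2l; first exact: expR_ge0.
apply: (le_trans (max_lip _ _ _)); apply: (le_trans (prod_lip _ _ cp cp')).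
by rewrite big_mkcond /=; apply: ler_sum => i _; case: ifP.
Qed.

Lemma psi_cont N eta (p : 'I_N -> R) u u' : 0 <= eta -> cube p ->
  `|psi eta p u - psi eta p u'| <= (eta * N%:R * L) * `|u - u'|.
Proof.
move=> eta0 cp; rewrite /psi -mulrBr normrM ger0_norm// -!mulrA; apply: ler_wpM2l => //.
rewrite -sumrB; apply: (le_trans (ler_norm_sum _ _ _)).
have -> : N%:R * (L * `|u - u'|) = \sum_(r < N) (L * `|u - u'|).
  by rewrite sumr_const card_ord mulr_natl.
apply: ler_sum => r _.
have le0 x : Num.min x n%:R + ln (Num.max (\prod_(i < N | (i < r)%N) p i) (expR (- n%:R))) <= n%:R.
  rewrite -[leRHS]addr0; apply: lerD; first by rewrite ge_min lexx orbT.
  apply: ln_le0; rewrite ge_max; apply/andP; split.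
    by apply: prodr_ile1 => i _; exact: cp.
  by rewrite -[leRHS]expR0 ler_expR oppr_le0.
apply: (le_trans (kpL (le0 u) (le0 u'))); apply: ler_wpM2l => //.
rewrite [X in `|X|](_ : _ = Num.min u n%:R - Num.min u' n%:R); last by ring.
exact: min_lip.
Qed.

Lemma psiE N eta (dl : nat -> R) u : (forall i, 0 <= dl i) -> u <= n%:R ->
  psi eta (fun i : 'I_N => expR (- dl i)) u = eta * \sum_(r < N) kp (u - \sum_(i < r) dl i).
Proof.
move=> dl0 un; rewrite /psi; congr (_ * _); apply: eq_bigr => r _.
have -> : \prod_(i < N | (i < r)%N) expR (- dl i) = expR (- \sum_(i < r) dl i).
  rewrite -sumrN expR_sum.
  by rewrite (big_ord_widen N (fun i => expR (- dl i)) (ltnW (ltn_ord r))).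
rewrite (_ : Num.min u n%:R = u); last exact/min_idPl.
set x := \sum_(i < r) dl i.
case: (leP x n%:R) => xn.
  by rewrite (_ : Num.max _ _ = expR (- x)) ?expRK//; apply/max_idPl; rewrite ler_expR lerN2.
rewrite (_ : Num.max _ _ = expR (- n%:R)) ?expRK; last by apply/max_idPr; rewrite ler_expR lerN2 ltW.
by rewrite !kp0//; lra.
Qed.

(** Each block of [q] points is replaced by its first point. The Lipschitz error is controlled by
    the decrease of the positive part [pos] across the block, and these decreases telescope to at
    most [u], whatever the number of blocks. *)
Lemma riemann_block (s : nat -> R) (N q : nat) u : (forall i j, (i <= j)%N -> s i <= s j) ->
  0 <= s 0 -> 0 <= u <= n%:R ->
  `|\sum_(k < N * q) kp (u - s k) - q%:R * \sum_(r < N) kp (u - s (r * q)%N)| <= q%:R * L * u.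
Proof.
move=> ms s0 /andP[u0 un].
pose pos r := Num.max (u - s (r * q)%N) 0.
suff h : `|\sum_(k < N * q) kp (u - s k) - q%:R * \sum_(r < N) kp (u - s (r * q)%N)|
    <= q%:R * L * (pos 0%N - pos N).
  apply: (le_trans h); apply: ler_wpM2l; first by rewrite mulr_ge0.
  have h1 : pos 0%N <= u by rewrite /pos ge_max mul0n u0 andbT; lra.
  have h2 : 0 <= pos N by rewrite /pos le_max lexx orbT.
  lra.
elim: N => [|N IH]; first by rewrite !big_ord0 mulr0 !subrr normr0 mulr0.
rewrite big_ord_recr /= mulrDr mulSnr big_split_ord /=.
set A := \sum_(k < N * q) _ in IH *; set B := \sum_(r < N) _ in IH *.
set A' := \sum_(i < q) _; set B' := kp _.
have -> : A + A' - (q%:R * B + q%:R * B') = (A - q%:R * B) + (A' - q%:R * B') by ring.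
apply: (le_trans (ler_normD _ _)).
have -> : q%:R * L * (pos 0%N - pos N.+1) = q%:R * L * (pos 0%N - pos N) + q%:R * L * (pos N - pos N.+1) by ring.
apply: lerD => //.
have -> : q%:R * B' = \sum_(i < q) B' by rewrite sumr_const card_ord mulr_natl.
rewrite /A' -sumrB; apply: (le_trans (ler_norm_sum _ _ _)).
have -> : q%:R * L * (pos N - pos N.+1) = \sum_(i < q) L * (pos N - pos N.+1).
  by rewrite sumr_const card_ord -mulrA mulr_natl.
apply: ler_sum => i _; rewrite /B'.
have kpm v : kp v = kp (Num.max v 0) by case: (leP v 0) => // v0; rewrite !kp0.
rewrite kpm [kp (u - s (N * q)%N)]kpm.
have sN : 0 <= s (N * q)%N by apply: le_trans s0 _; exact: ms.
have sN1 : s (N * q)%N <= s (N * q + i)%N by apply: ms; exact: leq_addr.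
have sN2 : s (N * q + i)%N <= s (N.+1 * q)%N by apply: ms; rewrite mulSnr leq_add2l ltnW.
have b x : 0 <= x -> Num.max (u - x) 0 <= n%:R by move=> x0; rewrite ge_max ler0n andbT; lra.
apply: (le_trans (kpL (b _ _) (b _ _))) => //; first exact: le_trans sN1.
apply: ler_wpM2l => //; rewrite distrC ger0_norm.
  by rewrite /pos lerD2l lerN2 ge_max !le_max lexx orbT andbT lerD2l lerN2 sN2.
by rewrite subr_ge0 ge_max !le_max lexx orbT andbT lerD2l lerN2 sN1.
Qed.

End psi.

(** * Uniform approximation and weak convergence *)

Section lower_integral.
Context {R : realType} {d : measure_display} {T : measurableType d} (P : probability T R).
Implicit Types f g : T -> R.
Import HBNNSimple.

(* No measurability is assumed: the integral of a nonnegative function is then a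
   lower integral. *)
Lemma lower_integral_le f g : (forall w, 0 <= f w) -> (forall w, f w <= g w) ->
  (\int[P]_w (f w)%:E <= \int[P]_w (g w)%:E)%E.
Proof.
move=> f0 fg; have g0 w : 0 <= g w by exact: le_trans (fg w).
rewrite !ge0_integralTE//; try by move=> w; rewrite lee_fin.
apply: le_ereal_sup => _ /= [h hf <-]; exists h => // w.
by apply: (le_trans (hf w)); rewrite lee_fin.
Qed.

Lemma lower_ExpE f M : (forall w, 0 <= f w <= M) -> (\int[P]_w (f w)%:E = (Exp P f)%:E)%E.
Proof.
move=> fM; rewrite /Exp fineK//.
have h0 : (0 <= \int[P]_w (f w)%:E)%E.
  by apply: integral_ge0 => w _; rewrite lee_fin; case/andP: (fM w).
rewrite ge0_fin_numE//; apply: (@le_lt_trans _ _ (\int[P]_w M%:E)%E).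
  by apply: lower_integral_le => w; case/andP: (fM w).
by rewrite integral_prob_cst ltry.
Qed.

Lemma lower_Exp_le f g M : (forall w, 0 <= f w) -> (forall w, f w <= g w) ->
  (forall w, g w <= M) -> Exp P f <= Exp P g.
Proof.
move=> f0 fg gM; rewrite -lee_fin -(@lower_ExpE f M); last first.
  by move=> w; rewrite f0 (le_trans (fg w)).
rewrite -(@lower_ExpE g M); last by move=> w; rewrite gM (le_trans (f0 w)).
exact: lower_integral_le.
Qed.

(** A simple function below [f] and one below [M - f] add up to a simple function below [M]. The
    lower integral is superadditive but in general not additive. *)
Lemma lower_Exp_super f M : (forall w, 0 <= f w <= M) ->
  Exp P f + Exp P (fun w => M - f w) <= M.
Proof.
move=> fM; have fM' w : 0 <= M - f w <= M.
  by have /andP[? ?] := fM w; apply/andP; split; lra.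
rewrite -lerBrDr -lee_fin -(lower_ExpE fM) ge0_integralTE; last first.
  by move=> w; rewrite lee_fin; case/andP: (fM w).
apply: ge_ereal_sup => _ /= [h1 hf1 <-].
have s1 : (sintegral P h1 \is a fin_num)%E.
  rewrite ge0_fin_numE ?sintegral_ge0//; apply: (@le_lt_trans _ _ (\int[P]_w (f w)%:E)%E).
    rewrite ge0_integralTE; last by move=> w; rewrite lee_fin; case/andP: (fM w).
    by apply: ereal_sup_ubound; exists h1.
  by rewrite (lower_ExpE fM) ltry.
rewrite -(fineK s1) lee_fin lerBrDr addrC -lerBrDr -lee_fin -(lower_ExpE fM') ge0_integralTE; last first.
  by move=> w; rewrite lee_fin; case/andP: (fM' w).
apply: ge_ereal_sup => _ /= [h2 hf2 <-].
rewrite EFinB fineK// leeBrDr// -sintegralD.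
rewrite -[leRHS](integral_prob_cst P) ge0_integralTE; last first.
  by move=> w; rewrite lee_fin; have /andP[? ?] := fM w; lra.
apply: ereal_sup_ubound; exists (add_nnsfun h2 h1) => // w.
have := hf1 w; have := hf2 w; rewrite !lee_fin /=; lra.
Qed.

(** [f] lies between the measurable functions [lo] and [hi], both of which agree with [g] off
    [B]. *)
Lemma lower_Exp_null f g M B : measurable_fun setT g -> (forall w, 0 <= f w <= M) ->
  (forall w, 0 <= g w <= M) -> measurable B -> P B = 0%E -> (forall w, ~ B w -> f w = g w) ->
  Exp P f = Exp P g.
Proof.
move=> mg fM gM mB PB fg.
pose lo w := (w \notin B)%:R * g w; pose hi w := lo w + M * (w \in B)%:R.
have m1 : measurable_fun setT (fun w => (w \notin B)%:R : R).
  rewrite (_ : (fun w => _) = \1_(~` B)); first by apply: measurable_indic; exact: measurableC.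
  by apply/funext => w; rewrite indicE in_setC.
have m2 : measurable_fun setT (fun w => (w \in B)%:R : R).
  by rewrite (_ : (fun w => _) = \1_B)//; apply: measurable_indic.
have mlo : measurable_fun setT lo by exact: measurable_funM.
have mhi : measurable_fun setT hi.
  by apply: measurable_funD => //; apply: measurable_funM => //; exact: measurable_cst.
have eq f' : measurable_fun setT f' -> (forall w, ~ B w -> f' w = g w) -> Exp P f' = Exp P g.
  move=> mf' h; rewrite /Exp; congr fine; apply: ae_eq_integral => //; try exact/measurable_EFinP.
  by exists B; split => // w /=; apply: contra_notP => wB _; rewrite h.
have cases w : (w \in B) = false \/ (w \in B) = true by case: (w \in B); [right|left].
apply: le_anti; apply/andP; split.
  rewrite -[leRHS](eq hi mhi); last by move=> w wB; rewrite /hi /lo memNset// mul1r mulr0 addr0.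
  apply: (@lower_Exp_le _ _ M) => w; rewrite /hi /lo; have /andP[? ?] := fM w; have /andP[? ?] := gM w => //.
    case: (cases w) => wB; rewrite wB /= ?mul1r ?mul0r ?mulr0 ?mulr1 ?addr0 ?add0r// fg//.
    by move=> /mem_set; rewrite wB.
  by case: (cases w) => wB; rewrite wB /= ?mul1r ?mul0r ?mulr0 ?mulr1 ?addr0 ?add0r.
rewrite -(eq lo mlo); last by move=> w wB; rewrite /lo memNset// mul1r.
apply: (@lower_Exp_le _ _ M) => w; rewrite /lo; have /andP[? ?] := fM w; have /andP[? ?] := gM w => //.
  by case: (cases w) => wB; rewrite wB /= ?mul1r ?mul0r.
case: (cases w) => wB; rewrite wB /= ?mul1r ?mul0r ?mulr0 ?mulr1 ?addr0 ?add0r// fg//.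
by move=> /mem_set; rewrite wB.
Qed.

Lemma Exp_cvg (Y : nat -> T -> R) (Z : T -> R) (M : R) :
  (forall j, measurable_fun setT (Y j)) -> (forall j w, `|Y j w| <= M) ->
  (forall w, Y j w @[j --> \oo] --> Z w) -> Exp P (Y j) @[j --> \oo] --> Exp P Z.
Proof.
move=> mY YM YZ.
have mZ : measurable_fun setT Z by apply: (@measurable_fun_cvg _ _ _ _ Y) => // w _; exact: YZ.
have [||||| iZ _ h] := @dominated_convergence _ _ _ P setT measurableT
  (fun j w => (Y j w)%:E) (fun w => (Z w)%:E) (fun=> M%:E).
- by move=> j; exact/measurable_EFinP.
- exact/measurable_EFinP.
- by apply: aeW => w _; apply: cvg_EFin; [exact: nearW|exact: YZ].
- apply: (@bounded_integrable _ _ _ P (fun=> M) `|M|) => //; exact: measurable_cst.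
- by apply: aeW => w j _; rewrite lee_fin.
apply: fine_cvg; rewrite [X in _ --> X](_ : _ = (\int[P]_w (Z w)%:E)%E)//.
by rewrite /Exp fineK//; exact: integrable_fin_num.
Qed.

End lower_integral.

Lemma borel_cantelli_geom {R : realType} {d : measure_display} {T : measurableType d}
    (P : probability T R) (F : nat -> set T) (K : R) : 0 <= K -> (forall j, measurable (F j)) ->
  (forall j, (P (F j) <= (K * 2 ^- j)%:E)%E) ->
  exists B, [/\ measurable B, P B = 0%E & forall w, ~ B w -> exists n : nat, forall j, (n <= j)%N -> ~ F j w].
Proof.
move=> K0 mF PF; pose G n j := if (n <= j)%N then F j else set0.
have mG n j : measurable (G n j) by rewrite /G; case: ifP.
pose B := \bigcap_n \bigcup_j G n j.
have mU n : measurable (\bigcup_j G n j) by exact: bigcup_measurable.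
have mB : measurable B by exact: bigcap_measurable.
exists B; split => //; last first.
  move=> w wB; apply: contrapT => h; apply: wB => n _.
  apply: contrapT => h2; apply: h; exists n => j nj Fj; apply: h2; exists j => //.
  by rewrite /G nj.
have PB n : (P B <= (2 * K * 2 ^- n)%:E)%E.
  apply: (@le_trans _ _ (P (\bigcup_j G n j))).
    by apply: le_measure; rewrite ?inE// => w; exact.
  apply: prob_bigcup_geom => // j; rewrite /G; first by rewrite ltnNge => /negbTE ->.
  by move=> nj; rewrite nj.
apply/eqP; rewrite eq_le measure_ge0 andbT.
have c2 : (2 * K * 2 ^- n)%:E @[n --> \oo] --> (0 : R)%:E.
  apply: cvg_EFin; first exact: nearW.
  rewrite -[X in _ --> X](mulr0 (2 * K)); apply: cvgMr.
  rewrite (_ : (fun j : nat => 2 ^- j : R) = (fun j => (2^-1 : R) ^+ j)); last first.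
    by apply/funext => j; rewrite exprVn.
  by apply: cvg_expr; rewrite ger0_norm ?invr_ge0//; lra.
by apply: (cvge_to_ge c2); exact: nearW.
Qed.

(** * Locally uniform closeness and inf-convolution *)

Section closeness.
Context {R : realType}.
Implicit Types (x y z : R -> R) (e : R).

(** One parameter measures both the error and the range [[e, 1 / e]]; for [e > 1] the range is empty
    and the condition void. *)
Definition uclose e x y := forall u, e <= u -> u * e <= 1 -> `|x u - y u| <= e.

Lemma uclose_sym e x y : uclose e x y -> uclose e y x.
Proof. by move=> h u ? ?; rewrite distrC; exact: h. Qed.

Lemma uclose_trans e e' x y z : 0 <= e -> 0 <= e' ->
  uclose e x y -> uclose e' y z -> uclose (e + e') x z.
Proof.
move=> e0 e'0 h h' u eu ue.
have u0 : 0 <= u by lra.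
have h1 : 0 <= u * e by rewrite mulr_ge0.
have h2 : 0 <= u * e' by rewrite mulr_ge0.
rewrite mulrDr in ue.
have -> : x u - z u = (x u - y u) + (y u - z u) by ring.
by apply: (le_trans (ler_normD _ _)); apply: lerD; [apply: h|apply: h']; lra.
Qed.

Lemma uclose_J1 (y : nat -> R -> R) x (c : nat -> R) :
  (forall j, 0 <= c j) -> c j @[j --> \oo] --> 0 ->
  (\forall j \near \oo, uclose (c j) (y j) x) -> J1_conv y x.
Proof.
move=> c0 cc cl a b a0 ab _ _.
exists (fun _ => id); split; first by move=> _; apply: continuous_subspaceT => u; exact: cvg_id.
split; first by move=> _ u v _ _.
split; first by [].
split; first by move=> e e0; apply: nearW => j t _; rewrite subrr normr0.
move=> e e0; have b0 : 0 < b by exact: lt_trans ab.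
pose m := Num.min (e / 2) (Num.min a b^-1).
have m0 : 0 < m by rewrite !lt_min a0 invr_gt0 b0 !andbT divr_gt0.
have cm : \forall j \near \oo, c j < m.
  have /cvgrPdist_lt /(_ _ m0) := cc.
  by apply: filterS => j; rewrite sub0r normrN ger0_norm.
near=> j => t /andP[ta tb].
have cj : c j < m by near: j.
move: cj; rewrite !lt_min => /and3P[c1 c2 c3].
have : uclose (c j) (y j) x by near: j.
move=> /(_ t _ _) h; apply: le_lt_trans (h _ _) _.
- by apply: le_trans ta; exact: ltW.
- apply: (@le_trans _ _ (b * c j)); first by apply: ler_wpM2r.
  by rewrite -ler_pdivlMl// mulr1 ltW.
- lra.
Unshelve. all: by end_near. Qed.

Section inf_convolution.
Variables (F : (R -> R) -> R) (M : R).
Hypothesis FM : forall x, 0 <= F x <= M.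

Definition infconv_set (k : R) x : set R :=
  [set r | exists y e, [/\ cadlag_pos y, 0 < e, uclose e x y & r = F y + k * e]].

(* The largest function below [F] that is [k]-Lipschitz with respect to [uclose]. *)
Definition infconv k x : R := inf (infconv_set k x).

Lemma infconv_has_inf k x : 0 <= k -> has_inf (infconv_set k x).
Proof.
move=> k0; split.
  (* At distance [2] closeness is void, so the zero path competes for every [x]. *)
  exists (F (fun=> 0) + k * 2), (fun=> 0), 2; split => //.
    by split=> t _; [exact: cvg_cst|exact: is_cvg_cst].
  by move=> u h1 h2; exfalso; lra.
exists 0 => _ [y [e [_ e0 _ ->]]]; rewrite addr_ge0 ?mulr_ge0 ?(ltW e0)//.
by case/andP: (FM y).
Qed.

Lemma infconv_ge0 k x : 0 <= k -> 0 <= infconv k x.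
Proof.
move=> k0; apply: lb_le_inf; first by case: (infconv_has_inf x k0).
move=> _ [y [e [_ e0 _ ->]]]; rewrite addr_ge0 ?mulr_ge0 ?(ltW e0)//.
by case/andP: (FM y).
Qed.

Lemma infconv_le k x y e : 0 <= k -> cadlag_pos y -> 0 < e -> uclose e x y ->
  infconv k x <= F y + k * e.
Proof.
by move=> k0 cy e0 c; apply: ge_inf; [case: (infconv_has_inf x k0)|exists y, e].
Qed.

Lemma infconv_le_self k x : 0 <= k -> cadlag_pos x -> infconv k x <= F x.
Proof.
move=> k0 cx; apply/ler_addgt0Pr => e e0.
apply: (@le_trans _ _ (F x + k * (e / (k + 1)))).
  apply: infconv_le => //; first by rewrite divr_gt0//; lra.
  by move=> u _ _; rewrite subrr normr0 divr_ge0; lra.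
rewrite lerD2l mulrCA ger_pMr// ler_pdivrMr; lra.
Qed.

Lemma infconv_bound k x : 0 <= k -> infconv k x <= M + k * 2.
Proof.
move=> k0; have := @infconv_le k x (fun=> 0) 2 k0.
have /andP[_ h] := FM (fun=> 0); move=> /(_ _ _ _) h1.
apply: le_trans (h1 _ _ _) _ => //; last by rewrite lerD2r.
  by split=> t _; [exact: cvg_cst|exact: is_cvg_cst].
by move=> u h2 h3; exfalso; lra.
Qed.

Lemma infconv_lip k x x' e : 0 <= k -> 0 < e -> uclose e x x' ->
  infconv k x <= infconv k x' + k * e.
Proof.
move=> k0 e0 c; rewrite -lerBlDr; apply: lb_le_inf; first by case: (infconv_has_inf x' k0).
move=> _ [y [e' [cy e'0 c' ->]]]; rewrite lerBlDr.
rewrite -addrA -mulrDr addrC [e' + e]addrC addrC; apply: infconv_le => //; first exact: addr_gt0.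
by apply: uclose_trans c'; rewrite ?ltW.
Qed.

(** Upper bound: moving [x] by [4 ^- j] costs [j * 4 ^- j <= 2 ^- j]. Lower bound: near-minimisers
    have a bounded penalty [j * e], so they lie within a distance of order [1 / j] of [x]; they
    converge to [x], and sequential continuity of [F] applies along them. *)
Lemma infconv_cvg x (g : nat -> R) : J1_continuous F -> cadlag_pos x ->
  (\forall j \near \oo, exists y, [/\ cadlag_pos y, uclose (4 ^- j) x y & g j = infconv j%:R y]) ->
  g j @[j --> \oo] --> F x.
Proof.
move=> cF cx [j0 _ hj0].
have p4 (j : nat) : 0 < 4 ^- j :> R by rewrite invr_gt0 exprn_gt0.
have j4 (j : nat) : j%:R * 4 ^- j <= 2 ^- j :> R.
  rewrite -[X in _ * X^-1](_ : 2 ^+ j * 2 ^+ j = _ :> R); last first.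
    by rewrite -exprMn; congr (_ ^+ _); lra.
  have p2 : 0 < 2 ^- j :> R by rewrite invr_gt0 exprn_gt0.
  rewrite invfM mulrA ler_piMl ?(ltW p2)// ler_pdivrMr ?exprn_gt0// mul1r -natrX ler_nat ltnW//.
  exact: ltn_expl.
have p21 (j : nat) : 2 ^- j <= 1 :> R by rewrite invf_le1 ?exprn_gt0// exprn_ege1// ler1n.
have FM1 : 0 <= M by have /andP[] := FM x; exact: le_trans.
have up j : (j0 <= j)%N -> g j <= F x + 2 ^- j.
  move=> jj; have [y [cy cl ->]] := hj0 j jj.
  apply: (le_trans (infconv_lip _ (p4 j) (uclose_sym cl))) => //.
  by apply: lerD; [exact: infconv_le_self|exact: j4].
have [z hz] : exists z : nat -> (R -> R) * R, forall j, [/\ cadlag_pos (z j).1, 0 <= (z j).2,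
    j%:R * (z j).2 <= M + 4 & (j0 <= j)%N -> uclose (z j).2 (z j).1 x /\ F (z j).1 <= g j + 2 ^- j].
  suff : forall j, exists zz : (R -> R) * R, [/\ cadlag_pos zz.1, 0 <= zz.2,
    j%:R * zz.2 <= M + 4 & (j0 <= j)%N -> uclose zz.2 zz.1 x /\ F zz.1 <= g j + 2 ^- j].
    by move=> /choice[z hz]; exists z.
  move=> j; case: (leqP j0 j) => jj; last first.
    by exists (x, 0); split => //=; [rewrite mulr0; lra].
  have [y [cy cl gE]] := hj0 j jj.
  have p2 : 0 < 2 ^- j :> R by rewrite invr_gt0 exprn_gt0.
  have [_ [y' [e [cy' e0 cl' ->]]]] := inf_adherent p2 (@infconv_has_inf j%:R y (ler0n _ _)).
  rewrite -/(infconv j%:R y) -gE => lt.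
  have /andP[F0 _] := FM y'.
  exists (y', 4 ^- j + e) => /=; split => //.
  - by rewrite addr_ge0 ?(ltW e0)// ltW.
  - have := up j jj; have := j4 j; have := p21 j.
    have /andP[_ FxM] := FM x.
    by rewrite mulrDr; lra.
  - move=> _; have je : 0 <= j%:R * e by rewrite mulr_ge0// ltW.
    split; last by lra.
    by apply: uclose_sym; apply: uclose_trans cl cl'; exact: ltW.
have c2 : 2 ^- j @[j --> \oo] --> (0 : R).
  rewrite (_ : (fun j : nat => 2 ^- j : R) = (fun j => (2^-1 : R) ^+ j)); last first.
    by apply/funext => j; rewrite exprVn.
  by apply: cvg_expr; rewrite ger0_norm ?invr_ge0//; lra.
have cz : F (z j).1 @[j --> \oo] --> F x.
  apply: (cF (fun j => (z j).1)) => //; first by move=> j; case: (hz j).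
  apply: (@uclose_J1 _ _ (fun j => (z j).2)).
  - by move=> j; case: (hz j).
  - apply: (@squeeze_cvgr _ _ _ _ (fun=> 0) (fun j : nat => (M + 4) * j.+1%:R^-1 * 2)).
    + near=> j; have [_ -> jz _] := hz j; rewrite /=.
      have jn : (1 <= j)%N by near: j; exists 1%N.
      have j0' : 0 < j%:R :> R by rewrite ltr0n.
      have j1 : 0 < j.+1%:R :> R by rewrite ltr0n.
      rewrite mulrAC ler_pdivlMr//.
      have [_ z0 _ _] := hz j.
      have : (z j).2 * j.+1%:R <= 2 * (j%:R * (z j).2).
        have : j.+1%:R <= 2 * j%:R :> R by rewrite -natrM ler_nat mul2n -addnn -addn1 leq_add2l.
        move=> /(ler_wpM2l z0); lra.
      lra.
    + exact: cvg_cst.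
    + rewrite [X in _ --> X](_ : 0 = (M + 4) * 0 * 2); last by rewrite mulr0 mul0r.
      by apply: cvgMl; apply: cvgMr; exact: cvg_harmonic.
  - by exists j0 => // j jj; have [_ _ _ /(_ jj)[]] := hz j.
apply: (@squeeze_cvgr _ _ _ _ (fun j => F (z j).1 - 2 ^- j) (fun j => F x + 2 ^- j)).
- exists j0 => // j jj; rewrite /= up// andbT lerBlDr.
  by have [_ _ _ /(_ jj)[]] := hz j.
- by rewrite -[X in _ --> X]subr0; apply: cvgB.
- by rewrite -[X in _ --> X]addr0; apply: cvgD => //; exact: cvg_cst.
Unshelve. all: by end_near. Qed.

End inf_convolution.
End closeness.

(** * Weak convergence from uniform approximation *)

Section weak_convergence.
Context {R : realType} {d d' : measure_display} {T : measurableType d} {T' : measurableType d'}.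
Variables (P : probability T R) (P' : probability T' R).
Variables (Y : R -> T -> R -> R) (Z : T' -> R -> R).

(* Both processes are close, off an event of small probability, to the same
   function of finitely many coordinates, which converge in distribution. *)
Definition approximable (eps : R) : Prop :=
  exists (N : nat) (Ps : ('I_N -> R) -> R -> R) (K : R) (p : R -> T -> 'I_N -> R) (q : T' -> 'I_N -> R),
  [/\ 0 <= K, (forall z, cube z -> cadlag_pos (Ps z)) &
      (forall z z' u, cube z -> cube z' -> `|Ps z u - Ps z' u| <= K * \sum_i `|z i - z' i|)] /\
  [/\ (forall t i, measurable_fun setT (fun w => p t w i)), (forall t w, cube (p t w)),
      (forall i, measurable_fun setT (fun w => q w i)), (forall w, cube (q w)) &
      (forall s : 'I_N -> nat, Exp P (fun w => \prod_i p t w i ^+ s i) @[t --> +oo] -->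
         Exp P' (fun w => \prod_i q w i ^+ s i))] /\
  (exists A, forall t, A <= t -> exists B, [/\ measurable B, (P B <= eps%:E)%E &
     forall w, ~ B w -> cadlag_pos (Y t w) /\ uclose eps (Y t w) (Ps (p t w))]) /\
  (exists B, [/\ measurable B, (P' B <= eps%:E)%E &
     forall w, ~ B w -> cadlag_pos (Z w) /\ uclose eps (Z w) (Ps (q w))]).

Hypothesis appr : forall eps, 0 < eps -> approximable eps.

Section nonnegative.
Variables (F : (R -> R) -> R) (M : R).
Hypothesis FM : forall x, 0 <= F x <= M.
Hypothesis cF : J1_continuous F.

(** The error [(k + M + 1) * eps] has three sources: the Lipschitz constant [k] times the closeness,
    the bound [M] on the exceptional event, and the convergence of the coordinates in
    distribution. *)
Let step (eps k : R) : 0 < eps -> 0 <= k -> exists gB : (T' -> R) * set T',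
  [/\ measurable_fun setT gB.1, (forall w, 0 <= gB.1 w <= M), measurable gB.2, (P' gB.2 <= eps%:E)%E &
   forall w, ~ gB.2 w -> cadlag_pos (Z w) /\
     exists y, [/\ cadlag_pos y, uclose eps (Z w) y & gB.1 w = infconv F k y]] /\
  exists A, forall t, A <= t -> Exp P' gB.1 <= Exp P (fun w => F (Y t w)) + (k + M + 1) * eps.
Proof.
move=> e0 k0; have [N [Ps [K [p [q [[K0 cPs lPs] [[mp cp mq cq fdd] [[A HA] [B' [mB' PB' hB']]]]]]]]]] := appr e0.
pose H z := infconv F k (Ps z).
have HM z : cube z -> 0 <= H z <= M.
  move=> cz; rewrite /H (infconv_ge0 FM)//= (le_trans (infconv_le_self FM k0 (cPs z cz)))//.
  by case/andP: (FM (Ps z)).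
have HL : lipschitz_cube (k * K) H.
  have half z z' : cube z -> cube z' -> H z <= H z' + k * K * \sum_i `|z i - z' i|.
    move=> cz cz'; apply/ler_addgt0Pr => e e00.
    set S := \sum_i _; have S0 : 0 <= S by rewrite sumr_ge0.
    have KS : 0 <= K * S by rewrite mulr_ge0.
    pose e1 := K * S + e / (k + 1).
    have e10 : 0 < e1 by rewrite ltr_wpDl// divr_gt0//; lra.
    apply: (@le_trans _ _ (H z' + k * e1)).
      apply: (infconv_lip FM) => // u _ _; apply: (le_trans (lPs z z' u cz cz')).
      by rewrite lerDl divr_ge0 ?(ltW e00)//; lra.
    rewrite /e1 mulrDr mulrA addrA lerD2l mulrCA ger_pMr// ler_pdivrMr; lra.
  move=> z z' cz cz'; rewrite ler_norml; apply/andP; split; last first.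
    by rewrite lerBlDl; exact: half.
  have := half z' z cz' cz.
  rewrite (eq_bigr (fun i => `|z i - z' i|)); last by move=> i _; rewrite distrC.
  lra.
have kK0 : 0 <= k * K by rewrite mulr_ge0.
have Hb z : `|H z| <= M + k * 2.
  by rewrite ger0_norm ?(infconv_ge0 FM)//; exact: infconv_bound.
have mHp t : measurable_fun setT (fun w => H (p t w)).
  exact: (measurable_cube_lipschitz kK0 HL (mp t) (cp t)).
exists ((fun w => H (q w)), B'); split.
  split => //=.
  - exact: (measurable_cube_lipschitz kK0 HL mq cq).
  - by move=> w; exact: HM.
  - move=> w /hB'[cZ cl]; split=> //; exists (Ps (q w)); split => //; exact: cPs.
have cv := @fdd_cvg _ _ _ _ _ P P' N (k * K) (M + k * 2) H p q kK0 HL Hb mp cp mq cq fdd.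
have /cvgrPdist_lt /(_ eps e0) [A1 [_ HA1]] := cv.
exists (Num.max A (A1 + 1)) => t; rewrite ge_max => /andP[At A1t].
have lt1 : `|Exp P' (fun w => H (q w)) - Exp P (fun w => H (p t w))| < eps by apply: HA1; lra.
have [B [mB PB hB]] := HA t At.
(* A measurable minorant of [F (Y t w)], which itself may fail to be measurable. *)
pose v w := (if w \in B then 0 else Num.max 0 (H (p t w) - k * eps)) : R.
have M0 : 0 <= M by have /andP[] := FM (fun=> 0); exact: le_trans.
have mI : measurable_fun setT (fun w => (w \in B)%:R : R).
  by rewrite (_ : (fun w => _) = \1_B)//; apply: measurable_indic.
have mv : measurable_fun setT v.
  rewrite (_ : v = fun w => (1 - (w \in B)%:R) * Num.max 0 (H (p t w) - k * eps)); last first.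
    by apply/funext => w; rewrite /v; case: (w \in B); rewrite ?subrr ?mul0r// subr0 mul1r.
  apply: measurable_funM; first by apply: measurable_funB => //; exact: measurable_cst.
  apply: measurable_maxr; first exact: measurable_cst.
  by apply: measurable_funB => //; exact: measurable_cst.
have ke : 0 <= k * eps by rewrite mulr_ge0// ltW.
have v0 w : 0 <= v w by rewrite /v; case: ifP => // _; rewrite le_max lexx.
have vF w : v w <= F (Y t w).
  rewrite /v; case: ifPn => [_|]; first by case/andP: (FM (Y t w)).
  rewrite notin_setE => /hB[cY cl]; rewrite ge_max; apply/andP; split; first by case/andP: (FM (Y t w)).
  rewrite lerBlDr; apply: (le_trans (infconv_lip FM k0 e0 (uclose_sym cl))).
  by rewrite lerD2r; exact: infconv_le_self.
have vM w : `|v w| <= M by rewrite ger0_norm//; apply: (le_trans (vF w)); case/andP: (FM (Y t w)).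
have h1 : Exp P v <= Exp P (fun w => F (Y t w)).
  by apply: (@lower_Exp_le _ _ _ _ _ _ M) => // w; case/andP: (FM (Y t w)).
have h2 : Exp P (fun w => H (p t w)) <= Exp P v + (k + M) * eps.
  pose u w := k * eps + M * (w \in B)%:R.
  have mu : measurable_fun setT u.
    apply: measurable_funD; first exact: measurable_cst.
    by apply: measurable_funM => //; exact: measurable_cst.
  have iB w : 0 <= ((w \in B)%:R : R) <= 1 by case: (w \in B); rewrite ?ler01 ?lexx.
  have u0 w : 0 <= u w <= k * eps + M.
    have /andP[i0 i1] := iB w.
    have := ler_wpM2l M0 i1; have := mulr_ge0 M0 i0; rewrite /u mulr1 => ? ?; apply/andP; split; lra.
  have ub w : `|u w| <= k * eps + M by have /andP[? ?] := u0 w; rewrite ger0_norm.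
  have Eu : Exp P u <= (k + M) * eps.
    rewrite /u (@ExpD _ _ _ P (fun=> k * eps) (fun w => M * (w \in B)%:R) (k * eps + M)).
    - rewrite Exp_cst (@ExpZ _ _ _ P _ 1)//; last first.
        by move=> w; have /andP[? ?] := iB w; rewrite ger0_norm.
      rewrite mulrDl lerD2l ler_wpM2l// /Exp.
      rewrite (_ : (fun w => ((w \in B)%:R)%:E) = (fun w => (\1_B w)%:E))// integral_indic// setIT.
      by rewrite -lee_fin fineK// fin_num_measure.
    - exact: measurable_cst.
    - by move=> w; rewrite ger0_norm// lerDl.
    - by apply: measurable_funM => //; exact: measurable_cst.
    - move=> w; have /andP[i0 i1] := iB w; rewrite ger0_norm ?mulr_ge0//.
      by have := ler_wpM2l M0 i1; lra.
  have -> : Exp P v + (k + M) * eps = (Exp P v + Exp P u) + ((k + M) * eps - Exp P u) by ring.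
  rewrite -(@ExpD _ _ _ P v u (2 * M + k * eps + k * 2)) //; first last.
  - by move=> w; apply: (le_trans (ub w)); lra.
  - by move=> w; apply: (le_trans (vM w)); lra.
  rewrite -[leLHS]addr0; apply: lerD; last by rewrite subr_ge0.
  apply: (@Exp_le _ _ _ P _ _ (2 * M + k * eps + k * 2)) => //.
  - by move=> w; apply: (le_trans (Hb _)); lra.
  - exact: measurable_funD.
  - move=> w; apply: (le_trans (ler_normD _ _)); have := vM w; have := ub w; lra.
  - move=> w; rewrite /v /u; case: (w \in B) => /=.
      by rewrite mulr1; have /andP[_ ?] := HM _ (cp t w); lra.
    by rewrite mulr0 addr0; have : H (p t w) - k * eps <= Num.max 0 (H (p t w) - k * eps);
      [rewrite le_max lexx orbT|lra].
move: lt1; rewrite ltr_norml => /andP[_ lt1].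
rewrite (_ : (k + M + 1) * eps = (k + M) * eps + eps); last by ring.
rewrite /=; lra.
Qed.

(** With [eps = 4 ^- j] and [k = j] the error vanishes and the exceptional events are summable, so
    by Borel-Cantelli [infconv_cvg] applies at almost every limit path. Hence [F (Z w)] is almost
    surely equal to a measurable function. *)
Let limit_measurable : exists g : nat -> T' -> R, exists2 G : T' -> R,
  [/\ measurable_fun setT G, forall w, 0 <= G w <= M, Exp P' (g j) @[j --> \oo] --> Exp P' G &
    forall j : nat, exists A, forall t, A <= t ->
      Exp P' (g j) <= Exp P (fun w => F (Y t w)) + (j%:R + M + 1) * 4 ^- j] &
  exists B, [/\ measurable B, P' B = 0 & forall w, ~ B w -> F (Z w) = G w].
Proof.
have p4 (j : nat) : 0 < 4 ^- j :> R by rewrite invr_gt0 exprn_gt0.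
have [gB hgB] := choice (fun j : nat => step (p4 j) (ler0n R j)).
have mBj j : measurable (gB j).2 by have [[]] := hgB j.
have PBj j : (P' (gB j).2 <= (1 * 2 ^- j)%:E)%E.
  have [[_ _ _ /le_trans h _] _] := hgB j; apply: h.
  rewrite lee_fin mul1r lef_pV2 ?posrE ?exprn_gt0// -!natrX ler_nat.
  by case: j => // j; rewrite leq_exp2r.
have [B [mB PB hB]] := borel_cantelli_geom ler01 mBj PBj.
pose ind w : R := (w \notin B)%:R.
have mind : measurable_fun setT ind.
  rewrite (_ : ind = \1_(~` B)); first by apply: measurable_indic; exact: measurableC.
  by apply/funext => w; rewrite /ind indicE in_setC.
pose g j w := ind w * (gB j).1 w.
pose G w := ind w * F (Z w).
have ind01 w : ind w = 0 \/ ind w = 1 by rewrite /ind; case: (w \in B); [left|right].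
have M0 : 0 <= M by have /andP[] := FM (fun=> 0); exact: le_trans.
have gE j : Exp P' (gB j).1 = Exp P' (g j).
  have [[m1 b1 _ _ _] _] := hgB j.
  have mg : measurable_fun setT (g j) by exact: measurable_funM.
  rewrite /Exp; congr fine; apply: ae_eq_integral => //; try exact/measurable_EFinP.
  exists B; split => // w /=; apply: contra_notP => wB _.
  by rewrite /g /ind memNset// mul1r.
exists (fun j => (gB j).1); exists G; last first.
  by exists B; split => // w wB; rewrite /G /ind memNset// mul1r.
have cvg_g w : g j w @[j --> \oo] --> G w.
  have [wB|wB] := pselect (B w).
    rewrite (_ : (fun j => g j w) = fun=> 0); last by apply/funext => j; rewrite /g /ind mem_set// mul0r.
    by rewrite /G /ind mem_set// mul0r; exact: cvg_cst.
  have [j0 hj0] := hB w wB.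
  rewrite /g /G /ind memNset//=; under eq_fun do rewrite mul1r.
  rewrite mul1r; apply: (infconv_cvg FM) => //.
    by have [[_ _ _ _ /(_ w (hj0 j0 (leqnn _)))[]]] := hgB j0.
  exists j0 => // j /= jj.
  by have [[_ _ _ _ /(_ w (hj0 j jj))[_ []y [cy cl ->]]]] := hgB j; exists y.
have gM j w : `|g j w| <= M.
  have [[_ /(_ w) /andP[b0 b1] _ _ _] _] := hgB j.
  by rewrite /g; case: (ind01 w) => ->; rewrite ?mul0r ?mul1r ?normr0// ger0_norm.
have mg j : measurable_fun setT (g j).
  by have [[m1 b1 _ _ _] _] := hgB j; exact: measurable_funM.
split.
- by apply: (@measurable_fun_cvg _ _ _ _ g) => // w _; exact: cvg_g.
- move=> w; rewrite /G; case: (ind01 w) => ->; rewrite ?mul0r ?mul1r ?lexx//.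
- under eq_fun do rewrite gE; exact: (@Exp_cvg _ _ _ P' g G M).
- by move=> j; have [_] := hgB j.
Qed.

(** The lower integral becomes additive here because [F (Z w)] differs from a measurable function on
    a null set only. *)
Lemma limit_compl : Exp P' (fun w => F (Z w)) + Exp P' (fun w => M - F (Z w)) = M.
Proof.
have [_ [G [mG GM _ _] [B [mB PB hB]]]] := limit_measurable.
rewrite (@lower_Exp_null _ _ _ P' (fun w => F (Z w)) G M B)//.
rewrite (@lower_Exp_null _ _ _ P' (fun w => M - F (Z w)) (fun w => M - G w) M B)//.
- have M0 : 0 <= M by have /andP[] := FM (fun=> 0); exact: le_trans.
  have mM : measurable_fun setT (fun w => M - G w) by apply: measurable_funB => //; exact: measurable_cst.
  rewrite -(@ExpD _ _ _ P' G (fun w => M - G w) M)//.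
  + rewrite (_ : (fun w => _) = fun=> M) ?Exp_cst//.
    by apply/funext => w; ring.
  + by move=> w; have /andP[? ?] := GM w; rewrite ger0_norm.
  + by move=> w; have /andP[? ?] := GM w; rewrite ger0_norm; lra.
- by apply: measurable_funB => //; exact: measurable_cst.
- by move=> w; have /andP[? ?] := FM (Z w); apply/andP; split; lra.
- by move=> w; have /andP[? ?] := GM w; apply/andP; split; lra.
- by move=> w /hB ->.
Qed.

Lemma weak_liminf (e : R) : 0 < e -> exists A, forall t, A <= t ->
  Exp P' (fun w => F (Z w)) <= Exp P (fun w => F (Y t w)) + e.
Proof.
move=> e0; have [g [G [mG GM gG HA] [B [mB PB hB]]]] := limit_measurable.
rewrite (@lower_Exp_null _ _ _ P' (fun w => F (Z w)) G M B)//.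
have M0 : 0 <= M by have /andP[] := FM (fun=> 0); exact: le_trans.
have e20 : 0 < e / 2 by rewrite divr_gt0.
have c4 : (j%:R + M + 1) * 4 ^- j @[j --> \oo] --> (0 : R).
  have p2 : 2 ^- j @[j --> \oo] --> (0 : R).
    rewrite (_ : (fun j : nat => 2 ^- j : R) = (fun j => (2^-1 : R) ^+ j)); last first.
      by apply/funext => j; rewrite exprVn.
    by apply: cvg_expr; rewrite ger0_norm ?invr_ge0//; lra.
  apply: (@squeeze_cvgr _ _ _ _ (fun=> 0) (fun j : nat => (M + 2) * 2 ^- j)).
  - apply: nearW => j /=.
    have p0 : 0 < 2 ^+ j :> R by rewrite exprn_gt0.
    rewrite -[X in _ * X^-1](_ : 2 ^+ j * 2 ^+ j = _ :> R); last first.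
      by rewrite -exprMn; congr (_ ^+ _); lra.
    rewrite invfM mulrA; have jM : 0 <= j%:R + M + 1 by rewrite !addr_ge0.
    apply/andP; split; first by rewrite divr_ge0 ?divr_ge0// ltW.
    rewrite ler_pM2r ?invr_gt0// ler_pdivrMr//.
    have j2 : j%:R <= 2 ^+ j :> R by rewrite -natrX ler_nat ltnW// ltn_expl.
    have o2 : 1 <= 2 ^+ j :> R by rewrite exprn_ege1// ler1n.
    have := ler_wpM2l M0 o2; lra.
  - exact: cvg_cst.
  - by rewrite -[X in _ --> X](mulr0 (M + 2)); apply: cvgMr.
have /cvgrPdist_lt /(_ _ e20) [j1 _ h1] := gG.
have /cvgrPdist_lt /(_ _ e20) [j2 _ h2] := c4.
pose j := maxn j1 j2.
have := h1 j (leq_maxl _ _); rewrite /= ltr_norml => /andP[_ g1].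
have := h2 j (leq_maxr _ _); rewrite /= sub0r normrN ltr_norml => /andP[_ g2].
have [A hA] := HA j; exists A => t /hA; lra.
Qed.

End nonnegative.

(** [weak_liminf] is applied to [F] and to [M - F]. Superadditivity before the limit and additivity
    at the limit turn the second bound into an upper bound for [F]. *)
Let weak_nonneg (F : (R -> R) -> R) (M : R) : (forall x, 0 <= F x <= M) -> J1_continuous F ->
  Exp P (fun w => F (Y t w)) @[t --> +oo] --> Exp P' (fun w => F (Z w)).
Proof.
move=> FM cF; apply/cvgrPdist_le => e e0.
have FM' x : 0 <= M - F x <= M by have /andP[? ?] := FM x; apply/andP; split; lra.
have cF' : J1_continuous (fun x => M - F x).
  by move=> fn f h1 h2 h3; apply: cvgB; [exact: cvg_cst|exact: cF].
have [A1 h1] := weak_liminf FM cF e0.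
have [A2 h2] := weak_liminf FM' cF' e0.
have := limit_compl FM cF; rewrite /= => hc.
near=> t.
have t1 : A1 <= t by near: t; apply: nbhs_pinfty_ge; rewrite num_real.
have t2 : A2 <= t by near: t; apply: nbhs_pinfty_ge; rewrite num_real.
have := h1 t t1; have := h2 t t2.
have := @lower_Exp_super _ _ _ P (fun w => F (Y t w)) M (fun w => FM _).
by rewrite /= => h3 h4 h5; rewrite ler_norml; apply/andP; split; lra.
Unshelve. all: by end_near. Qed.

Lemma weak_conv_J1_approx : weak_conv_J1 P Y P' Z.
Proof.
move=> F cF [M FM].
have M0 : 0 <= M by have := FM (fun=> 0); apply: le_trans.
(* The integral of a signed function is by definition the difference of the integrals of its two
   parts, measurable or not, so the nonnegative case applies to each part. *)
pose Fp x := Num.max (F x) 0; pose Fm x := Num.max (- F x) 0.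
have pM x : 0 <= Fp x <= M.
  by have := FM x; rewrite ler_norml /Fp le_max lexx orbT /= ge_max M0 andbT => /andP[].
have nM x : 0 <= Fm x <= M.
  have := FM x; rewrite ler_norml /Fm le_max lexx orbT /= ge_max M0 andbT => /andP[? ?]; lra.
have max_cvg (a : nat -> R) l : a n @[n --> \oo] --> l -> Num.max (a n) 0 @[n --> \oo] --> Num.max l 0.
  move=> /cvgrPdist_le h; apply/cvgrPdist_le => e /h; apply: filterS => n; apply: le_trans.
  exact: max_lip.
have cp : J1_continuous Fp.
  move=> fn f h1 h2 h3.
  have := cF fn f h1 h2 h3 => h; exact: max_cvg.
have cm : J1_continuous Fm.
  move=> fn f h1 h2 h3.
  have := cF fn f h1 h2 h3 => h.
  by apply: max_cvg; exact: cvgN.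
have intE (d1 : measure_display) (T1 : measurableType d1) (P1 : probability T1 R) (V : T1 -> R -> R) :
    (\int[P1]_w (F (V w))%:E = (Exp P1 (fun w => Fp (V w)) - Exp P1 (fun w => Fm (V w)))%:E)%E.
  rewrite integralE EFinB -(@lower_ExpE _ _ _ P1 (fun w => Fp (V w)) M)// -(@lower_ExpE _ _ _ P1 (fun w => Fm (V w)) M)//.
  by congr (_ - _)%E; apply: eq_integral => w _; rewrite ?funeposE ?funenegE /Fp /Fm ?EFin_max.
rewrite intE; under eq_fun do rewrite intE.
apply: cvg_EFin; first exact: nearW.
by apply: cvgB; exact: weak_nonneg.
Qed.

End weak_convergence.

(** * Block sums of the walk and increments of the subordinator *)

(** [fdd_cvg] on constant families shows that Lipschitz functions have the same expectation under
    both laws; the ramps [H k] increase to the indicator of the ray. *)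
Lemma moments_rays {R : realType} (d d' : measure_display) (T : measurableType d)
    (T' : measurableType d') (P : probability T R) (P' : probability T' R)
    (p : T -> R) (q : T' -> R) (a : R) :
  measurable_fun setT p -> measurable_fun setT q ->
  (forall w, 0 <= p w <= 1) -> (forall w, 0 <= q w <= 1) ->
  (forall k : nat, Exp P (fun w => p w ^+ k) = Exp P' (fun w => q w ^+ k)) ->
  P [set w | p w < a] = P' [set w | q w < a].
Proof.
move=> mp mq p01 q01 mom.
pose H (k : nat) (z : 'I_1 -> R) := Num.min (k%:R * Num.max (a - z ord0) 0) 1.
have HL k : lipschitz_cube k%:R (H k).
  move=> z z' _ _; rewrite /H big_ord1; apply: (le_trans (min_lip _ _ _)).
  rewrite -mulrBr normrM ger0_norm//; apply: ler_wpM2l => //.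
  apply: (le_trans (max_lip _ _ _)).
  by rewrite (_ : _ - _ = z' ord0 - z ord0) 1?distrC//; ring.
have H01 k z : 0 <= H k z <= 1.
  by rewrite /H le_min ler01 andbT mulr_ge0 ?le_max ?lexx ?orbT//= ge_min lexx orbT.
have HM k z : `|H k z| <= 1 by have /andP[? ?] := H01 k z; rewrite ger0_norm.
have eqH k : Exp P (fun w => H k (fun=> p w)) = Exp P' (fun w => H k (fun=> q w)).
  have := @fdd_cvg _ _ _ _ _ P P' 1 k%:R 1 (H k) (fun _ w _ => p w) (fun w _ => q w)
    (ler0n _ _) (HL k) (HM k) (fun _ _ => mp) (fun _ w _ => p01 w) (fun _ => mq) (fun w _ => q01 w).
  move=> /(_ _) h; apply: cvg_unique (cvg_cst _) (h _) => //.
  move=> s; rewrite (_ : Exp P' _ = Exp P (fun w => \prod_(i < 1) p w ^+ s i)); first exact: cvg_cst.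
  under [in RHS]eq_fun do rewrite big_ord1.
  by under eq_fun do rewrite big_ord1; rewrite mom.
have lim (d1 : measure_display) (T1 : measurableType d1) (P1 : probability T1 R) (r : T1 -> R) :
    measurable_fun setT r -> (forall w, 0 <= r w <= 1) ->
    Exp P1 (fun w => H k (fun=> r w)) @[k --> \oo] --> fine (P1 [set w | r w < a]).
  move=> mr r01.
  have mA : measurable [set w | r w < a].
    rewrite (_ : [set w | _] = ~` [set w | a <= r w]); last first.
      by apply/seteqP; split => w /=; rewrite ltNge => /negP.
    apply: measurableC; rewrite -[X in measurable X]setTI.
    by apply: measurable_fun_le => //; exact: measurable_cst.
  have -> : fine (P1 [set w | r w < a]) = Exp P1 (\1_[set w | r w < a]).
    by rewrite /Exp integral_indic// setIT.
  apply: (@Exp_cvg _ _ _ P1 _ _ 1).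
  - move=> k; apply: (@measurable_cube_lipschitz _ _ _ 1 k%:R (H k) (fun w _ => r w)) => //.
    by move=> w i; exact: r01.
  - by move=> k w; exact: HM.
  - move=> w; rewrite indicE; case: (ltP (r w) a) => ra.
      rewrite mem_set//=; have ra' : 0 < a - r w by rewrite subr_gt0.
      apply: cvg_near_cst; near=> k.
      rewrite /H (_ : Num.max _ _ = a - r w); last by apply/max_idPl; exact: ltW.
      apply/min_idPr; rewrite -ler_pdivrMr// mul1r.
      by near: k; apply: nbhs_infty_ger.
    rewrite memNset /=; last by rewrite ltNge ra.
    apply: cvg_near_cst; apply: nearW => k; rewrite /H (_ : Num.max _ _ = 0); last first.
      by apply/max_idPr; rewrite subr_le0.
    by rewrite mulr0; apply/min_idPl.
have e : fine (P [set w | p w < a]) = fine (P' [set w | q w < a]).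
  apply: cvg_unique (lim _ _ P p mp p01) _ => //.
  rewrite /= (_ : (fun k => _) = (fun k => Exp P' (fun w => H k (fun=> q w)))); last exact/funext.
  exact: lim.
have mA (d1 : measure_display) (T1 : measurableType d1) (r : T1 -> R) : measurable_fun setT r ->
    measurable [set w | r w < a].
  move=> mr; rewrite (_ : [set w | _] = ~` [set w | a <= r w]); last first.
    by apply/seteqP; split => w /=; rewrite ltNge => /negP.
  apply: measurableC; rewrite -[X in measurable X]setTI.
  by apply: measurable_fun_le => //; exact: measurable_cst.
by rewrite -[LHS]fineK ?fin_num_measure ?e ?fineK ?fin_num_measure//; exact: mA.
Unshelve. all: by end_near. Qed.

Section rays.
Context {R : realType}.

Definition rays : set (set R) := [set A | A = setT \/ exists c : R, A = `]c, +oo[%classic].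

Lemma rays_gen : @measurable _ (measurableTypeR R) = <<s rays >>.
Proof.
have -> : @measurable _ (measurableTypeR R) = <<s @RGenOInfty.G R >>.
  exact: RGenOInfty.measurableE.
apply/seteqP; split.
  by apply: sub_sigma_algebra2 => _ [c ->]; right; exists c.
apply: smallest_sub; first exact: smallest_sigma_algebra.
move=> _ [->|[c ->]]; last by apply: sub_sigma_algebra; exists c.
exact: (@measurableT _ (g_sigma_algebraType (@RGenOInfty.G R))).
Qed.

Lemma raysI : setI_closed rays.
Proof.
move=> A B [->|[c ->]] [->|[e ->]]; rewrite ?setTI ?setIT.
- by left.
- by right; exists e.
- by right; exists c.
right; exists (Num.max c e); apply/seteqP; split => x /=; rewrite !in_itv /= !andbT gt_max.
  by move=> [-> ->].
by move=> /andP[].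
Qed.

End rays.

Section subordinator.
Context {R : realType} {d : measure_display} {T : measurableType d} (P : probability T R).
Variables (alpha : R) (W : T -> R -> R).
Hypothesis alpha0 : 0 < alpha.
Hypothesis sub : stable_subordinator P alpha W.

Lemma sub_ge0 w t : 0 <= t -> 0 <= W w t.
Proof.
move=> t0; have [W0 [_ [mono _]]] := sub.
by rewrite -(W0 w); apply: mono; rewrite ?in_itv /= ?lexx ?t0.
Qed.

Lemma sub_mono w s t : 0 <= s -> s <= t -> W w s <= W w t.
Proof.
move=> s0 st; have [_ [_ [mono _]]] := sub.
by apply: mono; rewrite ?in_itv /= ?andbT// (le_trans s0).
Qed.

Lemma sub_measurable t : measurable_fun setT (fun w => W w t).
Proof. by have [_ [_ [_ [mW _]]]] := sub. Qed.

Variable theta : R.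
Hypothesis theta0 : 0 <= theta.

Definition sub_incr (k : nat) (w : T) : measurableTypeR R := W w (k.+1%:R * theta) - W w (k%:R * theta).

Lemma sub_incr_ge0 k w : 0 <= sub_incr k w.
Proof.
rewrite subr_ge0; apply: sub_mono; first by rewrite mulr_ge0.
by apply: ler_wpM2r => //; rewrite ler_nat.
Qed.

Lemma measurable_sub_incr k : measurable_fun setT (sub_incr k).
Proof. by apply: measurable_funB; exact: sub_measurable. Qed.

Lemma sub_incr_laplace k s : 0 <= s ->
  (\int[P]_w (expR (- (s * sub_incr k w)))%:E =
   (expR (- (theta * (Gammaf (1 - alpha) * s `^ alpha))))%:E)%E.
Proof.
move=> s0; have [_ [_ [_ [_ [lap _]]]]] := sub.
have := lap (k%:R * theta) (k.+1%:R * theta) s.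
have -> : k.+1%:R * theta - k%:R * theta = theta by rewrite -mulrBl -natrB// subSnn mul1r.
have h1 : 0 <= k%:R * theta by rewrite mulr_ge0.
have h2 : k%:R * theta <= k.+1%:R * theta by apply: ler_wpM2r => //; rewrite ler_nat.
move=> /(_ h1 h2 s0) <-.
by apply: eq_integral => w _; rewrite mulNr.
Qed.

Let incr0 : {mfun T >-> measurableTypeR R} :=
  HB.pack (sub_incr 0) (isMeasurableFun.Build _ _ _ _ _ (measurable_sub_incr 0)).

Definition incr_law : probability (measurableTypeR R) R := distribution P incr0.

Lemma incr_lawE (A : set R) : incr_law A = P (sub_incr 0 @^-1` A).
Proof. by []. Qed.

(** The definition of the subordinator gives independence of increments directly, but their equality
    in law only through Laplace transforms. At integer arguments these are the moments of
    [expR (- sub_incr k w)], which determine the law on rays. *)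
Lemma iid_sub : iid_gen P incr_law sub_incr (@rays R).
Proof.
split; [exact: rays_gen|exact: raysI|by left|exact: measurable_sub_incr|].
move=> n A rA.
have mA k : measurable (A k : set (measurableTypeR R)).
  by rewrite rays_gen; apply: sub_sigma_algebra.
rewrite bigcap_mkord; have [_ [_ [_ [_ [_ ind]]]]] := sub.
have := ind n (fun k => k%:R * theta) A; rewrite /= mul0r lexx => /(_ isT _ mA) ->; last first.
  by move=> i; apply: ler_wpM2r => //; rewrite ler_nat.
apply: eq_bigr => i _; rewrite incr_lawE -/(sub_incr i).
case: (rA i) => [->|[c ->]]; first by rewrite !preimage_setT || congr (P _).
pose p k w := expR (- sub_incr k w).
have E k : sub_incr k @^-1` `]c, +oo[ = [set w | p k w < expR (- c)].
  by apply/seteqP; split => w /=; rewrite in_itv /= andbT ltr_expR ltrN2.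
rewrite -[X in P X = _]/(sub_incr i @^-1` `]c, +oo[) !E.
have mp k : measurable_fun setT (p k).
  by apply: measurableT_comp => //; apply: measurableT_comp => //; exact: measurable_sub_incr.
have p01 k w : 0 <= p k w <= 1.
  by rewrite expR_ge0 -expR0 ler_expR oppr_le0 sub_incr_ge0.
apply: moments_rays; [exact: mp|exact: mp|exact: p01|exact: p01|move=> m].
rewrite /Exp; congr fine.
have eqm k : (\int[P]_w (p k w ^+ m)%:E = \int[P]_w (expR (- (m%:R * sub_incr k w)))%:E)%E.
  by apply: eq_integral => w _; rewrite /p -expRM_natl mulrN.
by rewrite !eqm !sub_incr_laplace.
Qed.

Lemma ge0_integral_incr_law (f : R -> \bar R) : measurable_fun setT f ->
  (forall e, 0 <= f e)%E -> (\int[incr_law]_e f e = \int[P]_w f (sub_incr 0 w))%E.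
Proof. by move=> mf f0; rewrite ge0_integral_distribution. Qed.

Lemma incr_law_laplace s : 0 <= s ->
  (\int[incr_law]_e (expR (- (s * e)))%:E =
   (expR (- (theta * (Gammaf (1 - alpha) * s `^ alpha))))%:E)%E.
Proof.
move=> s0; rewrite ge0_integral_incr_law.
- exact: sub_incr_laplace.
- by apply/measurable_EFinP; apply: measurableT_comp => //; apply: measurableT_comp.
- by move=> e; rewrite lee_fin expR_ge0.
Qed.

Lemma walk_sub n w : walk sub_incr id n w = W w (n%:R * theta).
Proof.
rewrite /walk; elim: n => [|n IH]; first by rewrite big_ord0 mul0r; have [-> _] := sub.
by rewrite big_ord_recr /= IH /sub_incr addrC subrK.
Qed.

Definition sub_coord N (w : T) (i : 'I_N) : R := expR (- sub_incr i w).

Lemma sub_coord_cube N w : cube (@sub_coord N w).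
Proof. by move=> i; rewrite expR_ge0 -expR0 ler_expR oppr_le0 sub_incr_ge0. Qed.

Lemma measurable_sub_coord N i : measurable_fun setT (fun w => @sub_coord N w i).
Proof.
by apply: measurableT_comp => //; apply: measurableT_comp => //; exact: measurable_sub_incr.
Qed.

Lemma sub_moments N (s : 'I_N -> nat) :
  Exp P (fun w => \prod_i @sub_coord N w i ^+ s i) =
  \prod_i expR (- (theta * (Gammaf (1 - alpha) * (s i)%:R `^ alpha))).
Proof.
pose s' (i : nat) : nat := if insub i is Some j then s j else 0%N.
have s'E (i : 'I_N) : s' i = s i by rewrite /s' valK.
rewrite /Exp.
have := @past_integral_prod _ _ _ P _ _ incr_law sub_incr (@rays R) iid_sub 0 N (fun=> 1)
  (fun i e => expR (- ((s' i)%:R * e)))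
  (fun i => expR (- (theta * (Gammaf (1 - alpha) * (s' i)%:R `^ alpha)))).
move=> /(_ _ _ _ _ _) h; rewrite [X in fine X = _](_ : _ = (\int[P]_w (1 * \prod_(i < N)
  expR (- ((s' i)%:R * sub_incr (0 + i) w)))%:E)%E); last first.
  apply: eq_integral => w _; rewrite mul1r; congr EFin; apply: eq_bigr => i _.
  by rewrite /sub_coord -expRM_natl mulrN s'E.
rewrite h => //.
- rewrite integral_prob_cst mul1e /=; apply: eq_bigr => i _; by rewrite s'E.
- by move=> i; apply: measurableT_comp => //; apply: measurableT_comp.
- by move=> i; exact: incr_law_laplace.
Qed.

End subordinator.

(** * Moments of the block sums of the walk *)

Section block_moments.
Context {R : realType} {d : measure_display} {T : measurableType d}.
Variable (P : probability T R).
Context {dE : measure_display} {E : measurableType dE} (mu : probability E R).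
Variables (Th : nat -> T -> E) (C : set (set E)).
Hypothesis iid : iid_gen P mu Th C.
Variable sz : E -> R.
Hypothesis msz : measurable_fun setT sz.
Hypothesis sz0 : forall e, 0 <= sz e.
Variable phi : R -> R.
Hypothesis phiE : forall l, 0 <= l -> (\int[mu]_e (expR (- (l * sz e)))%:E = (phi l)%:E)%E.
Variables (tl : R -> R) (Gam alpha : R).
Hypothesis alpha0 : 0 < alpha.
Hypothesis tl_gt0 : forall t, 0 < tl t.
Hypothesis tl_cvg0 : tl t @[t --> +oo] --> (0 : R).
Hypothesis phi_exponent : forall s, 0 < s -> ((1 - phi (s / t)) / tl t) @[t --> +oo] --> Gam * s `^ alpha.

(** About [eta / tl t] steps, after which the walk has moved by an amount of order [t]; the
    successor makes the block length positive, so that indices can be divided by it. *)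
Definition nblock (eta t : R) : nat := (Num.truncn (eta / tl t)).+1.

Lemma nblock_bounds eta t : 0 < eta -> eta < (nblock eta t)%:R * tl t <= eta + tl t.
Proof.
move=> eta0; have h : 0 <= eta / tl t by rewrite divr_ge0// ltW.
have /andP[h1 h2] := truncn_itv h.
rewrite -ltr_pdivrMr// h2 /= /nblock -natr1 mulrDl mul1r lerD2r.
by rewrite -ler_pdivlMr.
Qed.

Definition block_coord N (eta t : R) (w : T) (i : 'I_N) : R :=
  expR (- ((walk Th sz (i.+1 * nblock eta t) w - walk Th sz (i * nblock eta t) w) / t)).

Lemma walk_mono n m w : (n <= m)%N -> walk Th sz n w <= walk Th sz m w.
Proof.
move=> nm; rewrite /walk -(subnKC nm) big_split_ord /= lerDl.
by rewrite sumr_ge0.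
Qed.

Lemma big_block (F : nat -> R) (N q : nat) :
  \prod_(k < N * q) F k = \prod_(i < N) \prod_(r < q) F (i * q + r)%N.
Proof.
elim: N => [|N IH]; first by rewrite mul0n !big_ord0.
by rewrite mulSnr big_split_ord /= IH big_ord_recr.
Qed.

(** [1 - x] lies between [expR (- (x / (1 - x)))] and [expR (- x)]; the powers of these bounds have
    the same limit. *)
Lemma pow_exp_cvg (x : R -> R) (k : R -> nat) (c : R) :
  (\forall t \near +oo, 0 <= x t < 1) -> x t @[t --> +oo] --> (0 : R) ->
  (k t)%:R * x t @[t --> +oo] --> c -> (1 - x t) ^+ k t @[t --> +oo] --> expR (- c).
Proof.
move=> x01 x0 kx.
apply: (@squeeze_cvgr _ _ _ _ (fun t => expR (- ((k t)%:R * x t / (1 - x t)))) (fun t => expR (- ((k t)%:R * x t)))).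
- near=> t; have /andP[h0 h1] : 0 <= x t < 1 by near: t.
  have p : 0 < 1 - x t by rewrite subr_gt0.
  apply/andP; split.
    rewrite -mulrA -mulrN expRM_natl; apply: lerXn2r; rewrite ?nnegrE ?expR_ge0 ?(ltW p)//.
    rewrite expRN -[leRHS]invrK lef_pV2 ?posrE ?expR_gt0 ?invr_gt0//.
    have e1 : (1 - x t)^-1 = 1 + x t / (1 - x t) by field; rewrite gt_eqF.
    rewrite [leLHS]e1; exact: expR_ge1Dx.
  rewrite -mulrN expRM_natl; apply: lerXn2r; rewrite ?nnegrE ?expR_ge0 ?(ltW p)//.
  exact: expR_ge1Dx.
- apply: continuous_cvg; first exact: continuous_expR.
  apply: cvgN.
  rewrite -[X in _ --> X](divr1 c); apply: cvgM => //.
  have := oner_neq0 R => o; apply: cvgV => //.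
  by rewrite -[X in _ --> X](subr0 1); apply: cvgB => //; exact: cvg_cst.
- by apply: continuous_cvg; [exact: continuous_expR|exact: cvgN].
Unshelve. all: by end_near. Qed.

Let phi_le1 l : 0 <= l -> phi l <= 1.
Proof.
move=> l0; rewrite -lee_fin -phiE// -[leRHS](integral_prob_cst mu).
apply: lower_integral_le => e; first exact: expR_ge0.
by rewrite -expR0 ler_expR oppr_le0 mulr_ge0.
Qed.

Lemma phi_block_cvg eta s : 0 < eta -> 0 <= s ->
  phi (s / t) ^+ nblock eta t @[t --> +oo] --> expR (- (eta * (Gam * s `^ alpha))).
Proof.
move=> eta0; rewrite le_eqVlt => /predU1P[<-|s0].
  rewrite powR0 ?gt_eqF// !mulr0 oppr0 expR0.
  have -> : (fun t => phi (0 / t) ^+ nblock eta t) = fun=> 1.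
    apply/funext => t; rewrite mul0r (_ : phi 0 = 1) ?expr1n//.
    have := phiE (lexx 0); under eq_integral do rewrite mul0r oppr0 expR0.
    by rewrite integral_prob_cst => -[].
  exact: cvg_cst.
have c := phi_exponent s0.
rewrite (_ : (fun t => _) = (fun t => (1 - (1 - phi (s / t))) ^+ nblock eta t)); last first.
  by apply/funext => t; rewrite opprB addrC subrK.
have x0 : 1 - phi (s / t) @[t --> +oo] --> (0 : R).
  rewrite (_ : (fun t => _) = (fun t => (1 - phi (s / t)) / tl t * tl t)); last first.
    by apply/funext => t; rewrite mulfVK// gt_eqF.
  by rewrite -[X in _ --> X](mulr0 (Gam * s `^ alpha)); apply: cvgM.
apply: (@pow_exp_cvg (fun t => 1 - phi (s / t))) => //.
  near=> t; have t0 : 0 < t by near: t; apply: nbhs_pinfty_gt; rewrite num_real.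
  rewrite subr_ge0 phi_le1 ?divr_ge0 ?(ltW s0) ?(ltW t0)//=.
  by near: t; have /cvgr_lt := x0; apply.
have q0 : (nblock eta t)%:R * tl t @[t --> +oo] --> eta.
  apply: (@squeeze_cvgr _ _ _ _ (fun=> eta) (fun t => eta + tl t)).
  - by apply: nearW => t; have /andP[/ltW -> ->] := nblock_bounds t eta0.
  - exact: cvg_cst.
  - by rewrite -[X in _ --> X]addr0; apply: cvgD => //; exact: cvg_cst.
rewrite (_ : (fun t => _) = (fun t => ((nblock eta t)%:R * tl t) * ((1 - phi (s / t)) / tl t))); last first.
  by apply/funext => t; field; rewrite gt_eqF.
exact: cvgM.
Unshelve. all: by end_near. Qed.

(** The product over blocks is unfolded into one product over steps, step [k] receiving the exponent
    of its block [k %/ q]; independence makes the mixed moment a product of Laplace transforms. *)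
Lemma block_moments N eta (s : 'I_N -> nat) : 0 < eta ->
  Exp P (fun w => \prod_i @block_coord N eta t w i ^+ s i) @[t --> +oo] -->
  \prod_i expR (- (eta * (Gam * (s i)%:R `^ alpha))).
Proof.
move=> eta0.
pose s' (i : nat) : nat := if insub i is Some j then s j else 0%N.
have s'E (i : 'I_N) : s' i = s i by rewrite /s' valK.
have key t : 0 < t -> Exp P (fun w => \prod_i @block_coord N eta t w i ^+ s i) =
    \prod_(i < N) phi ((s i)%:R / t) ^+ nblock eta t.
  move=> t0; set q := nblock eta t.
  have q0 : (0 < q)%N by [].
  have := @past_integral_prod _ _ _ P _ _ mu Th C iid 0 (N * q) (fun=> 1)
    (fun k e => expR (- ((s' (k %/ q)%N)%:R / t * sz e))) (fun k => phi ((s' (k %/ q)%N)%:R / t)).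
  move=> /(_ _ _ _ _ _) h; rewrite /Exp [X in fine X = _](_ : _ = (\int[P]_w (1 * \prod_(k < N * q)
     expR (- ((s' (k %/ q)%N)%:R / t * sz (Th (0 + k)%N w))))%:E)%E); last first.
    apply: eq_integral => w _; rewrite mul1r; congr EFin.
    rewrite (big_block (fun k => expR (- ((s' (k %/ q)%N)%:R / t * sz (Th (0 + k)%N w))))).
    apply: eq_bigr => i _; rewrite /block_coord -expRM_natl -/q.
    have -> : walk Th sz (i.+1 * q) w - walk Th sz (i * q) w = \sum_(r < q) sz (Th (i * q + r)%N w).
      by rewrite /walk mulSnr big_split_ord /= addrAC subrr add0r.
    rewrite -expR_sum; congr expR; rewrite mulr_suml -sumrN mulr_sumr; apply: eq_bigr => r _.
    by rewrite divnMDl// divn_small// addn0 s'E add0n; field; rewrite gt_eqF.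
  rewrite h => //.
  - rewrite integral_prob_cst mul1e /= (big_block (fun k => phi ((s' (k %/ q)%N)%:R / t))).
    apply: eq_bigr => i _; rewrite -(card_ord q) -prodr_const card_ord; apply: eq_bigr => r _.
    by rewrite divnMDl// divn_small// addn0 s'E.
  - move=> k; apply: measurableT_comp => //; apply: measurableT_comp => //.
    by apply: measurable_funM => //; exact: measurable_cst.
  - by move=> k; apply: phiE; rewrite divr_ge0// ltW.
suff : \prod_(i < N) phi ((s i)%:R / t) ^+ nblock eta t @[t --> +oo] -->
    \prod_i expR (- (eta * (Gam * (s i)%:R `^ alpha))).
  apply: cvg_trans; apply: near_eq_cvg.
  by near=> t; rewrite key//; near: t; apply: nbhs_pinfty_gt; rewrite num_real.
apply: cvg_big => //.
  by move=> [x y]; exact: mul_continuous.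
by move=> i _; exact: phi_block_cvg.
Unshelve. all: by end_near. Qed.

End block_moments.

(** * Stieltjes integrals against the inverse of a path *)

Lemma LS_ocitv {R : realType} (F : cumulative R R) (a b : R) : a <= b ->
  lebesgue_stieltjes_measure F `]a, b]%classic = (F b - F a)%:E.
Proof.
move=> ab; rewrite /lebesgue_stieltjes_measure /= /measure_extension /= measurable_mu_extE; last exact: is_ocitv.
exact: wlength_itv_bnd.
Qed.

Section good_path.
Context {R : realType}.
Variables (f : R -> R) (g : R).

(** The path spends time at most [g ^+ j] in a window of length [2 ^- j]. This is the continuous
    counterpart of the bound on the number of points of the walk, and amounts to a Holder bound for
    the inverse. The second half bounds the time needed to exceed level [n]. *)
Definition good_path (n : nat) : Prop :=
  (forall j y a b, (n <= j)%N -> 0 <= y <= n%:R -> 0 <= a -> a <= b ->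
     y - 2 ^- j < f a -> f b <= y -> b - a <= g ^+ j) /\
  (forall b, 0 <= b -> f b <= n%:R -> b <= (n * 2 ^ n).+1%:R * g ^+ n).

Hypothesis f00 : f 0 = 0.
Hypothesis fmono : forall s t, 0 <= s -> s <= t -> f s <= f t.
Hypothesis g01 : 0 < g < 1.
Hypothesis good_ex : exists n1, forall n, (n1 <= n)%N -> good_path n.

Definition path_inv (y : R) : R := inf [set t | 0 <= t /\ y < f t].
Local Notation V := path_inv.

Lemma path_unbounded y : exists2 t, 0 <= t & y < f t.
Proof.
have [n1 hn1] := good_ex; pose n := maxn n1 (Num.truncn y).+1.
have yn : y < n%:R.
  by apply: (lt_le_trans (truncnS_gt y)); rewrite ler_nat leq_maxr.
have [_ h] := hn1 n (leq_maxl _ _).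
pose t := (n * 2 ^ n).+1%:R * g ^+ n + 1.
have gn : 0 <= (n * 2 ^ n).+1%:R * g ^+ n by rewrite mulr_ge0// exprn_ge0//; case/andP: g01 => /ltW.
exists t; first by rewrite /t; lra.
rewrite ltNge; apply/negP => fy.
have := h t _ _; rewrite /t => /(_ _ _) h'.
suff : (n * 2 ^ n).+1%:R * g ^+ n + 1 <= (n * 2 ^ n).+1%:R * g ^+ n by lra.
by apply: h'; [lra|apply: (le_trans fy); exact: ltW].
Qed.

Let has_infV y : has_inf [set t | 0 <= t /\ y < f t].
Proof.
split; first by have [t t0 ty] := path_unbounded y; exists t.
by exists 0 => t [].
Qed.

Lemma path_inv_ge0 y : 0 <= V y.
Proof. by apply: lb_le_inf; [case: (has_infV y)|move=> t []]. Qed.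

Lemma path_inv_le y s : 0 <= s -> y < f s -> V y <= s.
Proof. by move=> s0 ys; apply: ge_inf; [case: (has_infV y)|]. Qed.

Lemma path_inv_ge y s : 0 <= s -> f s <= y -> s <= V y.
Proof.
move=> s0 sy; apply: lb_le_inf; first by case: (has_infV y).
move=> t [t0 yt]; rewrite leNgt; apply/negP => ts.
by have := fmono t0 (ltW ts); lra.
Qed.

Lemma path_inv_lt y s : V y < s -> y < f s.
Proof.
move=> ys; have s0 : 0 <= s by apply: le_trans (path_inv_ge0 y) (ltW ys).
by rewrite ltNge; apply/negP => /(path_inv_ge s0); lra.
Qed.

Lemma path_inv_gt y s : 0 <= s -> s < V y -> f s <= y.
Proof. by move=> s0 sy; rewrite leNgt; apply/negP => /(path_inv_le s0); lra. Qed.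

Lemma path_inv_mono : {homo V : x y / x <= y}.
Proof.
move=> x y xy; rewrite leNgt; apply/negP => h.
have := path_inv_ge0 y; set s := (V x + V y) / 2 => Vy0.
have s0 : 0 <= s by rewrite /s; lra.
have : f s <= x by apply: path_inv_gt => //; rewrite /s; lra.
have : y < f s by apply: path_inv_lt; rewrite /s; lra.
lra.
Qed.

Lemma path_inv_neg y : y < 0 -> V y = 0.
Proof.
by move=> y0; apply: le_anti; rewrite path_inv_ge0 andbT path_inv_le// f00.
Qed.

Lemma path_inv_holder n j c e : good_path n -> (n <= j)%N -> c <= e -> e <= n%:R ->
  e - c <= 2 ^- j -> V e - V c <= g ^+ j.
Proof.
move=> [gd _] nj ce en ecj; have gj : 0 < g ^+ j by rewrite exprn_gt0//; case/andP: g01.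
case: (ltP e 0) => e0; first by rewrite !path_inv_neg ?subrr ?(ltW gj)//; lra.
rewrite leNgt; apply/negP => h.
(* The inverse is an infimum, so the path is controlled only strictly inside [[V c, V e]]. Giving up
   a third of the excess at each end leaves a time interval still longer than [g ^+ j]. *)
pose del := (V e - V c - g ^+ j) / 3; have del0 : 0 < del by rewrite /del; lra.
have Vc0 := path_inv_ge0 c.
have h1 : c < f (V c + del) by apply: path_inv_lt; lra.
have h2 : f (V e - del) <= e by apply: path_inv_gt; rewrite /del; lra.
have := gd j e (V c + del) (V e - del) nj; rewrite e0 en => /(_ isT).
have a0 : 0 <= V c + del by lra.
have ab : V c + del <= V e - del by rewrite /del; lra.
have w : e - 2 ^- j < f (V c + del) by lra.
by move=> /(_ a0 ab w h2); rewrite /del; lra.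
Qed.

(** A flat stretch would stay in windows of every length, hence last at most [g ^+ j] for all large
    [j]. *)
Lemma path_strict a b : 0 <= a -> a < b -> f a < f b.
Proof.
move=> a0 ab; have [n1 hn1] := good_ex.
rewrite ltNge; apply/negP => ba.
pose n := maxn n1 (Num.truncn (f a)).+1.
have an : f a <= n%:R.
  by apply: (le_trans (ltW (truncnS_gt _))); rewrite ler_nat leq_maxr.
have [gd _] := hn1 n (leq_maxl _ _).
have fa0 : 0 <= f a by rewrite -f00; exact: fmono.
have key j : (n <= j)%N -> b - a <= g ^+ j.
  move=> nj; apply: (gd j (f a)) => //; [by rewrite fa0 an|exact: ltW|].
  by rewrite gtrBl invr_gt0 exprn_gt0.
have c : g ^+ j @[j --> \oo] --> (0 : R).
  by apply: cvg_expr; case/andP: g01 => g0 g1; rewrite gtr0_norm.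
have /cvgrPdist_lt /(_ (b - a)) := c; rewrite subr_gt0 => /(_ ab) [m _ hm].
have := hm (maxn n m) (leq_maxr _ _); rewrite /= sub0r normrN ger0_norm; last first.
  by rewrite exprn_ge0//; case/andP: g01 => /ltW.
by have := key _ (leq_maxl n m); lra.
Qed.

Lemma path_invK s : 0 <= s -> V (f s) = s.
Proof.
move=> s0; apply: le_anti; rewrite path_inv_ge// andbT.
apply/ler_addgt0Pr => e e0; apply: path_inv_le; first lra.
by apply: path_strict => //; lra.
Qed.

Lemma path_inv_continuous : continuous V.
Proof.
move=> x; have [n1 hn1] := good_ex.
pose n := maxn n1 (Num.truncn (x + 1)).+1.
have xn : x + 1 <= n%:R.
  by apply: (le_trans (ltW (truncnS_gt _))); rewrite ler_nat leq_maxr.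
have gd := hn1 n (leq_maxl _ _).
have cg : g ^+ j @[j --> \oo] --> (0 : R).
  by apply: cvg_expr; case/andP: g01 => g0 g1; rewrite gtr0_norm.
apply/cvgrPdist_le => e e0.
have /cvgrPdist_lt /(_ e e0) [m _ hm] := cg.
pose j := maxn n m.
have gj : g ^+ j <= e.
  have := hm j (leq_maxr _ _); rewrite /= sub0r normrN ger0_norm; last first.
    by rewrite exprn_ge0//; case/andP: g01 => /ltW.
  exact: ltW.
have j0 : 0 < 2 ^- j :> R by rewrite invr_gt0 exprn_gt0.
have j1 : 2 ^- j <= 1 :> R by rewrite invf_le1 ?exprn_gt0// exprn_ege1// ler1n.
apply/nbhs_ballP; exists (2 ^- j) => //= y; rewrite /ball /= => /ltW xy.
apply: le_trans gj.
move: xy; rewrite ler_norml => /andP[h1 h2].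
case: (leP x y) => xy.
  rewrite distrC ger0_norm ?subr_ge0 ?path_inv_mono//.
  by apply: (path_inv_holder gd) => //; [exact: leq_maxl|lra|lra].
rewrite ger0_norm ?subr_ge0 ?path_inv_mono//; last exact: ltW.
by apply: (path_inv_holder gd) => //; [exact: leq_maxl|exact: ltW|lra].
Qed.

Section stieltjes.
Variable lam : {measure set (measurableTypeR R) -> \bar R}.
Hypothesis lamV : forall c e : R, c <= e -> lam (`]c, e]%classic) = (V e - V c)%:E.
Local Notation mT := (measurableTypeR R).

Lemma integral_block (F : mT -> R) (c e lo hi : R) : c <= e -> measurable_fun setT F ->
  (forall y, 0 <= F y) -> (forall y, c < y <= e -> lo <= F y <= hi) ->
  ((lo * (V e - V c))%:E <= \int[lam]_(y in `]c, e]) (F y)%:E <= (hi * (V e - V c))%:E)%E.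
Proof.
move=> ce mF F0 lohi.
have V0 : 0 <= V e - V c by rewrite subr_ge0 path_inv_mono.
have mD : measurable (`]c, e]%classic : set mT) by exact: measurable_itv.
have mF' : measurable_fun (`]c, e]%classic : set mT) (fun y => (F y)%:E).
  by apply/measurable_EFinP; exact: measurable_funTS.
apply/andP; split.
  apply: (@le_trans _ _ (Num.max lo 0 * (V e - V c))%:E).
    by rewrite lee_fin ler_wpM2r// le_max lexx.
  rewrite EFinM -lamV// -integral_cst//; apply: ge0_le_integral => //.
  - by move=> y _; rewrite lee_fin le_max lexx orbT.
  - move=> y /=; rewrite in_itv /= => /lohi /andP[h _].
    by rewrite lee_fin ge_max h F0.
case: (ltP c e) => [ce'|ec]; last first.
  have -> : e = c by lra.
  by rewrite set_itvoc0 ?integral_set0 ?subrr ?mulr0.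
have hi0 : 0 <= hi.
  by have := lohi e; rewrite ce' lexx => /(_ isT) /andP[_]; apply: le_trans; exact: F0.
rewrite EFinM -lamV// -integral_cst//; apply: ge0_le_integral => //.
- by move=> y _; rewrite lee_fin.
- move=> y /=; rewrite in_itv /= => /lohi /andP[_ h].
  by rewrite lee_fin.
Qed.

(** The partition points are the values [f (r * eta)]: since [V] inverts [f] on them, every cell has
    mass exactly [eta]. The Lipschitz errors telescope as in [riemann_block]. *)
Lemma integral_riemann (kp : R -> R) (L : R) (n N : nat) (eta u : R) (pos : nat -> R) :
  (forall r, pos r = Num.max (u - f (r%:R * eta)) 0) -> 0 <= L -> 0 < eta ->
  measurable_fun setT kp -> (forall v, 0 <= kp v) -> (forall v, v <= 0 -> kp v = 0) ->
  (forall v v', v <= n%:R -> v' <= n%:R -> `|kp v - kp v'| <= L * `|v - v'|) ->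
  0 <= u <= n%:R ->
  ((eta * \sum_(r < N) kp (u - f (r%:R * eta)) - eta * L * (pos 0%N - pos N))%:E
   <= \int[lam]_(y in `]0%R, f (N%:R * eta)]) (kp (u - y))%:E <=
  (eta * \sum_(r < N) kp (u - f (r%:R * eta)) + eta * L * (pos 0%N - pos N))%:E)%E.
Proof.
move=> posE L0 eta0 mkp kp_ge0 kp0 kpL /andP[u0 un].
have mF : measurable_fun setT (fun y : mT => kp (u - y)).
  by apply: measurableT_comp => //; apply: measurable_funB => //; exact: measurable_cst.
have f_ge0 s : 0 <= s -> 0 <= f s by move=> s0; rewrite -f00; exact: fmono.
have re0 (r : nat) : 0 <= r%:R * eta by rewrite mulr_ge0// ltW.
elim: N => [|N IH].
  rewrite big_ord0 mulr0 subrr mulr0 subr0 addr0 mul0r f00 set_itvoc0 ?integral_set0 ?lexx//.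
have re1 : N%:R * eta <= N.+1%:R * eta by rewrite ler_wpM2r ?(ltW eta0)// ler_nat.
set b := f (N%:R * eta) in IH *; set b' := f (N.+1%:R * eta).
have bb' : b <= b' by exact: fmono.
have b0 : 0 <= b by exact: f_ge0.
have -> : `]0, b']%classic = `]0, b]%classic `|` `]b, b']%classic :> set mT.
  rewrite -itv_bndbnd_setU// bnd_simp//.
rewrite ge0_integral_setU//=; first last.
- rewrite /disj_set; apply/eqP; rewrite -subset0 => y /=; rewrite !in_itv /=.
  by move=> [/andP[_ h1] /andP[h2 _]]; move: h1; rewrite leNgt h2.
- by move=> y _; rewrite lee_fin.
- by apply/measurable_EFinP; exact: measurable_funTS.
have Vbb : V b' - V b = eta.
  by rewrite /b /b' !path_invK// -mulrBl -natrB// subSnn mul1r.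
have kpm v : kp v = kp (Num.max v 0) by case: (leP v 0) => // v0; rewrite !kp0.
have pd : 0 <= pos N - pos N.+1.
  rewrite subr_ge0 !posE -/b -/b' ge_max !le_max lexx orbT andbT lerD2l lerN2 bb' //.
have blk := @integral_block (fun y : mT => kp (u - y)) b b' (kp (u - b) - L * (pos N - pos N.+1))
  (kp (u - b) + L * (pos N - pos N.+1)) bb' mF (fun y => kp_ge0 _).
have {blk} : (((kp (u - b) - L * (pos N - pos N.+1)) * eta)%:E <=
    \int[lam]_(y in `]b, b']) (kp (u - y))%:E <= ((kp (u - b) + L * (pos N - pos N.+1)) * eta)%:E)%E.
  rewrite -{1 2}Vbb; apply: blk => y /andP[by1 yb'].
  suff : `|kp (u - y) - kp (u - b)| <= L * (pos N - pos N.+1).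
    by rewrite ler_norml => /andP[? ?]; apply/andP; split; lra.
  rewrite kpm [kp (u - b)]kpm.
  have bd x : 0 <= x -> Num.max (u - x) 0 <= n%:R by move=> x0; rewrite ge_max ler0n andbT; lra.
  apply: (le_trans (kpL _ _ (bd y _) (bd b _))) => //; first lra.
  apply: ler_wpM2l => //; rewrite distrC ger0_norm.
    by rewrite !posE lerD2l lerN2 -/b' ge_max !le_max lexx orbT andbT lerD2l lerN2 yb'.
  by rewrite subr_ge0 ge_max !le_max lexx orbT andbT lerD2l lerN2 (ltW by1).
move=> /andP[l1 l2]; have /andP[i1 i2] := IH.
rewrite big_ord_recr /= -/b.
apply/andP; split.
  apply: le_trans (leeD i1 l1); rewrite -EFinD lee_fin le_eqVlt; apply/orP; left; apply/eqP; ring.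
apply: (le_trans (leeD i2 l2)); rewrite -EFinD lee_fin le_eqVlt; apply/orP; left; apply/eqP; ring.
Qed.

Variables (rho p : R).
Hypothesis p0 : 0 <= p.
Hypothesis prho : - p < rho.
Hypothesis Qg : 2 `^ p * g < 1.

(** The geometric tail, from index [n], of the kernel bound [(2 ^ p) ^ (j + 1)] times the mass
    [g ^+ j] of a window of length [2 ^- j]. *)
Definition near_err n : R := 2 `^ p * (2 `^ p * g) ^+ n / (1 - 2 `^ p * g).

Let Q0 : 0 < 2 `^ p :> R. Proof. by rewrite powR_gt0. Qed.
Let g0 : 0 < g. Proof. by case/andP: g01. Qed.

Let shell n u j (y : mT) : R := (2 `^ p) ^+ (n + j).+1 * \1_(`]u - 2 ^- (n + j), u]%classic : set mT) y.

Let mshell n u j : measurable_fun setT (shell n u j).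
Proof.
apply: measurable_funM; first exact: measurable_cst.
by apply: measurable_indic; exact: measurable_itv.
Qed.

Let shell_ge0 n u j y : 0 <= shell n u j y.
Proof. by rewrite /shell mulr_ge0// exprn_ge0// ltW. Qed.

Let shell_integral n u : good_path n -> 0 < u -> u <= n%:R ->
  (\int[lam]_(y in `]0%R, u]) (\sum_(j <oo) (shell n u j y)%:E) <= (near_err n)%:E)%E.
Proof.
move=> gd u0 un; have mD : measurable (`]0%R, u]%classic : set mT) by exact: measurable_itv.
rewrite integral_nneseries//; last 2 first.
- by move=> j; apply/measurable_EFinP; apply: measurable_funTS; exact: mshell.
- by move=> j y _; rewrite lee_fin shell_ge0.
have term j : (\int[lam]_(y in `]0%R, u]) (shell n u j y)%:E <= (2 `^ p * (2 `^ p * g) ^+ (n + j))%:E)%E.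
  under eq_integral do rewrite EFinM.
  rewrite ge0_integralZl_EFin//; last first.
  by apply/measurable_EFinP; apply: measurable_funTS; apply: measurable_indic; exact: measurable_itv.
  rewrite integral_indic//.
  rewrite (_ : 2 `^ p * (2 `^ p * g) ^+ (n + j) = (2 `^ p) ^+ (n + j).+1 * g ^+ (n + j)); last first.
    by rewrite exprS exprMn mulrA.
  rewrite [leRHS]EFinM; apply: lee_wpmul2l; first by rewrite lee_fin exprn_ge0// ltW.
  have j0 : 0 < 2 ^- (n + j) :> R by rewrite invr_gt0 exprn_gt0.
  apply: (@le_trans _ _ (lam (`]u - 2 ^- (n + j), u]%classic))).
    by apply: le_measure; rewrite ?inE; [apply: measurableI; exact: measurable_itv|exact: measurable_itv|exact: subIsetl].
  rewrite lamV; last by rewrite gerBl ltW.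
  rewrite lee_fin; apply: (path_inv_holder gd) => //; [exact: leq_addr|by rewrite gerBl ltW|].
  by rewrite opprB addrC subrK.
apply: lime_le; first by apply: is_cvg_nneseries => j _ _; apply: integral_ge0 => y _; rewrite lee_fin.
apply: nearW => m.
apply: (@le_trans _ _ (\sum_(0 <= j < m) (2 `^ p * (2 `^ p * g) ^+ (n + j))%:E)%E).
  by apply: lee_sum => j _; exact: term.
rewrite sumEFin lee_fin /near_err -mulr_sumr -mulrA; apply: ler_wpM2l; first exact: ltW.
have Qg0 : 0 <= 2 `^ p * g by apply: mulr_ge0; exact: ltW.
have := @geom_sum_lt1 _ (2 `^ p * g) n (m + n); rewrite Qg Qg0 => /(_ isT).
rewrite -{1}[n]add0n big_addn addnK (eq_bigr (fun j => (2 `^ p * g) ^+ (n + j)))//.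
by move=> j _; rewrite addnC.
Qed.

(** A point whose distance to [u] lies between [2 ^- (j + 1)] and [2 ^- j] is in the window of index
    [j], whose weight dominates both kernels. At [y = u] the power equals [0], or [1] when
    [rho = 0], and every weight is at least [1]. *)
Let near_dom n u y : 0 < y -> y <= u -> u - 2 ^- n < y ->
  (((u - y) `^ rho)%:E <= \sum_(j <oo) (shell n u j y)%:E)%E /\
  ((kap rho n (u - y))%:E <= \sum_(j <oo) (shell n u j y)%:E)%E.
Proof.
move=> y0 yu near_y.
have Q1 : 1 <= 2 `^ p :> R by rewrite -[leLHS](powRr0 2); apply: ler_powR => //; rewrite ler1n.
have term j0 : ((shell n u j0 y)%:E <= \sum_(j <oo) (shell n u j y)%:E)%E.
  apply: (@le_trans _ _ (\sum_(0 <= j < j0.+1) (shell n u j y)%:E)%E).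
    rewrite big_nat_recr//= leeDr//; apply: sume_ge0 => j _; by rewrite lee_fin.
  by apply: nneseries_lim_ge => j _ _; rewrite lee_fin.
have p2 : 0 < 2 ^- n :> R by rewrite invr_gt0 exprn_gt0.
have [j [h1 h2]] : exists j : nat, u - 2 ^- (n + j) < y /\ (y = u \/ 2 ^- (n + j).+1 <= u - y).
  have [->|yu'] := eqVneq y u; first by exists 0%N; rewrite addn0; split; [lra|left].
  have uy : 0 < u - y by rewrite subr_gt0 lt_neqAle yu' yu.
  have uy1 : 1 <= (u - y)^-1.
    rewrite -invr1 lef_pV2 ?posrE//; have : 2 ^- n <= 1 :> R.
      by rewrite invf_le1 ?exprn_gt0// exprn_ege1// ler1n.
    lra.
  have [J /andP[J1 J2]] := dyadic_scale uy1.
  have nJ : (n <= J)%N.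
    rewrite -ltnS -(ltr_eXn2l (x := 2 : R)) ?ltr1n//; apply: lt_trans J2.
    by rewrite -[ltLHS]invrK ltf_pV2 ?posrE//; lra.
  case: (ltP (u - y) (2 ^- J)) => hJ.
    exists (J - n)%N; rewrite subnKC//; split; first lra.
    by right; rewrite -[leRHS]invrK lef_pV2 ?posrE ?exprn_gt0 ?invr_gt0// ltW.
  have e : u - y = 2 ^- J.
    apply: le_anti; rewrite hJ andbT -[leLHS]invrK lef_pV2 ?posrE ?exprn_gt0 ?invr_gt0//.
  have nJ' : (n < J)%N.
    rewrite ltn_neqAle nJ andbT; apply/eqP => nE; move: near_y; rewrite nE; lra.
  case: J J1 J2 nJ hJ e nJ' => [//|J] J1 J2 nJ hJ e nJ'.
  exists (J - n)%N; rewrite subnKC//; split; last by right; rewrite e.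
  suff : 2 ^- J.+1 < 2 ^- J :> R by lra.
  by rewrite ltf_pV2 ?posrE ?exprn_gt0// ltr_eXn2l ?ltr1n.
have shE : shell n u j y = (2 `^ p) ^+ (n + j).+1.
  by rewrite /shell indicE mem_set ?mulr1//= in_itv /= h1 yu.
have Qj : 1 <= (2 `^ p) ^+ (n + j).+1 :> R by exact: exprn_ege1.
split; apply: le_trans (term j); rewrite lee_fin shE.
  case: h2 => [->|h2].
    rewrite subrr; have [->|r0] := eqVneq rho 0; first by rewrite powRr0.
    by rewrite powR0// (le_trans ler01).
  have m0 : 0 < 2 ^- (n + j).+1 :> R by rewrite invr_gt0 exprn_gt0.
  have uy : 0 < u - y by exact: lt_le_trans h2.
  have uy1 : u - y <= 1.
    have : 2 ^- n <= 1 :> R by rewrite invf_le1 ?exprn_gt0// exprn_ege1// ler1n.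
    lra.
  apply: (@le_trans _ _ ((u - y) `^ (- p))).
    by apply: ger_powR; [rewrite uy uy1|exact: ltW].
  have := @powR_near _ p 1 (u - y) (n + j).+1 p0 ltr01; rewrite divr1; exact.
apply: (@le_trans _ _ ((2 `^ p) ^+ n)); first by apply: kap_near => //; lra.
by apply: ler_weXn2l => //; rewrite -addnS leq_addr.
Qed.

Let mkap n : measurable_fun setT (kap rho n : mT -> R).
Proof.
apply: measurable_funM.
  apply: measurable_minr; last exact: measurable_cst.
  apply: measurable_funM; last exact: measurable_cst.
  by apply: measurable_maxr => //; exact: measurable_cst.
apply: (@measurableT_comp _ _ _ _ _ _ (fun x => x `^ rho)); first exact: measurable_powR.
by apply: measurable_maxr => //; exact: measurable_cst.
Qed.

(** The power and its truncation differ only within [2 ^- n] of [u], where the sum of shells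
    dominates both, so their integrals differ by at most [near_err]. The truncated kernel vanishes
    beyond [u] and is Lipschitz, which leaves a Riemann sum. *)
Lemma stieltjes_approx n N (eta u L : R) : good_path n -> 0 < u -> u <= n%:R -> 0 < eta -> 0 <= L ->
  (forall v v', v <= n%:R -> v' <= n%:R -> `|kap rho n v - kap rho n v'| <= L * `|v - v'|) ->
  u <= f (N%:R * eta) ->
  `|fine (\int[lam]_(y in `[0%R, u]) ((u - y) `^ rho)%:E)%E -
    eta * \sum_(r < N) kap rho n (u - f (r%:R * eta))| <= near_err n + eta * L * u.
Proof.
move=> gd u0 un eta0 L0 kL uN.
have mD : measurable (`]0%R, u]%classic : set mT) by exact: measurable_itv.
have mp : measurable_fun setT (fun y : mT => (u - y) `^ rho).
  apply: (@measurableT_comp _ _ _ _ _ _ (fun x => x `^ rho)); first exact: measurable_powR.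
  by apply: measurable_funB => //; exact: measurable_cst.
have mk : measurable_fun setT (fun y : mT => kap rho n (u - y)).
  by apply: (measurableT_comp (mkap n)); apply: measurable_funB => //; exact: measurable_cst.
(* The left endpoint carries no mass, because [V] vanishes on the negative half-line and at [0]. *)
have -> : (\int[lam]_(y in `[0%R, u]) ((u - y) `^ rho)%:E = \int[lam]_(y in `]0%R, u]) ((u - y) `^ rho)%:E)%E.
  have m0 : measurable ([set (0 : R)] : set mT) by exact: measurable_set1.
  have m1 : measurable (`[0%R, u]%classic : set mT) by exact: measurable_itv.
  have m2 : measurable_fun (`[0%R, u]%classic : set mT) (fun y : mT => ((u - y) `^ rho)%:E).
    by apply/measurable_EFinP; exact: measurable_funTS.
  have l0 : lam [set (0 : R)] = 0%E.
    apply/eqP; rewrite eq_le measure_ge0 andbT.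
    have V00 : V 0 = 0 by rewrite -[in V 0]f00 path_invK.
    have <- : lam (`](-1), 0]%classic) = 0%E.
      by rewrite lamV ?lerN10// V00 path_inv_neg ?ltrN10// subrr.
    apply: le_measure; rewrite ?inE; [exact: m0|exact: measurable_itv|].
    by move=> y ->; rewrite /= in_itv /= lexx ltrN10.
  have n0 (y : mT) : `[0%R, u]%classic y -> (0 <= ((u - y) `^ rho)%:E)%E by rewrite lee_fin powR_ge0.
  rewrite (ge0_negligible_integral m0 m1 m2 n0 l0).
  congr (integral _ _ _); apply/seteqP; split => y /=; rewrite !in_itv /=.
    by move=> [/andP[h1 h2] /eqP h3]; rewrite h2 andbT lt_neqAle h1 eq_sym h3.
  by move=> /andP[h1 h2]; rewrite (ltW h1) h2; split => // h3; rewrite h3 ltxx in h1.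
set A := (\int[lam]_(y in _) _)%E; pose K := (\int[lam]_(y in `]0%R, u]) (kap rho n (u - y))%:E)%E.
pose S := (\int[lam]_(y in `]0%R, u]) (\sum_(j <oo) (shell n u j y)%:E))%E.
have S0 y : (0 <= \sum_(j <oo) (shell n u j y)%:E)%E by apply: nneseries_ge0 => j _ _; rewrite lee_fin.
have mS : measurable_fun (`]0%R, u]%classic : set mT) (fun y => \sum_(j <oo) (shell n u j y)%:E)%E.
  apply: ge0_emeasurable_sum; first by move=> j y _ _; rewrite lee_fin.
  by move=> j _; apply/measurable_EFinP; exact: measurable_funTS.
have mp' : measurable_fun (`]0%R, u]%classic : set mT) (fun y : mT => ((u - y) `^ rho)%:E).
  by apply/measurable_EFinP; exact: measurable_funTS.
have mk' : measurable_fun (`]0%R, u]%classic : set mT) (fun y : mT => (kap rho n (u - y))%:E).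
  by apply/measurable_EFinP; exact: measurable_funTS.
have dom y : 0 < y <= u -> (((u - y) `^ rho)%:E <= (kap rho n (u - y))%:E + \sum_(j <oo) (shell n u j y)%:E)%E /\
    ((kap rho n (u - y))%:E <= ((u - y) `^ rho)%:E + \sum_(j <oo) (shell n u j y)%:E)%E.
  move=> /andP[y0 yu]; case: (ltP (u - 2 ^- n) y) => hy.
    have [h1 h2] := near_dom y0 yu hy.
    split; [apply: (le_trans h1)|apply: (le_trans h2)]; rewrite leeDr// lee_fin ?kap_ge0 ?powR_ge0//.
  rewrite kap_far; last lra.
  by split; rewrite leeDl.
have A_le : (A <= K + S)%E.
  rewrite /K /S -ge0_integralD//; try by move=> y _; rewrite lee_fin kap_ge0.
  apply: ge0_le_integral => //.
  - by move=> y _; rewrite lee_fin powR_ge0.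
  - exact: emeasurable_funD.
  - by move=> y /=; rewrite in_itv /= => /dom[].
have K_le : (K <= A + S)%E.
  rewrite /A /S -ge0_integralD//; try by move=> y _; rewrite lee_fin powR_ge0.
  apply: ge0_le_integral => //.
  - by move=> y _; rewrite lee_fin kap_ge0.
  - exact: emeasurable_funD.
  - by move=> y /=; rewrite in_itv /= => /dom[].
have S_le : (S <= (near_err n)%:E)%E by exact: shell_integral.
have /= := @integral_riemann (kap rho n) L n N eta u _ (fun=> erefl) L0 eta0 (mkap n) (kap_ge0 rho n) (kap_le0 rho n) kL.
rewrite (ltW u0) un => /(_ isT).
have -> : (\int[lam]_(y in `]0%R, f (N%:R * eta)]) (kap rho n (u - y))%:E = K)%E.
  have -> : `]0, f (N%:R * eta)]%classic = `]0, u]%classic `|` `]u, f (N%:R * eta)]%classic :> set mT.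
    by rewrite -itv_bndbnd_setU// bnd_simp// ltW.
  rewrite ge0_integral_setU//=; first last.
  - rewrite /disj_set; apply/eqP; rewrite -subset0 => y /=; rewrite !in_itv /=.
    by move=> [/andP[_ h1] /andP[h2 _]]; move: h1; rewrite leNgt h2.
  - by move=> y _; rewrite lee_fin kap_ge0.
  - by apply/measurable_EFinP; exact: measurable_funTS.
  rewrite [X in (_ + X)%E]integral0_eq ?adde0// => y /=; rewrite in_itv /= => /andP[h1 _].
  by rewrite kap_le0// subr_le0 ltW.
set X := eta * \sum_(r < N) _; rewrite mul0r f00 subr0.
rewrite (_ : Num.max u 0 = u); last by apply/max_idPl; exact: ltW.
rewrite (_ : Num.max (u - f (N%:R * eta)) 0 = 0); last by apply/max_idPr; rewrite subr_le0.
rewrite subr0 => /andP[K1 K2].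
have A0 : (0 <= A)%E by apply: integral_ge0 => y _; rewrite lee_fin powR_ge0.
have K0 : (0 <= K)%E by apply: integral_ge0 => y _; rewrite lee_fin kap_ge0.
have Kf : (K \is a fin_num)%E by rewrite ge0_fin_numE// (le_lt_trans K2)// ltry.
have Sf : (S \is a fin_num)%E.
  by rewrite ge0_fin_numE ?(le_lt_trans S_le) ?ltry//; exact: integral_ge0.
have Af : (A \is a fin_num)%E by rewrite ge0_fin_numE// (le_lt_trans A_le)// -(fineK Kf) -(fineK Sf) -EFinD ltry.
move: A_le K_le S_le K1 K2; rewrite -(fineK Kf) -(fineK Sf) -(fineK Af) -!EFinD !lee_fin => h1 h2 h3 h4 h5.
by rewrite ler_norml; apply/andP; split; lra.
Qed.

End stieltjes.

Section stieltjes_process.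
Variables (rho p : R).
Hypothesis p0 : 0 <= p.
Hypothesis prho : - p < rho.
Hypothesis Qg : 2 `^ p * g < 1.
Let J u := fine (LS_integral V (fun y => powR (u - y) rho) `[0, u]).

Lemma LS_approx n N (eta u L : R) : good_path n -> 0 < u -> u <= n%:R -> 0 < eta -> 0 <= L ->
  (forall v v', v <= n%:R -> v' <= n%:R -> `|kap rho n v - kap rho n v'| <= L * `|v - v'|) ->
  u <= f (N%:R * eta) ->
  `|J u - eta * \sum_(r < N) kap rho n (u - f (r%:R * eta))| <= near_err p n + eta * L * u.
Proof.
move=> gd u0 un eta0 L0 kL uN; rewrite /J /LS_integral; case: pselect => [pf|[]]; last first.
  split; first exact: path_inv_mono.
  by move=> x; apply: cvg_at_right_filter; exact: path_inv_continuous.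
apply: stieltjes_approx => // c e ce.
exact: LS_ocitv.
Qed.

Lemma near_err_cvg : near_err p n @[n --> \oo] --> (0 : R).
Proof.
have Qg0 : 0 <= 2 `^ p * g by apply: mulr_ge0; [exact: powR_ge0|case/andP: g01 => /ltW].
rewrite /near_err (_ : (fun n => _) = fun n => (2 `^ p / (1 - 2 `^ p * g)) * (2 `^ p * g) ^+ n); last first.
  by apply/funext => n; ring.
rewrite -[X in _ --> X](mulr0 (2 `^ p / (1 - 2 `^ p * g))); apply: cvgMr; apply: cvg_expr.
by rewrite ger0_norm.
Qed.

(** Locally uniformly in [u], the integral is a limit of Lipschitz functions of [u], namely the sums
    of [LS_approx]. *)
Lemma LS_continuous u0 : 0 < u0 -> {for u0, continuous J}.
Proof.
move=> u00; apply/cvgrPdist_le => e e0.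
have [n1 hn1] := good_ex.
have e8 : 0 < e / 8 by rewrite divr_gt0.
have /cvgrPdist_lt /(_ _ e8) [n2 _ hn2] := near_err_cvg.
pose n := maxn (maxn n1 n2) (Num.truncn (u0 + 1)).+1.
have un : u0 + 1 <= n%:R.
  by apply: (le_trans (ltW (truncnS_gt _))); rewrite ler_nat leq_maxr.
have gd : good_path n by apply: hn1; rewrite leq_max leq_maxl.
have ne : near_err p n <= e / 8.
  have := hn2 n; rewrite /= leq_max leq_maxr => /(_ isT); rewrite sub0r normrN ltr_norml => /andP[_].
  exact: ltW.
have [L L0 kL] := @kap_lip _ rho n n%:R (ler0n _ _).
have Ln : 0 < L * n%:R + 1 by rewrite ltr_wpDl// mulr_ge0.
pose eta := e / 8 / (L * n%:R + 1); have eta0 : 0 < eta by rewrite divr_gt0.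
have etaL u : 0 <= u <= n%:R -> eta * L * u <= e / 8.
  move=> /andP[uu0 uun]; have h1 := ler_wpM2l L0 uun; have h0 := mulr_ge0 L0 uu0.
  rewrite (_ : eta * L * u = e / 8 * (L * u / (L * n%:R + 1))); last by rewrite /eta; field; rewrite gt_eqF.
  by rewrite ler_piMr ?(ltW e8)// ler_pdivrMr// mul1r; lra.
clearbody eta.
have [t t0 ft] := path_unbounded n%:R.
pose N := (Num.truncn (t / eta)).+1.
have fN : n%:R <= f (N%:R * eta).
  apply: (le_trans (ltW ft)); apply: fmono => //.
  by rewrite -ler_pdivrMr// ltW// truncnS_gt.
pose S u := eta * \sum_(r < N) kap rho n (u - f (r%:R * eta)).
have JS u : 0 < u -> u <= n%:R -> `|J u - S u| <= e / 4.
  move=> uu0 uun; have := @LS_approx n N eta u L gd uu0 uun eta0 L0 kL (le_trans uun fN).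
  have := etaL u; rewrite (ltW uu0) uun => /(_ isT); rewrite /S; lra.
pose M := eta * N%:R * L; have M0 : 0 <= M.
  by apply: mulr_ge0 => //; apply: mulr_ge0 => //; exact: ltW.
have f0 (r : nat) : 0 <= f (r%:R * eta).
  have re : 0 <= r%:R * eta by rewrite mulr_ge0// ltW.
  by have := fmono (lexx 0) re; rewrite f00.
have SL u u' : u <= n%:R -> u' <= n%:R -> `|S u - S u'| <= M * `|u - u'|.
  move=> uun u'n; rewrite /S -mulrBr normrM gtr0_norm// /M -!mulrA; apply: ler_wpM2l; first exact: ltW.
  rewrite -sumrB; apply: (le_trans (ler_norm_sum _ _ _)).
  have -> : N%:R * (L * `|u - u'|) = \sum_(r < N) (L * `|u - u'|) by rewrite sumr_const card_ord mulr_natl.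
  apply: ler_sum => r _; have := f0 r => fr.
  apply: (le_trans (kL _ _ _ _)); [lra|lra|].
  by rewrite (_ : u - f (r%:R * eta) - (u' - f (r%:R * eta)) = u - u')//; ring.
have M1 : 0 < M + 1 by lra.
pose del := Num.min u0 (Num.min 1 (e / 4 / (M + 1))).
have del0 : 0 < del by rewrite !lt_min u00 ltr01 !divr_gt0.
apply/nbhs_ballP; exists del => //= u; rewrite /ball /= !lt_min => /and3P[d1 d2 d3].
move: (d1) (d2); rewrite !ltr_norml => /andP[a1 a2] /andP[a3 a4].
have uu0 : 0 < u by lra.
have uun : u <= n%:R by lra.
have u0n : u0 <= n%:R by lra.
have := JS u uu0 uun; have := JS u0 u00 u0n; have := SL u0 u u0n uun.
have : M * `|u0 - u| <= e / 4.
  apply: (@le_trans _ _ ((M + 1) * `|u0 - u|)); first by apply: ler_wpM2r => //; lra.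
  by rewrite mulrC -ler_pdivlMr// ltW.
move=> h1 h2 h3 h4.
have tri (a b c z : R) : a - z = (a - b) + (b - c) + (c - z) by ring.
rewrite (tri _ (S u0) (S u)).
apply: (le_trans (ler_normD _ _)); rewrite [`|S u - J u|]distrC.
by have := ler_normD (J u0 - S u0) (S u0 - S u); lra.
Qed.

End stieltjes_process.
End good_path.

Lemma grid_count {R : realType} (theta a b : R) (m : nat) : 0 < theta -> 0 <= a ->
  m%:R * theta <= b - a -> exists N, (m <= \sum_(k < N) (a <= k%:R * theta <= b)%R)%N.
Proof.
move=> th0 a0 mb; have h : 0 <= a / theta by rewrite divr_ge0// ltW.
have /andP[h1 h2] := truncn_itv h.
pose k0 := (Num.truncn (a / theta)).+1; exists (k0 + m)%N.
rewrite big_split_ord /=; apply: (@leq_trans (\sum_(i < m) 1)%N); first by rewrite sum1_card card_ord.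
apply: leq_trans (leq_addl _ _); apply: leq_sum => i _.
rewrite lt0b; move: h1 h2; rewrite ler_pdivlMr// ltr_pdivrMr// => h1 h2.
have im : i.+1%:R * theta <= m%:R * theta by rewrite ler_pM2r// ler_nat.
have i0 : 0 <= i%:R * theta by rewrite mulr_ge0// ltW.
rewrite /k0 natrD mulrDl; apply/andP; split; first by apply: (le_trans (ltW h2)); rewrite lerDl.
move: im; rewrite -!natr1 !mulrDl !mul1r; lra.
Qed.

Lemma small_dyadic {R : realType} (x : R) : 0 < x -> exists i : nat, forall i', (i <= i')%N -> 2 ^- i' <= x.
Proof.
move=> x0; have c : (2^-1 : R) ^+ j @[j --> \oo] --> (0 : R).
  by apply: cvg_expr; rewrite ger0_norm ?invr_ge0//; lra.
have /cvgrPdist_lt /(_ _ x0) [i _ hi] := c; exists i => i' /hi.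
by rewrite /= sub0r normrN ger0_norm ?exprn_ge0 ?invr_ge0// exprVn => /ltW.
Qed.

(** * Approximation of the limit process *)

Section limit_process.
Context {R : realType} {d : measure_display} {T : measurableType d} (P : probability T R).
Variables (alpha gam : R) (W : T -> R -> R).
Hypothesis alpha01 : 0 < alpha < 1.
Hypothesis gam0 : 0 < gam.
Hypothesis gam_alpha : gam < alpha.
Hypothesis Gam0 : 0 < Gammaf (1 - alpha).
Hypothesis sub : stable_subordinator P alpha W.
Local Notation g := (gcst gam).

Let g01 : 0 < g < 1.
Proof.
rewrite gcst_gt0 /= /gcst powRN invf_lt1 ?powR_gt0//.
rewrite -[ltLHS](powRr0 2) /powR gt_eqF// ltr_expR ltr_pM2r//.
by apply: ln_gt0; lra.
Qed.

(** The subordinator is sampled along the mesh [theta] and treated as a walk. The condition on [j]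
    bounds the loss from rounding [g ^+ j / theta] down, uniformly in [theta]. *)
Definition sub_bad (theta : R) (n : nat) : set T :=
  bad_walk (sub_incr W theta) id n (fun j => theta * (2 `^ alpha) ^+ j <= 1) (fun j => 2 ^- j)
    (fun j => Num.truncn (g ^+ j / theta)).

Lemma measurable_sub_bad theta n : 0 < theta -> measurable (sub_bad theta n).
Proof. by move=> th0; exact: (measurable_bad_walk (iid_sub sub (ltW th0))). Qed.

Lemma prob_sub_bad : exists2 K, 0 < K & forall theta n, 0 < theta ->
  (P (sub_bad theta n) <= (K * 2 ^- n)%:E)%E.
Proof.
have /andP[a0 a1] := alpha01.
pose c := Gammaf (1 - alpha) * 2 `^ (- alpha); have c0 : 0 < c by rewrite mulr_gt0// powR_gt0.
pose B : R := 2 `^ alpha * g.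
have B1 : 1 < B.
  rewrite /B /gcst -powRD; last by rewrite pnatr_eq0 implybT.
  rewrite -[ltLHS](powRr0 2) /powR gt_eqF// ltr_expR ltr_pM2r; first by rewrite subr_gt0.
  by apply: ln_gt0; lra.
have [K1 K10 dec] := exp_decay c0 B1.
exists (2 * (3 * expR 1 * expR c * K1)); first by rewrite !mulr_gt0// expR_gt0.
move=> theta n th0.
have iid := iid_sub sub (ltW th0).
apply: (prob_bad_walk iid _ (expR_gt0 c) K10 dec (q := fun j =>
  expR (- (theta * (Gammaf (1 - alpha) * ((2 * 2 ^- j)^-1) `^ alpha))))) => // j nj cj.
have j0 : 0 < 2 ^- j :> R by rewrite invr_gt0 exprn_gt0.
split => //.
  rewrite -(@incr_law_laplace _ _ _ P alpha W sub theta (ltW th0) (2 * 2 ^- j)^-1); last first.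
    by rewrite invr_ge0 mulr_ge0// ltW.
  by apply: eq_integral => e _; rewrite mulNr.
set m := Num.truncn _.
have pE : ((2 * 2 ^- j)^-1) `^ alpha = 2 `^ (- alpha) * (2 `^ alpha) ^+ j.
  rewrite -dyadic_powR -powRM ?(ltW j0)//.
  have x0 : 0 < 2 * 2 ^- j :> R by rewrite mulr_gt0.
  by rewrite -powR_inv1 ?(ltW x0)// -powRrM mulN1r.
rewrite -expRM_natl -expRD ler_expR pE.
have mlow : g ^+ j <= m%:R * theta + theta.
  have : g ^+ j / theta <= m%:R + 1 by rewrite natr1 ltW// truncnS_gt.
  by rewrite ler_pdivrMr// mulrDl mul1r.
have Qj : 0 < (2 `^ alpha) ^+ j :> R by rewrite exprn_gt0// powR_gt0.
have -> : m%:R * - (theta * (Gammaf (1 - alpha) * (2 `^ (- alpha) * (2 `^ alpha) ^+ j))) =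
   - (c * (2 `^ alpha) ^+ j * (m%:R * theta)) by rewrite /c; ring.
have : c * (2 `^ alpha) ^+ j * g ^+ j <= c * (2 `^ alpha) ^+ j * (m%:R * theta + theta).
  by rewrite ler_pM2l// mulr_gt0.
have : c * (theta * (2 `^ alpha) ^+ j) <= c by rewrite -[leRHS]mulr1 ler_wpM2l// ltW.
rewrite /B exprMn mulrDr; lra.
Qed.

(** An increasing union of events on which all sufficiently fine dyadic meshes are bad, each no
    likelier than a single bad mesh. Off this set arbitrarily fine meshes are good. *)
Definition sub_bad_lim n : set T := \bigcup_i \bigcap_(i' in [set i' | (i <= i')%N]) sub_bad (2 ^- i') n.

Let mcap i n : measurable (\bigcap_(i' in [set i' | (i <= i')%N]) sub_bad (2 ^- i') n).
Proof.
by apply: bigcap_measurable => [|k _]; [exists i => /=|apply: measurable_sub_bad; rewrite invr_gt0 exprn_gt0].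
Qed.

Lemma measurable_sub_bad_lim n : measurable (sub_bad_lim n).
Proof. by apply: bigcup_measurable => i _; exact: mcap. Qed.

Lemma prob_sub_bad_lim : exists2 K, 0 < K & forall n, (P (sub_bad_lim n) <= (K * 2 ^- n)%:E)%E.
Proof.
have [K K0 hK] := prob_sub_bad; exists K => // n.
have c := @nondecreasing_cvg_mu _ _ _ P (fun i => \bigcap_(i' in [set i' | (i <= i')%N]) sub_bad (2 ^- i') n).
have {c} c := c (fun i => mcap i n) (measurable_sub_bad_lim n).
apply: (cvge_to_le (c _)).
  move=> i j ij; apply/subsetPset => w h k /= jk; apply: h => /=; exact: leq_trans jk.
apply: nearW => i /=; apply: (@le_trans _ _ (P (sub_bad (2 ^- i) n))).
  apply: le_measure; rewrite ?inE; [exact: mcap|by apply: measurable_sub_bad; rewrite invr_gt0 exprn_gt0|].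
  by move=> w; apply => /=.
by apply: hK; rewrite invr_gt0 exprn_gt0.
Qed.

(** On a good mesh the number of sampling times in a window, multiplied by the mesh, is at most
    [g ^+ j], and it misses the time spent there by at most one mesh. Arbitrarily fine good meshes
    remove this error. *)
Lemma good_sub_path n w : ~ sub_bad_lim n w -> good_path (W w) g n.
Proof.
move=> nb.
have inf i : exists2 i', (i <= i')%N & ~ sub_bad (2 ^- i') n w.
  apply: contrapT => h; apply: nb; exists i => // i' /= ii'.
  by apply: contrapT => h2; apply: h; exists i'.
have pos i k : 0 <= id (sub_incr W (2 ^- i) k w).
  by apply: (sub_incr_ge0 sub); rewrite invr_ge0 exprn_ge0.
have g0 : 0 < g by case/andP: g01.
split.
- move=> j y a b nj /andP[y0 yn] a0 ab fa fb; apply/ler_addgt0Pr => e e0.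
  pose x := Num.min e ((2 `^ alpha) ^+ j)^-1.
  have x0 : 0 < x by rewrite lt_min e0 invr_gt0 exprn_gt0// powR_gt0.
  have [i hi] := small_dyadic x0; have [i' ii' nb'] := inf i.
  set theta : R := 2 ^- i' in nb'.
  have th0 : 0 < theta by rewrite invr_gt0 exprn_gt0.
  have := hi i' ii'; rewrite -/theta le_min => /andP[the thc].
  have cj : theta * (2 `^ alpha) ^+ j <= 1.
    by rewrite -ler_pdivlMr ?exprn_gt0 ?powR_gt0// mul1r.
  pose m := Num.truncn ((b - a) / theta).
  have ba : 0 <= (b - a) / theta by rewrite divr_ge0 ?subr_ge0// ltW.
  have /andP[m1 m2] := truncn_itv ba; rewrite -/m in m1 m2.
  have m1' : m%:R * theta <= b - a by rewrite -ler_pdivlMr.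
  have [N hN] := grid_count th0 a0 m1'.
  have jx : 0 < 2 ^- j :> R by rewrite invr_gt0 exprn_gt0.
  have yn' : y <= (n * 2 ^ j)%:R * 2 ^- j by rewrite natrM natrX mulfK// expf_neq0.
  have := @good_window _ _ _ _ _ (sub_incr W theta) id n _ _ _ j N y w (pos i') nb' nj cj jx y0 yn'.
  move=> gw.
  have mN : (m <= Num.truncn (g ^+ j / theta))%N.
    apply: leq_trans gw; apply: (leq_trans hN); apply: leq_sum => k _.
    case: (boolP (a <= k%:R * theta <= b)) => // /andP[ak kb].
    have k0 : 0 <= k%:R * theta by rewrite mulr_ge0// ltW.
    rewrite lt0b (walk_sub sub).
    by rewrite (lt_le_trans fa (sub_mono sub w a0 ak)) (le_trans (sub_mono sub w k0 kb)).
  have gt0 : 0 <= g ^+ j / theta by rewrite divr_ge0 ?exprn_ge0 ?ltW.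
  have : m%:R <= g ^+ j / theta.
    by apply: (@le_trans _ _ (Num.truncn (g ^+ j / theta))%:R); [rewrite ler_nat|rewrite truncn_le].
  rewrite ler_pdivlMr// => h1.
  move: m2; rewrite -natr1 ltr_pdivrMr// mulrDl mul1r; lra.
- move=> b b0 fb; apply/ler_addgt0Pr => e e0.
  pose x := Num.min e ((2 `^ alpha) ^+ n)^-1.
  have x0 : 0 < x by rewrite lt_min e0 invr_gt0 exprn_gt0// powR_gt0.
  have [i hi] := small_dyadic x0; have [i' ii' nb'] := inf i.
  set theta : R := 2 ^- i' in nb'.
  have th0 : 0 < theta by rewrite invr_gt0 exprn_gt0.
  have := hi i' ii'; rewrite -/theta le_min => /andP[the thc].
  have cj : theta * (2 `^ alpha) ^+ n <= 1.
    by rewrite -ler_pdivlMr ?exprn_gt0 ?powR_gt0// mul1r.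
  pose m := Num.truncn (b / theta).
  have ba : 0 <= b / theta by rewrite divr_ge0// ltW.
  have /andP[m1 m2] := truncn_itv ba; rewrite -/m in m1 m2.
  have m1' : m%:R * theta <= b - 0 by rewrite subr0 -ler_pdivlMr.
  have [N hN] := grid_count th0 (lexx 0) m1'.
  have jx : 0 < 2 ^- n :> R by rewrite invr_gt0 exprn_gt0.
  have En : (n * 2 ^ n)%:R * 2 ^- n = n%:R :> R by rewrite natrM natrX mulfK// expf_neq0.
  have := @window_total _ (fun k => walk (sub_incr W theta) id k w) N theta (g ^+ n) (2 ^- n) (n * 2 ^ n) th0 jx.
  have S0 k : 0 <= walk (sub_incr W theta) id k w.
    by rewrite (walk_sub sub); apply: (sub_ge0 sub); rewrite mulr_ge0// ltW.
  move=> /(_ S0 _ n%:R); rewrite En lexx => wt.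
  have {wt} : theta * (\sum_(k < N) (walk (sub_incr W theta) id k w <= n%:R)%R)%:R <= (n * 2 ^ n).+1%:R * g ^+ n.
    apply: wt => // k kM.
    have y0 : 0 <= k%:R * 2 ^- n :> R by rewrite mulr_ge0// ltW.
    have yn' : k%:R * 2 ^- n <= (n * 2 ^ n)%:R * 2 ^- n :> R by rewrite ler_pM2r// ler_nat.
    have := @good_window _ _ _ _ _ (sub_incr W theta) id n _ _ _ n N _ w (pos i') nb' (leqnn n) cj jx y0 yn'.
    rewrite -/(window (fun k => walk (sub_incr W theta) id k w) N (k%:R * 2 ^- n - 2 ^- n) (k%:R * 2 ^- n)) => gw.
    have gt0 : 0 <= g ^+ n / theta by rewrite divr_ge0 ?exprn_ge0 ?ltW.
    rewrite mulrC -ler_pdivlMr//.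
    by apply: (@le_trans _ _ (Num.truncn (g ^+ n / theta))%:R); [rewrite ler_nat|rewrite truncn_le].
  have : m%:R <= (\sum_(k < N) (walk (sub_incr W theta) id k w <= n%:R)%R)%:R :> R.
    rewrite ler_nat; apply: (leq_trans hN); apply: leq_sum => k _.
    case: (boolP (0 <= k%:R * theta <= b)) => // /andP[k0 kb].
    rewrite lt0b (walk_sub sub); apply: le_trans fb; exact: (sub_mono sub).
  move=> h1 h2.
  have : theta * m%:R <= theta * (\sum_(k < N) (walk (sub_incr W theta) id k w <= n%:R)%R)%:R.
    by rewrite ler_pM2l.
  move: m2; rewrite -natr1 ltr_pdivrMr// mulrDl mul1r; lra.
Qed.

Variables (rho p : R).
Hypothesis p0 : 0 <= p.
Hypothesis prho : - p < rho.
Hypothesis Qg : 2 `^ p * g < 1.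

Lemma limit_approx (eps : R) : 0 < eps -> exists n0 : nat, forall n N (eta L : R), (n0 <= n)%N ->
  0 < eta -> 0 <= L ->
  (forall v v', v <= n%:R -> v' <= n%:R -> `|kap rho n v - kap rho n v'| <= L * `|v - v'|) ->
  eta * L * n%:R <= eps / 2 -> (n * 2 ^ n).+1%:R * g ^+ n < N%:R * eta ->
  exists B, [/\ measurable B, (P B <= eps%:E)%E & forall w, ~ B w ->
    cadlag_pos (J_proc rho W w) /\
    uclose eps (J_proc rho W w) (psi (kap rho n) n eta (@sub_coord _ _ _ W eta N w))].
Proof.
move=> eps0; have [K K0 PK] := prob_sub_bad_lim.
have [B0 [mB0 PB0 hB0]] := borel_cantelli_geom (ltW K0) measurable_sub_bad_lim PK.
have [n2 hn2] := small_dyadic (divr_gt0 eps0 K0).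
have e20 : 0 < eps / 2 by rewrite divr_gt0.
have /cvgrPdist_lt /(_ _ e20) [n3 _ hn3] := near_err_cvg g01 Qg.
pose n4 := (Num.truncn eps^-1).+1.
exists (maxn n2 (maxn n3 n4)) => n N eta L; rewrite !geq_max => /and3P[n2n n3n n4n] eta0 L0 kL etaL NL.
(* Off [sub_bad_lim n] the path is good at the level [n] of the approximation; off the null set [B0]
   it is good at all large levels, which gives continuity of the inverse and of the limit
   process. *)
exists (sub_bad_lim n `|` B0); split.
- by apply: measurableU => //; exact: measurable_sub_bad_lim.
- apply: (le_trans (measureU2 _ _ _)) => //; first exact: measurable_sub_bad_lim.
  apply: (@le_trans _ _ ((K * 2 ^- n)%:E + 0)%E).
    by apply: leeD; [exact: PK|rewrite le_eqVlt; apply/orP; left; apply/eqP].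
  rewrite adde0 lee_fin.
  by have := hn2 n n2n; rewrite ler_pdivlMr// mulrC.
move=> w /not_orP[w1 w2].
have f00 : W w 0 = 0 by have [] := sub.
have fmono s t : 0 <= s -> s <= t -> W w s <= W w t by exact: (sub_mono sub).
have gex : exists n1, forall m, (n1 <= m)%N -> good_path (W w) g m.
  by have [n1 hn1] := hB0 w w2; exists n1 => m /hn1; exact: good_sub_path.
have gd := good_sub_path w1.
have JE : J_proc rho W w = fun u => fine (LS_integral (path_inv (W w)) (fun y => powR (u - y) rho) `[0, u]) by [].
have cJ u : 0 < u -> {for u, continuous (J_proc rho W w)}.
  by move=> u0; rewrite JE; exact: (LS_continuous f00 fmono g01 gex p0 prho Qg).
split.
  split=> u u0; first by apply: cvg_at_right_filter; exact: cJ.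
  by apply/cvg_ex; exists (J_proc rho W w u); apply: cvg_at_left_filter; exact: cJ.
move=> u eu ue; have u0 : 0 < u by exact: lt_le_trans eu.
have un : u <= n%:R.
  have h : u <= eps^-1 by rewrite -[leRHS]mul1r ler_pdivlMr.
  apply: (le_trans h); apply: (le_trans (ltW (truncnS_gt _))); by rewrite ler_nat.
have uN : u <= W w (N%:R * eta).
  apply: (le_trans un); rewrite leNgt; apply/negP => /ltW h.
  have [_ /(_ (N%:R * eta))] := gd; rewrite mulr_ge0 ?(ltW eta0)// => /(_ isT h).
  by rewrite leNgt NL.
have := LS_approx f00 fmono g01 gex p0 prho Qg gd u0 un eta0 L0 kL uN.
have -> : psi (kap rho n) n eta (@sub_coord _ _ _ W eta N w) u =
    eta * \sum_(r < N) kap rho n (u - W w (r%:R * eta)).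
  have := @psiE _ (kap rho n) n (kap_le0 rho n) N eta (fun i => sub_incr W eta i w) u.
  rewrite un => /(_ _ isT) ->; last by move=> i; exact: (sub_incr_ge0 sub (ltW eta0)).
  congr (_ * _); apply: eq_bigr => r _; congr (kap _ _ (_ - _)).
  by rewrite -(walk_sub sub).
move=> h; rewrite JE; apply: (le_trans h).
have := hn3 n n3n; rewrite /= sub0r normrN ltr_norml => /andP[_ h1].
have h2 : eta * L * u <= eta * L * n%:R by rewrite ler_wpM2l// mulr_ge0// ltW.
lra.
Qed.

End limit_process.

(** * The mean part of the shot noise *)

Section rv_growth.
Context {R : realType}.
Variables (f : R -> R) (rho : R).
Hypothesis rvf : rv f rho.

Lemma rv_lower e : 0 < e -> exists2 A, 1 <= A & exists2 c, 0 < c &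
  forall t, A <= t -> c * t `^ (rho - e) <= f t.
Proof.
move=> e0; have [A A1 [C C0 HA]] := rv_potter rvf e0.
have A0 : 0 < A by exact: lt_le_trans A1.
have [fA _ _ _] := HA A A (lexx _) (lexx _).
exists A => //; exists (f A / (C * A `^ (rho - e))).
  by rewrite divr_gt0// mulr_gt0// powR_gt0.
move=> t At; have t0 : 0 < t by exact: lt_le_trans At.
have [_ ft h _] := HA A t (lexx _) At.
rewrite mulrAC ler_pdivrMr ?mulr_gt0 ?powR_gt0//.
have tp : 0 < t `^ (rho - e) by rewrite powR_gt0.
have tV : (A / t) `^ (rho - e) = A `^ (rho - e) / t `^ (rho - e).
  rewrite powRM ?(ltW A0) ?invr_ge0 ?(ltW t0)//; congr (_ * _).
  by rewrite -[t^-1]powR_inv1 ?(ltW t0)// -powRrM mulN1r powRN.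
move: h; rewrite tV => h.
have := ler_wpM2r (ltW tp) h.
have -> : C * (A `^ (rho - e) / t `^ (rho - e)) * f t * t `^ (rho - e) = f t * (C * A `^ (rho - e)).
  by field; rewrite gt_eqF.
exact.
Qed.

Lemma rv_upper e : 0 < e -> exists2 A, 1 <= A & exists2 C, 0 < C &
  forall t, A <= t -> f t <= C * t `^ (rho + e).
Proof.
move=> e0; have [A A1 [C C0 HA]] := rv_potter rvf e0.
have A0 : 0 < A by exact: lt_le_trans A1.
have [fA _ _ _] := HA A A (lexx _) (lexx _).
exists A => //; exists (C * A `^ (- rho - e) * f A).
  by rewrite !mulr_gt0// powR_gt0.
move=> t At; have t0 : 0 < t by exact: lt_le_trans At.
have [_ ft _ h] := HA A t (lexx _) At.
apply: (le_trans h); rewrite le_eqVlt; apply/orP; left; apply/eqP.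
rewrite powRM ?(ltW A0) ?invr_ge0 ?(ltW t0)// -[t^-1]powR_inv1 ?(ltW t0)// -powRrM mulN1r.
by rewrite opprB opprK [e + rho]addrC; ring.
Qed.

End rv_growth.

Lemma dyadic_exprn_powR {R : realType} (a : R) (J : nat) : (2 `^ a) ^+ J = (2 ^+ J) `^ a :> R.
Proof.
rewrite -powR_mulrn; last exact: powR_ge0.
rewrite -[2 ^+ J]powR_mulrn; last exact: ler0n.
by rewrite -!powRrM mulrC.
Qed.

Lemma near_errE {R : realType} (g p : R) (n m : nat) : 0 < g -> 2 `^ p * g < 1 ->
  2 `^ p * \sum_(n <= j < m) (2 `^ p * g) ^+ j <= near_err g p n.
Proof.
move=> g0 Qg; have Q0 : 0 < 2 `^ p :> R by rewrite powR_gt0.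
rewrite /near_err -mulrA; apply: ler_wpM2l; first exact: ltW.
by apply: geom_sum_lt1; rewrite Qg mulr_ge0// ltW.
Qed.

Section walk_sums.
Context {R : realType} {d : measure_display} {T : measurableType d}.
Variable (P : probability T R).
Context {dE : measure_display} {E : measurableType dE} (mu : probability E R).
Variables (Th : nat -> T -> E) (C : set (set E)).
Hypothesis iid : iid_gen P mu Th C.
Variable sz : E -> R.
Hypothesis msz : measurable_fun setT sz.
Hypothesis sz0 : forall e, 0 <= sz e.
Local Notation walk := (walk Th sz).
Variables (tl : R -> R) (alpha gam : R).
Hypothesis gam0 : 0 < gam.
Hypothesis gam_alpha : gam < alpha.
Hypothesis rvtl : rv tl (- alpha).
Hypothesis tl01 : forall t, 0 < tl t <= 1.
Hypothesis tl_mono : forall x y, x <= y -> tl y <= tl x.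
Local Notation g := (gcst gam).
Local Notation sbad := (sbad Th sz tl gam).

Let g0 : 0 < g. Proof. exact: gcst_gt0. Qed.

Definition total_cst n : R := (n * 2 ^ n).+1%:R * g ^+ n.

Lemma total_cst_ge0 n : 0 <= total_cst n.
Proof. by rewrite mulr_ge0// exprn_ge0// ltW. Qed.

Lemma walk_ge0 k w : 0 <= walk k w.
Proof. by rewrite sumr_ge0. Qed.

Lemma total_le n t y N w : ~ sbad n t w -> 2 ^+ n <= t -> y <= n%:R * t ->
  tl t * (\sum_(k < N) (walk k w <= y)%R)%:R <= total_cst n.
Proof.
move=> nb nt yn; have /andP[t0 _] := tl01 t.
apply: le_trans (good_total tl01 N (fun k => sz0 _) nb nt).
rewrite ler_pM2l// ler_nat; apply: leq_sum => k _.
by case: (leP (walk k w) y) => // ky; rewrite lt0b (le_trans ky).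
Qed.

Lemma walk_exceeds n t M w : ~ sbad n t w -> 2 ^+ n <= t -> total_cst n < M%:R * tl t ->
  n%:R * t < walk M w.
Proof.
move=> nb nt hM; rewrite ltNge; apply/negP => h.
have := total_le M.+1 nb nt (lexx _); rewrite leNgt => /negP; apply.
apply: (lt_le_trans hM); rewrite mulrC; have /andP[t0 _] := tl01 t.
rewrite ler_pM2l// ler_nat.
apply: (@leq_trans (\sum_(k < M.+1) 1)%N); first by rewrite sum1_card card_ord.
apply: leq_sum => k _; rewrite lt0b; apply: le_trans h.
by apply: walk_mono => //; rewrite -ltnS.
Qed.

(** Ages below [2 ^- n * t] are handled by the dyadic shells; the remaining ones are bounded by [B],
    and the total number of points is used. *)
Lemma split_sum n t y N w (f : R -> R) (p A B : R) : ~ sbad n t w -> 2 ^+ n <= t ->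
  0 <= y <= n%:R * t -> 0 <= p -> 0 <= A -> 0 <= B ->
  (forall z, 0 <= z < 2 ^- n * t -> f z <= A * (Num.max z 1 / t) `^ (- p)) ->
  (forall z, 2 ^- n * t <= z <= n%:R * t -> f z <= B) ->
  exists2 J, 2 ^+ J <= t & tl t * shot_rate Th sz f y N w <=
    A * 2 `^ p * \sum_(n <= j < J.+1) (2 `^ p * g) ^+ j + B * total_cst n.
Proof.
move=> nb nt yn p0 A0 B0 fA fB; have /andP[t0 _] := tl01 t.
have /andP[y0 yt] := yn.
have [J Jt hJ] := good_near tl01 N (fun k => sz0 _) nb nt yn p0 A0 fA.
exists J => //; apply: (le_trans _ (lerD hJ (ler_wpM2l B0 (total_le N nb nt yt)))).
rewrite mulrCA -mulrDr ler_pM2l// /shot_rate natr_sum mulr_sumr -big_split /=.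
apply: ler_sum => k _; have wk := walk_ge0 k w.
case: (leP (walk k w) y) => ky; last first.
  by rewrite andbF mulr0 addr0.
rewrite andbT mulr1; case: (ltP (y - 2 ^- n * t) (walk k w)) => hk; first by rewrite lerDl.
by rewrite add0r; apply: fB; apply/andP; split; lra.
Qed.

Lemma tl_cvg0 e : 0 < e -> exists A, forall t, A <= t -> tl t <= e.
Proof.
move=> e0; have ga := gam_alpha; have gg := gam0.
have a2 : 0 < alpha / 2 by lra.
have [A A1 [C1 C10 H]] := rv_upper rvtl a2.
pose B := (C1 / e) `^ (2 / alpha).
exists (Num.max A B) => t; rewrite ge_max => /andP[At Bt].
have t0 : 0 < t by apply: lt_le_trans At; exact: lt_le_trans A1.
apply: (le_trans (H t At)).
have -> : - alpha + alpha / 2 = - (alpha / 2) by lra.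
rewrite powRN ler_pdivrMr ?powR_gt0// mulrC -ler_pdivrMr//.
have Ce : 0 <= C1 / e by rewrite divr_ge0// ltW.
have -> : C1 / e = B `^ (alpha / 2).
  by rewrite /B -powRrM (_ : 2 / alpha * (alpha / 2) = 1) ?powRr1//; field; rewrite gt_eqF//; lra.
apply: ge0_ler_powR => //; rewrite ?nnegrE ?powR_ge0 ?(ltW t0)//; lra.
Qed.

Section mean.
Variables (h : R -> R) (rho p : R).
Hypothesis rvh : rv h rho.
Hypothesis h_ge0 : forall z, 0 <= z -> 0 <= h z.
Hypothesis h_bound : forall b, 0 <= b -> exists M, forall z, 0 <= z <= b -> h z <= M.
Hypothesis p0 : 0 < p.
Hypothesis prho : - p < rho.
Hypothesis Qg : 2 `^ p * g < 1.

(** This also bounds the accumulated variance of the centred part, since the variance of one term is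
    at most a multiple of [h]. *)
Lemma mean_rate n : (0 < n)%N -> exists2 K, 0 < K & exists A, forall t, A <= t -> 0 < h t /\
  forall w N y, ~ sbad n t w -> 0 <= y <= n%:R * t -> tl t * shot_rate Th sz h y N w <= K * h t.
Proof.
move=> n0.
have [A1 A11 [Ch Ch0 near_h]] := rv_near rvh p0 prho h_bound.
have p2 : 0 < 2 ^- n :> R by rewrite invr_gt0 exprn_gt0.
have p21 : 2 ^- n <= 1 :> R by rewrite invf_le1 ?exprn_gt0// exprn_ege1// ler1n.
have n1 : 1 <= n%:R :> R by rewrite ler1n.
have [A2 far_h] := rv_uniform rvh p2 (le_trans p21 n1) ltr01.
have [L L0 [M M0 HM]] := powR_lip rho n%:R p2.
exists (Ch * near_err g p n + (M + 1) * total_cst n + 1).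
  have ne0 : 0 <= near_err g p n.
    by rewrite /near_err divr_ge0 ?subr_ge0 ?(ltW Qg)// mulr_ge0 ?powR_ge0// exprn_ge0// mulr_ge0 ?powR_ge0// ltW.
  have := mulr_ge0 (ltW Ch0) ne0; have := mulr_ge0 (addr_ge0 M0 ler01) (total_cst_ge0 n); lra.
exists (Num.max A1 (Num.max A2 (2 ^+ n))) => t; rewrite !ge_max => /and3P[t1 t2 nt].
have t0 : 0 < t by apply: lt_le_trans t1; exact: lt_le_trans A11.
have tt : 0 <= t <= t by rewrite (ltW t0) lexx.
have [ht _] := near_h t t t1 tt.
split; first exact: ht.
move=> w N y nb yn.
have fA z : 0 <= z < 2 ^- n * t -> h z <= Ch * h t * (Num.max z 1 / t) `^ (- p).
  move=> /andP[z0 zn]; have [|_] := near_h t z t1 _ => //.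
  by rewrite z0 (le_trans (ltW zn))// ler_piMl// ltW.
have fB z : 2 ^- n * t <= z <= n%:R * t -> h z <= (M + 1) * h t.
  move=> /andP[z1 z2].
  have v : 2 ^- n <= z / t <= n%:R by rewrite ler_pdivlMr// z1 ler_pdivrMr// z2.
  have [_] := far_h t (z / t) t2 v; rewrite mulfVK ?gt_eqF// ler_norml => /andP[_ h1].
  have [_ h2] := HM _ _ v v.
  by rewrite -ler_pdivrMr//; lra.
have [J Jt] := @split_sum n t y N w h p _ _ nb nt yn (ltW p0) (mulr_ge0 (ltW Ch0) (ltW ht))
  (mulr_ge0 (addr_ge0 M0 ler01) (ltW ht)) fA fB.
move=> /le_trans; apply.
have := ler_wpM2l (mulr_ge0 (ltW Ch0) (ltW ht)) (near_errE n J.+1 g0 Qg).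
have -> : (Ch * near_err g p n + (M + 1) * total_cst n + 1) * h t =
  Ch * h t * near_err g p n + (M + 1) * h t * total_cst n + h t by ring.
rewrite mulrA; lra.
Qed.

(** The order of choices matters: [K] precedes [n], so [n] can make [K * near_err] small, and [e]
    comes last, to be small against [total_cst n]. *)
Lemma mean_approx : exists2 K, 0 < K & forall n (e : R), (0 < n)%N -> 0 < e -> exists A, forall t, A <= t ->
  [/\ 0 < t, 0 < h t & forall w N y, ~ sbad n t w -> 0 <= y <= n%:R * t ->
   `|tl t / h t * shot_rate Th sz h y N w - tl t * \sum_(k < N) kap rho n (y / t - walk k w / t)| <=
     e * total_cst n + K * near_err g p n].
Proof.
have [A1 A11 [Ch Ch0 near_h]] := rv_near rvh p0 prho h_bound.
exists (Ch + 1); first by lra.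
move=> n e n0 e0.
have p2 : 0 < 2 ^- n :> R by rewrite invr_gt0 exprn_gt0.
have p21 : 2 ^- n <= 1 :> R by rewrite invf_le1 ?exprn_gt0// exprn_ege1// ler1n.
have n1 : 1 <= n%:R :> R by rewrite ler1n.
have [A2 far_h] := rv_uniform rvh p2 (le_trans p21 n1) e0.
exists (Num.max A1 (Num.max A2 (2 ^+ n))) => t; rewrite !ge_max => /and3P[t1 t2 nt].
have t0 : 0 < t by apply: lt_le_trans t1; exact: lt_le_trans A11.
have tt : 0 <= t <= t by rewrite (ltW t0) lexx.
have [ht _] := near_h t t t1 tt.
split=> // w N y nb yn.
pose F z := `|h z / h t - kap rho n (z / t)|.
have fA z : 0 <= z < 2 ^- n * t -> F z <= (Ch + 1) * (Num.max z 1 / t) `^ (- p).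
  move=> /andP[z0 zn].
  have zt : 0 <= z <= t by rewrite z0 (le_trans (ltW zn))// ler_piMl// ltW.
  have [_ h1] := near_h t z t1 zt.
  have h2 : h z / h t <= Ch * (Num.max z 1 / t) `^ (- p) by rewrite ler_pdivrMr// mulrAC.
  have h3 : kap rho n (z / t) <= (Num.max z 1 / t) `^ (- p).
    apply: (@le_trans _ _ ((2 `^ p) ^+ n)).
      by apply: kap_near => //; [exact: ltW|rewrite ler_pdivrMr// ltW].
    rewrite -dyadic_powR !powRN lef_pV2 ?posrE ?powR_gt0 ?divr_gt0 ?lt_max ?ltr01 ?orbT//.
    apply: ge0_ler_powR; [exact: ltW|by rewrite nnegrE divr_ge0 ?le_max ?ler01 ?orbT// ltW|by rewrite nnegrE ltW|].
    rewrite ler_pdivrMr// ge_max (ltW zn) /=.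
    by rewrite mulrC ler_pdivlMr ?exprn_gt0// mul1r.
  have h4 : 0 <= h z / h t by rewrite divr_ge0 ?h_ge0// ltW.
  have h5 := kap_ge0 rho n (z / t).
  by rewrite /F ler_norml mulrDl mul1r; apply/andP; split; lra.
have fB z : 2 ^- n * t <= z <= n%:R * t -> F z <= e.
  move=> /andP[z1 z2].
  have v : 2 ^- n <= z / t <= n%:R by rewrite ler_pdivlMr// z1 ler_pdivrMr// z2.
  have [_] := far_h t (z / t) t2 v; rewrite mulfVK ?gt_eqF//.
  by rewrite /F kap_far//; case/andP: v.
have Ch1 : 0 <= Ch + 1 by lra.
have [J Jt hJ] := @split_sum n t y N w F p _ _ nb nt yn (ltW p0) Ch1 (ltW e0) fA fB.
have /andP[tl0 _] := tl01 t.
have -> : tl t / h t * shot_rate Th sz h y N w = tl t * (shot_rate Th sz h y N w / h t) by ring.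
rewrite -mulrBr normrM gtr0_norm//.
apply: (@le_trans _ _ (tl t * shot_rate Th sz F y N w)).
  rewrite ler_pM2l// /shot_rate mulr_suml -sumrB; apply: (le_trans (ler_norm_sum _ _ _)).
  apply: ler_sum => k _; case: (leP (walk k w) y) => ky; first by rewrite /F mulrBl.
  rewrite kap_le0 ?mul0r ?subrr ?normr0//.
  by rewrite -mulrBl pmulr_lle0 ?invr_gt0// subr_le0 ltW.
apply: (le_trans hJ); rewrite addrC lerD2l -mulrA; apply: ler_wpM2l => //.
exact: near_errE.
Qed.

(** After [mean_approx], points are moved to the start of their block and the block weight
    [q * tl t] is replaced by [eta]. The cost is [eta * L * n] plus terms proportional to [tl t],
    which vanish as [t] grows. *)
Lemma mean_psi : exists2 K, 0 < K & forall n N (eta L e : R), (0 < n)%N -> 0 < e -> 0 < eta -> 0 <= L ->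
  (forall v v', v <= n%:R -> v' <= n%:R -> `|kap rho n v - kap rho n v'| <= L * `|v - v'|) ->
  eta * L * n%:R <= e / 8 -> K * near_err g p n <= e / 4 -> total_cst n < N%:R * eta ->
  exists A, forall t, A <= t -> forall w, ~ sbad n t w ->
    n%:R * t < walk (N * nblock tl eta t) w /\
    forall u, 0 <= u <= n%:R ->
    `|tl t / h t * shot_rate Th sz h (u * t) (N * nblock tl eta t) w -
      psi (kap rho n) n eta (@block_coord _ _ _ _ _ Th sz tl N eta t w) u| <= e.
Proof.
have [K K0 HK] := mean_approx; exists K => // n N eta L e n0 e0 eta0 L0 kL etaL Ke NC.
have tc1 : 0 < total_cst n + 1 by have := total_cst_ge0 n; lra.
have e1 : 0 < e / 8 / (total_cst n + 1) by rewrite !divr_gt0.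
have [A1 H1] := HK n _ n0 e1.
pose D := L * n%:R * (N%:R + 1) + 1.
have D0 : 0 < D by rewrite ltr_wpDl// mulr_ge0 ?mulr_ge0// addr_ge0.
have [A3 H3] := tl_cvg0 (divr_gt0 (divr_gt0 e0 (ltr0n R 8)) D0).
exists (Num.max A1 (Num.max A3 (2 ^+ n))) => t; rewrite !ge_max => /and3P[t1 t3 nt] w nb.
have [t0 ht H] := H1 t t1.
have /andP[tl0 tl1] := tl01 t.
have /andP[q1 q2] := nblock_bounds (fun t => proj1 (andP (tl01 t))) t eta0.
set q := nblock tl eta t in q1 q2 *.
split.
  apply: (walk_exceeds nb nt); rewrite natrM -mulrA; apply: (lt_le_trans NC).
  by apply: ler_wpM2l => //; exact: ltW.
move=> u /andP[u0 un].
have utn : 0 <= u * t <= n%:R * t by rewrite mulr_ge0 ?(ltW t0)// ler_pM2r.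
have := H w (N * q)%N (u * t) nb utn; rewrite mulfK ?gt_eqF//.
set Y := tl t / h t * _; set Z := \sum_(k < N * q) _ => h1.
have smono i j : (i <= j)%N -> walk i w / t <= walk j w / t.
  by move=> ij; rewrite ler_pM2r ?invr_gt0//; exact: walk_mono.
have s0 : 0 <= walk 0 w / t by rewrite divr_ge0 ?walk_ge0// ltW.
have un' : 0 <= u <= n%:R by rewrite u0.
have := @riemann_block _ (kap rho n) n L L0 (kap_le0 rho n) kL (fun k => walk k w / t) N q u smono s0 un'.
rewrite -/Z; set S := \sum_(r < N) _ => h2.
have -> : psi (kap rho n) n eta (@block_coord _ _ _ _ _ Th sz tl N eta t w) u = eta * S.
  have := @psiE _ (kap rho n) n (kap_le0 rho n) N eta
    (fun i => (walk (i.+1 * q) w - walk (i * q) w) / t) u.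
  rewrite un => /(_ _ isT) ->; last first.
    by move=> i; rewrite divr_ge0 ?(ltW t0)// subr_ge0 walk_mono// leq_mul2r leqnSn orbT.
  congr (_ * _); apply: eq_bigr => r _; congr (kap _ _ (_ - _)).
  rewrite -mulr_suml; congr (_ / _).
  elim: (nat_of_ord r) => [|m IH]; first by rewrite big_ord0 mul0n /walk big_ord0.
  by rewrite big_ord_recr /= IH addrC subrK.
have Sb : `|S| <= N%:R * (L * n%:R).
  apply: (le_trans (ler_norm_sum _ _ _)).
  have -> : N%:R * (L * n%:R) = \sum_(r < N) (L * n%:R) by rewrite sumr_const card_ord mulr_natl.
  apply: ler_sum => r _; apply: (kp_bound L0 (kap_le0 rho n) kL).
  by have : 0 <= walk (r * q)%N w / t by [rewrite divr_ge0 ?walk_ge0// ltW]; lra.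
have Ln0 : 0 <= L * n%:R by rewrite mulr_ge0.
have h3 : `|tl t * Z - (q%:R * tl t) * S| <= (eta + tl t) * L * n%:R.
  have -> : tl t * Z - (q%:R * tl t) * S = tl t * (Z - q%:R * S) by ring.
  rewrite normrM gtr0_norm//; apply: (le_trans (ler_wpM2l (ltW tl0) h2)).
  have -> : tl t * (q%:R * L * u) = (q%:R * tl t) * (L * u) by ring.
  rewrite -[leRHS]mulrA; apply: ler_pM => //.
  - by rewrite mulr_ge0// ltW.
  - by rewrite mulr_ge0.
  - by rewrite ler_wpM2l.
have h4 : `|(q%:R * tl t) * S - eta * S| <= tl t * (N%:R * (L * n%:R)).
  rewrite -mulrBl normrM; apply: ler_pM => //; rewrite ger0_norm; lra.
have h5 : tl t * (L * n%:R * (N%:R + 1)) <= e / 8.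
  have h6 := H3 t t3; rewrite ler_pdivlMr// in h6; apply: le_trans h6.
  by apply: ler_wpM2l; [exact: ltW|rewrite /D; lra].
have h6 : e / 8 / (total_cst n + 1) * total_cst n <= e / 8.
  rewrite mulrAC ler_pdivrMr//; apply: ler_wpM2l; [by rewrite divr_ge0 ?ltW|lra].
have -> : Y - eta * S = (Y - tl t * Z) + (tl t * Z - q%:R * tl t * S) + (q%:R * tl t * S - eta * S) by ring.
apply: (le_trans (ler_normD _ _)); have := ler_normD (Y - tl t * Z) (tl t * Z - q%:R * tl t * S).
have E1 : (eta + tl t) * L * n%:R = eta * L * n%:R + tl t * (L * n%:R) by ring.
have E2 : tl t * (L * n%:R * (N%:R + 1)) = tl t * (N%:R * (L * n%:R)) + tl t * (L * n%:R) by ring.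
rewrite E1 in h3; rewrite E2 in h5; move: h1 h3 h4 h5 h6 etaL Ke.
set x1 := `|Y - _|; set x2 := `|_ - q%:R * tl t * S|; set x3 := `|q%:R * tl t * S - _|.
move=> h1 h3 h4 h5 h6 etaL Ke h7; lra.
Qed.

End mean.

(** * Polynomial growth of the accumulated oscillation rates *)

Section rates.
Variable kk : R.
Hypothesis kk0 : 2 * (alpha - gam) <= kk.

(** With [p = 2 * alpha - gam > alpha], the shell ratio is [2 ^ (2 * (alpha - gam)) > 1], so the
    last shell, with [2 ^+ J <= t], dominates the sum. The growth is a power of [t] with the small
    exponent [2 * (alpha - gam)]. *)
Lemma tl_rate n : exists2 K, 0 < K & exists A, forall t, A <= t ->
  forall w N y, ~ sbad n t w -> 0 <= y <= n%:R * t -> shot_rate Th sz tl y N w <= K * t `^ kk.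
Proof.
have ga := gam_alpha; have gg := gam0.
pose p := 2 * alpha - gam.
have p0 : 0 < p by rewrite /p; lra.
have tb b : 0 <= b -> exists M, forall z, 0 <= z <= b -> tl z <= M.
  by move=> _; exists 1 => z _; case/andP: (tl01 z).
have pa : - p < - alpha by rewrite /p; lra.
have [A1 A11 [Ch Ch0 near_t]] := rv_near rvtl p0 pa tb.
have Q1 : 1 < 2 `^ p * g.
  rewrite /gcst -powRD; last by rewrite pnatr_eq0 implybT.
  rewrite -[ltLHS](powRr0 2) /powR gt_eqF// ltr_expR ltr_pM2r; first by rewrite /p; lra.
  by apply: ln_gt0; lra.
have Q0 : 0 < 2 `^ p :> R by rewrite powR_gt0.
have p2 : 0 < 2 ^- n :> R by rewrite invr_gt0 exprn_gt0.
have p21 : 2 ^- n <= 1 :> R by rewrite invf_le1 ?exprn_gt0// exprn_ege1// ler1n.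
pose K1 := Ch * 2 `^ p * (2 `^ p * g / (2 `^ p * g - 1)).
have K10 : 0 < K1 by rewrite mulr_gt0 ?divr_gt0 ?mulr_gt0// subr_gt0.
pose K2 := Ch * (2 `^ p) ^+ n * total_cst n.
have K20 : 0 <= K2 by rewrite mulr_ge0 ?total_cst_ge0// mulr_ge0 ?exprn_ge0 ?ltW.
exists (K1 + K2); first by rewrite ltr_wpDr.
exists (Num.max A1 (2 ^+ n)) => t; rewrite ge_max => /andP[t1 nt] w N y nb yn.
have t1' : 1 <= t by exact: le_trans t1.
have t0 : 0 < t by exact: lt_le_trans t1'.
have /andP[tl0 _] := tl01 t.
have fA z : 0 <= z < 2 ^- n * t -> tl z <= Ch * tl t * (Num.max z 1 / t) `^ (- p).
  move=> /andP[z0 zn]; have zt : 0 <= z <= t by rewrite z0 (le_trans (ltW zn))// ler_piMl// ltW.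
  by have [_] := near_t t z t1 zt.
have fB z : 2 ^- n * t <= z <= n%:R * t -> tl z <= Ch * tl t * (2 `^ p) ^+ n.
  move=> /andP[z1 _]; apply: (le_trans (tl_mono z1)).
  have zt : 0 <= 2 ^- n * t <= t by rewrite mulr_ge0 ?(ltW p2) ?(ltW t0)//= ler_piMl// ltW.
  have [_ /le_trans] := near_t t (2 ^- n * t) t1 zt; apply.
  apply: ler_wpM2l; first by rewrite mulr_ge0// ltW.
  have one : 1 <= 2 ^- n * t by rewrite mulrC ler_pdivlMr ?exprn_gt0// mul1r.
  rewrite (_ : Num.max _ _ = 2 ^- n * t); last exact/max_idPl.
  by rewrite mulfK ?gt_eqF// dyadic_powR.
have Ct : 0 <= Ch * tl t by rewrite mulr_ge0// ltW.
have CQ : 0 <= Ch * tl t * (2 `^ p) ^+ n by rewrite mulr_ge0// exprn_ge0// ltW.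
have [J Jt] := @split_sum n t y N w tl p _ _ nb nt yn (ltW p0) Ct CQ fA fB.
have k0 := kk0.
have tkk : 1 <= t `^ kk.
  by rewrite -[leLHS](powRr0 t); apply: ler_powR => //; lra.
have hJ : (2 `^ p * g) ^+ J <= t `^ kk.
  rewrite /gcst -powRD; last by rewrite pnatr_eq0 implybT.
  have -> : (2 `^ (p - gam)) ^+ J = (2 ^+ J) `^ (p - gam).
    exact: dyadic_exprn_powR.
  apply: (@le_trans _ _ (t `^ (p - gam))).
    by apply: ge0_ler_powR; rewrite ?nnegrE ?exprn_ge0 ?(ltW t0)//; rewrite /p; lra.
  by apply: ler_powR => //; rewrite /p; lra.
have gs := @geom_sum_gt1 _ (2 `^ p * g) n J.+1 Q1.
move=> h; rewrite -(ler_pM2l tl0); apply: (le_trans h).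
have h1 : Ch * tl t * 2 `^ p * \sum_(n <= j < J.+1) (2 `^ p * g) ^+ j <= tl t * (K1 * t `^ kk).
  have c0 : 0 <= Ch * tl t * 2 `^ p by rewrite mulr_ge0// ltW.
  apply: (le_trans (ler_wpM2l c0 gs)).
  have -> : Ch * tl t * 2 `^ p * ((2 `^ p * g) ^+ J.+1 / (2 `^ p * g - 1)) = tl t * (K1 * (2 `^ p * g) ^+ J).
    by rewrite /K1 exprS; field; rewrite gt_eqF// subr_gt0.
  by rewrite ler_pM2l// ler_pM2l.
have h2 : Ch * tl t * (2 `^ p) ^+ n * total_cst n <= tl t * (K2 * t `^ kk).
  have -> : Ch * tl t * (2 `^ p) ^+ n * total_cst n = tl t * K2 by rewrite /K2; ring.
  by rewrite ler_pM2l// ler_peMr.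
rewrite mulrDl mulrDr; exact: lerD.
Qed.

(** Ages in one unit cell come from points in a window of length one, which sits in a window of the
    finest scale, of length [2 ^- J * t >= 1]. A cell thus holds at most [g ^+ J / tl t] points, of
    order [t ^ (2 * (alpha - gam))], while the cell values are summable. *)
Lemma cell_rate n (a : nat -> R) (atot : R) : (forall j, 0 <= a j) ->
  (forall m, \sum_(j < m) a j <= atot) -> exists2 K, 0 < K & exists A, forall t, A <= t ->
  forall w N y, ~ sbad n t w -> 0 <= y <= n%:R * t ->
  shot_rate Th sz (fun x => a (Num.truncn x)) y N w <= K * t `^ kk.
Proof.
move=> a0 atotE; have ga := gam_alpha; have gg := gam0.
have atot0 : 0 <= atot by have := atotE 0%N; rewrite big_ord0.
have ag : 0 < alpha - gam by lra.
have [A1 A11 [c c0 low]] := rv_lower rvtl ag.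
exists ((atot + 1) * (2 `^ gam / c)); first by rewrite mulr_gt0 ?divr_gt0 ?powR_gt0//; lra.
exists (Num.max A1 (2 ^+ n)) => t; rewrite ge_max => /andP[t1 nt] w N y nb /andP[y0 yn].
have t1' : 1 <= t by exact: le_trans t1.
have t0 : 0 < t by exact: lt_le_trans t1'.
have /andP[tl0 _] := tl01 t.
have [J /andP[J1 J2]] := dyadic_scale t1'.
have nJ : (n <= J)%N by rewrite -ltnS -(ltr_eXn2l (x := 2 : R)) ?ltr1n//; exact: le_lt_trans J2.
have JK : g ^+ J / tl t <= 2 `^ gam / c * t `^ kk.
  have gJ : g ^+ J <= 2 `^ gam * t `^ (- gam).
    have -> : g ^+ J = (2 ^+ J) `^ (- gam).
      exact: dyadic_exprn_powR.
    rewrite !powRN ler_pdivlMr ?powR_gt0// mulrC ler_pdivrMr ?powR_gt0 ?exprn_gt0//.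
    rewrite -powRM ?exprn_ge0//; apply: ge0_ler_powR; rewrite ?nnegrE ?mulr_ge0 ?exprn_ge0 ?(ltW t0) ?(ltW gg)//.
    by rewrite -exprS ltW.
  have lo := low t t1.
  have tp : 0 < t `^ (- alpha - (alpha - gam)) by rewrite powR_gt0.
  rewrite ler_pdivrMr//; apply: (le_trans gJ).
  rewrite -!mulrA ler_pM2l ?powR_gt0// mulrC -ler_pdivrMr ?invr_gt0// invrK.
  apply: (@le_trans _ _ (t `^ kk * (c * t `^ (- alpha - (alpha - gam))))); last first.
    by apply: ler_wpM2l => //; exact: powR_ge0.
  rewrite (mulrC c) mulrA ler_pM2r// -powRD; last by rewrite (gt_eqF t0) implybT.
  by have k0 := kk0; apply: ler_powR => //; lra.
pose m := (Num.truncn y).+1.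
have cell (x : R) : 0 <= x -> x <= y -> a (Num.truncn x) = \sum_(j < m) a j * (j%:R <= x < j.+1%:R)%R%:R.
  move=> x0 xy; have jm : (Num.truncn x < m)%N by rewrite ltnS; apply: le_truncn.
  rewrite (bigD1 (Ordinal jm))//= big1 ?addr0.
    by rewrite (truncn_itv x0) mulr1.
  move=> j jx; rewrite (_ : (_ <= x < _) = false) ?mulr0//; apply/negbTE/negP => hj.
  have := truncn_def hj => E'; move/eqP: jx; apply; apply: val_inj => /=; by rewrite E'.
apply: (@le_trans _ _ (\sum_(j < m) a j * (window (walk ^~ w) N (y - j%:R - 1) (y - j%:R))%:R)).
  rewrite /shot_rate /window.
  under [leRHS]eq_bigr do rewrite natr_sum mulr_sumr.
  rewrite exchange_big /=; apply: ler_sum => k _.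
  have wk := walk_ge0 k w.
  case: (leP (walk k w) y) => ky; last by apply: sumr_ge0 => j _; rewrite mulr_ge0.
  rewrite cell; [|lra|lra]; apply: ler_sum => j _; apply: ler_wpM2l => //.
  case: (boolP (j%:R <= y - walk k w < j.+1%:R)) => // /andP[h1 h2].
  by rewrite -natr1 in h2; rewrite ler_nat lt0b; apply/andP; split; lra.
apply: (@le_trans _ _ (\sum_(j < m) a j * (g ^+ J / tl t))).
  apply: ler_sum => j _; apply: ler_wpM2l => //.
  case: (ltP (y - j%:R) 0) => yj.
    rewrite (_ : window _ _ _ _ = 0%N) ?divr_ge0 ?exprn_ge0 ?(ltW tl0) ?(ltW g0)//.
    rewrite /window big1// => k _; have := walk_ge0 k w.
    by case: (boolP (_ < _ <= _)) => // /andP[_ h1] h2; exfalso; lra.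
  have yj' : 0 <= y - j%:R <= n%:R * t.
    by rewrite yj /=; have : 0 <= j%:R :> R by []; lra.
  rewrite ler_pdivlMr// mulrC; apply: le_trans (good_count tl01 N (fun k => sz0 _) nb t0 nJ J1 yj').
  rewrite ler_pM2l// ler_nat; apply: leq_sum => k _.
  case: (boolP (_ < walk k w <= _)) => // /andP[h1 h2]; rewrite lt0b h2 andbT.
  apply: le_lt_trans h1; rewrite lerD2l lerN2.
  by rewrite mulrC ler_pdivlMr ?exprn_gt0// mul1r.
rewrite -mulr_suml -mulrA; apply: ler_pM => //.
- by rewrite sumr_ge0.
- by rewrite divr_ge0 ?exprn_ge0 ?(ltW tl0) ?(ltW g0).
- by apply: (le_trans (atotE m)); lra.
Qed.

End rates.
End walk_sums.

(** * The centred part of the shot noise *)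

Lemma lower_integral_lee {R : realType} {d : measure_display} {T : measurableType d}
    (P : probability T R) (f g : T -> \bar R) : (forall w, 0 <= f w)%E -> (forall w, f w <= g w)%E ->
  (\int[P]_w f w <= \int[P]_w g w)%E.
Proof.
move=> f0 fg; have g0 w : (0 <= g w)%E by exact: le_trans (fg w).
rewrite !ge0_integralTE//; apply: le_ereal_sup => _ /= [h hf <-]; exists h => // w.
exact: (le_trans (hf w)).
Qed.

Lemma grid_above {R : realType} (del v : R) : 0 < del -> 0 <= v ->
  exists j : nat, 0 <= j%:R * del - v < del.
Proof.
move=> del0 v0; pose j := `|Num.ceil (v / del)|%N; exists j.
have vd : 0 <= v / del by rewrite divr_ge0// ltW.
have c0 : 0 <= Num.ceil (v / del) by rewrite ceil_ge0 (lt_le_trans _ vd)// ltrN10.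
have jE : (j%:R : R) = (Num.ceil (v / del))%:~R by rewrite /j natr_absz ger0_norm.
have h1 : v / del <= j%:R by rewrite jE; exact: ceil_ge.
have h2 : j%:R - 1 < v / del by rewrite jE; have := ceilB1_lt (v / del); rewrite ?intrB.
move: h1 h2; rewrite ler_pdivrMr// ltr_pdivlMr// mulrBl mul1r => h1 h2.
by apply/andP; split; lra.
Qed.

Section shots_grid.
Context {R : realType} {d : measure_display} {T : measurableType d}.
Variable (P : probability T R).
Context {dE : measure_display} {E : measurableType dE} (mu : probability E R).
Variables (Th : nat -> T -> E) (C : set (set E)).
Hypothesis iid : iid_gen P mu Th C.
Variable sz : E -> R.
Hypothesis msz : measurable_fun setT sz.

Lemma shots_grid (l : nat) : exists2 K : R, 0 <= K &
  forall (D : E * R -> R) (c m b : R -> R) (L y del S : R) (N : nat) (good : T -> Prop),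
  measurable_fun setT D -> measurable_fun setT b -> 1 <= L -> 0 < y -> 0 < del -> 0 <= S ->
  (forall x, 0 <= x ->
    (\int[mu]_e (D (e, x) ^+ 2 + D (e, x) ^+ (2 * l.+1))%:E <= (c x)%:E)%E) ->
  (forall x, 0 <= x -> `|fine (\int[mu]_e (D (e, x))%:E)%E| <= m x) ->
  (forall x, 0 <= x -> c x / L ^+ 2 + m x / L <= b x) ->
  (forall w s, good w -> 0 <= s <= S -> shot_rate Th sz b s N w <= 1) ->
  exists B, [/\ measurable B, (P B <= ((S / del + 1) * (expR K * (L / y) ^+ (2 * l.+1)))%:E)%E &
    forall w, ~ B w -> good w -> forall j : nat, j%:R * del <= S ->
      `|shots Th sz D (j%:R * del) N w| <= y].
Proof.
have [K K0 HK] := @shots_tail _ _ _ P _ _ mu Th C iid sz msz l.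
exists K => // D c m b L y del S N good mD mb L1 y0 del0 S0 hc hm hb hgood.
pose M := (Num.truncn (S / del)).+1.
pose F (j : nat) : set T := [set w | (y < `|shots Th sz D (j%:R * del) N w|)%R /\
   (shot_rate Th sz b (j%:R * del) N w <= 1)%R].
have mF j : measurable (F j).
  rewrite (_ : F j = [set w | y < `|shots Th sz D (j%:R * del) N w|] `&`
    [set w | shot_rate Th sz b (j%:R * del) N w <= 1])//.
  apply: measurableI.
    apply: measurable_set_gt; apply: measurableT_comp => //; exact: (measurable_shots iid).
  apply: measurable_set_le; exact: (measurable_shot_rate iid).
exists (\big[setU/set0]_(j < M) F j); split.
- by apply: bigsetU_measurable => j _.
- apply: (le_trans (Boole_inequality P (A := F) (fun j _ => mF j))).
  apply: (@le_trans _ _ (\sum_(j < M) (expR K * (L / y) ^+ (2 * l.+1))%:E)%E).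
    by apply: lee_sum => j _; exact: (HK D c m b).
  rewrite sumEFin lee_fin sumr_const card_ord -[_ *+ M]mulr_natl; apply: ler_wpM2r.
    by rewrite mulr_ge0 ?expR_ge0// exprn_ge0// divr_ge0 ?(ltW y0)// (le_trans ler01).
  by rewrite /M -natr1 lerD2r truncn_le divr_ge0// ltW.
- move=> w wB gw j jS; rewrite leNgt; apply/negP => h; apply: wB.
  have jM : (j < M)%N.
    rewrite ltnS truncn_ge_nat ?divr_ge0 ?(ltW del0)// ler_pdivlMr//.
  rewrite (bigD1 (Ordinal jM))//=; left; split => //.
  by apply: hgood => //; rewrite jS andbT mulr_ge0// ltW.
Qed.

End shots_grid.

(** * A measurable version of the local oscillation *)

Section oscillation.
Context {R : realType}.
Variable (h : R -> R) (del : R).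
Hypothesis ch : cadlag0 h.
Hypothesis del0 : 0 < del.
Local Notation M := (markT R).

(** The value [0] at negative ages reproduces the indicator in the oscillation condition and removes
    the points that lie after the time of observation. *)
Definition cent (z : M * R) : R := if 0 <= z.2 then mark_path z.1 z.2 - h z.2 else 0.

Lemma measurable_cent : measurable_fun setT cent.
Proof.
apply: (@measurable_joint _ _ M (fun e x => mark_path e x - h x)).
  move=> t t0; apply: measurable_funB; last exact: measurable_cst.
  exact: measurable_mark_path.
move=> e t t0; apply: cvgB; first by have [c _] := mark_cadlag e; exact: c.
by have [c _] := ch; exact: c.
Qed.

Lemma cent_right e (z : R) : cent (e, x) @[x --> z^'+] --> cent (e, z).
Proof.
case: (leP 0 z) => z0.
  rewrite /cent /= z0.
  have c : mark_path e x - h x @[x --> z^'+] --> mark_path e z - h z.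
    by apply: cvgB; [have [c _] := mark_cadlag e; exact: c|have [c _] := ch; exact: c].
  apply: cvg_trans c; apply: near_eq_cvg; near=> x; rewrite ifT//.
  by apply: (le_trans z0); near: x; exact: nbhs_right_ge.
rewrite {2}/cent /= leNgt z0 /=.
apply: cvg_near_cst; near=> x; rewrite /cent /= ifF//; apply/negbTE; rewrite -ltNge.
by near: x; exact: nbhs_right_lt.
Unshelve. all: by end_near. Qed.

(** An enumeration of the rationals of [[0, del[], with default [0]; a countable family of shifts
    makes the supremum measurable. *)
Definition osc_shift (n : nat) : R :=
  let q := if @unpickle rat n is Some q then ratr q else 0 in if 0 <= q < del then q else 0.

Lemma osc_shift_itv n : 0 <= osc_shift n < del.
Proof. by rewrite /osc_shift; case: unpickle => [q|] //; case: ifP => // _; rewrite lexx. Qed.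

Definition osc (z : M * R) : R := sups (fun n => `|cent z - cent (z.1, z.2 - osc_shift n)|) 0.

Lemma osc_bounded z : has_ubound (range (fun n => `|cent z - cent (z.1, z.2 - osc_shift n)|)).
Proof.
case: z => e x.
have [M1 M10 hM1] : exists2 B, 0 <= B & forall y, y <= x -> `|cent (e, y)| <= B.
  case: (ltP x 0) => x0.
    by exists 0 => // y yx; rewrite /cent /= ifF ?normr0//; apply/negbTE; rewrite -ltNge; lra.
  have [B1 B10 hB1] := cadlag0_bounded (mark_cadlag e) x0.
  have [B2 B20 hB2] := cadlag0_bounded ch x0.
  exists (B1 + B2); first exact: addr_ge0.
  move=> y yx; rewrite /cent /=; case: ifP => y0; last by rewrite normr0 addr_ge0.
  apply: (le_trans (ler_normB _ _)); apply: lerD; [apply: hB1|apply: hB2]; by rewrite y0.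
exists (M1 + M1) => _ [n _ <-] /=; have /andP[s0 _] := osc_shift_itv n.
by apply: (le_trans (ler_normB _ _)); apply: lerD; apply: hM1; lra.
Qed.

Lemma measurable_osc : measurable_fun setT osc.
Proof.
apply: (@measurable_fun_sups _ _ _ setT (fun n z => `|cent z - cent (z.1, z.2 - osc_shift n)|) 0).
  by move=> z _; exact: osc_bounded.
move=> n; apply: measurableT_comp => //; apply: measurable_funB; first exact: measurable_cent.
apply: (measurableT_comp measurable_cent).
apply/measurable_fun_pairP; split => /=; first exact: measurable_fst.
by apply: measurable_funB; [exact: measurable_snd|exact: measurable_cst].
Qed.

Lemma osc_ge_shift z n : `|cent z - cent (z.1, z.2 - osc_shift n)| <= osc z.
Proof. by apply: ub_le_sup; [have [B hB] := osc_bounded z; exists B => _ [k _ <-]; apply: hB; exists k|exists n]. Qed.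

Lemma osc_ge0 z : 0 <= osc z.
Proof. exact: le_trans (osc_ge_shift z 0). Qed.

(** Right-continuity in the age: a rational shift slightly below [y] gives an age slightly above
    [x - y]. *)
Lemma osc_ge e x y : 0 <= y < del -> `|cent (e, x) - cent (e, x - y)| <= osc (e, x).
Proof.
move=> /andP[y0 yd]; case: (ltP 0 y) => y0'; last first.
  have -> : y = 0 by lra.
  by rewrite subr0 subrr normr0 osc_ge0.
apply/ler_addgt0Pr => eps eps0.
have /cvgrPdist_le /(_ eps eps0) := @cent_right e (x - y).
move=> [eta /= eta0 heta].
have lt : Num.max 0 (y - eta) < y by rewrite gt_max y0' gtrBl.
have [q] := rat_in_itvoo lt; rewrite in_itv /= gt_max => /andP[/andP[q0 qe] qy].
have sE : osc_shift (pickle q) = ratr q.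
  by rewrite /osc_shift pickleK (ltW q0) (lt_trans qy yd).
have := osc_ge_shift (e, x) (pickle q); rewrite sE /= => h1.
have h2 : `|cent (e, x - y) - cent (e, x - ratr q)| <= eps.
  by apply: heta; rewrite /= ?ltr_norml ?in_itv /=; [apply/andP; split; lra|lra].
have -> : cent (e, x) - cent (e, x - y) =
  (cent (e, x) - cent (e, x - ratr q)) + (cent (e, x - ratr q) - cent (e, x - y)) by ring.
by apply: (le_trans (ler_normD _ _)); rewrite lerD// distrC.
Qed.

(* [osc] is a supremum of countably many of the increments whose supremum
   enters the modulus of the statement. *)
Lemma osc_pow_le e (S : \bar R) x (l : nat) : (0 < l)%N ->
  (forall y, 0 <= y < del -> ((`|cent (e, x) - cent (e, x - y)| ^+ l)%:E <= S)%E) ->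
  ((osc (e, x) ^+ l)%:E <= S)%E.
Proof.
move=> l0 hS.
have S0 : (0 <= S)%E.
  have d0 : 0 <= (0 : R) < del by rewrite lexx.
  by apply: le_trans (hS 0 d0); rewrite lee_fin exprn_ge0.
case: S hS S0 => [s|//|//] hS s0; last by rewrite leey.
rewrite lee_fin; rewrite lee_fin in s0.
pose c := s `^ (l%:R^-1).
have cl : c ^+ l = s.
  rewrite -powR_mulrn ?powR_ge0// -powRrM mulVf ?powRr1//.
  by rewrite pnatr_eq0 -lt0n.
have oc : osc (e, x) <= c.
  apply: ge_sup; first by exists `|cent (e, x) - cent (e, x - osc_shift 0)|; exists 0%N.
  move=> _ [n _ <-] /=; have := hS _ (osc_shift_itv n); rewrite lee_fin -{1}cl => h1.
  by rewrite -(ler_pXn2r l0) ?nnegrE ?powR_ge0.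
by rewrite -cl; apply: lerXn2r; rewrite ?nnegrE ?osc_ge0 ?powR_ge0.
Qed.

End oscillation.

Section grid_bridge.
Context {R : realType} {d : measure_display} {T : measurableType d}.
Variables (Th : nat -> T -> markT R) (sz : markT R -> R) (h : R -> R) (del : R).
Hypothesis ch : cadlag0 h.
Hypothesis del0 : 0 < del.

(** The time [v] is compared with the next grid time [s]. Ages at [v] are those at [s] reduced by
    [s - v < del]; a point between [v] and [s] has negative age at [v], where [cent] is [0]. *)
Lemma shots_bridge s v N w : 0 <= s - v < del ->
  `|shots Th sz (cent h) v N w| <=
  `|shots Th sz (cent h) s N w| + `|shots Th sz (osc h del) s N w|.
Proof.
move=> sv; have /andP[sv0 svd] := sv.
suff : `|shots Th sz (cent h) s N w - shots Th sz (cent h) v N w| <= `|shots Th sz (osc h del) s N w|.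
  set a := shots _ _ _ v _ _; set b := shots _ _ _ s _ _ => hab.
  have -> : a = b - (b - a) by ring.
  by apply: (le_trans (ler_normB _ _)); rewrite lerD2l.
rewrite /shots -sumrB; apply: (le_trans (ler_norm_sum _ _ _)).
apply: le_trans (ler_norm _); apply: ler_sum => k _.
set W := walk Th sz k w.
case: (leP W s) => Ws; last first.
  by rewrite ifF ?subrr ?normr0//; apply/negbTE; rewrite -ltNge; lra.
have -> : (if W <= v then cent h (Th k w, v - W) else 0) = cent h (Th k w, (s - W) - (s - v)).
  rewrite (_ : s - W - (s - v) = v - W); last by ring.
  case: (leP W v) => Wv //; rewrite /cent /= ifF//; apply/negbTE; rewrite -ltNge; lra.
exact: osc_ge.
Qed.

End grid_bridge.

Lemma shot_rate_lin {R : realType} {d : measure_display} {T : measurableType d}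
    {dE : measure_display} {E : measurableType dE} (Th : nat -> T -> E) (sz : E -> R)
    (f g : R -> R) (a b s : R) N w :
  shot_rate Th sz (fun x => a * f x + b * g x) s N w =
  a * shot_rate Th sz f s N w + b * shot_rate Th sz g s N w.
Proof.
rewrite /shot_rate !mulr_sumr -big_split /=; apply: eq_bigr => k _.
by case: ifP => // _; rewrite !mulr0 addr0.
Qed.

Lemma eq_shot_rate {R : realType} {d : measure_display} {T : measurableType d}
    {dE : measure_display} {E : measurableType dE} (Th : nat -> T -> E) (sz : E -> R)
    (f g : R -> R) (s : R) N w : (forall x, 0 <= x -> f x = g x) ->
  shot_rate Th sz f s N w = shot_rate Th sz g s N w.
Proof.
move=> fg; apply: eq_bigr => k _; case: ifP => // h.
by rewrite fg// subr_ge0.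
Qed.

Lemma exprD_le {R : realType} (a b : R) m : 0 <= a -> 0 <= b -> (a + b) ^+ m <= 2 ^+ m * (a ^+ m + b ^+ m).
Proof.
move=> a0 b0; apply: (@le_trans _ _ ((2 * Num.max a b) ^+ m)).
  apply: lerXn2r; rewrite ?nnegrE ?addr_ge0 ?mulr_ge0 ?le_max ?a0//.
  by case: (leP a b) => ab; lra.
rewrite exprMn; apply: ler_wpM2l; first exact: exprn_ge0.
by case: (leP a b) => ab; rewrite ?lerDl ?lerDr exprn_ge0.
Qed.

Lemma osc_rate_bound {R : realType} (K1 K2 K3 tau x1 x2 x3 : R) : 0 <= K1 -> 0 <= K2 -> 0 <= K3 ->
  1 <= tau -> x1 <= K1 * tau -> x2 <= K2 * tau -> x3 <= K3 * tau ->
  let L := 3 * (K1 + K2 + K3 + 1) * tau in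
  1 <= L /\ L ^- 2 * (x2 + x3) + L^-1 * x1 <= 1.
Proof.
move=> K10 K20 K30 tau1 g1 g2 g3 L.
have tau0 : 0 <= tau by lra.
have k1 := mulr_ge0 K10 tau0; have k2 := mulr_ge0 K20 tau0; have k3 := mulr_ge0 K30 tau0.
have LE : L = 3 * (K1 * tau) + 3 * (K2 * tau) + 3 * (K3 * tau) + 3 * tau by rewrite /L; ring.
have L1 : 1 <= L by rewrite LE; lra.
have L0 : 0 < L by lra.
split=> //.
have h1 : L ^- 2 * (x2 + x3) <= 1 / 3.
  rewrite mulrC ler_pdivrMr ?exprn_gt0//.
  have : L <= L ^+ 2 by rewrite expr2 ler_peMr// ltW.
  by rewrite {1}LE; lra.
have h2 : L^-1 * x1 <= 1 / 3 by rewrite mulrC ler_pdivrMr// LE; lra.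
lra.
Qed.

Section poly_decay.
Context {R : realType}.
Variable s0 : R.
Hypothesis s00 : 0 < s0.

(** Chosen so that [(s0 / 2) * decay_exp.+1 >= 2]: the tail bound then decays like [t ^ (-2)], which
    beats a number of grid points of order [t]. *)
Definition decay_exp : nat := Num.truncn (4 / s0).

Lemma grid_prob_small (A0 K Cz e : R) : 0 <= A0 -> 0 <= Cz -> 0 < e ->
  exists2 A, 1 <= A & forall t z, A <= t -> 0 <= z -> z ^+ 2 <= Cz * t `^ (- (s0 / 2)) ->
  (A0 * t + 1) * (expR K * z ^+ (2 * decay_exp.+1)) <= e.
Proof.
move=> A00 Cz0 e0; set l := decay_exp.
pose D := (A0 + 1) * (expR K * Cz ^+ l.+1).
have D0 : 0 <= D by rewrite !mulr_ge0 ?addr_ge0 ?expR_ge0// exprn_ge0.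
exists (Num.max 1 (D / e)); first by rewrite le_max lexx.
move=> t z; rewrite ge_max => /andP[t1 tD] z0 zC.
have t0 : 0 < t by exact: lt_le_trans t1.
have h1 : z ^+ (2 * l.+1) <= Cz ^+ l.+1 * t^-1 ^+ 2.
  rewrite exprM; apply: (@le_trans _ _ ((Cz * t `^ (- (s0 / 2))) ^+ l.+1)).
    by apply: lerXn2r; rewrite ?nnegrE ?exprn_ge0 ?mulr_ge0 ?powR_ge0.
  rewrite exprMn; apply: ler_wpM2l; first exact: exprn_ge0.
  rewrite -powR_mulrn ?powR_ge0// -powRrM.
  have -> : t^-1 ^+ 2 = t `^ (- 2%:R) by rewrite powR_invn ?(ltW t0)// exprVn.
  apply: ler_powR => //; rewrite mulNr lerN2.
  have : 4 / s0 < l.+1%:R by exact: truncnS_gt.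
  rewrite ltr_pdivrMr//; lra.
apply: (@le_trans _ _ (((A0 + 1) * t) * (expR K * (Cz ^+ l.+1 * t^-1 ^+ 2)))).
  apply: ler_pM.
  - by rewrite addr_ge0// mulr_ge0// ltW.
  - by rewrite mulr_ge0 ?expR_ge0// exprn_ge0.
  - by rewrite mulrDl mul1r lerD2l.
  - by apply: ler_wpM2l => //; exact: expR_ge0.
have -> : (A0 + 1) * t * (expR K * (Cz ^+ l.+1 * t^-1 ^+ 2)) = D / t.
  by rewrite /D; field; rewrite gt_eqF.
by move: tD; rewrite ler_pdivrMr// ler_pdivrMr// mulrC.
Qed.

End poly_decay.

(** * Uniform smallness of the centred part *)

Section model.
Context {R : realType} {d : measure_display} {T : measurableType d} (P : probability T R).
Variables (X : nat -> T -> R -> R) (xi : nat -> T -> R).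
Hypothesis mX : forall k t, measurable_fun setT (fun w => X k w t).
Hypothesis mxi : forall k, measurable_fun setT (xi k).
Hypothesis cX : forall k w, cadlag0 (X k w).
Hypothesis iidX : iid_pairs P X xi.
Hypothesis momX : forall t, 0 <= t -> forall l : nat,
  P.-integrable setT (fun w => ((`|X 0%N w t| ^+ l)%R)%:E).
Let h t := Exp P (fun w => X 0%N w t).
Let Xh w t := X 0%N w t - h t.
Hypothesis ch : cadlag0 h.
Variables (alpha rho gam p : R).
Let tl := tail P (xi 0%N).
Hypothesis alpha01 : 0 < alpha < 1.
Hypothesis rvtl : rv tl (- alpha).
Hypothesis rvh : rv h rho.
Hypothesis momh : forall l : nat, (0 < l)%N -> exists C, 0 < C /\
     forall t, 0 <= t -> Exp P (fun w => Xh w t ^+ (2 * l)) <= C * h t.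
Variable del : R.
Hypothesis del0 : 0 < del.
Hypothesis hosc : forall l : nat, (0 < l)%N ->
     ((forall t, 0 <= t -> (sup_mod P Xh del l t < +oo)%E) /\
        dRi (fun t => fine (sup_mod P Xh del l t)))
     \/
     ((forall b, exists M, forall t, 0 <= t <= b -> (sup_mod P Xh del l t <= M%:E)%E) /\
      (exists C A, forall t, A <= t ->
         (sup_mod P Xh del l t <= (C * tail P (xi 0%N) t)%:E)%E)).
Hypothesis gam0 : 0 < gam.
Hypothesis gam_alpha : gam < alpha.
Hypothesis p0 : 0 < p.
Hypothesis prho : - p < rho.
Hypothesis Qg : 2 `^ p * gcst gam < 1.
Let s0 := rho + alpha.
Hypothesis s00 : 0 < s0.
Hypothesis kk0 : 2 * (alpha - gam) <= s0 / 4.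

Local Notation Th := (marks xi cX).
Local Notation mu := (mark_law P mX mxi cX).

Definition mark_step (e : markT R) : R := Num.max 0 (mark_size e).
Local Notation sz := mark_step.

Lemma measurable_mark_step : measurable_fun setT sz.
Proof. by apply: measurable_maxr; [exact: measurable_cst|exact: measurable_mark_size]. Qed.

Lemma mark_step_ge0 e : 0 <= sz e.
Proof. by rewrite /mark_step le_max lexx. Qed.

Let iid : iid_gen P mu Th (@cylinder R) := iid_marks mX mxi cX iidX.

Lemma tl01 t : 0 < tl t <= 1.
Proof.
rewrite tail_le1 ?andbT//; have [A A1 [C C0 HA]] := rv_potter rvtl ltr01.
have At : A <= Num.max A t by rewrite le_max lexx.
have [h1 _ _ _] := HA (Num.max A t) (Num.max A t) At (lexx _).
by apply: (lt_le_trans h1); apply: tail_nonincr => //; rewrite le_max lexx orbT.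
Qed.

Lemma tl_mono x y : x <= y -> tl y <= tl x.
Proof. exact: tail_nonincr. Qed.

Lemma step_laplace l : 0 <= l -> (\int[mu]_e (expR (- (l * sz e)))%:E = (laplace P (xi 0%N) l)%:E)%E.
Proof.
move=> l0; rewrite ge0_integral_mark_law.
- by rewrite -laplaceE.
- apply/measurable_EFinP; apply: measurableT_comp => //; apply: measurableT_comp => //.
  by apply: measurable_funM; [exact: measurable_cst|exact: measurable_mark_step].
- by move=> e; rewrite lee_fin expR_ge0.
Qed.

(** The sign comes from the moment condition, which puts an even moment below [C * h z]. *)
Lemma h_ge0 z : 0 <= z -> 0 <= h z.
Proof.
move=> z0; have [C [C0 hC]] := momh (ltn0Sn 0); have := hC z z0; apply: contraTT.
rewrite -!ltNge => hz; apply: (@lt_le_trans _ _ 0); first by rewrite pmulr_rlt0.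
rewrite /Exp fine_ge0//; apply: integral_ge0 => w _.
by rewrite lee_fin muln1 sqr_ge0.
Qed.

Lemma h_bound b : 0 <= b -> exists M, forall z, 0 <= z <= b -> h z <= M.
Proof.
move=> b0; have [M _ hM] := cadlag0_bounded ch b0; exists M => z /hM.
by apply: le_trans; exact: ler_norm.
Qed.

Lemma integral_mark_law (f : markT R -> \bar R) : measurable_fun setT f ->
  (\int[mu]_e f e = \int[P]_w f (Th 0 w))%E.
Proof.
move=> mf; rewrite integralE [RHS]integralE; congr (_ - _)%E.
- rewrite (ge0_integral_mark_law P mX mxi cX (f := f^\+)%E)//; last exact: measurable_funepos.
  by apply: eq_integral => w _; rewrite !funeposE.
- rewrite (ge0_integral_mark_law P mX mxi cX (f := f^\-)%E)//; last exact: measurable_funeneg.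
  by apply: eq_integral => w _; rewrite !funenegE.
Qed.

Let mXh x : measurable_fun setT (fun w => Xh w x).
Proof. by apply: measurable_funB => //; exact: measurable_cst. Qed.

Lemma cent_integrable m x : 0 <= x -> P.-integrable setT (fun w => (`|Xh w x| ^+ m)%:E).
Proof.
move=> x0.
have i2 : P.-integrable setT (fun w => (2 ^+ m * (`|X 0%N w x| ^+ m + `|h x| ^+ m))%:E).
  rewrite (_ : (fun w => _) = (fun w => (2 ^+ m)%:E * ((`|X 0%N w x| ^+ m)%:E + (`|h x| ^+ m)%:E))%E); last first.
    by apply/funext => w; rewrite -EFinD -EFinM.
  apply: integrableZl => //; apply: integrableD => //; first exact: momX.
  by apply: (@bounded_integrable _ _ _ P (fun=> `|h x| ^+ m) `|h x ^+ m|) => // w; rewrite normrX normr_id normrX.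
apply: le_integrable i2 => //.
  apply/measurable_EFinP; apply: measurable_funX; apply: measurableT_comp => //; exact: mXh.
move=> w _; rewrite !abse_EFin lee_fin ger0_norm ?exprn_ge0// ger0_norm; last first.
  by rewrite mulr_ge0 ?addr_ge0 ?exprn_ge0.
apply: le_trans (exprD_le _ _ _) => //; apply: lerXn2r; rewrite ?nnegrE ?addr_ge0//.
exact: ler_normB.
Qed.

Lemma cent_moment l x : 0 <= x ->
  (\int[P]_w (Xh w x ^+ (2 * l))%:E = (Exp P (fun w => Xh w x ^+ (2 * l)))%:E)%E.
Proof.
move=> x0; rewrite /Exp fineK//.
have -> : (fun w => (Xh w x ^+ (2 * l))%:E) = (fun w => (`|Xh w x| ^+ (2 * l))%:E).
  by apply/funext => w; rewrite !exprM real_normK ?num_real.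
by apply: integrable_fin_num => //; exact: cent_integrable.
Qed.

Let centE x w : 0 <= x -> cent h (Th 0 w, x) = Xh w x.
Proof. by move=> x0; rewrite /cent /= x0. Qed.

Let mcent x : measurable_fun setT (fun e => cent h (e, x)).
Proof.
apply: (measurableT_comp (measurable_cent ch)); apply/measurable_fun_pairP.
by split => /=; [exact: measurable_id|exact: measurable_cst].
Qed.

Let mosc x : measurable_fun setT (fun e => osc h del (e, x)).
Proof.
apply: (measurableT_comp (measurable_osc ch del0)); apply/measurable_fun_pairP.
by split => /=; [exact: measurable_id|exact: measurable_cst].
Qed.

Lemma cent_var (l : nat) : exists2 C, 0 < C & forall x, 0 <= x ->
  (\int[mu]_e (cent h (e, x) ^+ 2 + cent h (e, x) ^+ (2 * l.+1))%:E <= (C * h x)%:E)%E.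
Proof.
have [C1 [C10 h1]] := momh (ltn0Sn 0); have [C2 [C20 h2]] := momh (ltn0Sn l).
exists (C1 + C2); first exact: addr_gt0.
move=> x x0; have ev (k : nat) (z : R) : 0 <= z ^+ (2 * k) by rewrite exprM exprn_ge0// sqr_ge0.
rewrite integral_mark_law; last first.
  by apply/measurable_EFinP; apply: measurable_funD; apply: measurable_funX; exact: mcent.
under eq_integral do rewrite centE// EFinD.
rewrite ge0_integralD//; first last.
- by apply/measurable_EFinP; apply: measurable_funX; exact: mXh.
- by move=> w _; rewrite lee_fin.
- by apply/measurable_EFinP; apply: measurable_funX; exact: mXh.
- by move=> w _; rewrite lee_fin sqr_ge0.
have e1 := @cent_moment 1 x x0; rewrite muln1 in e1; rewrite e1 cent_moment// -EFinD lee_fin mulrDl.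
by have := h1 x x0; rewrite muln1 => h1'; apply: lerD; [exact: h1'|exact: h2].
Qed.

Lemma cent_mean x : 0 <= x -> fine (\int[mu]_e (cent h (e, x))%:E)%E = 0.
Proof.
move=> x0; rewrite integral_mark_law; last by apply/measurable_EFinP; exact: mcent.
have iX : P.-integrable setT (fun w => (X 0%N w x)%:E).
  apply: le_integrable (momX x0 1) => //; first exact/measurable_EFinP.
  by move=> w _; rewrite !abse_EFin lee_fin expr1 normr_id.
under eq_integral do rewrite centE// EFinB.
rewrite integralB//; last by apply: (@bounded_integrable _ _ _ P (fun=> h x) `|h x|).
rewrite integral_prob_cst fineB ?integrable_fin_num//.
by rewrite /= /h /Exp subrr.
Qed.

(** The supremum inside [sup_mod] may fail to be measurable; [osc] is measurable, lies below it, and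
    lower integrals are monotone. *)
Lemma osc_moment l x : (0 < l)%N -> 0 <= x ->
  (\int[mu]_e (osc h del (e, x) ^+ l)%:E <= sup_mod P Xh del l x)%E.
Proof.
move=> l0 x0; rewrite integral_mark_law; last first.
  by apply/measurable_EFinP; apply: measurable_funX; exact: mosc.
apply: lower_integral_lee => w; first by rewrite lee_fin exprn_ge0// osc_ge0.
apply: osc_pow_le => // y /andP[y0 yd]; apply: ereal_sup_ubound.
exists y; first by rewrite /= in_itv /= y0 yd.
congr (_%:E); congr (`|_| ^+ _).
rewrite centE//; congr (_ - _); rewrite /cent /= subr_ge0; by case: ifP.
Qed.

(** Under direct Riemann integrability the rate is the step function of the upper values on unit
    cells, which are summable. In the other case it is a multiple of the tail, enlarged to cover the
    compact range where only local boundedness is known. *)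
Lemma osc_rate (l : nat) : (0 < l)%N -> exists b : R -> R, [/\ measurable_fun setT b,
  (forall x, 0 <= b x), (forall x, 0 <= x -> (\int[mu]_e (osc h del (e, x) ^+ l)%:E <= (b x)%:E)%E) &
  forall n, exists2 K, 0 < K & exists A, forall t, A <= t -> forall w N y,
    ~ sbad Th sz tl gam n t w -> 0 <= y <= n%:R * t -> shot_rate Th sz b y N w <= K * t `^ (s0 / 4)].
Proof.
move=> l0; have sup0 x : (0 <= sup_mod P Xh del l x)%E.
  apply: integral_ge0 => w _; apply: (@le_trans _ _ ((`|Xh w x - (if 0 <= x then Xh w (x - 0) else 0)| ^+ l)%:E)).
    by rewrite lee_fin exprn_ge0.
  by apply: ereal_sup_ubound; exists 0 => //; rewrite /= in_itv /= lexx del0.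
case: (hosc l0) => [[supf [dri _]]|[supb [C [A hC]]]].
- pose f t := fine (sup_mod P Xh del l t).
  have f0 t : 0 <= f t by exact: fine_ge0.
  have [hsum _] := dri 1 ltr01.
  have up_ge x (j : nat) : j%:R <= x <= j.+1%:R -> ((f x)%:E <= upper_val f 1 j)%E.
    by move=> hx; apply: ereal_sup_ubound; exists x => //; rewrite /= in_itv /= !mulr1.
  have up0 j : (0 <= upper_val f 1 j)%E.
    by apply: le_trans (up_ge j%:R j _); [rewrite lee_fin|rewrite lexx ler_nat leqnSn].
  have partial m : (\sum_(j < m) upper_val f 1 j <= \sum_(0 <= j <oo) `|upper_val f 1 j|)%E.
    apply: (@le_trans _ _ (\sum_(0 <= j < m) `|upper_val f 1 j|)%E).
      rewrite big_mkord; apply: lee_sum => j _; exact: lee_abs.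
    exact: nneseries_lim_ge.
  have upf j : (upper_val f 1 j \is a fin_num)%E.
    rewrite ge0_fin_numE//; apply: le_lt_trans hsum; apply: le_trans (partial j.+1).
    by rewrite big_ord_recr /= leeDr//; apply: sume_ge0.
  pose a j := fine (upper_val f 1 j).
  have a0 j : 0 <= a j by exact: fine_ge0.
  pose atot := fine (\sum_(0 <= j <oo) `|upper_val f 1 j|)%E.
  have atotE m : \sum_(j < m) a j <= atot.
    rewrite -lee_fin fineK; last by rewrite ge0_fin_numE//; exact: nneseries_ge0.
    apply: le_trans (partial m); rewrite -sumEFin; apply: lee_sum => j _.
    by rewrite /a fineK.
  exists (fun x => a (Num.truncn x)); split => //.
  + rewrite (_ : (fun x => _) = a \o (fun x : R => (Num.truncn x))); last by [].
    apply: measurableT_comp; first by move=> _ Y _; rewrite setTI.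
    move=> _ Y _; rewrite setTI.
    have -> : (fun x : R => Num.truncn x) @^-1` Y = \bigcup_(j in Y) [set x | Num.truncn x = j].
      by apply/seteqP; split => x /=; [move=> Yx; exists (Num.truncn x)|move=> [j Yj] /= ->].
    apply: bigcup_measurable => j _.
    have -> : [set x : R | Num.truncn x = j] = if j is 0%N then `]-oo, 1[%classic else `[j%:R, j.+1%:R[%classic.
      case: j => [|j]; apply/seteqP; split => x /=; rewrite in_itv /=.
      * by move=> tx; have := truncnS_gt x; rewrite tx.
      * by move=> x1; apply/eqP; rewrite -leqn0 truncn_le_nat.
      * move=> tx; have x1 : 0 <= x by have : (0 < Num.truncn x)%N by [rewrite tx]; rewrite truncn_gt0; apply: le_trans.
        by have := truncn_itv x1; rewrite tx.
      * exact: truncn_def.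
    by case: j => [|j]; exact: measurable_itv.
  + move=> x x0; apply: (le_trans (osc_moment l0 x0)).
    rewrite -[leLHS]fineK; last by rewrite ge0_fin_numE//; exact: supf.
    rewrite /a [leRHS]fineK//; apply: up_ge.
    by have /andP[-> /ltW ->] := truncn_itv x0.
  + move=> n; exact: (cell_rate Th mark_step_ge0 gam0 gam_alpha rvtl tl01 kk0 n a0 atotE).
- pose A' := Num.max A 0; have [M hM] := supb A'.
  pose C' := `|C| + `|M| / tl A'.
  have /andP[tA _] := tl01 A'.
  have C'0 : 0 <= C' by rewrite addr_ge0// divr_ge0// ltW.
  exists (fun x => C' * tl x); split.
  + by apply: measurable_funM; [exact: measurable_cst|exact: measurable_tail].
  + by move=> x; rewrite mulr_ge0//; have /andP[/ltW] := tl01 x.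
  + move=> x x0; apply: (le_trans (osc_moment l0 x0)).
    have /andP[tx _] := tl01 x.
    case: (leP A' x) => Ax.
      apply: (le_trans (hC x _)); first by apply: le_trans Ax; rewrite le_max lexx.
      rewrite lee_fin; apply: ler_wpM2r; first exact: ltW.
      by apply: (le_trans (ler_norm C)); rewrite lerDl divr_ge0// ltW.
    apply: (le_trans (hM x _)); first by rewrite x0 ltW.
    rewrite lee_fin; apply: (@le_trans _ _ (`|M| / tl A' * tl x)).
      rewrite mulrAC ler_pdivlMr//; apply: (@le_trans _ _ (`|M| * tl A')).
        by apply: ler_wpM2r; [exact: ltW|exact: ler_norm].
      by apply: ler_wpM2l => //; apply: tl_mono; exact: ltW.
    by apply: ler_wpM2r; [exact: ltW|rewrite lerDr].
  + move=> n; have [K K0 [A1 HA1]] := tl_rate Th mark_step_ge0 gam0 gam_alpha rvtl tl01 tl_mono kk0 n.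
    exists (C' * K + 1); first by rewrite ltr_wpDl// mulr_ge0// ltW.
    exists (Num.max 1 A1) => t; rewrite ge_max => /andP[t1 tA1] w N y nb yn.
    have := shot_rate_lin Th sz tl tl C' 0 y N w.
    rewrite (_ : (fun x => C' * tl x + 0 * tl x) = (fun x => C' * tl x)); last first.
      by apply/funext => x; rewrite mul0r addr0.
    move=> ->; rewrite mul0r addr0; apply: (le_trans (ler_wpM2l C'0 (HA1 t tA1 w N y nb yn))).
    by rewrite mulrA; apply: ler_wpM2r; [exact: powR_ge0|lra].
Qed.

(** [h / tl] has index [s0 = rho + alpha]; a quarter of it is given up to two Potter losses of
    [s0 / 8]. *)
Lemma ratio_lower : exists2 c, 0 < c & exists2 A, 1 <= A & forall t, A <= t ->
  [/\ 0 < h t & c * t `^ (3 * s0 / 4) <= h t / tl t].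
Proof.
have e0 : 0 < s0 / 8 by rewrite divr_gt0.
have [A1 A11 [c1 c10 H1]] := rv_lower rvh e0.
have [A2 A21 [C2 C20 H2]] := rv_upper rvtl e0.
exists (c1 / C2); first exact: divr_gt0.
exists (Num.max A1 A2); first by rewrite le_max A11.
move=> t; rewrite ge_max => /andP[t1 t2].
have t0 : 0 < t by apply: lt_le_trans t1; exact: lt_le_trans A11.
have g1 := H1 t t1; have g2 := H2 t t2.
have q1 : 0 < c1 * t `^ (rho - s0 / 8) by rewrite mulr_gt0// powR_gt0.
have ht : 0 < h t by exact: lt_le_trans g1.
split => //; have /andP[tt0 _] := tl01 t.
rewrite ler_pdivlMr//; apply: (@le_trans _ _ (c1 / C2 * t `^ (3 * s0 / 4) * (C2 * t `^ (- alpha + s0 / 8)))).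
  by apply: ler_wpM2l => //; rewrite mulr_ge0 ?powR_ge0// divr_ge0 ?ltW.
apply: le_trans g1; rewrite le_eqVlt; apply/orP; left; apply/eqP.
have -> : c1 / C2 * t `^ (3 * s0 / 4) * (C2 * t `^ (- alpha + s0 / 8)) =
  c1 * (t `^ (3 * s0 / 4) * t `^ (- alpha + s0 / 8)) by field; rewrite gt_eqF.
congr (_ * _); rewrite -powRD; last by rewrite (gt_eqF t0) implybT.
by congr (_ `^ _); rewrite /s0; field.
Qed.

Lemma centered_small n (e : R) (Nf : R -> nat) : (0 < n)%N -> 0 < e -> exists A, forall t, A <= t ->
  exists B, [/\ measurable B, (P B <= e%:E)%E & forall w, ~ B w -> ~ sbad Th sz tl gam n t w ->
    forall v, 0 <= v -> v + del <= n%:R * t ->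
      `|tl t / h t * shots Th sz (cent h) v (Nf t) w| <= e].
Proof.
move=> n0 e0; pose l := decay_exp s0.
have [K K0 HK] := @shots_grid _ _ _ P _ _ mu Th _ iid sz measurable_mark_step l.
have [Cv Cv0 hCv] := cent_var l.
have [Kr Kr0 [A1 HA1]] := mean_rate Th mark_step_ge0 tl01 rvh h_bound p0 prho Qg n0.
have [cr cr0 [A2 A21 HA2]] := ratio_lower.
have [b1 [mb1 b10 hb1 rb1]] := osc_rate (ltn0Sn 0).
have [b2 [mb2 b20 hb2 rb2]] := osc_rate (ltn0Sn 1).
have l20 : (0 < 2 * l.+1)%N by [].
have [b3 [mb3 b30 hb3 rb3]] := osc_rate l20.
have [K1 K10 [A3 HA3]] := rb1 n; have [K2 K20 [A4 HA4]] := rb2 n; have [K3 K30 [A5 HA5]] := rb3 n.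
pose Ko := K1 + K2 + K3 + 1.
have Ko1 : 1 <= Ko by rewrite /Ko; lra.
have e20 : 0 < e / 2 by rewrite divr_gt0.
pose Q := Cv * Kr + 1; have Q0 : 0 < Q by rewrite ltr_wpDl// mulr_ge0// ltW.
have An0 : 0 <= n%:R / del by rewrite divr_ge0// ltW.
pose Cz1 := Q / ((e / 2) ^+ 2 * cr).
have Cz10 : 0 <= Cz1 by rewrite divr_ge0 ?mulr_ge0 ?exprn_ge0 ?ltW.
have [A6 A61 HA6] := grid_prob_small s00 K An0 Cz10 e20.
pose Cz2 := (3 * Ko / (e / 2 * cr)) ^+ 2.
have Cz20 : 0 <= Cz2 by exact: sqr_ge0.
have [A7 A71 HA7] := grid_prob_small s00 K An0 Cz20 e20.
have [A8 HA8] : exists A, forall t, A <= t -> 1 <= Q * (cr * t `^ (3 * s0 / 4)).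
  exists (Num.max 1 ((Q * cr)^-1 `^ (4 / (3 * s0)))) => t; rewrite ge_max => /andP[t1 tq].
  have q0 : 0 < Q * cr by rewrite mulr_gt0.
  rewrite mulrA -ler_pdivrMl// mulr1.
  have -> : (Q * cr)^-1 = ((Q * cr)^-1 `^ (4 / (3 * s0))) `^ (3 * s0 / 4).
    rewrite -powRrM (_ : 4 / (3 * s0) * (3 * s0 / 4) = 1) ?powRr1 ?invr_ge0 ?(ltW q0)//.
    by field; rewrite gt_eqF.
  apply: ge0_ler_powR; rewrite ?nnegrE ?powR_ge0 ?(le_trans ler01 t1)//.
  by rewrite divr_ge0// mulr_ge0// ltW.
exists (Num.max A1 (Num.max A2 (Num.max A3 (Num.max A4 (Num.max A5 (Num.max A6 (Num.max A7 A8))))))) => t.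
rewrite !ge_max => /andP[t1 /andP[t2 /andP[t3 /andP[t4 /andP[t5 /andP[t6 /andP[t7 t8]]]]]]].
have tge1 : 1 <= t by exact: le_trans t2.
have t0 : 0 < t by exact: lt_le_trans tge1.
have [ht hr] := HA2 t t2; have [_ hrate] := HA1 t t1.
have /andP[tl0 _] := tl01 t.
set r := h t / tl t in hr.
have r0 : 0 < r by rewrite divr_gt0.
have S0 : 0 <= n%:R * t by rewrite mulr_ge0// ltW.
have y0 : 0 < e / 2 * r by rewrite mulr_gt0.
pose good w := ~ sbad Th sz tl gam n t w.
have tp a b : a <= b -> t `^ a <= t `^ b by move=> ab; exact: ler_powR.
have SE : n%:R * t / del + 1 = n%:R / del * t + 1 by rewrite mulrAC.
have [B1 [mB1 PB1 hB1]] : exists B, [/\ measurable B, (P B <= (e / 2)%:E)%E &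
   forall w, ~ B w -> good w -> forall j : nat, j%:R * del <= n%:R * t ->
     `|shots Th sz (cent h) (j%:R * del) (Nf t) w| <= e / 2 * r].
  (* The accumulated variance is at most [Cv * Kr * r], so [L ^+ 2 = Q * r] keeps the accumulated
     rate below [1]. Then [(L / y) ^+ 2] is of order [1 / r], at most a multiple of
     [t ^ (- (s0 / 2))]. *)
  pose L := Num.sqrt (Q * r).
  have Qr : 1 <= Q * r by apply: (le_trans (HA8 t t8)); rewrite ler_pM2l.
  have L2 : L ^+ 2 = Q * r by rewrite sqr_sqrtr// (le_trans ler01).
  have L1 : 1 <= L by rewrite -sqrtr1 ler_wsqrtr.
  pose hx x := if 0 <= x then h x else 0.
  have mhx : measurable_fun setT hx.
    have m := @measurable_joint _ _ T (fun _ => h) (fun t _ => measurable_cst _) _.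
    have {m} m := m (fun _ t t0 => proj1 ch t t0).
    have := measurableT_comp m (_ : measurable_fun setT (fun x : R => (point : T, x))).
    apply; apply/measurable_fun_pairP; split => /=; [exact: measurable_cst|exact: measurable_id].
  pose b x := Cv / L ^+ 2 * hx x + 0 * hx x.
  have mb : measurable_fun setT b.
    by apply: measurable_funD; apply: measurable_funM => //; exact: measurable_cst.
  have hm x : 0 <= x -> `|fine (\int[mu]_e (cent h (e, x))%:E)%E| <= 0.
    by move=> x0; rewrite cent_mean// normr0.
  have hb x : 0 <= x -> Cv * h x / L ^+ 2 + 0 / L <= b x.
    by move=> x0; rewrite /b /hx x0 !mul0r !addr0 mulrAC.
  have hg w s : good w -> 0 <= s <= n%:R * t -> shot_rate Th sz b s (Nf t) w <= 1.
    move=> gw sS; rewrite /b shot_rate_lin mul0r addr0 (@eq_shot_rate _ _ _ _ _ Th sz hx h); last first.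
      by move=> x x0; rewrite /hx x0.
    have := hrate w (Nf t) s gw sS; rewrite mulrC -ler_pdivlMr// => hs.
    have c0 : 0 <= Cv / L ^+ 2 by rewrite divr_ge0 ?sqr_ge0// ltW.
    apply: (le_trans (ler_wpM2l c0 hs)).
    rewrite L2 -[Kr * h t / tl t]mulrA -/r.
    rewrite (_ : Cv / (Q * r) * (Kr * r) = Cv * Kr / Q); last by field; rewrite !gt_eqF.
    by rewrite ler_pdivrMr// mul1r /Q lerDl.
  have [B [mB PB hB]] := HK (cent h) (fun x => Cv * h x) (fun=> 0) b L (e / 2 * r) del (n%:R * t) (Nf t) good
    (measurable_cent ch) mb L1 y0 del0 S0 hCv hm hb hg.
  exists B; split => //; apply: (le_trans PB); rewrite lee_fin SE.
  apply: HA6 => //; first by rewrite divr_ge0 ?(ltW y0)// (le_trans ler01).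
    rewrite expr_div_n L2 exprMn.
    have -> : Q * r / ((e / 2) ^+ 2 * r ^+ 2) = Q / ((e / 2) ^+ 2) / r.
      by field; rewrite !gt_eqF.
    rewrite ler_pdivrMr//; apply: (@le_trans _ _ (Cz1 * t `^ (- (s0 / 2)) * (cr * t `^ (3 * s0 / 4)))); last first.
      by apply: ler_wpM2l => //; rewrite mulr_ge0// powR_ge0.
    have -> : Cz1 * t `^ (- (s0 / 2)) * (cr * t `^ (3 * s0 / 4)) =
      Q / (e / 2) ^+ 2 * (t `^ (- (s0 / 2)) * t `^ (3 * s0 / 4)).
      by rewrite /Cz1; field; rewrite !gt_eqF.
    rewrite -powRD; last by rewrite (gt_eqF t0) implybT.
    rewrite ler_peMr ?divr_ge0 ?sqr_ge0 ?(ltW Q0)//.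
    rewrite -[leLHS](powRr0 t); apply: tp; have := s00; rewrite /s0; lra.
have [B2 [mB2 PB2 hB2]] : exists B, [/\ measurable B, (P B <= (e / 2)%:E)%E &
   forall w, ~ B w -> good w -> forall j : nat, j%:R * del <= n%:R * t ->
     `|shots Th sz (osc h del) (j%:R * del) (Nf t) w| <= e / 2 * r].
  (* The oscillation terms are not centred, but their accumulated moments are only of order [tau],
     so [L] of order [tau] suffices. Then [L / y] is of order [t ^ (s0 / 4 - 3 * s0 / 4)]. *)
  pose tau := t `^ (s0 / 4); pose L := 3 * Ko * tau.
  have tau1 : 1 <= tau by rewrite -[leLHS](powRr0 t); apply: tp; rewrite divr_ge0// ltW.
  have L1 : 1 <= L.
    have tau0 : 0 <= tau by exact: powR_ge0.
    by have [] := osc_rate_bound (ltW K10) (ltW K20) (ltW K30) tau1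
      (mulr_ge0 (ltW K10) tau0) (mulr_ge0 (ltW K20) tau0) (mulr_ge0 (ltW K30) tau0).
  have Lp : 0 < L by exact: lt_le_trans L1.
  pose b x := L ^- 2 * (1 * b2 x + 1 * b3 x) + L^-1 * b1 x.
  have mb : measurable_fun setT b.
    apply: measurable_funD; apply: measurable_funM => //; try exact: measurable_cst.
    by apply: measurable_funD; apply: measurable_funM => //; exact: measurable_cst.
  have o0 (k : nat) z : 0 <= osc h del z ^+ k by rewrite exprn_ge0// osc_ge0.
  have mo (k : nat) x : measurable_fun setT (fun e => (osc h del (e, x) ^+ k)%:E).
    by apply/measurable_EFinP; apply: measurable_funX; exact: mosc.
  have hc x : 0 <= x -> (\int[mu]_e (osc h del (e, x) ^+ 2 + osc h del (e, x) ^+ (2 * l.+1))%:E <= (b2 x + b3 x)%:E)%E.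
    move=> x0; under eq_integral do rewrite EFinD.
    rewrite ge0_integralD//; try by move=> ? _; rewrite lee_fin.
    by rewrite EFinD; apply: leeD; [exact: hb2|exact: hb3].
  have hm x : 0 <= x -> `|fine (\int[mu]_e (osc h del (e, x))%:E)%E| <= b1 x.
    move=> x0; have i0 : (0 <= \int[mu]_e (osc h del (e, x))%:E)%E.
      by apply: integral_ge0 => ? _; rewrite lee_fin osc_ge0.
    have i1 : (\int[mu]_e (osc h del (e, x))%:E <= (b1 x)%:E)%E by exact: (hb1 x x0).
    rewrite ger0_norm ?fine_ge0// -lee_fin fineK//.
    by rewrite ge0_fin_numE// (le_lt_trans i1)// ltry.
  have hb x : 0 <= x -> (b2 x + b3 x) / L ^+ 2 + b1 x / L <= b x.
    by move=> x0; rewrite /b !mul1r mulrC [b1 x / L]mulrC.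
  have hg w s : good w -> 0 <= s <= n%:R * t -> shot_rate Th sz b s (Nf t) w <= 1.
    move=> gw sS; rewrite /b (@shot_rate_lin _ _ _ _ _ Th sz (fun x => 1 * b2 x + 1 * b3 x) b1) shot_rate_lin !mul1r.
    have g1 := HA3 t t3 w (Nf t) s gw sS; have g2 := HA4 t t4 w (Nf t) s gw sS.
    have g3 := HA5 t t5 w (Nf t) s gw sS; rewrite -/tau in g1 g2 g3.
    by have [_] := osc_rate_bound (ltW K10) (ltW K20) (ltW K30) tau1 g1 g2 g3.
  have [B [mB PB hB]] := HK (osc h del) (fun x => b2 x + b3 x) b1 b L (e / 2 * r) del (n%:R * t) (Nf t) good
    (measurable_osc ch del0) mb L1 y0 del0 S0 hc hm hb hg.
  exists B; split => //; apply: (le_trans PB); rewrite lee_fin SE.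
  have z0 : 0 <= L / (e / 2 * r) by rewrite divr_ge0 ?(ltW y0)// ltW.
  apply: HA7 => //.
  pose U := 3 * Ko / (e / 2 * cr).
  have U0 : 0 <= U.
    apply: divr_ge0; apply: mulr_ge0 => //; [exact: le_trans Ko1|exact: ltW|exact: ltW].
  have zU : L / (e / 2 * r) <= U * t `^ (- (s0 / 2)).
    rewrite ler_pdivrMr//.
    apply: (@le_trans _ _ (U * t `^ (- (s0 / 2)) * (e / 2 * (cr * t `^ (3 * s0 / 4))))); last first.
      by apply: ler_wpM2l; [rewrite mulr_ge0// powR_ge0|rewrite ler_pM2l].
    have -> : U * t `^ (- (s0 / 2)) * (e / 2 * (cr * t `^ (3 * s0 / 4))) =
      3 * Ko * (t `^ (- (s0 / 2)) * t `^ (3 * s0 / 4)).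
      by rewrite /U; field; rewrite !gt_eqF.
    rewrite -powRD; last by rewrite (gt_eqF t0) implybT.
    by rewrite /L /tau (_ : - (s0 / 2) + 3 * s0 / 4 = s0 / 4)//; field.
  apply: (@le_trans _ _ ((U * t `^ (- (s0 / 2))) ^+ 2)).
    apply: lerXn2r; [exact: z0| |exact: zU].
    by apply: mulr_ge0 => //; exact: powR_ge0.
  rewrite exprMn /Cz2 -/U; apply: ler_wpM2l; first exact: sqr_ge0.
  rewrite expr2 ler_piMr ?powR_ge0//.
  by rewrite -[leRHS](powRr0 t); apply: tp; rewrite oppr_le0 divr_ge0// ltW.
exists (B1 `|` B2); split.
- exact: measurableU.
- apply: (le_trans (measureU2 _ mB1 mB2)); rewrite (_ : e = e / 2 + e / 2); last by field.
  by rewrite EFinD; exact: leeD.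
move=> w /not_orP[w1 w2] gw v v0 vS.
have [j /andP[j1 j2]] := grid_above del0 v0.
have jS : j%:R * del <= n%:R * t by lra.
have sv : 0 <= j%:R * del - v < del by rewrite j1.
have := shots_bridge Th sz ch del0 (Nf t) w sv.
have := hB1 w w1 gw j jS; have := hB2 w w2 gw j jS => g1 g2 g3.
rewrite normrM gtr0_norm ?divr_gt0//.
have g4 : `|shots Th sz (cent h) v (Nf t) w| <= e * r by lra.
have -> : e = tl t / h t * (e * r) by rewrite /r; field; rewrite !gt_eqF.
by rewrite ler_pM2l// divr_gt0.
Qed.

End model.

(** * Null sets and the limit theorem *)

Section cadlag_paths.
Context {R : realType}.
Implicit Types f : R -> R.

Lemma at_right_affine (c b t : R) : 0 < c -> (x * c - b) @[x --> t^'+] --> (t * c - b)^'+.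
Proof.
move=> c0 A [e /= e0 he]; exists (e / c); first by rewrite /= divr_gt0.
move=> x /= xe tx; apply: he => /=; last by rewrite ltrD2r ltr_pM2r.
rewrite (_ : t * c - b - (x * c - b) = (t - x) * c); last by ring.
by rewrite normrM (gtr0_norm c0) -ltr_pdivlMr.
Qed.

Lemma at_left_affine (c b t : R) : 0 < c -> (x * c - b) @[x --> t^'-] --> (t * c - b)^'-.
Proof.
move=> c0 A [e /= e0 he]; exists (e / c); first by rewrite /= divr_gt0.
move=> x /= xe tx; apply: he => /=; last by rewrite ltrD2r ltr_pM2r.
rewrite (_ : t * c - b - (x * c - b) = (t - x) * c); last by ring.
by rewrite normrM (gtr0_norm c0) -ltr_pdivlMr.
Qed.

Lemma cadlag0_extend f : cadlag0 f -> let phi x := if 0 <= x then f x else 0 in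
  forall t, phi x @[x --> t^'+] --> phi t /\ cvg (phi x @[x --> t^'-]).
Proof.
move=> [fr fl] phi t; split.
  case: (leP 0 t) => t0.
    rewrite /phi t0; apply: cvg_trans (fr t t0); apply: near_eq_cvg; near=> x; rewrite ifT//.
    by apply: (le_trans t0); near: x; exact: nbhs_right_ge.
  rewrite {2}/phi leNgt t0 /=; apply: cvg_near_cst; near=> x.
  rewrite /phi ifF//; apply/negbTE; rewrite -ltNge; near: x; exact: nbhs_right_lt.
case: (ltP 0 t) => t0.
  have /cvg_ex[l hl] := fl t t0; apply/cvg_ex; exists l.
  apply: cvg_trans hl; apply: near_eq_cvg; near=> x; rewrite /phi ifT//.
  by near: x; exact: nbhs_left_ge.
apply/cvg_ex; exists 0; apply: cvg_near_cst; near=> x.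
rewrite /phi ifF//; apply/negbTE; rewrite -ltNge; apply: lt_le_trans t0.
by near: x; exact: nbhs_left_lt.
Unshelve. all: by end_near. Qed.

Lemma lipschitz_cadlag f (K : R) : 0 <= K -> (forall x y, `|f x - f y| <= K * `|x - y|) -> cadlag_pos f.
Proof.
move=> K0 fK.
have cf : continuous f.
  move=> x; apply/cvgrPdist_le => e e0.
  have K1 : 0 < K + 1 by lra.
  apply/nbhs_ballP; exists (e / (K + 1)); first by rewrite /= divr_gt0.
  move=> y /= xy; apply: (le_trans (fK x y)).
  apply: (@le_trans _ _ ((K + 1) * `|x - y|)); first by apply: ler_wpM2r => //; lra.
  by rewrite mulrC -ler_pdivlMr// ltW.
split=> t _; first by apply: cvg_at_right_filter; exact: cf.
by apply/cvg_ex; exists (f t); apply: cvg_at_left_filter; exact: cf.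
Qed.

Context {d : measure_display} {T : measurableType d}.
Variables (X : nat -> T -> R -> R) (xi : nat -> T -> R) (w : T).
Hypothesis cX : forall k, cadlag0 (X k w).
Local Notation S k := (partial_sum xi k w).

Lemma shot_noise_finite (s : R) (M : nat) : (forall k, (M <= k)%N -> s < S k) ->
  shot_noise X xi w s = \sum_(k < M) (if S k <= s then X k w (s - S k) else 0).
Proof.
move=> hM; rewrite /shot_noise; apply: cvg_lim => //.
apply: cvg_near_cst; exists M => // m /= Mm.
rewrite /series /= (@big_cat_nat _ _ _ M)//= [X in _ + X]big1_seq ?addr0.
  rewrite big_mkord; apply: eq_bigr => k _.
  by case: ifP => _; rewrite ?mulr1 ?mulr0.
move=> k /=; rewrite mem_index_iota => /andP[Mk _].
by rewrite leNgt hM// mulr0.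
Qed.

(** On [u <= t + 1] the series is one fixed finite sum of translated paths, each extended by [0] to
    negative ages. *)
Lemma shot_noise_cadlag (a c : R) : 0 < c ->
  (forall b, exists M : nat, forall k, (M <= k)%N -> b < S k) ->
  cadlag_pos (fun u => a * shot_noise X xi w (u * c)).
Proof.
move=> c0 unb.
pose phi k x := if 0 <= x then X k w x else 0.
have fin b : exists M : nat, forall u, u <= b ->
    a * shot_noise X xi w (u * c) = a * \sum_(k < M) phi k (u * c - S k).
  have [M hM] := unb (b * c); exists M => u ub; congr (_ * _).
  rewrite (@shot_noise_finite _ M); last first.
    by move=> k /hM; apply: le_lt_trans; rewrite ler_pM2r.
  by apply: eq_bigr => k _; rewrite /phi subr_ge0.
have pr k t : phi k (u * c - S k) @[u --> t^'+] --> phi k (t * c - S k).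
  have [h _] := cadlag0_extend (cX k) (t * c - S k).
  exact: cvg_comp (@at_right_affine c (S k) t c0) h.
have pl k t : exists l : R, phi k (u * c - S k) @[u --> t^'-] --> l.
  have [_ /cvg_ex[l h]] := cadlag0_extend (cX k) (t * c - S k).
  exists l; exact: cvg_comp (@at_left_affine c (S k) t c0) h.
split=> t t0; have [M hM] := fin (t + 1).
  rewrite hM; last lra.
  apply: (@cvg_trans _ (a * \sum_(k < M) phi k (u * c - S k) @[u --> t^'+])).
    apply: near_eq_cvg; near=> u; rewrite hM//; near: u.
    by apply: nbhs_right_le; lra.
  by apply: cvgMr; apply: cvg_big => //; move=> [x y]; exact: add_continuous.
have [l hl] := choice (fun k => pl k t).
apply/cvg_ex; exists (a * \sum_(k < M) l k).
apply: (@cvg_trans _ (a * \sum_(k < M) phi k (u * c - S k) @[u --> t^'-])).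
  apply: near_eq_cvg; near=> u; rewrite hM//.
  by apply: (@le_trans _ _ t); [near: u; exact: nbhs_left_le|lra].
by apply: cvgMr; apply: cvg_big => //; move=> [x y]; exact: add_continuous.
Unshelve. all: by end_near. Qed.

End cadlag_paths.

Section null_set.
Context {R : realType} {d : measure_display} {T : measurableType d} (P : probability T R).
Variables (X : nat -> T -> R -> R) (xi : nat -> T -> R).
Hypothesis mX : forall k t, measurable_fun setT (fun w => X k w t).
Hypothesis mxi : forall k, measurable_fun setT (xi k).
Hypothesis cX : forall k w, cadlag0 (X k w).
Hypothesis iidX : iid_pairs P X xi.
Hypothesis xi0 : P [set w | 0 < xi 0%N w] = 1%E.
Variables (alpha gam : R).
Hypothesis gam0 : 0 < gam.
Hypothesis gam_alpha : gam < alpha.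
Hypothesis rvtl : rv (tail P (xi 0%N)) (- alpha).
Local Notation tl := (tail P (xi 0%N)).
Local Notation Th := (marks xi cX).
Local Notation mu := (mark_law P mX mxi cX).
Let iid : iid_gen P mu Th (@cylinder R) := iid_marks mX mxi cX iidX.

Lemma prob_step_bad : exists2 K, 0 < K & exists A, forall n t, (0 < n)%N -> A <= t ->
  (P (sbad Th mark_step tl gam n t) <= (K * 2 ^- n)%:E)%E.
Proof.
apply: (prob_sbad iid measurable_mark_step (q := fun x => laplace P (xi 0%N) x^-1) gam0 gam_alpha rvtl
  (tl01 mxi rvtl) (tl_mono P mxi)).
- move=> x x0; rewrite -(@step_laplace _ _ _ P X xi mX mxi cX x^-1).
    by apply: eq_integral => e _; rewrite mulNr.
  by rewrite invr_ge0 ltW.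
- by move=> x x0; exact: laplace_lower.
Qed.

Lemma walk_partial_sum w : (forall k, 0 < xi k w) -> forall k, walk Th mark_step k w = partial_sum xi k w.
Proof.
move=> pos k; apply: eq_bigr => i _; rewrite /mark_step /=.
by apply/max_idPr; exact: ltW.
Qed.

(** Along the horizons [tn n] the bad events are summable, so by Borel-Cantelli the walk eventually
    passes [n.+1 * tn n] for all large [n]. Positivity of all steps comes from that of the first one
    by equality of laws. *)
Lemma steps_null : exists B, [/\ measurable B, P B = 0%E & forall w, ~ B w ->
  (forall k, 0 < xi k w) /\ forall b, exists M : nat, forall k, (M <= k)%N -> b < partial_sum xi k w].
Proof.
have [K K0 [A HA]] := prob_step_bad.
pose tn (n : nat) := Num.max A (2 ^+ n.+1).
pose F n := sbad Th mark_step tl gam n.+1 (tn n).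
have mF n : measurable (F n) by exact: (measurable_sbad iid measurable_mark_step).
have PF n : (P (F n) <= (K * 2 ^- n)%:E)%E.
  apply: (le_trans (HA _ _ _ _)) => //; first by rewrite le_max lexx.
  rewrite lee_fin ler_pM2l// lef_pV2 ?posrE ?exprn_gt0// ler_eXn2l ?ltr1n//.
have [B1 [mB1 PB1 hB1]] := borel_cantelli_geom (ltW K0) mF PF.
have mZ k : measurable [set w | xi k w <= 0] by exact: measurable_set_le.
have PZ k : P [set w | xi k w <= 0] = 0%E.
  have mS : measurable ([set e | mark_size e <= 0] : set (markT R)).
    by apply: measurable_set_le; exact: measurable_mark_size.
  have := iid_law iid k mS; rewrite mark_lawE -/(_ @^-1` _) => E.
  have -> : [set w | xi k w <= 0] = Th k @^-1` [set e | mark_size e <= 0] by [].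
  rewrite E; have -> : Th 0 @^-1` [set e | mark_size e <= 0] = ~` [set w | 0 < xi 0%N w].
    by apply/seteqP; split => w /=; rewrite leNgt => /negP.
  by rewrite probability_setC ?xi0 ?subee//; exact: measurable_set_gt.
exists (B1 `|` \bigcup_k [set w | xi k w <= 0]); split.
- by apply: measurableU => //; exact: bigcupT_measurable.
- apply/eqP; rewrite eq_le measure_ge0 andbT.
  apply: (le_trans (measureU2 _ _ _)) => //; first exact: bigcupT_measurable.
  have U0 : P (\bigcup_k [set w | xi k w <= 0]) = 0%E.
    apply/eqP; rewrite eq_le measure_ge0 andbT.
    apply: (@le_trans _ _ (\sum_(k <oo) P [set w | (xi k w <= 0)%R])%E).
      by apply: generalized_Boole_inequality => //; exact: bigcupT_measurable.
    by rewrite eseries0.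
  apply: (@le_trans _ _ (0 + 0)%E); last by rewrite adde0.
  by apply: leeD; rewrite le_eqVlt; apply/orP; left; apply/eqP.
move=> w /not_orP[w1 w2].
have pos k : 0 < xi k w by rewrite ltNge; apply/negP => h; apply: w2; exists k.
split=> // b; have [n1 hn1] := hB1 w w1.
pose n := maxn n1 (Num.truncn b).+1.
have nb : ~ F n w by apply: hn1; exact: leq_maxl.
have t2 : 2 ^+ n.+1 <= tn n by rewrite le_max lexx orbT.
have t1 : 1 <= tn n by apply: le_trans t2; rewrite exprn_ege1// ler1n.
have /andP[tl0 _] := tl01 mxi rvtl (tn n).
pose M := (Num.truncn (total_cst gam n.+1 / tl (tn n))).+1.
have hM : total_cst gam n.+1 < M%:R * tl (tn n) by rewrite -ltr_pdivrMr// truncnS_gt.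
have := walk_exceeds mark_step_ge0 (tl01 mxi rvtl) nb t2 hM => ex.
exists M => k Mk; rewrite -(walk_partial_sum pos).
apply: (lt_le_trans _ (walk_mono Th mark_step_ge0 w Mk)); apply: lt_trans ex.
have bn : b < n%:R by apply: (lt_le_trans (truncnS_gt b)); rewrite ler_nat leq_maxr.
apply: (lt_le_trans bn); apply: (@le_trans _ _ n.+1%:R); first by rewrite ler_nat.
by rewrite ler_peMr.
Qed.

End null_set.

(** * Approximation of the rescaled shot noise *)

Section prelimit.
Context {R : realType} {d : measure_display} {T : measurableType d} (P : probability T R).
Variables (X : nat -> T -> R -> R) (xi : nat -> T -> R).
Hypothesis mX : forall k t, measurable_fun setT (fun w => X k w t).
Hypothesis mxi : forall k, measurable_fun setT (xi k).
Hypothesis cX : forall k w, cadlag0 (X k w).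
Hypothesis iidX : iid_pairs P X xi.
Hypothesis xi0 : P [set w | 0 < xi 0%N w] = 1%E.
Hypothesis momX : forall t, 0 <= t -> forall l : nat,
  P.-integrable setT (fun w => ((`|X 0%N w t| ^+ l)%R)%:E).
Let h t := Exp P (fun w => X 0%N w t).
Let Xh w t := X 0%N w t - h t.
Hypothesis ch : cadlag0 h.
Variables (alpha rho gam p : R).
Let tl := tail P (xi 0%N).
Hypothesis alpha01 : 0 < alpha < 1.
Hypothesis rvtl : rv tl (- alpha).
Hypothesis rvh : rv h rho.
Hypothesis momh : forall l : nat, (0 < l)%N -> exists C, 0 < C /\
     forall t, 0 <= t -> Exp P (fun w => Xh w t ^+ (2 * l)) <= C * h t.
Variable del : R.
Hypothesis del0 : 0 < del.
Hypothesis hosc : forall l : nat, (0 < l)%N ->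
     ((forall t, 0 <= t -> (sup_mod P Xh del l t < +oo)%E) /\
        dRi (fun t => fine (sup_mod P Xh del l t)))
     \/
     ((forall b, exists M, forall t, 0 <= t <= b -> (sup_mod P Xh del l t <= M%:E)%E) /\
      (exists C A, forall t, A <= t ->
         (sup_mod P Xh del l t <= (C * tail P (xi 0%N) t)%:E)%E)).
Hypothesis gam0 : 0 < gam.
Hypothesis gam_alpha : gam < alpha.
Hypothesis p0 : 0 < p.
Hypothesis prho : - p < rho.
Hypothesis Qg : 2 `^ p * gcst gam < 1.
Hypothesis s00 : 0 < rho + alpha.
Hypothesis kk0 : 2 * (alpha - gam) <= (rho + alpha) / 4.
Local Notation Th := (marks xi cX).
Local Notation mu := (mark_law P mX mxi cX).
Let iid : iid_gen P mu Th (@cylinder R) := iid_marks mX mxi cX iidX.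

Lemma prelimit_moments N (eta : R) (s : 'I_N -> nat) : 0 < eta ->
  Exp P (fun w => \prod_i block_coord Th mark_step tl eta t w i ^+ s i) @[t --> +oo] -->
  \prod_i expR (- (eta * (Gammaf (1 - alpha) * (s i)%:R `^ alpha))).
Proof.
move=> eta0; apply: (block_moments iid measurable_mark_step mark_step_ge0 (phi := laplace P (xi 0%N))) => //.
- by move=> l l0; exact: step_laplace.
- by case/andP: alpha01.
- by move=> t; have /andP[] := tl01 mxi rvtl t.
- apply/cvgrPdist_le => e e0; have [A HA] := tl_cvg0 gam0 gam_alpha rvtl e0.
  near=> t; rewrite sub0r normrN ger0_norm; last by have /andP[/ltW] := tl01 mxi rvtl t.
  by apply: HA; near: t; apply: nbhs_pinfty_ge; rewrite num_real.
- by move=> z z0; exact: laplace_exponent.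
Unshelve. all: by end_near. Qed.

Lemma prelimit_approx (eps : R) : 0 < eps -> exists n0 : nat, forall n N (eta L : R), (n0 <= n)%N ->
  0 < eta -> 0 <= L ->
  (forall v v', v <= n%:R -> v' <= n%:R -> `|kap rho n v - kap rho n v'| <= L * `|v - v'|) ->
  eta * L * n%:R <= eps / 16 -> total_cst gam n < N%:R * eta ->
  exists A, forall t, A <= t -> exists B, [/\ measurable B, (P B <= eps%:E)%E & forall w, ~ B w ->
    let Y := fun u => tl t / h t * shot_noise X xi w (u * t) in
    cadlag_pos Y /\ uclose eps Y (psi (kap rho n) n eta (@block_coord _ _ _ _ _ Th mark_step tl N eta t w))].
Proof.
move=> eps0.
have g01 : 0 < gcst gam < 1.
  rewrite gcst_gt0 /= /gcst powRN invf_lt1 ?powR_gt0//.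
  rewrite -[ltLHS](powRr0 2) /powR gt_eqF// ltr_expR ltr_pM2r//.
  by apply: ln_gt0; lra.
have [K K0 HK] := mean_psi Th mark_step_ge0 gam0 gam_alpha rvtl (tl01 mxi rvtl) rvh (h_ge0 momh) (h_bound ch) p0 prho Qg.
have [Kb Kb0 [Ab HAb]] := prob_step_bad mX mxi cX iidX gam0 gam_alpha rvtl.
have [B0 [mB0 PB0 hB0]] := steps_null mX mxi cX iidX xi0 gam0 gam_alpha rvtl.
have e4 : 0 < eps / 4 by rewrite divr_gt0.
have e2 : 0 < eps / 2 by rewrite divr_gt0.
have [n1 hn1] := small_dyadic (divr_gt0 e4 Kb0).
have e8K : 0 < eps / 8 / K by rewrite !divr_gt0.
have /cvgrPdist_lt /(_ _ e8K) [n2 _ hn2] := near_err_cvg g01 Qg.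
(* The [.+2] ensures [u + 1 <= n] whenever [u * eps <= 1]; the extra unit leaves room for the next
   grid time after [u * t], which lies within [del <= t]. *)
exists (maxn n1 (maxn n2 (Num.truncn eps^-1).+2)) => n N eta L.
rewrite !geq_max => /and3P[n1n n2n n3n] eta0 L0 kL etaL NC.
have n0 : (0 < n)%N by apply: leq_trans n3n.
have etaL' : eta * L * n%:R <= eps / 2 / 8 by lra.
have Kn : K * near_err (gcst gam) p n <= eps / 2 / 4.
  have := hn2 n n2n; rewrite /= sub0r normrN ltr_norml => /andP[_].
  by rewrite ltr_pdivlMr// mulrC => ?; lra.
have [A1 HA1] := HK n N eta L (eps / 2) n0 e2 eta0 L0 kL etaL' Kn NC.
have [A2 HA2] := centered_small mX mxi cX iidX momX ch rvtl rvh momh del0 hosc gam0 gam_alpha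
  p0 prho Qg s00 kk0 (fun t => (N * nblock tl eta t)%N) n0 e2.
exists (Num.max A1 (Num.max A2 (Num.max Ab (Num.max del 1)))) => t.
rewrite !ge_max => /andP[t1 /andP[t2 /andP[t3 /andP[t4 t5]]]].
have t0 : 0 < t by lra.
have [B1 [mB1 PB1 hB1]] := HA2 t t2.
have mS : measurable (sbad Th mark_step tl gam n t) by exact: (measurable_sbad iid measurable_mark_step).
exists (sbad Th mark_step tl gam n t `|` (B1 `|` B0)); split.
- by apply: measurableU => //; exact: measurableU.
- apply: (@le_trans _ _ ((eps / 4)%:E + ((eps / 2)%:E + 0))%E); last first.
    by rewrite adde0 -EFinD lee_fin; lra.
  apply: (le_trans (measureU2 _ _ _)) => //; first exact: measurableU.
  apply: leeD.
    apply: (le_trans (HAb n t n0 t3)); rewrite lee_fin.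
    by have := hn1 n n1n; rewrite ler_pdivlMr// mulrC.
  apply: (le_trans (measureU2 _ _ _)) => //; apply: leeD => //.
  by rewrite le_eqVlt; apply/orP; left; apply/eqP.
move=> w /not_orP[w1 /not_orP[w2 w3]] Y.
have [pos unb] := hB0 w w3.
split; first exact: shot_noise_cadlag.
have [ex hu] := HA1 t t1 w w1.
move=> u eu ue; have u0 : 0 <= u by apply: le_trans eu; exact: ltW.
have un : u + 1 <= n%:R.
  have hu1 : u <= eps^-1 by rewrite -[leRHS]mul1r ler_pdivlMr.
  have := truncnS_gt eps^-1; have : (Num.truncn eps^-1).+2%:R <= n%:R :> R by rewrite ler_nat.
  by rewrite -natr1; lra.
have un' : 0 <= u <= n%:R by rewrite u0 /=; lra.
have ut0 : 0 <= u * t by rewrite mulr_ge0// ltW.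
have utn : u * t + del <= n%:R * t.
  have : (u + 1) * t <= n%:R * t by rewrite ler_pM2r.
  by rewrite mulrDl mul1r; lra.
set N1 := (N * nblock tl eta t)%N in ex hu.
have SE := walk_partial_sum cX pos.
have E : shot_noise X xi w (u * t) = shot_rate Th mark_step h (u * t) N1 w + shots Th mark_step (cent h) (u * t) N1 w.
  rewrite (@shot_noise_finite _ _ _ X xi w (u * t) N1); last first.
    move=> k Nk; rewrite -SE; apply: (lt_le_trans _ (walk_mono Th mark_step_ge0 w Nk)).
    by apply: le_lt_trans ex; rewrite ler_pM2r//; case/andP: un'.
  rewrite /shot_rate /shots -big_split /=; apply: eq_bigr => k _; rewrite SE.
  case: (leP (partial_sum xi k w) (u * t)) => kut; last by rewrite addr0.
  by rewrite /cent /= subr_ge0 kut; ring.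
have g1 := hu u un'; have g2 := hB1 w w2 w1 (u * t) ut0 utn.
rewrite /Y E mulrDr -/N1 in g2 *.
rewrite addrAC; apply: (le_trans (ler_normD _ _)).
apply: (@le_trans _ _ (eps / 2 + eps / 2)); last lra.
by apply: lerD.
Qed.

End prelimit.

Theorem theorem1p2 (R : realType) (d : measure_display) (T : measurableType d)
  (P : probability T R) (X : nat -> T -> R -> R) (xi : nat -> T -> R)
  (alpha rho : R) :
  (* measurability, paths in D[0,oo), independent copies, xi > 0 *)
  (forall k t, measurable_fun setT (fun w => X k w t)) ->
  (forall k, measurable_fun setT (xi k)) ->
  (forall k w, cadlag0 (X k w)) ->
  iid_pairs P X xi ->
  P [set w | 0 < xi 0%N w] = 1%E ->
  (* all moments finite *)
  (forall t, 0 <= t -> forall l : nat,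
     P.-integrable setT (fun w => ((`|X 0%N w t| ^+ l)%R)%:E)) ->
  let h := fun t => Exp P (fun w => X 0%N w t) in
  let Xh := fun w t => X 0%N w t - h t in
  cadlag0 h ->
  (* (A1) *)
  0 < alpha < 1 ->
  (exists lxi, slowly_varying lxi /\
     asym_equiv (tail P (xi 0%N)) (fun t => powR t (- alpha) * lxi t)) ->
  (* (A2) *)
  - alpha < rho ->
  (exists lh, slowly_varying lh /\ asym_equiv h (fun t => powR t rho * lh t)) ->
  (* moment condition on the centered process *)
  (forall l : nat, (0 < l)%N -> exists C, 0 < C /\
     forall t, 0 <= t -> Exp P (fun w => Xh w t ^+ (2 * l)) <= C * h t) ->
  (* condition on the local oscillation *)
  (exists delta, 0 < delta /\ forall l : nat, (0 < l)%N ->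
     ((forall t, 0 <= t -> (sup_mod P Xh delta l t < +oo)%E) /\
        dRi (fun t => fine (sup_mod P Xh delta l t)))
     \/
     ((forall b, exists M, forall t, 0 <= t <= b -> (sup_mod P Xh delta l t <= M%:E)%E) /\
      (exists C A, forall t, A <= t ->
         (sup_mod P Xh delta l t <= (C * tail P (xi 0%N) t)%:E)%E))) ->
  (* conclusion: for any alpha-stable subordinator W (on any probability space) *)
  forall (d' : measure_display) (T' : measurableType d') (P' : probability T' R)
         (W : T' -> R -> R),
  stable_subordinator P' alpha W ->
  weak_conv_J1 P
    (fun t w u => tail P (xi 0%N) t / h t * shot_noise X xi w (u * t))
    P' (J_proc rho W).
Proof.
move=> mX mxi cX iidX xi0 momX h Xh ch alpha01 rvtl arho rvh momh [del [del0 hosc]] d' T' P' W sub.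
have /andP[a0 a1] := alpha01.
(* The slack [m] fixes the exponents: [gam = alpha - m] and [p = alpha - 2 * m] make the shell ratio
   [2 ^ (- m) < 1]. The bound by [rho + alpha] gives [- p < rho] and [2 * m <= (rho + alpha) / 4];
   the bound by [alpha] keeps [gam] and [p] positive. *)
pose m := Num.min (rho + alpha) alpha / 16.
have [m0 m1 m2] : [/\ 0 < m, 16 * m <= rho + alpha & 16 * m <= alpha].
  have : 0 < Num.min (rho + alpha) alpha by rewrite lt_min a0 andbT; lra.
  have : Num.min (rho + alpha) alpha <= rho + alpha by rewrite ge_min lexx.
  have : Num.min (rho + alpha) alpha <= alpha by rewrite ge_min lexx orbT.
  by rewrite /m; split; lra.
clearbody m.
pose gam := alpha - m; pose p := alpha - 2 * m.
have gam0 : 0 < gam by rewrite /gam; lra.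
have gam_alpha : gam < alpha by rewrite /gam; lra.
have p0 : 0 < p by rewrite /p; lra.
have prho : - p < rho by rewrite /p; lra.
have s00 : 0 < rho + alpha by lra.
have kk0 : 2 * (alpha - gam) <= (rho + alpha) / 4 by rewrite /gam; lra.
have Qg : 2 `^ p * gcst gam < 1.
  rewrite /gcst -powRD; last by rewrite pnatr_eq0 implybT.
  rewrite -[ltRHS](powRr0 2) /powR gt_eqF// ltr_expR ltr_pM2r; first by rewrite /p /gam; lra.
  by apply: ln_gt0; lra.
have Gam0 : 0 < Gammaf (1 - alpha) by exact: (Gammaf_gt0 (mxi 0%N) alpha01 rvtl).
apply: weak_conv_J1_approx => eps eps0.
have [n1 H1] := prelimit_approx mX mxi cX iidX xi0 momX ch rvtl rvh momh del0 hosc gam0 gam_alpha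
  p0 prho Qg s00 kk0 eps0.
have [n2 H2] := limit_approx alpha01 gam0 gam_alpha Gam0 sub (ltW p0) prho Qg eps0.
pose n := maxn n1 n2.
have [L L0 kL] := @kap_lip _ rho n n%:R (ler0n _ _).
have Ln : 0 < L * n%:R + 1 by rewrite ltr_wpDl// mulr_ge0.
pose eta := eps / 16 / (L * n%:R + 1).
have eta0 : 0 < eta by rewrite !divr_gt0.
have etaL : eta * L * n%:R <= eps / 16.
  rewrite /eta -mulrA mulrAC ler_pdivrMr//; apply: ler_wpM2l; [by rewrite divr_ge0// ltW|lra].
have etaL2 : eta * L * n%:R <= eps / 2 by lra.
clearbody eta.
pose N := (Num.truncn (total_cst gam n / eta)).+1.
have NC : total_cst gam n < N%:R * eta by rewrite -ltr_pdivrMr// truncnS_gt.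
(* The coordinates have to lie in the cube for every real [t]; the maximum with [1] keeps the
   divisor positive and is [t] itself for large [t]. *)
pose pt (t : R) (w : T) : 'I_N -> R :=
  block_coord (marks xi cX) (@mark_step R) (tail P (xi 0%N)) eta (Num.max t 1) w.
exists N, (fun z => psi (kap rho n) n eta z), (eta * N%:R * (L * expR n%:R)), pt, (@sub_coord _ _ _ W eta N).
split; first split.
- by rewrite mulr_ge0 ?mulr_ge0 ?(ltW eta0) ?expR_ge0.
- move=> z cz; apply: (@lipschitz_cadlag _ _ (eta * N%:R * L)).
    by apply: mulr_ge0 => //; apply: mulr_ge0 => //; exact: ltW.
  by move=> u u'; apply: psi_cont => //; exact: ltW.
- by move=> z z' u cz cz'; apply: psi_lip => //; exact: ltW.
have iid := iid_marks mX mxi cX iidX.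
split; first split.
- move=> t i; apply: measurableT_comp => //; apply: measurableT_comp => //.
  apply: measurable_funM; last exact: measurable_cst.
  by apply: measurable_funB; exact: (measurable_walk iid measurable_mark_step).
- move=> t w i; rewrite /pt /block_coord expR_ge0 -[leRHS]expR0 ler_expR oppr_le0 divr_ge0//.
    by rewrite subr_ge0; apply: walk_mono; [exact: mark_step_ge0|rewrite leq_mul2r leqnSn orbT].
  by rewrite le_max ler01 orbT.
- exact: (measurable_sub_coord sub).
- exact: (sub_coord_cube sub (ltW eta0)).
- move=> s; rewrite (sub_moments sub (ltW eta0)).
  have := @prelimit_moments _ _ _ P X xi mX mxi cX iidX alpha gam alpha01 rvtl gam0 gam_alpha N eta s eta0.
  apply: cvg_trans; apply: near_eq_cvg; near=> t.
  rewrite /pt (_ : Num.max t 1 = t)//; apply/max_idPl.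
  by near: t; apply: nbhs_pinfty_ge; rewrite num_real.
split.
- have [A HA] := H1 n N eta L (leq_maxl _ _) eta0 L0 kL etaL NC.
  exists (Num.max A 1) => t; rewrite ge_max => /andP[At t1].
  have [B [mB PB hB]] := HA t At; exists B; split; [exact: mB|exact: PB|move=> w wB].
  rewrite /pt (_ : Num.max t 1 = t); last exact/max_idPl.
  exact: hB wB.
- exact: (H2 n N eta L (leq_maxr _ _) eta0 L0 kL etaL2 NC).
Unshelve. all: by end_near. Qed.
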